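(* Let $(M,g)$ be a compact $m$-dimensional manifold with smooth Riemannian metric $g$, and let $N\subset M$ be a compact submanifold of dimension $n$ with $m\ge n+2$, such that the metric $g$ can be diagonalized near $N$ (in the sense defined in the context). Choose local coordinates $(x_1,\dots,x_{m-n},y_1,\dots,y_n)$ in a neighborhood of $N$ so that $g=\begin{pmatrix} g_1 & 0\\ 0 & g_2\end{pmatrix}$ in this neighborhood. Let $\tilde g$ be another smooth regular metric on $M\setminus N$ such that $\tilde g=\begin{pmatrix} f^2 g_1 & 0\\ 0 & g_2\end{pmatrix}$ in a neighborhood of $N$, where $f\in C^\infty(M\setminus N)$. If $m=2$, assume that $f\in L^{2+\epsilon}_g(M)$ for some $\epsilon\in(0,\infty)$. If $m\ge 3$, assume that $\inf(f)>0$ and $f\in L_g^{(m(m-n)/2)+\epsilon}(M)$ for some $\epsilon\in(0,\infty)$. Then the operator $\overline{\triangle}^F_{\tilde g}$ on $(M\setminus N,\tilde g)$ has discrete spectrum consisting of eigenvalues $$0=\lambda_1<\lambda_2\le\dots\le\lambda_j\le\dots\to+\infty,$$ each with multiplicity $1$. The corresponding eigenfunctions $\phi_1,\phi_2,\dots\in W^{1,2}_{\tilde g}(M\setminus N)$ can be chosen as an orthonormal basis for $L^2_{\tilde g}(M\setminus N)$. Furthermore, the variational characterization for the eigenvalues holds: $$\lambda_j=\inf_{V^j}\ \sup_{\phi\in V^j,\ \phi\ne 0}\frac{\|\nabla\phi\|^2_{L^2_{\tilde g}(M\setminus N)}}{\|\phi\|^2_{L^2_{\tilde g}(M\setminus N)}},$$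 where $V^j$ represents an arbitrary $j$-dimensional subspace of $W^{1,2}_{0,\tilde g}(M\setminus N)$.
   Context: The metric $g$ ''can be diagonalized near $N$'' means: in a neighborhood of $N$ there exist local coordinates $(x_1,\dots,x_{m-n},y_1,\dots,y_n)$, where $(0,\dots,0,y_1,\dots,y_n)$ are coordinates for $N$, such that $(dx_1,\dots,dx_{m-n},dy_1,\dots,dy_n)$ is globally defined in some open neighborhood of $N$ and such that $g$ is written in block form $g=\begin{pmatrix} g_1&0\\0&g_2\end{pmatrix}$, where $g_1$ is an $(m-n)\times(m-n)$ positive definite matrix and $g_2$ is an $n\times n$ positive definite matrix. (The matrices are with respect to $dx_1,\dots,dx_{m-n},dy_1,\dots,dy_n$.) $L^p_g$ and $L^p_{\tilde g}$ denote the $L^p$ spaces with respect to the Riemannian measures of $g$ and $\tilde g$. $W^{1,2}_{\tilde g}(M\setminus N)$ is the Sobolev space of functions $u\in L^2_{\tilde g}(M\setminus N)$ whose weak gradient is in $L^2$ with respect to $\tilde g$, with norm $\|u\|^2_{W^{1,2}_{\tilde g}}=\|u\|^2_{L^2_{\tilde g}}+\|\nabla u\|^2_{L^2_{\tilde g}}$ (gradient and its norm taken with respect to $\tilde g$). $W^{1,2}_{0,\tilde g}(M\setminus N)$ is the closure of $C_0^\infty(M\setminus N)$ (smooth compactly supported functions) in the $W^{1,2}_{\tilde g}(M\setminus N)$ norm. $\overline{\triangle}^F_{\tilde g}$ denotes the Friedrichs self-adjoint extension of the Laplacian of $\tilde g$ with domain $C_0^\infty(M\setminus N)$, with the sign convention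 that makes the Laplacian nonnegative.
   Formalization: M is assumed connected and nonempty (for disconnected M the claim 0 = λ_1 < λ_2 fails), and ''each with multiplicity 1'' is read as: eigenvalues are listed repeatedly according to their multiplicity (simplicity fails on round spheres). *)

(* Defs.v *)
From HB Require Import structures.
From mathcomp Require Import all_boot all_order all_algebra.
From mathcomp Require Import all_classical all_reals all_analysis.

Set Implicit Arguments.
Unset Strict Implicit.
Unset Printing Implicit Defensive.
Import Order.TTheory GRing.Theory Num.Theory.
Import numFieldNormedType.Exports.

Local Open Scope classical_set_scope.
Local Open Scope ring_scope.

Section SmoothMaps.
Context {R : realType} {m : nat} {W : normedModType R}.

(* Meaningful for open A only. *)
Fixpoint Ck_on (k : nat) (A : set 'rV[R]_m) (F : 'rV[R]_m -> W) : Prop :=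
  if k is k'.+1 then
    (forall x, A x -> differentiable F x) /\ (forall v, Ck_on k' A ('D_v F))
  else forall x, A x -> {for x, continuous F}.

Definition smooth_on (A : set 'rV[R]_m) (F : 'rV[R]_m -> W) : Prop :=
  forall k, Ck_on k A F.

End SmoothMaps.

(* A homeomorphism between an open set of M and an open set of R^m; both
   directions are total functions with junk values outside these sets. *)
Record chart (R : realType) (M : topologicalType) (m : nat) := Chart {
  cdom : set M;
  cmap : M -> 'rV[R]_m;
  cinv : 'rV[R]_m -> M;
  cdom_open : open cdom;
  cimg_open : open (cmap @` cdom);
  cmapK : {in cdom, cancel cmap cinv};
  cmap_cont : forall p, cdom p -> {for p, continuous cmap};
  cinv_cont : forall x, (cmap @` cdom) x -> {for x, continuous cinv} }.

Definition compatible (R : realType) (M : topologicalType) (m : nat)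
    (c d : chart R M m) : Prop :=
  smooth_on (cmap c @` (cdom c `&` cdom d)) (cmap d \o cinv c).

(* [atlas] is the maximal atlas.  [chart_at p] is a preferred chart around p:
   the tangent space at p is identified with R^m through that chart, so that a
   tensor field is given by its components with respect to [chart_at p] at
   each point p, and its components in another chart are obtained from them by
   the Jacobian of the change of coordinates. *)
Record manifold (R : realType) (M : topologicalType) (m : nat) := Manifold {
  atlas : set (chart R M m);
  chart_at : M -> chart R M m;
  atlas_chart_at : forall p, atlas (chart_at p);
  cdom_chart_at : forall p, cdom (chart_at p) p;
  atlas_compatible : forall c d, atlas c -> atlas d -> compatible c d;
  atlas_maximal : forall c,
    (forall d, atlas d -> compatible c d /\ compatible d c) -> atlas c;
  manifold_hausdorff : hausdorff_space M;
  manifold_second_countable : @second_countable M }.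

Notation borel M := (g_sigma_algebraType (@open M)).

(* The Lebesgue integral over R^n of a nonnegative Borel function, as an
   iterated integral (Tonelli). *)
Fixpoint rV_integral (R : realType) (n : nat) :
    ('rV[R]_n -> \bar R) -> \bar R :=
  if n is n'.+1 then fun h =>
    (\int[@lebesgue_measure R]_t
       rV_integral (fun y : 'rV[R]_n' => h (row_mx (t%:M : 'rV[R]_1) y)))%E
  else fun h => h 0.

Section Riemannian.
Context {R : realType} {m : nat} {M : ptopologicalType} (S : manifold R M m).
Implicit Types (U N K : set M) (c d : chart R M m) (u f : M -> R)
  (X Y : M -> 'rV[R]_m) (g h : M -> 'M[R]_m).

Definition smooth_function U u : Prop := forall c, atlas S c ->
  smooth_on (cmap c @` (cdom c `&` U)) (u \o cinv c).

Definition supported_compactly_in (V : zmodType) U (F : M -> V) : Prop :=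
  exists K, [/\ compact K, K `<=` U & forall p, ~ K p -> F p = 0].

(* Functions on U are represented by functions on M extended by 0. *)
Definition test_function U u : Prop :=
  smooth_function U u /\ supported_compactly_in U u.

(* Vectors are rows, so 'd F x v = v *m 'J F x. *)
Definition field_in c X (p : M) : 'rV[R]_m :=
  X p *m 'J (cmap c \o cinv (chart_at S p)) (cmap (chart_at S p) p).

Definition metric_in c g (p : M) : 'M[R]_m :=
  let J := 'J (cmap (chart_at S p) \o cinv c) (cmap c p) in
  J *m g p *m J^T.

Definition test_field U Y : Prop :=
  (forall c, atlas S c ->
     smooth_on (cmap c @` (cdom c `&` U)) (field_in c Y \o cinv c)) /\
  supported_compactly_in U Y.

Definition riemannian_metric U g : Prop :=
  [/\ forall p, U p -> (g p)^T = g p,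
      forall p, U p -> forall v : 'rV[R]_m, v != 0 ->
        0 < (v *m g p *m v^T) 0 0
    & forall c, atlas S c ->
        smooth_on (cmap c @` (cdom c `&` U)) (metric_in c g \o cinv c)].

Definition inner g X Y (p : M) : R := (X p *m g p *m (Y p)^T) 0 0.

(* mu is the measure sqrt(det g) dx of (U, g), extended by 0 to Borel sets of M;
   these two conditions determine mu. *)
Definition riemannian_measure U g (mu : {measure set (borel M) -> \bar R}) :
    Prop :=
  mu (~` U) = 0%E /\
  forall c (A : set (borel M)), atlas S c -> measurable A ->
    A `<=` cdom c `&` U ->
    mu A = rV_integral (fun x =>
      (\1_(cmap c @` A) x * Num.sqrt (\det (metric_in c g (cinv c x))))%:E).

Definition grad g u : M -> 'rV[R]_m := fun p =>
  let c := chart_at S p in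
  (\row_i 'D_(delta_mx 0 i) (u \o cinv c) (cmap c p)) *m invmx (g p).

(* div Y = (det g)^(-1/2) sum_i d_i((det g)^(1/2) Y^i) in [chart_at p]. *)
Definition divergence g Y : M -> R := fun p =>
  let c := chart_at S p in
  let vol q := Num.sqrt (\det (metric_in c g q)) in
  (vol p)^-1 * \sum_(i < m)
    'D_(delta_mx 0 i) (fun x => vol (cinv c x) * field_in c Y (cinv c x) 0 i)
      (cmap c p).

Definition laplacian g u : M -> R := fun p => - divergence g (grad g u) p.

Section Spaces.
Variables (U : set M) (g : M -> 'M[R]_m)
  (mu : {measure set (borel M) -> \bar R}).

Definition Lp (p : R) u : Prop :=
  measurable_fun (U : set (borel M)) (u : borel M -> R) /\
  (\int[mu]_(x in U) (`|u x| `^ p)%:E < +oo)%E.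

Definition L2 : set (M -> R) := Lp 2.

Definition ipL2 (u v : M -> R) : R := \int[mu]_(x in U) (u x * v x).

Definition L2_field X : Prop :=
  (forall c i, atlas S c ->
     measurable_fun (cdom c `&` U : set (borel M))
       (fun p : borel M => field_in c X p 0 i)) /\
  (\int[mu]_(x in U) (inner g X X x)%:E < +oo)%E.

Definition weak_gradient u X : Prop := forall Y, test_field U Y ->
  \int[mu]_(x in U) inner g X Y x = - \int[mu]_(x in U) (u x * divergence g Y x).

Definition W12 : set (M -> R) := [set u | L2 u /\
  exists X, L2_field X /\ weak_gradient u X].

(* The weak gradient is unique up to a null set; one representative is picked. *)
Definition wgrad u : M -> 'rV[R]_m :=
  xget (fun=> 0) [set X | L2_field X /\ weak_gradient u X].

Definition normL2sq u : R := ipL2 u u.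

Definition gradL2sq u : R := \int[mu]_(x in U) inner g (wgrad u) (wgrad u) x.

Definition normW12sq u : R := normL2sq u + gradL2sq u.

Definition W120 : set (M -> R) := [set u | W12 u /\
  forall e, 0 < e -> exists2 v, test_function U v & normW12sq (u - v) < e].

End Spaces.

Definition submanifold (n : nat) N : Prop := forall p, N p ->
  exists c, [/\ atlas S c, cdom c p &
    N `&` cdom c =
      [set q | cdom c q /\ forall i : 'I_m, (i < m - n)%N -> cmap c q 0 i = 0]].

(* The coordinates (x_1..x_(m-n), y_1..y_n) near N: a family of charts covering
   N.  The coframe (dx, dy) is globally defined on the union of their domains,
   i.e. the Jacobians of the changes of coordinates are the identity. *)
Definition diagonal_coordinates g (n : nat) N (coords : set (chart R M m)) :
    Prop :=
  [/\ coords `<=` atlas S,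
      N `<=` \bigcup_(c in coords) cdom c,
      forall c, coords c -> N `&` cdom c =
        [set q | cdom c q /\
           forall i : 'I_m, (i < m - n)%N -> cmap c q 0 i = 0],
      forall c d p, coords c -> coords d -> cdom c p -> cdom d p ->
        'J (cmap d \o cinv c) (cmap c p) = 1%:M
    & forall c p, coords c -> cdom c p -> forall i j : 'I_m,
        (i < m - n)%N != (j < m - n)%N -> metric_in c g p i j = 0].

(* diag(a * G1, G2), where G1 and G2 are the diagonal blocks of G, of sizes
   m - n and n. *)
Definition scale_block (n : nat) (a : R) (G : 'M[R]_m) : 'M[R]_m :=
  \matrix_(i, j)
    if (i < m - n)%N && (j < m - n)%N then a * G i j
    else if (m - n <= i)%N && (m - n <= j)%N then G i j
    else 0.

Definition conformal_block_near g h f (n : nat) N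
    (coords : set (chart R M m)) : Prop :=
  exists2 W, open W /\ N `<=` W &
    forall c p, coords c -> cdom c p -> W p -> ~ N p ->
      metric_in c h p = scale_block n (f p ^+ 2) (metric_in c g p).

End Riemannian.

(* Unbounded operators in the Hilbert space obtained from a set H of vectors
   with a semi-inner product ip, by identifying u and v when |u - v| = 0.  An
   operator is given by its graph. *)
Section Operators.
Context {R : realType} {V : lmodType R} (H : set V) (ip : V -> V -> R).
Implicit Types (u v w : V) (T : V -> V -> Prop).

Definition cvgH (s : nat -> V) u : Prop :=
  (fun k => ip (s k - u) (s k - u)) @ \oo --> (0 : R).

(* The domain of the closure of the form v |-> <A v, v> with domain D. *)
Definition form_domain (D : set V) (A : V -> V) u : Prop :=
  H u /\ exists s : nat -> V,
    [/\ forall k, D (s k), cvgH s u &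
        forall e : R, 0 < e -> exists K : nat, forall i j : nat,
          (K <= i)%N -> (K <= j)%N -> ip (A (s i - s j)) (s i - s j) < e].

(* The Friedrichs extension of a nonnegative symmetric operator A with domain
   D: the restriction of the adjoint of A to the domain of the closed form. *)
Definition friedrichs (D : set V) (A : V -> V) u w : Prop :=
  [/\ form_domain D A u, H w & forall v, D v -> ip u (A v) = ip w v].

Definition op_resolvent_set T : set R := [set z |
  (forall w, H w -> exists u, T u (z *: u + w)) /\
  (exists C : R, forall u w, T u w ->
     ip u u <= C * ip (w - z *: u) (w - z *: u))].

Definition op_spectrum T : set R := ~` op_resolvent_set T.

Definition op_eigenspace T (z : R) : set V := [set u | T u (z *: u)].

Definition subspace_of_dim (d : nat) (E : set V) : Prop :=
  exists b : 'I_d -> V,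
    [/\ forall i, H (b i),
        forall a : 'I_d -> R,
          ip (\sum_i a i *: b i) (\sum_i a i *: b i) = 0 ->
          forall i, a i = 0
      & E = [set v | H v /\ exists a : 'I_d -> R,
               ip (v - \sum_i a i *: b i) (v - \sum_i a i *: b i) = 0]].

Definition orthonormal_basis (phi : nat -> V) : Prop :=
  [/\ forall i, H (phi i),
      forall i j, ip (phi i) (phi j) = (i == j)%:R
    & forall u, H u ->
        cvgH (fun k => \sum_(i < k) ip u (phi i) *: phi i) u].

End Operators.

(* Main.v *)
(** In a coordinate cube around a point of [N], and with k = m - n, the measure
    of [g'] has density comparable to |f|^k, which lies in L^s for some s > m/2,
    and |f|^k |du|^2_{g'} >= b |du|^2 with b > 0.  Since s > m/2, a Morrey-type
    argument bounds the weighted oscillation of u on a dyadic subcube by its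
    Euclidean Dirichlet integral, with a factor that decays geometrically in the
    scale.  Covering M by finitely many such cubes, the unit ball of the
    Dirichlet form is, up to an arbitrarily small L^2 error, controlled by
    finitely many means; so the form domain embeds compactly in L^2, and the
    eigenvectors are obtained by successive minimization.

    The eigenvalue 0 needs 1 in the form domain.  The radial cutoffs at distance
    2^-j from [N] have energy at most the integral of 4^j |f|^(k-2) over a slab
    of volume O(2^(-jk)), and 4^j |f|^(k-2) <= 2^(jk) + |f|^k: the energies are
    bounded, which suffices for 1 to be a limit of test functions in the form
    norm.  A function of zero energy is constant on each cube, hence constant as
    M is connected and N has empty interior. *)
Require Import Defs.
From HB Require Import structures.
From mathcomp Require Import all_boot all_order all_algebra.
From mathcomp Require Import all_classical all_reals all_analysis.
From mathcomp Require Import ring lra.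
From mathcomp Require Import measurable_realfun.
Import Order.TTheory GRing.Theory Num.Theory.
Import numFieldNormedType.Exports.
Set Implicit Arguments.
Unset Strict Implicit.
Unset Printing Implicit Defensive.
Local Open Scope classical_set_scope.
Local Open Scope ring_scope.

(** Functions that agree almost everywhere are not identified. The spaces carry semi-inner products,
    equality means [ip (u - v) (u - v) = 0], and stability under null vectors has to be proved
    wherever a statement depends on it. With k = m - n, the exponent mk/2 is the critical one: for f
    in L^(mk/2), Hoelder's inequality makes h^2 times the integral of |f|^k over a cube of side h of
    the order of the volume h^m. The extra epsilon leaves a positive power of h, which is the decay
    factor of the oscillation estimate. The Dirichlet density of g' carries |f|^(k-2) in the
    directions normal to N and |f|^k in the tangential ones. In dimension m = 2 with n = 0 the first
    factor is 1, by conformal invariance of the Dirichlet integral, which is why that case assumes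
    no lower bound on f. The cube estimate is proved for C^1 functions only, by descending dyadic
    scales: their a priori bound makes the remainder vanish at infinite depth and leaves no trace in
    the result. Test functions are of this kind, and closing the form carries the estimate
    further. *)

Lemma ler_sqr_disc (R : realFieldType) (a b c : R) : 0 <= a -> 0 <= c ->
  (forall t, 0 <= a * t ^+ 2 + 2 * b * t + c) -> b ^+ 2 <= a * c.
Proof.
move=> a0 c0 h; have [az|an0] := eqVneq a 0.
  have [->|bn0] := eqVneq b 0; first by rewrite expr0n mulr_ge0.
  (* For a = 0 the polynomial is affine; this is the point where it equals -1. *)
  have := h (- (c + 1) / (2 * b)).
  have -> : a * (- (c + 1) / (2 * b)) ^+ 2 + 2 * b * (- (c + 1) / (2 * b)) + c = -1.
    by rewrite az; field.
  by rewrite oppr_ge0 ler10.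
have ap : 0 < a by rewrite lt_neqAle eq_sym an0.
have := h (- b / a).
have -> : a * (- b / a) ^+ 2 + 2 * b * (- b / a) + c = (a * c - b ^+ 2) / a by field.
by rewrite pmulr_lge0 ?invr_gt0// subr_ge0.
Qed.

(** * Semi-inner products *)

(** The laws are required on [H] only: [ip] will be an integral, which takes default values on
    functions that are not square integrable, so linearity can fail outside [H]. Definiteness is
    dropped because functions equal almost everywhere stay distinct. *)
Record semi_ip (R : realType) (V : lmodType R) (H : set V) (ip : V -> V -> R) :
    Prop := SemiIp {
  semi_ip0 : H 0;
  semi_ip_closed : forall a u v, H u -> H v -> H (a *: u + v);
  semi_ipC : forall u v, H u -> H v -> ip u v = ip v u;
  semi_ip_linear : forall a u v w, H u -> H v -> H w ->
    ip (a *: u + v) w = a * ip u w + ip v w;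
  semi_ip_ge0 : forall u, H u -> 0 <= ip u u }.

Section SemiInnerProduct.
Context {R : realType} {V : lmodType R} {H : set V} {ip : V -> V -> R}.
Hypothesis hs : semi_ip H ip.

Lemma sipD u v : H u -> H v -> H (u + v).
Proof. by move=> hu hv; have := semi_ip_closed hs 1 hu hv; rewrite scale1r. Qed.

Lemma sipZ a u : H u -> H (a *: u).
Proof.
by move=> hu; have := semi_ip_closed hs a hu (semi_ip0 hs); rewrite addr0.
Qed.

Lemma sipN u : H u -> H (- u).
Proof. by move=> hu; rewrite -scaleN1r; apply: sipZ. Qed.

Lemma sipB u v : H u -> H v -> H (u - v).
Proof. by move=> hu hv; apply: sipD => //; apply: sipN. Qed.

Lemma sip_sum (I : Type) (r : seq I) (P : pred I) (F : I -> V) :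
  (forall i, P i -> H (F i)) -> H (\sum_(i <- r | P i) F i).
Proof. by move=> h; elim/big_ind : _ => //; [exact: (semi_ip0 hs)|exact: sipD]. Qed.

Lemma ipDl u v w : H u -> H v -> H w -> ip (u + v) w = ip u w + ip v w.
Proof.
by move=> hu hv hw; have := semi_ip_linear hs 1 hu hv hw; rewrite scale1r mul1r.
Qed.

Lemma ip0l w : H w -> ip 0 w = 0.
Proof.
move=> hw; have := ipDl (semi_ip0 hs) (semi_ip0 hs) hw; rewrite addr0.
by move/eqP; rewrite -subr_eq0 opprD addNKr oppr_eq0 => /eqP.
Qed.

Lemma ipZl a u w : H u -> H w -> ip (a *: u) w = a * ip u w.
Proof.
move=> hu hw; have := semi_ip_linear hs a hu (semi_ip0 hs) hw.
by rewrite addr0 ip0l// addr0.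
Qed.

Lemma ipNl u w : H u -> H w -> ip (- u) w = - ip u w.
Proof. by move=> hu hw; rewrite -scaleN1r ipZl// mulN1r. Qed.

Lemma ipBl u v w : H u -> H v -> H w -> ip (u - v) w = ip u w - ip v w.
Proof. by move=> hu hv hw; rewrite ipDl ?ipNl//; exact: sipN. Qed.

Lemma ipDr u v w : H u -> H v -> H w -> ip w (u + v) = ip w u + ip w v.
Proof.
by move=> hu hv hw; rewrite !(semi_ipC hs hw)//; [apply: ipDl|exact: sipD].
Qed.

Lemma ip0r w : H w -> ip w 0 = 0.
Proof. by move=> hw; rewrite (semi_ipC hs hw) ?ip0l//; exact: (semi_ip0 hs). Qed.

Lemma ipZr a u w : H u -> H w -> ip w (a *: u) = a * ip w u.
Proof. by move=> hu hw; rewrite !(semi_ipC hs hw)//; [apply: ipZl|exact: sipZ]. Qed.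

Lemma ipNr u w : H u -> H w -> ip w (- u) = - ip w u.
Proof. by move=> hu hw; rewrite -scaleN1r ipZr// mulN1r. Qed.

Lemma ipBr u v w : H u -> H v -> H w -> ip w (u - v) = ip w u - ip w v.
Proof. by move=> hu hv hw; rewrite ipDr ?ipNr//; exact: sipN. Qed.

Lemma ip_suml (I : Type) (r : seq I) (P : pred I) (F : I -> V) w : H w ->
  (forall i, P i -> H (F i)) ->
  ip (\sum_(i <- r | P i) F i) w = \sum_(i <- r | P i) ip (F i) w.
Proof.
move=> hw h; elim: r => [|a r ih]; first by rewrite !big_nil ip0l.
rewrite !big_cons; case: ifP => // Pa; rewrite ipDl ?ih//; first exact: h.
exact: sip_sum.
Qed.

Lemma ip_sumr (I : Type) (r : seq I) (P : pred I) (F : I -> V) w : H w ->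
  (forall i, P i -> H (F i)) ->
  ip w (\sum_(i <- r | P i) F i) = \sum_(i <- r | P i) ip w (F i).
Proof.
move=> hw h; rewrite (semi_ipC hs)//; last exact: sip_sum.
by rewrite ip_suml//; apply: eq_bigr => i Pi; rewrite (semi_ipC hs)//; exact: h.
Qed.

Lemma nipD u v : H u -> H v -> ip (u + v) (u + v) = ip u u + 2 * ip u v + ip v v.
Proof.
move=> hu hv; rewrite ipDl//; last exact: sipD.
rewrite !ipDr// (semi_ipC hs hv hu); ring.
Qed.

Lemma nipN u : H u -> ip (- u) (- u) = ip u u.
Proof.
by move=> hu; rewrite ipNl// ?ipNr ?opprK//; exact: sipN.
Qed.

Lemma nipB u v : H u -> H v -> ip (u - v) (u - v) = ip u u - 2 * ip u v + ip v v.
Proof.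
by move=> hu hv; rewrite nipD ?nipN ?ipNr ?mulrN//; exact: sipN.
Qed.

Lemma nipBC u v : H u -> H v -> ip (u - v) (u - v) = ip (v - u) (v - u).
Proof. by move=> hu hv; rewrite -nipN ?opprB//; exact: sipB. Qed.

Lemma nipZ a u : H u -> ip (a *: u) (a *: u) = a ^+ 2 * ip u u.
Proof.
by move=> hu; rewrite ipZl ?ipZr ?expr2 ?mulrA//; exact: sipZ.
Qed.

Lemma ip_CS u v : H u -> H v -> ip u v ^+ 2 <= ip u u * ip v v.
Proof.
move=> hu hv; apply: ler_sqr_disc; [exact: (semi_ip_ge0 hs)|exact: (semi_ip_ge0 hs)|].
move=> t; have := semi_ip_ge0 hs (sipD (sipZ t hu) hv).
rewrite nipD ?nipZ ?ipZl//; last exact: sipZ.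
by congr (0 <= _); ring.
Qed.

Lemma nipD_le u v : H u -> H v -> ip (u + v) (u + v) <= 2 * ip u u + 2 * ip v v.
Proof.
move=> hu hv; have := semi_ip_ge0 hs (sipB hu hv).
by rewrite nipB// nipD//; lra.
Qed.

Lemma nipB_le u v : H u -> H v -> ip (u - v) (u - v) <= 2 * ip u u + 2 * ip v v.
Proof.
move=> hu hv; have := semi_ip_ge0 hs (sipD hu hv).
by rewrite nipB// nipD//; lra.
Qed.

Lemma nipB_le2 u v w : H u -> H v -> H w ->
  ip (u - v) (u - v) <= 2 * ip (u - w) (u - w) + 2 * ip (v - w) (v - w).
Proof.
move=> hu hv hw; have -> : u - v = (u - w) - (v - w) by rewrite opprB addrA subrK.
by apply: nipB_le; exact: sipB.
Qed.

Lemma ip_null u v : H u -> H v -> ip u u = 0 -> ip u v = 0.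
Proof.
move=> hu hv u0; have := ip_CS hu hv; rewrite u0 mul0r => h.
by apply/eqP; rewrite -sqrf_eq0 eq_le h sqr_ge0.
Qed.

Lemma ip_nullr u v : H u -> H v -> ip u u = 0 -> ip v u = 0.
Proof. by move=> hu hv u0; rewrite (semi_ipC hs)// ip_null. Qed.

Lemma nip_nullB u v : H u -> H v -> ip v v = 0 -> ip (u - v) (u - v) = ip u u.
Proof. by move=> hu hv v0; rewrite nipB// v0 (ip_nullr hv hu v0); ring. Qed.

Lemma ip_eq_null u v w : H u -> H v -> H w -> ip (u - v) (u - v) = 0 ->
  ip u w = ip v w.
Proof.
move=> hu hv hw h; apply/eqP; rewrite -subr_eq0 -ipBl//; apply/eqP.
by apply: ip_null => //; exact: sipB.
Qed.

Lemma nip_eq_null u v : H u -> H v -> ip (u - v) (u - v) = 0 -> ip u u = ip v v.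
Proof.
move=> hu hv h; rewrite (ip_eq_null hu hv hu h) (semi_ipC hs hv hu).
exact: ip_eq_null.
Qed.

End SemiInnerProduct.

Lemma semi_ip_sub (R : realType) (V : lmodType R) (H D : set V) ip :
  semi_ip H ip -> D `<=` H -> D 0 ->
  (forall a u v, D u -> D v -> D (a *: u + v)) -> semi_ip D ip.
Proof.
move=> hs DH D0 Dl; split => //.
- by move=> u v /DH hu /DH hv; exact: (semi_ipC hs).
- by move=> a u v w /DH hu /DH hv /DH hw; exact: (semi_ip_linear hs).
- by move=> u /DH hu; exact: (semi_ip_ge0 hs).
Qed.

Lemma cvg0_sqr_le (R : realType) (x y : nat -> R) :
  (forall k, x k ^+ 2 <= y k) -> y @ \oo --> (0 : R) -> x @ \oo --> (0 : R).
Proof.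
move=> xy y0; apply/cvgr0Pnorm_lt => e e0.
have e2 : 0 < e ^+ 2 by rewrite exprn_gt0.
move/cvgr0Pnorm_lt: y0 => h; near=> k.
have : `|y k| < e ^+ 2 by near: k; exact: h.
move=> hk; have : `|x k| ^+ 2 < e ^+ 2.
  rewrite real_normK ?num_real//; apply: (le_lt_trans (xy k)).
  by apply: le_lt_trans hk; exact: ler_norm.
by rewrite ltr_pXn2r// ?nnegrE ltW.
Unshelve. all: by end_near. Qed.

Lemma seq_cauchy_cvg (R : realType) (x : nat -> R) :
  (forall e, 0 < e -> exists K, forall i j, (K <= i)%N -> (K <= j)%N ->
     `|x i - x j| < e) -> exists l : R, x @ \oo --> l.
Proof.
move=> h; apply/cvg_ex; apply/cauchy_cvgP; apply/cauchy_ballP => e e0 /=.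
have [K hK] := h e e0.
exists (x @` [set n | (K <= n)%N], x @` [set n | (K <= n)%N]) => /=.
  by split; exists K => // i /= Ki; exists i.
by case=> _ _ /= [[i Ki <-] [j Kj <-]]; exact: hK.
Qed.

Section Convergence.
Context {R : realType} {V : lmodType R} {H : set V} {ip : V -> V -> R}.
Hypothesis hs : semi_ip H ip.
Local Notation cvH := (cvgH ip).

Lemma cvgH_ip s t u v : (forall k, H (s k)) -> (forall k, H (t k)) -> H u -> H v ->
  cvH s u -> cvH t v -> (fun k => ip (s k) (t k)) @ \oo --> ip u v.
Proof.
move=> hs' ht hu hv su tv.
pose x1 k := ip (s k - u) (t k - v); pose x2 k := ip (s k - u) v.
pose x3 k := ip u (t k - v).
have e k : ip (s k) (t k) = x1 k + x2 k + x3 k + ip u v.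
  rewrite /x1 /x2 /x3 -(ipDr hs)//; [|exact: (sipB hs)|exact: (sipB hs)].
  by rewrite subrK (ipBl hs)// (ipBr hs)//; ring.
rewrite (_ : (fun k => _) = (fun k => x1 k + x2 k + x3 k + ip u v)); last exact/funext.
rewrite -[X in _ --> X]add0r -[X in _ --> X + _]add0r -[X in _ --> X + _ + _]add0r.
apply: cvgD; last exact: cvg_cst.
apply: cvgD; [apply: cvgD|].
- apply: (@cvg0_sqr_le _ _ (fun k => ip (s k - u) (s k - u) * ip (t k - v) (t k - v))).
    by move=> k; apply: (ip_CS hs); exact: (sipB hs).
  by rewrite -(mulr0 (0 : R)); exact: cvgM.
- apply: (@cvg0_sqr_le _ _ (fun k => ip (s k - u) (s k - u) * ip v v)).
    by move=> k; apply: (ip_CS hs) => //; exact: (sipB hs).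
  by rewrite -[X in _ --> X](mul0r (ip v v)); apply: cvgM => //; exact: cvg_cst.
- apply: (@cvg0_sqr_le _ _ (fun k => ip u u * ip (t k - v) (t k - v))).
    by move=> k; apply: (ip_CS hs) => //; exact: (sipB hs).
  by rewrite -[X in _ --> X](mulr0 (ip u u)); apply: cvgM => //; exact: cvg_cst.
Qed.

Lemma cvgH_cst u : H u -> cvH (fun=> u) u.
Proof. by move=> hu; rewrite /cvgH subrr (ip0l hs (semi_ip0 hs)); exact: cvg_cst. Qed.

Lemma cvgH_lin a s t u v : (forall k, H (s k)) -> (forall k, H (t k)) ->
  H u -> H v -> cvH s u -> cvH t v -> cvH (fun k => a *: s k + t k) (a *: u + v).
Proof.
move=> Hs Ht hu hv su tv; rewrite /cvgH.
apply: (@squeeze_cvgr _ _ _ _ (fun=> 0) (fun k => 2 * (a ^+ 2 * ip (s k - u) (s k - u))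
    + 2 * ip (t k - v) (t k - v))).
- near=> k; have e : a *: s k + t k - (a *: u + v) = a *: (s k - u) + (t k - v).
    by rewrite scalerBr opprD addrACA.
  have h1 : H (s k - u) by exact: (sipB hs).
  have h2 : H (t k - v) by exact: (sipB hs).
  rewrite e (semi_ip_ge0 hs)/=; last exact: (semi_ip_closed hs).
  rewrite -(nipZ hs)//; apply: (nipD_le hs) => //; exact: (sipZ hs).
- exact: cvg_cst.
- rewrite -[X in _ --> X](addr0 (0 : R)) -{1}(mulr0 (2 : R)) -[X in 2 * X + _](mulr0 (a ^+ 2)).
  rewrite -[X in _ --> _ + X](mulr0 (2 : R)).
  apply: cvgD; apply: cvgM; try exact: cvg_cst; last exact: tv.
  by apply: cvgM; [exact: cvg_cst|exact: su].
Unshelve. all: by end_near. Qed.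

End Convergence.

(** * Closed forms *)

Section ClosedForm.
Context {R : realType} {V : lmodType R} {H D : set V} {ip : V -> V -> R}
  {A : V -> V}.
Local Notation qD := (fun u v => ip (A u) v).
Hypothesis hs : semi_ip H ip.
Hypothesis hq : semi_ip D qD.
Hypothesis DH : D `<=` H.
Hypothesis AH : forall u, D u -> H (A u).
Hypothesis Hcomplete : forall s, (forall k, H (s k)) ->
  (forall e, 0 < e -> exists K, forall i j, (K <= i)%N -> (K <= j)%N ->
    ip (s i - s j) (s i - s j) < e) -> exists2 u, H u & cvgH ip s u.

Local Notation F := (form_domain H ip D A).

(** The witness part of [form_domain], isolated so that given sequences can be combined and used to
    compute the closed form. *)
Definition form_approx (s : nat -> V) u :=
  [/\ forall k, D (s k), cvgH ip s u &
      forall e : R, 0 < e -> exists K : nat, forall i j : nat,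
        (K <= i)%N -> (K <= j)%N -> ip (A (s i - s j)) (s i - s j) < e].

Lemma form_approx_cst u : D u -> form_approx (fun=> u) u.
Proof.
move=> Du; split=> //; first by apply: (cvgH_cst hs); exact: DH.
move=> e e0; exists 0%N => i j _ _.
by rewrite subrr (ip0r hs (AH (semi_ip0 hq))).
Qed.

Lemma form_approx_lin a s t u v : H u -> H v ->
  form_approx s u -> form_approx t v ->
  form_approx (fun k => a *: s k + t k) (a *: u + v).
Proof.
move=> hu hv [Ds su cs] [Dt tv ct]; split.
- by move=> k; exact: (semi_ip_closed hq).
- by apply: (cvgH_lin hs) => // k; exact: DH.
- move=> e e0; pose b := 2 * a ^+ 2 + 1.
  have b0 : 0 < b by rewrite ltr_wpDl// mulr_ge0// sqr_ge0.
  have e1 : 0 < e / 2 / b by rewrite !divr_gt0.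
  have e2 : 0 < e / 4 by rewrite divr_gt0.
  have [K1 h1] := cs _ e1; have [K2 h2] := ct _ e2.
  exists (maxn K1 K2) => i j; rewrite !geq_max => /andP[i1 i2] /andP[j1 j2].
  have e3 : a *: s i + t i - (a *: s j + t j) = a *: (s i - s j) + (t i - t j).
    by rewrite scalerBr opprD addrACA.
  have d1 : D (s i - s j) by exact: (sipB hq).
  have d2 : D (t i - t j) by exact: (sipB hq).
  rewrite e3; apply: (le_lt_trans (nipD_le hq (sipZ hq _ d1) d2)).
  rewrite (nipZ hq)//.
  have x0 := semi_ip_ge0 hq d1; have x1 := h1 _ _ i1 j1; have x2 := h2 _ _ i2 j2.
  have : ip (A (s i - s j)) (s i - s j) * b < e / 2.
    by rewrite -ltr_pdivlMr.
  by rewrite /b; move: x0 x2 => /=; nra.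
Qed.

Lemma form_approx_bounded s u : form_approx s u ->
  exists2 C, 0 <= C & forall k, ip (A (s k)) (s k) <= C.
Proof.
move=> [Ds _ cs]; have [K hK] := cs 1 ltr01.
pose C0 := \sum_(i < K.+1) ip (A (s i)) (s i).
have C0ge i : (i < K.+1)%N -> ip (A (s i)) (s i) <= C0.
  move=> iK; rewrite /C0 (bigD1 (Ordinal iK))//= lerDl sumr_ge0// => j _.
  exact: (semi_ip_ge0 hq).
have C00 : 0 <= C0 by rewrite sumr_ge0// => j _; exact: (semi_ip_ge0 hq).
exists (2 * C0 + 2) => [|k]; first by lra.
have [kK|Kk] := ltnP k K.+1; first by have := C0ge k kK; lra.
have h1 := hK k K (ltnW Kk) (leqnn K).
have h2 := C0ge K (leqnn _).
have := nipD_le hq (sipB hq (Ds k) (Ds K)) (Ds K).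
by rewrite /= subrK; lra.
Qed.

(** Closability of the form, with 0 replaced by any null vector. Split q(s_k) = <A s_k, s_k - s_m> +
    <A s_k, s_m>. Cauchy-Schwarz for q makes the first term small, since q(s_k) stays bounded; the
    second tends to 0 as m grows, because A s_k is a fixed vector of [H]. *)
Lemma form_approx_null s u : H u -> form_approx s u -> ip u u = 0 ->
  (fun k => ip (A (s k)) (s k)) @ \oo --> (0 : R).
Proof.
move=> hu as_ u0; have [C C0 hC] := form_approx_bounded as_.
case: as_ => Ds su cs.
have Hs k : H (s k) by exact: DH.
have c0 k : (fun m => ip (A (s k)) (s m)) @ \oo --> (0 : R).
  rewrite -(ip_nullr hs hu (AH (Ds k)) u0).
  exact: (cvgH_ip hs (fun=> AH (Ds k)) Hs (AH (Ds k)) hu (cvgH_cst hs (AH (Ds k))) su).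
apply/cvgr0Pnorm_lt => e e0.
have e2 : 0 < e / 2 by exact: divr_gt0.
have C1 : 0 < C + 1 by rewrite ltr_wpDl.
have e3 : 0 < (e / 2) ^+ 2 / (C + 1) by rewrite divr_gt0// exprn_gt0.
have [K hK] := cs _ e3; exists K => // k /= Kk.
rewrite ger0_norm; last exact: (semi_ip_ge0 hq).
move/cvgr0Pnorm_lt: (c0 k) => /(_ _ e2) [L _ hL].
pose m := maxn K L.
have h1 : ip (A (s k)) (s k) = ip (A (s k)) (s k - s m) + ip (A (s k)) (s m).
  by rewrite -(ipDr hs) ?subrK//; [exact: (sipB hs)|exact: AH].
have h2 : `|ip (A (s k)) (s m)| < e / 2 by apply: hL => /=; rewrite leq_maxr.
have h3 : ip (A (s k)) (s k - s m) ^+ 2 < (e / 2) ^+ 2.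
  apply: (le_lt_trans (ip_CS hq (Ds k) (sipB hq (Ds k) (Ds m)))) => /=.
  have h4 := hK k m Kk (leq_maxl _ _).
  have h5 := semi_ip_ge0 hq (sipB hq (Ds k) (Ds m)).
  have h6 := hC k; have h7 := semi_ip_ge0 hq (Ds k).
  move: h4; rewrite ltr_pdivlMr// => h4; move: h5 h7 => /= h5 h7.
  apply: le_lt_trans h4; rewrite mulrC; apply: ler_wpM2l => //.
  by apply: (le_trans h6); rewrite lerDl.
have h4 : `|ip (A (s k)) (s k - s m)| < e / 2.
  rewrite -(ltr_pXn2r (n := 2))// ?nnegrE ?(ltW e2)//.
  by rewrite real_normK ?num_real.
rewrite h1; move: (ler_norm (ip (A (s k)) (s k - s m))) (ler_norm (ip (A (s k)) (s m))).
by lra.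
Qed.

Lemma form_pair_cvg s t u v : form_approx s u -> form_approx t v ->
  exists l : R, (fun k => ip (A (s k)) (t k)) @ \oo --> l.
Proof.
move=> as_ at_; have [C C0 hC] := form_approx_bounded as_.
have [E E0 hE] := form_approx_bounded at_.
case: as_ at_ => Ds _ cs [Dt _ ct].
apply: seq_cauchy_cvg => e e0.
have e2 : 0 < e / 2 by exact: divr_gt0.
have d1 : 0 < (e / 2) ^+ 2 / (E + 1) by rewrite divr_gt0 ?exprn_gt0// ltr_wpDl.
have d2 : 0 < (e / 2) ^+ 2 / (C + 1) by rewrite divr_gt0 ?exprn_gt0// ltr_wpDl.
have [K1 h1] := cs _ d1; have [K2 h2] := ct _ d2.
have aux (x y B : R) : 0 <= B -> 0 <= x -> 0 <= y -> x < (e / 2) ^+ 2 / (B + 1) -> y <= B ->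
   x * y < (e / 2) ^+ 2.
  move=> B0 x0 y0; rewrite ltr_pdivlMr ?ltr_wpDl// => h yB.
  by apply: le_lt_trans h; apply: ler_wpM2l => //; rewrite (le_trans yB)// lerDl.
have aux2 (x : R) : x ^+ 2 < (e / 2) ^+ 2 -> `|x| < e / 2.
  move=> h; rewrite -(ltr_pXn2r (n := 2))// ?nnegrE ?(ltW e2)//.
  by rewrite real_normK ?num_real.
exists (maxn K1 K2) => i j; rewrite !geq_max => /andP[i1 i2] /andP[j1 j2].
have x1 : `|ip (A (s i - s j)) (t i)| < e / 2.
  apply: aux2; apply: le_lt_trans (ip_CS hq (sipB hq (Ds i) (Ds j)) (Dt i)) _.
  apply: (aux _ _ E) => //; [exact: (semi_ip_ge0 hq (sipB hq (Ds i) (Ds j)))| |exact: h1].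
  exact: (semi_ip_ge0 hq).
have x2 : `|ip (A (s j)) (t i - t j)| < e / 2.
  apply: aux2; apply: le_lt_trans (ip_CS hq (Ds j) (sipB hq (Dt i) (Dt j))) _.
  rewrite mulrC; apply: (aux _ _ C) => //; [exact: (semi_ip_ge0 hq (sipB hq (Dt i) (Dt j)))| |exact: h2].
  exact: (semi_ip_ge0 hq).
have -> : ip (A (s i)) (t i) - ip (A (s j)) (t j) =
    ip (A (s i - s j)) (t i) + ip (A (s j)) (t i - t j).
  have -> := ipBl hq (Ds i) (Ds j) (Dt i).
  have -> := ipBr hq (Dt i) (Dt j) (Ds j).
  by rewrite /=; ring.
by apply: (le_lt_trans (ler_normD _ _)); lra.
Qed.

Definition form_seq u : nat -> V := xget (fun=> 0) [set s | form_approx s u].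

(** The closed form, computed along chosen sequences; [form_ext_cvg] shows that every approximating
    sequence gives the same value. *)
Definition form_ext u v : R := lim ((fun k => ip (A (form_seq u k)) (form_seq v k)) @ \oo).

Local Notation q := form_ext.

Lemma form_seqP u : F u -> form_approx (form_seq u) u.
Proof. by case=> _ [s hs']; rewrite /form_seq; case: xgetP => [t -> //|/(_ s)]. Qed.

Lemma form_domain_sub : F `<=` H.
Proof. by move=> u []. Qed.

Lemma form_approx_domain s u : H u -> form_approx s u -> F u.
Proof. by move=> hu ?; split => //; exists s. Qed.

(** Two approximations of the same [u] differ by an approximation of 0, whose energy tends to 0 by
    closability; Cauchy-Schwarz transfers this to pairings with [t], whose energies are bounded. *)
Lemma form_approx_le s s' t u v : H u -> form_approx s u -> form_approx s' u ->
  form_approx t v ->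
  (fun k => ip (A (s k)) (t k) - ip (A (s' k)) (t k)) @ \oo --> (0 : R).
Proof.
move=> hu as_ as' at_; have [E E0 hE] := form_approx_bounded at_.
have ad := form_approx_lin (-1) hu hu as' as_.
have z : -1 *: u + u = 0 by rewrite scaleN1r addNr.
rewrite z in ad.
have d0 := form_approx_null (semi_ip0 hs) ad (ip0l hs (semi_ip0 hs)).
case: as_ as' at_ => Ds _ _ [Ds' _ _] [Dt _ _].
apply: (@cvg0_sqr_le _ _ (fun k => ip (A (-1 *: s' k + s k)) (-1 *: s' k + s k) * E)).
  move=> k; have -> : ip (A (s k)) (t k) - ip (A (s' k)) (t k) = ip (A (-1 *: s' k + s k)) (t k).
    have -> := semi_ip_linear hq (-1) (Ds' k) (Ds k) (Dt k).
    by rewrite /=; ring.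
  have Dk : D (-1 *: s' k + s k) by exact: (semi_ip_closed hq).
  apply: (le_trans (ip_CS hq Dk (Dt k))); apply: ler_wpM2l => //.
  exact: (semi_ip_ge0 hq Dk).
by rewrite -[X in _ --> X](mul0r E); apply: cvgM => //; exact: cvg_cst.
Qed.

Lemma form_ext_cvg s t u v : H u -> H v -> form_approx s u -> form_approx t v ->
  (fun k => ip (A (s k)) (t k)) @ \oo --> q u v.
Proof.
move=> hu hv as_ at_.
have au := form_seqP (form_approx_domain hu as_).
have av := form_seqP (form_approx_domain hv at_).
have [l hl] := form_pair_cvg au av.
have -> : q u v = l by apply: cvg_lim => //; exact: Rhausdorff.
have c1 := form_approx_le hu as_ au at_.
have c2 := form_approx_le hv at_ av au.
pose x1 k := ip (A (form_seq u k)) (form_seq v k).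
pose x2 k := ip (A (t k)) (form_seq u k) - ip (A (form_seq v k)) (form_seq u k).
pose x3 k := ip (A (s k)) (t k) - ip (A (form_seq u k)) (t k).
rewrite (_ : (fun k => _) = (fun k => x1 k + x2 k + x3 k)); last first.
  case: as_ at_ au av => Ds _ _ [Dt _ _] [Dfu _ _] [Dfv _ _]; apply/funext => k.
  have e1 := semi_ipC hq (Dt k) (Dfu k); have e2 := semi_ipC hq (Dfv k) (Dfu k).
  by rewrite /= in e1 e2; rewrite /x1 /x2 /x3 e1 e2; ring.
rewrite -[X in _ --> X]addr0 -[X in _ --> X + _]addr0.
by apply: cvgD; [apply: cvgD|].
Qed.

Lemma form_ext_D u v : D u -> D v -> q u v = ip (A u) v.
Proof.
move=> Du Dv; have := form_ext_cvg (DH Du) (DH Dv) (form_approx_cst Du) (form_approx_cst Dv).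
by move=> /(cvg_unique (@Rhausdorff R)) /(_ (cvg_cst _)).
Qed.

Lemma form_domain_D : D `<=` F.
Proof. by move=> u Du; apply: form_approx_domain (form_approx_cst Du); exact: DH. Qed.

Lemma form_ext_semi_ip : semi_ip F q.
Proof.
have cl a u v : F u -> F v -> F (a *: u + v).
  move=> Fu Fv; have [hu _] := Fu; have [hv _] := Fv.
  apply: (form_approx_domain (semi_ip_closed hs _ hu hv)).
  exact: (form_approx_lin a hu hv (form_seqP Fu) (form_seqP Fv)).
split => //.
- by apply: form_domain_D; exact: (semi_ip0 hq).
- move=> u v Fu Fv; have [hu _] := Fu; have [hv _] := Fv.
  have au := form_seqP Fu; have av := form_seqP Fv.
  have := form_ext_cvg hv hu av au.
  rewrite (_ : (fun k => _) = (fun k => ip (A (form_seq u k)) (form_seq v k))); last first.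
    case: au av => Du _ _ [Dv _ _]; apply/funext => k.
    exact: (semi_ipC hq (Dv k) (Du k)).
  by move=> /(cvg_unique (@Rhausdorff R)) /(_ (form_ext_cvg hu hv au av)) ->.
- move=> a u v w Fu Fv Fw; have [hu _] := Fu; have [hv _] := Fv; have [hw _] := Fw.
  have au := form_seqP Fu; have av := form_seqP Fv; have aw := form_seqP Fw.
  have := form_ext_cvg (semi_ip_closed hs a hu hv) hw (form_approx_lin a hu hv au av) aw.
  rewrite (_ : (fun k => _) = (fun k => a * ip (A (form_seq u k)) (form_seq w k) + ip (A (form_seq v k)) (form_seq w k))); last first.
    case: au av aw => Du _ _ [Dv _ _] [Dw _ _]; apply/funext => k.
    exact: (semi_ip_linear hq).
  move=> /(cvg_unique (@Rhausdorff R)); apply.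
  by apply: cvgD; [apply: cvgM; [exact: cvg_cst|]|]; exact: form_ext_cvg.
- move=> u Fu; have [hu _] := Fu; have au := form_seqP Fu.
  have c := form_ext_cvg hu hu au au.
  have <- := cvg_lim (@Rhausdorff R) c.
  apply: limr_ge; first by apply/cvg_ex; exists (q u u).
  by case: au => Du _ _; near=> k; exact: (semi_ip_ge0 hq).
Unshelve. all: by end_near. Qed.

Lemma form_ext_A u v : F u -> D v -> q u v = ip u (A v).
Proof.
move=> Fu Dv; have [hu _] := Fu; have au := form_seqP Fu.
have := form_ext_cvg hu (DH Dv) au (form_approx_cst Dv).
case: au => Du su _.
rewrite (_ : (fun k => _) = (fun k => ip (form_seq u k) (A v))); last first.
  apply/funext => k; have e := semi_ipC hq (Du k) Dv; rewrite /= in e.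
  by rewrite e (semi_ipC hs) //; [exact: AH|exact: DH].
move=> /(cvg_unique (@Rhausdorff R)); apply.
by apply: (cvgH_ip hs) => //; [move=> k; exact: DH|move=> _; exact: AH|exact: AH|apply: (cvgH_cst hs); exact: AH].
Qed.

Lemma form_approx_cvg s u : H u -> form_approx s u ->
  (fun k => q (s k - u) (s k - u)) @ \oo --> (0 : R).
Proof.
move=> hu as_; have [Ds su cs] := as_.
apply/cvgr0Pnorm_le => e e0; have [K hK] := cs _ e0.
exists K => // i /= Ki.
have Fs : F (s i - u).
  apply: (sipB form_ext_semi_ip); [exact: form_domain_D|exact: (form_approx_domain hu as_)].
rewrite ger0_norm; last exact: (semi_ip_ge0 form_ext_semi_ip).
have ad : form_approx (fun k => -1 *: s k + s i) (s i - u).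
  have := form_approx_lin (-1) hu (DH (Ds i)) as_ (form_approx_cst (Ds i)).
  by rewrite scaleN1r addrC.
have hd : H (s i - u) by apply: (sipB hs) => //; exact: DH.
have c := form_ext_cvg hd hd ad ad.
have <- := cvg_lim (@Rhausdorff R) c.
apply: limr_le; first by apply/cvg_ex; exists (q (s i - u) (s i - u)).
exists K => // j /= Kj; rewrite scaleN1r addrC.
exact/ltW/hK.
Qed.

Lemma form_approxP u e : F u -> 0 < e -> exists2 v, D v &
  ip (v - u) (v - u) < e /\ q (v - u) (v - u) < e.
Proof.
move=> Fu e0; have [hu _] := Fu; have au := form_seqP Fu.
have c := form_approx_cvg hu au; case: au => Du su _.
move/cvgr0Pnorm_lt: c => /(_ _ e0) c; move/cvgr0Pnorm_lt: su => /(_ _ e0) c'.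
near \oo => k; exists (form_seq u k) => //.
have x1 : `|ip (form_seq u k - u) (form_seq u k - u)| < e by near: k.
have x2 : `|q (form_seq u k - u) (form_seq u k - u)| < e by near: k.
by split; [apply: le_lt_trans x1|apply: le_lt_trans x2]; exact: ler_norm.
Unshelve. all: by end_near. Qed.

(** Each [s k] is replaced by a vector [t k] of [D] within 1/(k+1) for both forms. Completeness of
    [H] provides the limit of [t], and [t] itself is the approximating sequence that puts this limit
    into the form domain. *)
Lemma form_complete s : (forall k, F (s k)) ->
  (forall e, 0 < e -> exists K, forall i j, (K <= i)%N -> (K <= j)%N ->
    ip (s i - s j) (s i - s j) < e /\ q (s i - s j) (s i - s j) < e) ->
  exists2 u, F u & cvgH ip s u /\ cvgH q s u.
Proof.
move=> Fs cs.
have /choice[t ht] : forall k, exists v, [/\ D v, ip (v - s k) (v - s k) < k.+1%:R^-1 &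
   q (v - s k) (v - s k) < k.+1%:R^-1].
  move=> k; have [v Dv [h1 h2]] := form_approxP (Fs k) (e := k.+1%:R^-1) ltac:(by rewrite invr_gt0).
  by exists v.
have Dt k : D (t k) by case: (ht k).
have hF := form_ext_semi_ip.
have Ft k : F (t k) by exact: form_domain_D.
have small e : 0 < e -> exists K, forall k, (K <= k)%N -> (k.+1%:R^-1 : R) < e.
  move=> e0; exists (Num.truncn e^-1) => k hk.
  rewrite invf_plt ?posrE//; apply: lt_le_trans (truncnS_gt _) _.
  by rewrite ler_nat.
(* 10 = 2 + 2(2 + 2): the inequality |a - b|^2 <= 2|a - c|^2 + 2|b - c|^2 is used twice, through s_i
   and then through s_j. *)
have tri (B : set V) (b : V -> V -> R) i j (e : R) : semi_ip B b -> (forall k, B (s k)) ->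
  (forall k, B (t k)) -> b (t i - s i) (t i - s i) < e -> b (t j - s j) (t j - s j) < e ->
  b (s i - s j) (s i - s j) < e -> b (t i - t j) (t i - t j) < 10 * e.
  move=> hb Bs Bt h1 h2 h3.
  have h4 := nipB_le2 hb (Bt i) (Bt j) (Bs i).
  have h5 := nipB_le2 hb (Bt j) (Bs i) (Bs j).
  by lra.
have ct e : 0 < e -> exists K, forall i j, (K <= i)%N -> (K <= j)%N ->
    ip (t i - t j) (t i - t j) < e /\ q (t i - t j) (t i - t j) < e.
  move=> e0; have e1 : 0 < e / 10 by rewrite divr_gt0.
  have [K1 h1] := cs _ e1; have [K2 h2] := small _ e1.
  exists (maxn K1 K2) => i j; rewrite !geq_max => /andP[i1 i2] /andP[j1 j2].
  have [x1 x2] := h1 i j i1 j1.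
  have [_ y1 y2] := ht i; have [_ z1 z2] := ht j.
  have -> : e = 10 * (e / 10) by field.
  split.
    apply: (tri H) => //; [by move=> k; case: (Fs k)|by move=> k; exact: DH| |].
      by apply: lt_trans y1 _; exact: h2.
    by apply: lt_trans z1 _; exact: h2.
  apply: (tri F) => //.
    by apply: lt_trans y2 _; exact: h2.
  by apply: lt_trans z2 _; exact: h2.
have [u hu tu] : exists2 u, H u & cvgH ip t u.
  apply: Hcomplete => [k|e e0]; first exact: DH.
  by have [K hK] := ct e e0; exists K => i j Ki Kj; case: (hK i j Ki Kj).
have at_ : form_approx t u.
  split=> // e e0; have [K hK] := ct e e0; exists K => i j Ki Kj.
  by case: (hK i j Ki Kj) => _; rewrite form_ext_D//; exact: (sipB hq).
have Fu := form_approx_domain hu at_.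
exists u => //.
have inv0 : (fun k => 2 * (k.+1%:R^-1 : R)) @ \oo --> (0 : R).
  rewrite -[X in _ --> X](mulr0 (2 : R)); apply: cvgM; first exact: cvg_cst.
  apply/cvgr0Pnorm_lt => e e0; have [K hK] := small e e0.
  by exists K => // k /= Kk; rewrite ger0_norm; [exact: hK|rewrite invr_ge0].
have fin (B : set V) (b : V -> V -> R) : semi_ip B b -> (forall k, B (s k)) ->
  (forall k, B (t k)) -> B u -> (forall k, b (t k - s k) (t k - s k) < k.+1%:R^-1) ->
  (fun k => b (t k - u) (t k - u)) @ \oo --> (0 : R) -> cvgH b s u.
  move=> hb Bs Bt Bu h1 h2.
  apply: (@squeeze_cvgr _ _ _ _ (fun=> 0) (fun k => 2 * k.+1%:R^-1 + 2 * b (t k - u) (t k - u))).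
  - near=> k; rewrite (semi_ip_ge0 hb)/=; last exact: (sipB hb).
    have := nipB_le2 hb (Bs k) Bu (Bt k); have e1 := nipBC hb (Bs k) (Bt k).
    have e2 := nipBC hb Bu (Bt k); rewrite e1 e2 => h3.
    by apply: (le_trans h3); rewrite lerD2r ler_pM2l// ltW.
  - exact: cvg_cst.
  - rewrite -[X in _ --> X](addr0 (0 : R)); apply: cvgD => //.
    rewrite -[X in _ --> X](mulr0 (2 : R)); apply: cvgM => //; exact: cvg_cst.
split.
  apply: (fin H) => //; [by move=> k; case: (Fs k)|by move=> k; exact: DH|].
  by move=> k; case: (ht k).
apply: (fin F) => //; first by move=> k; case: (ht k).
exact: form_approx_cvg.
Unshelve. all: by end_near. Qed.

End ClosedForm.

(** * Compactness of the form embedding *)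

Lemma ultra_bounded_cvg (R : realType) (G : set_system nat) (x : nat -> R) (B : R) :
  UltraFilter G -> (forall k, `|x k| <= B) -> exists l : R, x @ G --> l.
Proof.
move=> GU xB; have GP : ProperFilter G by exact: ultra_proper.
have [l [_ lc]] : exists l, (`[- B, B] `&` cluster (x @ G)) l.
  have h : G (x @^-1` `[- B, B]%classic).
    by apply: filterE => k /=; rewrite in_itv/= -ler_norml.
  exact: (segment_compact (F := x @ G) _ h).
exists l => W Wl; have [//|h] := in_ultra_setVsetC (x @^-1` W) GU.
by have [y [/= ? ?]] := lc (~` W) W h Wl.
Qed.

Section Compactness.
Context {R : realType} {V : lmodType R} {H D : set V} {ip : V -> V -> R}
  {A : V -> V}.
Local Notation qD := (fun u v => ip (A u) v).
Hypothesis hs : semi_ip H ip.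
Hypothesis hq : semi_ip D qD.
Hypothesis DH : D `<=` H.
Hypothesis AH : forall u, D u -> H (A u).
Hypothesis hfin : forall e : R, 0 < e ->
  exists (d : nat) (L : 'I_d -> V -> R) (C : R),
    [/\ forall i u v, D u -> D v -> L i (u - v) = L i u - L i v,
        forall i u, D u -> (L i u) ^+ 2 <= C * (ip u u + ip (A u) u)
      & forall u, D u ->
          ip u u <= e * (ip u u + ip (A u) u) + \sum_i (L i u) ^+ 2].

(** Along an ultrafilter all the bounded sequences L_i(t_k) converge at once, without extraction of
    subsequences. On a member of the ultrafilter where these finitely many values nearly agree,
    [hfin] bounds |t_k - t_l|^2 by a small multiple of the energy plus small squares. *)
Lemma finite_rank_small (G : set_system nat) (t : nat -> V) (C e : R) :
  UltraFilter G -> (forall k, D (t k)) ->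
  (forall k, ip (t k) (t k) + ip (A (t k)) (t k) <= C) -> 0 < e ->
  exists2 B, G B & forall k l, B k -> B l -> ip (t k - t l) (t k - t l) < e.
Proof.
move=> GU Dt tC e0; have GP : ProperFilter G by exact: ultra_proper.
have C0 : 0 <= C.
  apply: le_trans (tC 0%N); apply: addr_ge0; first by apply: (semi_ip_ge0 hs); exact: DH.
  exact: (semi_ip_ge0 hq).
have C1 : 0 < C + 1 by rewrite ltr_wpDl.
(* The form norm of a difference is at most 4C, so this coefficient leaves at most e/2 for the
   energy term. *)
have e1 : 0 < e / (8 * (C + 1)) by rewrite divr_gt0// mulr_gt0.
have [d [L [K [Ladd Lb hL]]]] := hfin e1.
have /choice[l hl] : forall i, exists l : R, (fun k => L i (t k)) @ G --> l.
  move=> i; apply: (ultra_bounded_cvg (B := `|K| * C + 1)) => // k.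
  have h : L i (t k) ^+ 2 <= `|K| * C.
    apply: (le_trans (Lb i _ (Dt k))).
    apply: (@le_trans _ _ (`|K| * (ip (t k) (t k) + ip (A (t k)) (t k)))).
      apply: ler_wpM2r; last exact: ler_norm.
      apply: addr_ge0; first by apply: (semi_ip_ge0 hs); exact: DH.
      exact: (semi_ip_ge0 hq).
    exact: ler_wpM2l.
  have h2 : 0 <= `|K| * C by exact: mulr_ge0.
  rewrite -(ler_pXn2r (n := 2))// ?nnegrE ?addr_ge0//.
  rewrite real_normK ?num_real//; apply: le_trans h _.
  by nra.
(* The functionals differ by at most 2 dl; as dl <= 1, the d squares sum to at most 4 d dl, which is
   below e/2. *)
pose dl := Num.min 1 (e / (8 * (d.+1)%:R)).
have dl0 : 0 < dl by rewrite /dl lt_min ltr01/= divr_gt0// mulr_gt0.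
pose B := [set k | forall i, `|l i - L i (t k)| < dl].
exists B.
  apply: filter_forall => i; move: (hl i) => /cvgrPdist_lt; exact.
move=> j k Bj Bk; have Djk : D (t j - t k) by exact: (sipB hq).
apply: (le_lt_trans (hL _ Djk)).
have h1 : ip (t j - t k) (t j - t k) + ip (A (t j - t k)) (t j - t k) <= 4 * C.
  have x1 := nipB_le hs (DH (Dt j)) (DH (Dt k)).
  have x2 := nipB_le hq (Dt j) (Dt k).
  by have y1 := tC j; have y2 := tC k; rewrite /= in x2; lra.
have h2 : e / (8 * (C + 1)) * (ip (t j - t k) (t j - t k) + ip (A (t j - t k)) (t j - t k)) <= e / 2.
  apply: (@le_trans _ _ (e / (8 * (C + 1)) * (4 * C))); first by apply: ler_wpM2l => //; exact: ltW.
  have -> : e / (8 * (C + 1)) * (4 * C) = e / 2 * (C / (C + 1)) by field; rewrite gt_eqF.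
  by rewrite ler_piMr ?divr_ge0 ?(ltW e0)// ler_pdivrMr// mul1r lerDl.
have h3 : \sum_i L i (t j - t k) ^+ 2 <= \sum_(i < d) 4 * dl ^+ 2.
  apply: ler_sum => i _; rewrite Ladd//.
  have := Bj i; have := Bk i; rewrite !ltr_norml => /andP[a1 a2] /andP[b1 b2].
  have : `|L i (t j) - L i (t k)| <= 2 * dl by rewrite ler_norml; lra.
  move=> h; rewrite -(real_normK (num_real _)).
  have -> : 4 * dl ^+ 2 = (2 * dl) ^+ 2 by ring.
  by rewrite ler_pXn2r// nnegrE// mulr_ge0// ltW.
have h4 : \sum_(i < d) 4 * dl ^+ 2 < e / 2.
  rewrite sumr_const card_ord -mulr_natl.
  have d1 : dl ^+ 2 <= dl.
    by rewrite expr2 ler_piMl ?(ltW dl0)// /dl ge_min lexx.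
  have d2 : dl * (8 * d.+1%:R) <= e.
    by rewrite -ler_pdivlMr ?mulr_gt0// /dl ge_min lexx orbT.
  have d3 : (d%:R : R) < d.+1%:R by rewrite ltr_nat.
  have d4 : (0 : R) <= d%:R by [].
  have d5 : d%:R * dl ^+ 2 <= d%:R * dl by exact: ler_wpM2l.
  have d6 : d%:R * dl < d.+1%:R * dl by rewrite ltr_pM2r.
  lra.
lra.
Qed.

Hypothesis Hcomplete : forall s, (forall k, H (s k)) ->
  (forall e, 0 < e -> exists K, forall i j, (K <= i)%N -> (K <= j)%N ->
    ip (s i - s j) (s i - s j) < e) -> exists2 u, H u & cvgH ip s u.

Local Notation F := (form_domain H ip D A).
Local Notation q := (form_ext (D := D) (ip := ip) (A := A)).

Lemma invn_small (e : R) : 0 < e -> exists K, forall k, (K <= k)%N -> (k.+1%:R^-1 : R) < e.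
Proof.
move=> e0; exists (Num.truncn e^-1) => k hk.
rewrite invf_plt ?posrE//; apply: lt_le_trans (truncnS_gt _) _.
by rewrite ler_nat.
Qed.

(** An ultrafilter finer than the neighbourhoods of infinity has, for each n, a member B_n on which
    the approximating test vectors vary by less than 1/(n+1); [sub n] is picked beyond n in the
    intersection of B_0, ..., B_n. The selection is not made increasing: only n <= sub n is
    recorded. *)
Lemma form_compact s (C : R) : (forall k, F (s k)) ->
  (forall k, ip (s k) (s k) + q (s k) (s k) <= C) ->
  exists2 sub : nat -> nat, forall k, (k <= sub k)%N &
   forall e, 0 < e -> exists K, forall i j, (K <= i)%N -> (K <= j)%N ->
    ip (s (sub i) - s (sub j)) (s (sub i) - s (sub j)) < e.
Proof.
move=> Fs sC; have hF := form_ext_semi_ip hs hq DH AH.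
have FD := form_domain_D hs hq DH AH.
have /choice[t ht] : forall k, exists v, [/\ D v, ip (v - s k) (v - s k) < k.+1%:R^-1 &
   q (v - s k) (v - s k) < k.+1%:R^-1].
  move=> k; have [v Dv [h1 h2]] := form_approxP hs hq DH AH (Fs k) (e := k.+1%:R^-1) ltac:(by rewrite invr_gt0).
  by exists v.
have Dt k : D (t k) by case: (ht k).
have tC k : ip (t k) (t k) + ip (A (t k)) (t k) <= 2 * C + 4.
  have [_ h1 h2] := ht k; have Hk : H (s k) by case: (Fs k).
  have x1 := nipD_le hs (sipB hs (DH (Dt k)) Hk) Hk.
  have x2 := nipD_le hF (sipB hF (FD _ (Dt k)) (Fs k)) (Fs k).
  rewrite subrK in x1; rewrite /= subrK (form_ext_D hs hq DH AH) // in x2.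
  have x3 := sC k; have x4 : (k.+1%:R^-1 : R) <= 1 by rewrite invf_le1// ler1n.
  have {}h1 := lt_le_trans h1 x4; have {}h2 := lt_le_trans h2 x4.
  lra.
have [G [GU Goo]] : exists G : set_system nat, UltraFilter G /\ \oo `<=` G.
  exact: ultraFilterLemma.
have GP : ProperFilter G by exact: ultra_proper.
have /choice[B hB] : forall n : nat, exists B, G B /\ forall k l, B k -> B l ->
    ip (t k - t l) (t k - t l) < n.+1%:R^-1.
  move=> n; have n0 : 0 < (n.+1%:R^-1 : R) by rewrite invr_gt0.
  by have [B GB hB] := finite_rank_small GU Dt tC n0; exists B.
have /choice[sub hsub] : forall n : nat, exists k, (n <= k)%N /\ forall j : 'I_n.+1, B j k.
  move=> n; have : G ([set k | (n <= k)%N] `&` [set k | forall j : 'I_n.+1, B j k]).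
    apply: filterI; first by apply: Goo; exact: nbhs_infty_ge.
    by apply: filter_forall => j; case: (hB j).
  by move=> /filter_ex[k [h1 h2]]; exists k.
exists sub => [k|e e0]; first by case: (hsub k).
have e1 : 0 < e / 10 by rewrite divr_gt0.
have [K hK] := invn_small e1; exists K => i j Ki Kj.
have [i1 i2] := hsub i; have [j1 j2] := hsub j.
have x1 : ip (t (sub i) - t (sub j)) (t (sub i) - t (sub j)) < e / 10.
  apply: lt_trans (hK _ (leqnn K)); apply: (hB K).2.
    by have := i2 (inord K); rewrite inordK.
  by have := j2 (inord K); rewrite inordK.
have [_ y1 _] := ht (sub i); have [_ y2 _] := ht (sub j).
have Hk k : H (s k) by case: (Fs k).
have z1 := hK _ (leq_trans Ki i1); have z2 := hK _ (leq_trans Kj j1).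
have h4 := nipB_le2 hs (Hk (sub i)) (Hk (sub j)) (DH (Dt (sub i))).
have h5 := nipB_le2 hs (Hk (sub j)) (DH (Dt (sub i))) (DH (Dt (sub j))).
have f1 := nipBC hs (Hk (sub i)) (DH (Dt (sub i))).
have f2 := nipBC hs (Hk (sub j)) (DH (Dt (sub j))).
have {}y1 := lt_trans y1 z1; have {}y2 := lt_trans y2 z2; clear z1 z2.
lra.
Qed.

(** The adjoint condition is tested on [D] only. It extends to the form domain because test vectors
    approximate [v] in the form norm and both sides are continuous for it. The Friedrichs extension
    thus becomes the operator represented by the closed form. *)
Lemma friedrichsP (Ddense : forall w, H w -> (forall v, D v -> ip w v = 0) -> ip w w = 0)
  u w : friedrichs H ip D A u w <->
  [/\ F u, H w & forall v, F v -> q u v = ip w v].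
Proof.
have hF := form_ext_semi_ip hs hq DH AH.
have FD := form_domain_D hs hq DH AH.
split=> [[Fu Hw h]|[Fu Hw h]]; split => // v.
- move=> Fv; have [Hv _] := Fv.
  have [s Ds sv] : exists2 s, (forall k, D (s k)) & cvgH ip s v /\ cvgH q s v.
    have av := form_seqP Fv; have [Ds sv _] := av.
    exists (form_seq (D := D) (ip := ip) (A := A) v) => //; split => //.
    exact: (form_approx_cvg hs hq DH AH Hv av).
  have c1 := cvgH_ip hF (fun=> Fu) (fun k => FD _ (Ds k)) Fu Fv (cvgH_cst hF Fu) sv.2.
  have c2 := cvgH_ip hs (fun=> Hw) (fun k => DH (Ds k)) Hw Hv (cvgH_cst hs Hw) sv.1.
  rewrite (_ : (fun k => _) = (fun k => ip w (s k))) in c1; last first.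
    by apply/funext => k; rewrite (form_ext_A hs hq DH AH)// h.
  exact: (cvg_unique (@Rhausdorff R) c1 c2).
- by move=> Dv; rewrite -(form_ext_A hs hq DH AH)// h//; exact: FD.
Qed.

End Compactness.

(** * Spectral theory of a compactly embedded form *)

Lemma exists_mx_kernel (K : fieldType) (j : nat) (M : 'I_j.+1 -> 'I_j -> K) :
  exists2 a : 'I_j.+1 -> K, (exists i, a i != 0) &
    forall k, \sum_i a i * M i k = 0.
Proof.
pose A : 'M[K]_(j.+1, j) := \matrix_(i, k) M i k.
have rk : \rank (kermx A) != 0%N.
  rewrite mxrank_ker subn_eq0 -ltnNge; apply: leq_ltn_trans (rank_leq_col A) _.
  exact: ltnSn.
have /rowV0Pn[v vA v0] : kermx A != 0 by rewrite -mxrank_eq0.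
exists (v 0).
  apply/existsP; apply: contraNT v0; rewrite negb_exists => /forallP h.
  by apply/eqP/rowP => i; rewrite mxE; apply/eqP; have := h i; rewrite negbK.
move=> k; have /sub_kermxP/matrixP/(_ 0 k) := vA; rewrite !mxE => h.
by apply: etrans h; apply: eq_bigr => i _; rewrite !mxE.
Qed.

Section Spectral.
Context {R : realType} {V : lmodType R} {H F : set V} {ip q : V -> V -> R}.
Hypothesis hs : semi_ip H ip.
Hypothesis hF : semi_ip F q.
Hypothesis FH : F `<=` H.
Hypothesis Hcomplete : forall s, (forall k, H (s k)) ->
  (forall e, 0 < e -> exists K, forall i j, (K <= i)%N -> (K <= j)%N ->
    ip (s i - s j) (s i - s j) < e) -> exists2 u, H u & cvgH ip s u.
Hypothesis Fcomplete : forall s, (forall k, F (s k)) ->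
  (forall e, 0 < e -> exists K, forall i j, (K <= i)%N -> (K <= j)%N ->
    ip (s i - s j) (s i - s j) < e /\ q (s i - s j) (s i - s j) < e) ->
  exists2 u, F u & cvgH ip s u /\ cvgH q s u.
Hypothesis Fcompact : forall s (C : R), (forall k, F (s k)) ->
  (forall k, ip (s k) (s k) + q (s k) (s k) <= C) ->
  exists2 sub : nat -> nat, forall k, (k <= sub k)%N &
   forall e, 0 < e -> exists K, forall i j, (K <= i)%N -> (K <= j)%N ->
    ip (s (sub i) - s (sub j)) (s (sub i) - s (sub j)) < e.
Hypothesis Fdense : forall w, H w -> (forall v, F v -> ip w v = 0) -> ip w w = 0.
Hypothesis Finf : forall d, exists b : 'I_d -> V, (forall i, F (b i)) /\
  forall a : 'I_d -> R, ip (\sum_i a i *: b i) (\sum_i a i *: b i) = 0 ->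
    forall i, a i = 0.

Let hsF : semi_ip F ip.
Proof.
by apply: (semi_ip_sub hs) => //; [exact: (semi_ip0 hF)|exact: (semi_ip_closed hF)].
Qed.

(** There are j linear conditions on j + 1 coefficients. Independence modulo null vectors, stronger
    than linear independence, makes the solution non-null. *)
Lemma exists_orthogonal (j : nat) (phi : nat -> V) (b : 'I_j.+1 -> V) :
  (forall k, F (phi k)) -> (forall i, F (b i)) ->
  (forall a : 'I_j.+1 -> R, ip (\sum_i a i *: b i) (\sum_i a i *: b i) = 0 ->
    forall i, a i = 0) ->
  exists a : 'I_j.+1 -> R, let v := \sum_i a i *: b i in
    [/\ F v, ip v v != 0 & forall k, (k < j)%N -> ip v (phi k) = 0].
Proof.
move=> Fphi Fb bi.
have [a [i0 ai0] ha] := exists_mx_kernel (fun (i : 'I_j.+1) (k : 'I_j) => ip (b i) (phi k)).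
have FZ i : F (a i *: b i) by exact: (sipZ hF).
exists a; split.
- by apply: (sip_sum hF) => i _.
- by apply/eqP => /bi /(_ i0) /eqP; rewrite (negbTE ai0).
- move=> k kj; rewrite (ip_suml hsF) //; apply: etrans (ha (Ordinal kj)).
  by apply: eq_bigr => i _; rewrite (ipZl hsF).
Qed.

Definition minimizer (G : set V) (p : V) :=
  [/\ G p, ip p p = 1 & forall v, G v -> q p p * ip v v <= q v v].

(** Direct method. Compactness gives a minimizing selection that is Cauchy for [ip]. By the
    parallelogram identity q(t_i - t_j) = 2 q(t_i) + 2 q(t_j) - q(t_i + t_j), and q(t_i + t_j) >= l
    |t_i + t_j|^2, so the selection is Cauchy for q too and its limit attains the infimum l. *)
Lemma minimizer_exists (G : set V) : G `<=` F -> G 0 ->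
  (forall a u v, G u -> G v -> G (a *: u + v)) ->
  (forall s u, (forall k, G (s k)) -> F u -> cvgH ip s u -> G u) ->
  (exists2 v, G v & ip v v != 0) -> exists p, minimizer G p.
Proof.
move=> GF G0 Gl Gc [v0 Gv0 v0n].
have gip := semi_ip_sub hsF GF G0 Gl; have gq := semi_ip_sub hF GF G0 Gl.
have normalize v : G v -> ip v v != 0 -> exists2 w, G w &
    ip w w = 1 /\ q w w = q v v / ip v v.
  move=> Gv vn; have vp : 0 < ip v v by rewrite lt_neqAle eq_sym vn (semi_ip_ge0 gip).
  exists ((Num.sqrt (ip v v))^-1 *: v); first exact: (sipZ gip).
  rewrite (nipZ gip)// (nipZ gq)// exprVn sqr_sqrtr ?(ltW vp)//.
  by rewrite mulVf// mulrC.
pose E := [set q v v | v in [set v | G v /\ ip v v = 1]].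
have Einf : has_inf E.
  split; last by exists 0 => _ [v [Gv _] <-]; exact: (semi_ip_ge0 gq).
  by have [w Gw [w1 _]] := normalize _ Gv0 v0n; exists (q w w); exists w.
pose l := inf E.
have lE v : G v -> l * ip v v <= q v v.
  move=> Gv; have [v0'|vn] := eqVneq (ip v v) 0.
    by rewrite v0' mulr0 (semi_ip_ge0 gq).
  have vp : 0 < ip v v by rewrite lt_neqAle eq_sym vn (semi_ip_ge0 gip).
  have [w Gw [w1 w2]] := normalize _ Gv vn.
  rewrite -ler_pdivlMr// -w2; apply: (ge_inf Einf.2).
  by exists w.
have /choice[s hs_] : forall k : nat, exists v, [/\ G v, ip v v = 1 & q v v < l + k.+1%:R^-1].
  move=> k; have k0 : 0 < (k.+1%:R^-1 : R) by rewrite invr_gt0.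
  have [_ [v [Gv v1] <-] hv] := inf_adherent k0 Einf.
  by exists v.
have Gs k : G (s k) by case: (hs_ k).
have s1 k : ip (s k) (s k) = 1 by case: (hs_ k).
have sl k : q (s k) (s k) < l + k.+1%:R^-1 by case: (hs_ k).
have l0 : 0 <= l by apply: lb_le_inf; [exact: Einf.1|move=> _ [v [Gv _] <-]; exact: (semi_ip_ge0 gq)].
have k1 k : (k.+1%:R^-1 : R) <= 1 by rewrite invf_le1// ler1n.
have [|sub hsub cs] := Fcompact (s := s) (C := 2 + l) (fun k => GF _ (Gs k)).
  by move=> k; rewrite s1 -(addrA 1 1) lerD2l addrC; apply: le_trans (ltW (sl k)) _; rewrite lerD2l.
pose t k := s (sub k).
have [|p Fp [tp tq]] := Fcomplete (s := t) (fun k => GF _ (Gs (sub k))).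
  (* With x = |t_i - t_j|^2 the parallelogram bound reads q(t_i - t_j) <= 4(e/8) + l x; this
     threshold for x keeps l x below e/2 and x below e. *)
  move=> e e0; have d0 : 0 < e / (2 * (l + 4)) by rewrite divr_gt0//; lra.
  have [K1 h1] := cs _ d0.
  have e4 : 0 < e / 8 by rewrite divr_gt0.
  have [K2 h2] := invn_small e4.
  exists (maxn K1 K2) => i j; rewrite !geq_max => /andP[i1 i2] /andP[j1 j2].
  have x1 := h1 i j i1 j1; rewrite -/(t i) -/(t j) in x1.
  have x0 := semi_ip_ge0 gip (sipB gip (Gs (sub i)) (Gs (sub j))).
  rewrite -/(t i) -/(t j) in x0.
  have y1 : q (t i) (t i) < l + e / 8.
    by apply: lt_trans (sl _) _; rewrite ltrD2l h2// (leq_trans i2).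
  have y2 : q (t j) (t j) < l + e / 8.
    by apply: lt_trans (sl _) _; rewrite ltrD2l h2// (leq_trans j2).
  move: x1; rewrite ltr_pdivlMr => [x1|]; last by lra.
  have lx := mulr_ge0 l0 x0.
  split; first by nra.
  have z1 := nipB gq (Gs (sub i)) (Gs (sub j)).
  have z2 := nipD gq (Gs (sub i)) (Gs (sub j)).
  have z3 := nipB gip (Gs (sub i)) (Gs (sub j)).
  have z4 := nipD gip (Gs (sub i)) (Gs (sub j)).
  rewrite !s1 -/(t i) -/(t j) in z1 z2 z3 z4.
  have z5 := lE _ (sipD gip (Gs (sub i)) (Gs (sub j))); rewrite -/(t i) -/(t j) in z5.
  rewrite z4 in z5; rewrite z2 in z5; rewrite z1.
  have : ip (t i) (t j) = 1 - ip (t i - t j) (t i - t j) / 2 by rewrite z3; field.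
  move=> h; rewrite h in z5.
  lra.
have Gp : G p by apply: (Gc t) => // k; exact: Gs.
have p1 : ip p p = 1.
  have c := cvgH_ip hsF (fun k => GF _ (Gs (sub k))) (fun k => GF _ (Gs (sub k))) Fp Fp tp tp.
  rewrite (_ : (fun k => _) = fun=> 1) in c; last by apply/funext => k; exact: s1.
  by apply: (cvg_unique (@Rhausdorff R) c); exact: cvg_cst.
exists p; split => // v Gv; apply: le_trans (lE v Gv); apply: ler_wpM2r.
  exact: (semi_ip_ge0 gip).
have c := cvgH_ip hF (fun k => GF _ (Gs (sub k))) (fun k => GF _ (Gs (sub k))) Fp Fp tq tq.
rewrite -(cvg_lim (@Rhausdorff R) c).
apply/ler_addgt0Pr => e e0; have [K hK] := invn_small e0.
apply: limr_le; first by apply/cvg_ex; exists (q p p).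
exists K => // k /= Kk; apply: ltW; apply: lt_trans (sl _) _.
by rewrite ltrD2l hK// (leq_trans Kk).
Qed.

(** Minimality says that q - q(p, p) ip is again a semi-inner product on [G], with [p] as a null
    vector; by Cauchy-Schwarz a null vector is orthogonal to everything. *)
Lemma minimizer_euler (G : set V) p : G `<=` F -> G 0 ->
  (forall a u v, G u -> G v -> G (a *: u + v)) -> minimizer G p ->
  forall v, G v -> q p v = q p p * ip p v.
Proof.
move=> GF G0 Gl [Gp p1 pmin] v Gv.
have gip := semi_ip_sub hsF GF G0 Gl; have gq := semi_ip_sub hF GF G0 Gl.
pose b u w := q u w - q p p * ip u w.
have gb : semi_ip G b.
  split => //.
  - by move=> u w Gu Gw; rewrite /b (semi_ipC gq Gu Gw) (semi_ipC gip Gu Gw).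
  - move=> a u w z Gu Gw Gz; rewrite /b (semi_ip_linear gq)// (semi_ip_linear gip)//; ring.
  - by move=> u Gu; rewrite /b subr_ge0; exact: pmin.
have := ip_null gb Gp Gv; rewrite /b p1 mulr1 subrr => /(_ erefl) /eqP.
by rewrite subr_eq0 => /eqP.
Qed.

Definition orth_to (l : seq V) : set V :=
  [set u | F u /\ forall i, (i < size l)%N -> ip u (nth 0 l i) = 0].

Lemma orth_to_min (l : seq V) : (forall i, F (nth 0 l i)) ->
  exists p, minimizer (orth_to l) p.
Proof.
move=> Fl; apply: minimizer_exists.
- by move=> u [].
- by split; [exact: (semi_ip0 hF)|move=> i _; rewrite (ip0l hsF)].
- move=> a u v [Fu hu] [Fv hv]; split; first exact: (semi_ip_closed hF).
  by move=> i il; rewrite (semi_ip_linear hsF)// hu// hv// mulr0 addr0.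
- move=> s u Gs Fu su; split => // i il.
  have Fs k : F (s k) by case: (Gs k).
  have c := cvgH_ip hsF Fs (fun=> Fl i) Fu (Fl i) su (cvgH_cst hsF (Fl i)).
  rewrite (_ : (fun k => _) = fun=> 0) in c; last by apply/funext => k; case: (Gs k) => _; exact.
  by apply: (cvg_unique (@Rhausdorff R) c); exact: cvg_cst.
(* Infinite dimension modulo null vectors provides one vector more than there are conditions. *)
- have [b [Fb bi]] := Finf (size l).+1.
  have [a [Fv vn hv]] := exists_orthogonal (phi := nth 0 l) Fl Fb bi.
  by exists (\sum_i a i *: b i).
Qed.

(** The recursion runs on lists because each eigenvector minimizes over the complement of all the
    previous ones. The default 0 is never taken, by [orth_to_min]. *)
Definition next_eigen (l : seq V) : V := xget 0 (minimizer (orth_to l)).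
Fixpoint eigen_list (n : nat) : seq V :=
  if n is n'.+1 then rcons (eigen_list n') (next_eigen (eigen_list n')) else [::].
Definition eigenvec n := next_eigen (eigen_list n).
Definition eigenval n := q (eigenvec n) (eigenvec n).
Local Notation phi := eigenvec.
Local Notation lam := eigenval.

Lemma size_eigen_list n : size (eigen_list n) = n.
Proof. by elim: n => //= n ih; rewrite size_rcons ih. Qed.

Lemma nth_eigen_list n i : (i < n)%N -> nth 0 (eigen_list n) i = phi i.
Proof.
elim: n => //= n ih; rewrite ltnS leq_eqVlt => /predU1P[->|lt_in].
  by rewrite nth_rcons size_eigen_list ltnn eqxx.
by rewrite nth_rcons size_eigen_list lt_in ih.
Qed.

Definition orth_below n : set V := [set u | F u /\ forall i, (i < n)%N -> ip u (phi i) = 0].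

Lemma orth_belowE n : orth_to (eigen_list n) = orth_below n.
Proof.
apply/seteqP; split=> u [Fu h]; split => // i; rewrite ?size_eigen_list => lt_in.
  by have := h i; rewrite size_eigen_list nth_eigen_list//; apply.
by rewrite nth_eigen_list//; exact: h.
Qed.

Lemma F_eigen_list n i : F (nth 0 (eigen_list n) i).
Proof.
elim: n i => [|n ih] i; first by rewrite nth_nil; exact: (semi_ip0 hF).
rewrite nth_rcons; case: ifP => _; first exact: ih.
case: ifP => _; last exact: (semi_ip0 hF).
rewrite /next_eigen; case: xgetP => [p _ [[]]//|_]; exact: (semi_ip0 hF).
Qed.

Lemma eigenvec_min n : minimizer (orth_below n) (phi n).
Proof.
rewrite -orth_belowE; have [p hp] := orth_to_min (F_eigen_list n).
by rewrite /eigenvec /next_eigen; case: xgetP => [r -> //|/(_ p)].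
Qed.

Lemma eigenvec_F n : F (phi n).
Proof. by have [[]] := eigenvec_min n. Qed.

Let phiF := eigenvec_F.
Let phiH n : H (phi n).
Proof. exact: FH. Qed.

Lemma eigenvec_orth i j : ip (phi i) (phi j) = (i == j)%:R.
Proof.
have aux a b : (b < a)%N -> ip (phi a) (phi b) = 0.
  by move=> ba; have [[_ h] _ _] := eigenvec_min a; exact: h.
have [<-|ij] := eqVneq i j; first by have [] := eigenvec_min i.
by case: (ltngtP i j) ij => // h _; [rewrite (semi_ipC hs)//|]; exact: aux.
Qed.

Lemma orth_below0 n : orth_below n 0.
Proof. by split; [exact: (semi_ip0 hF)|move=> i _; rewrite (ip0l hsF)]. Qed.

Lemma orth_below_lin n a u v : orth_below n u -> orth_below n v -> orth_below n (a *: u + v).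
Proof.
move=> [Fu hu] [Fv hv]; split; first exact: (semi_ip_closed hF).
by move=> i il; rewrite (semi_ip_linear hsF)// hu// hv// mulr0 addr0.
Qed.

Definition fproj n u := \sum_(i < n) ip u (phi i) *: phi i.

Lemma fproj_F n u : F (fproj n u).
Proof. by apply: (sip_sum hF) => i _; exact: (sipZ hF). Qed.

Lemma ip_fproj n u j : ip (fproj n u) (phi j) = if (j < n)%N then ip u (phi j) else 0.
Proof.
rewrite (ip_suml hsF)//; last by move=> i _; exact: (sipZ hF).
case: ifP => [jn|/negbT jn].
  rewrite (bigD1 (Ordinal jn))//= big1 ?addr0.
    by rewrite (ipZl hsF)// eigenvec_orth eqxx mulr1.
  move=> i ij; rewrite (ipZl hsF)// eigenvec_orth; case: eqP => [e|_]; last by rewrite mulr0.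
  by move: ij; rewrite -val_eqE/= e eqxx.
rewrite big1// => i _; rewrite (ipZl hsF)// eigenvec_orth.
by case: eqP => [e|_]; rewrite ?mulr0//; move: jn; rewrite -e ltn_ord.
Qed.

Lemma fproj_orth n u : F u -> orth_below n (u - fproj n u).
Proof.
move=> Fu; split; first by apply: (sipB hF) => //; exact: fproj_F.
by move=> i lt_in; rewrite (ipBl hsF) ?ip_fproj ?lt_in ?subrr//; exact: fproj_F.
Qed.

(** Minimality gives the Euler equation only on the complement of phi_0, ..., phi_(n-1). On their
    span both sides vanish, since q(phi_n, phi_i) = q(phi_i, phi_n) = lam_i ip(phi_i, phi_n) = 0 by
    induction. *)
Lemma q_eigenvec n v : F v -> q (phi n) v = lam n * ip (phi n) v.
Proof.
elim/ltn_ind: n v => n ih v Fv.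
have hm := eigenvec_min n; have [[_ hn] _ _] := hm.
have hv := fproj_orth n Fv.
have GF : orth_below n `<=` F by move=> u [].
have hE := minimizer_euler GF (orth_below0 n) (@orth_below_lin n) hm.
have z : q (phi n) (fproj n v) = 0.
  rewrite (semi_ipC hF)//; last exact: fproj_F.
  rewrite (ip_suml hF)//; last by move=> i _; exact: (sipZ hF).
  rewrite big1// => i _; rewrite (ipZl hF)// ih//.
  by rewrite (semi_ipC hs (phiH i) (phiH n)) hn ?ltn_ord// !mulr0.
have z' : ip (phi n) (fproj n v) = 0.
  by rewrite (semi_ipC hsF) ?ip_fproj ?ltnn//; exact: fproj_F.
have := hE _ hv; rewrite (ipBr hF) ?(ipBr hsF)//; try exact: fproj_F.
by rewrite z z' !subr0.
Qed.

Lemma eigenval_ge0 n : 0 <= lam n.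
Proof. exact: (semi_ip_ge0 hF). Qed.

Lemma eigenval_nd n : lam n <= lam n.+1.
Proof.
have [_ _ h] := eigenvec_min n; have [[Fp hp] p1 _] := eigenvec_min n.+1.
have := h (phi n.+1); rewrite p1 mulr1; apply; split => // i lt_in.
by apply: hp; rewrite ltnW.
Qed.

Lemma eigenval_le : {homo lam : i j / (i <= j)%N >-> i <= j}.
Proof. exact: homo_leq lexx (@le_trans _ _) eigenval_nd. Qed.

(** Were the eigenvalues bounded, the orthonormal sequence would be bounded in the form norm and
    have a Cauchy selection, yet its members lie at squared distance 2. *)
Lemma eigenval_cvg : lam @ \oo --> +oo.
Proof.
apply/cvgryPge => B; apply: contrapT => hB.
have lB n : lam n <= B.
  rewrite leNgt; apply/negP => Bn; apply: hB; exists n => // k /= nk.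
  by apply: le_trans (ltW Bn) _; exact: eigenval_le.
have [||sub hsub cs] := Fcompact (s := phi) (C := 1 + B) => //.
  by move=> k; rewrite eigenvec_orth eqxx lerD2l; exact: lB.
have [K hK] := cs 1 ltr01.
(* [sub] may repeat values; [(sub K).+1] is taken as second index because its image exceeds
   [sub K]. *)
have := hK K (sub K).+1 (leqnn K) (leq_trans (hsub K) (leqnSn _)).
rewrite (nipB hs)// !eigenvec_orth !eqxx.
have -> : (sub K == sub (sub K).+1) = false.
  by apply/negbTE; rewrite neq_ltn hsub.
by rewrite /=; lra.
Qed.

Lemma nip_fproj n u : H u -> ip (u - fproj n u) (u - fproj n u) = ip u u - \sum_(i < n) ip u (phi i) ^+ 2.
Proof.
move=> hu; have hP : H (fproj n u) by apply: FH; exact: fproj_F.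
rewrite (nipB hs)//.
have e1 : ip u (fproj n u) = \sum_(i < n) ip u (phi i) ^+ 2.
  rewrite (ip_sumr hs)//; last by move=> i _; exact: (sipZ hs).
  by apply: eq_bigr => i _; rewrite (ipZr hs)// expr2.
have e2 : ip (fproj n u) (fproj n u) = \sum_(i < n) ip u (phi i) ^+ 2.
  rewrite {1}/fproj (ip_suml hs)//; last by move=> i _; exact: (sipZ hs).
  apply: eq_bigr => i _; by rewrite (ipZl hs)// (semi_ipC hs (phiH i) hP) ip_fproj ltn_ord// expr2.
by rewrite e1 e2; ring.
Qed.

Lemma bessel n u : H u -> \sum_(i < n) ip u (phi i) ^+ 2 <= ip u u.
Proof.
move=> hu; rewrite -subr_ge0 -nip_fproj//; apply: (semi_ip_ge0 hs); apply: (sipB hs) => //.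
by apply: FH; exact: fproj_F.
Qed.

Lemma q_fproj_le n u : F u -> q (u - fproj n u) (u - fproj n u) <= q u u.
Proof.
move=> Fu; have FP := fproj_F n u.
have Fr : F (u - fproj n u) by exact: (sipB hF).
have o : q (fproj n u) (u - fproj n u) = 0.
  rewrite {1}/fproj (ip_suml hF)//; last by move=> i _; exact: (sipZ hF).
  rewrite big1// => i _; rewrite (ipZl hF)// q_eigenvec// (semi_ipC hsF (phiF i) Fr).
  by have [_ h] := fproj_orth n Fu; rewrite h// !mulr0.
have := nipD hF FP Fr; rewrite o addrC subrK => ->.
by rewrite mulr0 addr0 lerDr (semi_ip_ge0 hF).
Qed.

(** The remainder lies in the complement of the first n eigenvectors, where q >= lam_n ip, and its
    energy is at most q(u, u); so its squared norm is at most q(u, u) / lam_n. *)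
Lemma fproj_cvgF u : F u -> cvgH ip (fun n => fproj n u) u.
Proof.
move=> Fu; rewrite /cvgH; apply/cvgr0Pnorm_lt => e e0.
have q0 := semi_ip_ge0 hF Fu.
have /cvgryPgt/(_ (q u u / e + 1)) [K _ hK] := eigenval_cvg.
exists K => // n /= Kn; have Fr : F (u - fproj n u) by apply: (sipB hF) => //; exact: fproj_F.
rewrite (nipBC hsF) //; last exact: fproj_F.
rewrite ger0_norm; last exact: (semi_ip_ge0 hsF).
have [_ _ hm] := eigenvec_min n; have := hm _ (fproj_orth n Fu); rewrite -/(lam n) => h1.
have h2 := q_fproj_le n Fu; have h3 := hK n Kn.
have x0 := semi_ip_ge0 hsF Fr.
have : (q u u / e + 1) * ip (u - fproj n u) (u - fproj n u) <= q u u.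
  by apply: le_trans h2; apply: le_trans h1; apply: ler_wpM2r => //; exact: ltW.
set x := ip _ _ in x0 *; move=> h4.
rewrite ltNge; apply/negP => ex.
have : (q u u / e + 1) * e <= q u u.
  by apply: le_trans h4; apply: ler_wpM2l => //; rewrite addr_ge0// divr_ge0// ltW.
rewrite mulrDl divfK ?gt_eqF// mul1r; lra.
Qed.

Lemma sumsq_small (c : nat -> R) (B : R) : (forall n, \sum_(i < n) c i ^+ 2 <= B) ->
  forall e, 0 < e -> exists K, forall i j, (K <= i)%N -> (i <= j)%N ->
    \sum_(i <= k < j) c k ^+ 2 < e.
Proof.
move=> hB e e0; pose S n := \sum_(0 <= k < n) c k ^+ 2.
have Snd : nondecreasing_seq S.
  apply/nondecreasing_seqP => n; rewrite /S big_nat_recr//= lerDl; exact: sqr_ge0.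
have SB : has_ubound (range S).
  by exists B => _ [n _ <-]; rewrite /S big_mkord.
have := nondecreasing_cvgn Snd SB; set l := sup _ => Sl.
have Sle n : S n <= l.
  by apply: ub_le_sup => //; exists n.
move/cvgrPdist_lt : Sl => /(_ _ e0) [K _ hK].
exists K => i j Ki ij.
have := hK i Ki; rewrite ger0_norm ?subr_ge0// => h.
have : S j = S i + \sum_(i <= k < j) c k ^+ 2 by rewrite /S -big_cat_nat.
have := Sle j; lra.
Qed.

Lemma nip_eigen_sum (c : nat -> R) i j :
  ip (\sum_(i <= k < j) c k *: phi k) (\sum_(i <= k < j) c k *: phi k) =
  \sum_(i <= k < j) c k ^+ 2.
Proof.
have hZ k : H (c k *: phi k) by exact: (sipZ hs).
rewrite (ip_suml hs)//; last by apply: (sip_sum hs).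
rewrite !big_nat; apply: eq_bigr => k kij; rewrite -big_nat.
rewrite (ip_sumr hs)// (bigD1_seq k)/= ?mem_index_iota ?iota_uniq//.
rewrite big1 ?addr0 => [|l lk].
  by rewrite (ipZl hs)// (ipZr hs)// eigenvec_orth eqxx mulr1 expr2.
by rewrite (ipZl hs)// (ipZr hs)// eigenvec_orth eq_sym (negbTE lk) !mulr0.
Qed.

Lemma q_eigen_sum (c : nat -> R) i j :
  q (\sum_(i <= k < j) c k *: phi k) (\sum_(i <= k < j) c k *: phi k) =
  \sum_(i <= k < j) lam k * c k ^+ 2.
Proof.
have hZ k : F (c k *: phi k) by exact: (sipZ hF).
rewrite (ip_suml hF)//; last by apply: (sip_sum hF).
rewrite !big_nat; apply: eq_bigr => k kij; rewrite -big_nat.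
rewrite (ip_sumr hF)// (bigD1_seq k)/= ?mem_index_iota ?iota_uniq//.
rewrite big1 ?addr0 => [|l lk].
  by rewrite (ipZl hF)// (ipZr hF)// q_eigenvec// eigenvec_orth eqxx mulr1; ring.
by rewrite (ipZl hF)// (ipZr hF)// q_eigenvec// eigenvec_orth eq_sym (negbTE lk) !mulr0.
Qed.

Lemma eigen_sum_diff (c : nat -> R) i j : (i <= j)%N ->
  \sum_(k < j) c k *: phi k - \sum_(k < i) c k *: phi k = \sum_(i <= k < j) c k *: phi k.
Proof.
move=> ij; rewrite -!(big_mkord xpredT (fun k => c k *: phi k)).
by rewrite (@big_cat_nat _ _ _ i 0 j)//= addrAC subrr add0r.
Qed.

Lemma eigen_series_cvg (c : nat -> R) (B : R) : (forall n, \sum_(i < n) c i ^+ 2 <= B) ->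
  exists2 u, H u & cvgH ip (fun n => \sum_(k < n) c k *: phi k) u.
Proof.
move=> hB.
have HS n : H (\sum_(k < n) c k *: phi k) by apply: (sip_sum hs) => i _; exact: (sipZ hs).
apply: Hcomplete => // e e0.
have [K hK] := sumsq_small hB e0; exists K => i j Ki Kj.
wlog ij : i j Ki Kj / (i <= j)%N => [hw|].
  by case: (leqP i j) => [|/ltnW]; [exact: hw|move=> ji; rewrite (nipBC hs)//; exact: hw].
by rewrite (nipBC hs)// eigen_sum_diff// nip_eigen_sum; exact: hK.
Qed.

(** Bessel's inequality gives a limit v of the expansion of u. Then u - v is orthogonal to every
    eigenvector, hence to [F] by [fproj_cvgF], hence null by density, and v can be exchanged for
    u. *)
Lemma fproj_cvg u : H u -> cvgH ip (fun n => fproj n u) u.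
Proof.
move=> hu; have [v hv cv] := eigen_series_cvg (c := fun i => ip u (phi i)) (fun n => bessel n hu).
have hP n : H (fproj n u) by apply: FH; exact: fproj_F.
have e i : ip (u - v) (phi i) = 0.
  rewrite (ipBl hs)//; have c := cvgH_ip hs hP (fun=> phiH i) hv (phiH i) cv (cvgH_cst hs (phiH i)).
  apply/eqP; rewrite subr_eq0; apply/eqP; apply: (cvg_unique (@Rhausdorff R) _ c).
  apply: cvg_near_cst; exists i.+1 => // n /= ltin.
  by apply/esym/eqP; rewrite ip_fproj ltin.
have huv : H (u - v) by exact: (sipB hs).
have z : ip (u - v) (u - v) = 0.
  apply: Fdense => // w Fw; have hw := FH Fw.
  have hPw n : H (fproj n w) by apply: FH; exact: fproj_F.
  have c := cvgH_ip hs (fun=> huv) hPw huv hw (cvgH_cst hs huv) (fproj_cvgF Fw).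
  apply: (cvg_unique (@Rhausdorff R) c).
  rewrite (_ : (fun=> _) = fun=> 0); first exact: cvg_cst.
  apply/funext => n; rewrite (ip_sumr hs)//; last by move=> i _; exact: (sipZ hs).
  by rewrite big1// => i _; rewrite (ipZr hs)// e mulr0.
rewrite /cvgH (_ : (fun k => _) = (fun k => ip (fproj k u - v) (fproj k u - v)))//.
apply/funext => n; have -> : fproj n u - u = (fproj n u - v) - (u - v).
  by rewrite opprB addrA subrK.
by rewrite (nip_nullB hs)//; exact: (sipB hs).
Qed.

Lemma eigen_orthonormal_basis : orthonormal_basis H ip phi.
Proof.
split; [exact: phiH|by move=> i j; exact: eigenvec_orth|].
exact: fproj_cvg.
Qed.

Lemma parseval_le u (B : R) : H u -> (forall n, \sum_(i < n) ip u (phi i) ^+ 2 <= B) -> ip u u <= B.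
Proof.
move=> hu hB; have c := fproj_cvg hu; have hP n : H (fproj n u) by apply: FH; exact: fproj_F.
apply/ler_addgt0Pr => e e0; move/cvgr0Pnorm_lt: c => /(_ _ e0) [K _ /(_ K (leqnn K))] /=.
rewrite (nipBC hs)//; rewrite ger0_norm; last by apply: (semi_ip_ge0 hs); exact: (sipB hs).
by rewrite nip_fproj//; have := hB K; lra.
Qed.

Hypothesis Fnull : forall u v, F u -> H v -> ip (v - u) (v - u) = 0 ->
  F v /\ q (v - u) (v - u) = 0.
Context {T : V -> V -> Prop}.
Hypothesis TP : forall u w, T u w <->
  [/\ F u, H w & forall v, F v -> q u v = ip w v].

Lemma eigenvec_T n : T (phi n) (lam n *: phi n).
Proof.
apply/TP; split=> //; first exact: (sipZ hs).
by move=> v Fv; rewrite q_eigenvec// (ipZl hsF).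
Qed.

Lemma T_coef u w i : T u w -> ip w (phi i) = lam i * ip u (phi i).
Proof.
move=> /TP [Fu Hw h]; rewrite -h// (semi_ipC hF)// q_eigenvec//.
by rewrite (semi_ipC hsF).
Qed.

Lemma eigenval_gap z : (forall i, lam i != z) ->
  exists2 d, 0 < d & forall i, d <= `|lam i - z|.
Proof.
move=> hz; have /cvgryPge/(_ (z + 1)) [K _ hK] := eigenval_cvg.
have [d d0 hd] : exists2 d, 0 < d & forall i, (i < K)%N -> d <= `|lam i - z|.
  elim: K {hK} => [|K [d d0 hd]]; first by exists 1.
  exists (Num.min d `|lam K - z|).
    by rewrite lt_min d0 normr_gt0 subr_eq0 hz.
  move=> i; rewrite ltnS leq_eqVlt => /predU1P[->|iK]; rewrite ge_min ?lexx ?orbT//.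
  by rewrite hd.
exists (Num.min d 1); first by rewrite lt_min d0 ltr01.
move=> i; have [iK|Ki] := ltnP i K; first by rewrite ge_min hd.
have := hK i Ki; rewrite /= => h; rewrite ge_min; apply/orP; right.
by rewrite ler_normr; apply/orP; left; lra.
Qed.

(** The solution has the coefficients c_i = ip(w, phi_i) / (lam_i - z). Its series must converge in
    the form norm, so lam_i c_i^2, and not just c_i^2, has to be dominated by ip(w, phi_i)^2. *)
Lemma resolvent_exists z w : (forall i, lam i != z) -> H w ->
  exists u, T u (z *: u + w).
Proof.
move=> hz hw; have [d d0 hd] := eigenval_gap hz.
have dn i : lam i - z != 0 by rewrite subr_eq0.
pose c i := ip w (phi i) / (lam i - z).
have bw n : \sum_(i < n) ip w (phi i) ^+ 2 <= ip w w by exact: bessel.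
(* The first two terms come from lam_i / (lam_i - z)^2 = 1 / (lam_i - z) + z / (lam_i - z)^2, the
   last from 1 / (lam_i - z)^2; d is a lower bound for all |lam_i - z|. *)
pose B := d^-1 + `|z| / d ^+ 2 + (d ^+ 2)^-1.
have i2 i : ((lam i - z) ^+ 2)^-1 <= (d ^+ 2)^-1.
  have z2 : 0 < (lam i - z) ^+ 2 by rewrite exprn_even_gt0//= dn.
  rewrite lef_pV2 ?posrE//; last exact: exprn_gt0.
  by rewrite -(real_normK (num_real (lam i - z))) ler_pXn2r// ?nnegrE ltW.
have i1 i : `|lam i - z|^-1 <= d^-1 by rewrite lef_pV2 ?posrE// normr_gt0.
have B1 : (d ^+ 2)^-1 <= B by rewrite /B lerDr addr_ge0 ?invr_ge0 ?divr_ge0 ?exprn_ge0// ltW.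
have c1 i : c i ^+ 2 <= B * ip w (phi i) ^+ 2.
  rewrite /c exprMn exprVn mulrC; apply: ler_wpM2r; first exact: sqr_ge0.
  exact: le_trans (i2 i) B1.
have c2 i : lam i * c i ^+ 2 <= B * ip w (phi i) ^+ 2.
  rewrite /c exprMn exprVn (mulrC (_ ^+ 2)) mulrA; apply: ler_wpM2r; first exact: sqr_ge0.
  have -> : lam i = (lam i - z) + z by rewrite subrK.
  rewrite mulrDl addrK; apply: (@le_trans _ _ (d^-1 + `|z| / d ^+ 2)); last first.
    by rewrite /B lerDl invr_ge0 exprn_ge0// ltW.
  apply: lerD.
    apply: le_trans (i1 i).
    have -> : (lam i - z) / (lam i - z) ^+ 2 = (lam i - z)^-1 by field.
    by rewrite -normfV ler_norm.
  apply: (@le_trans _ _ (`|z| / (lam i - z) ^+ 2)).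
    by apply: ler_wpM2r; [rewrite invr_ge0 sqr_ge0|exact: ler_norm].
  by apply: ler_wpM2l.
have B0 : 0 < B by apply: lt_le_trans B1; rewrite invr_gt0 exprn_gt0.
pose S n := \sum_(k < n) c k *: phi k.
have FS n : F (S n) by apply: (sip_sum hF) => i _; exact: (sipZ hF).
have [|u Fu [Su Sq]] := Fcomplete (s := S) FS.
  move=> e e0; have e1 : 0 < e / B by exact: divr_gt0.
  have [K hK] := sumsq_small (c := fun i => ip w (phi i)) bw e1.
  exists K => i j Ki Kj.
  have aux a b : (K <= a)%N -> (a <= b)%N ->
      ip (S b - S a) (S b - S a) < e /\ q (S b - S a) (S b - S a) < e.
    move=> Ka ab; rewrite /S eigen_sum_diff// nip_eigen_sum q_eigen_sum.
    have := hK a b Ka ab; rewrite ltr_pdivlMr// mulrC mulr_sumr => h.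
    by split; apply: le_lt_trans h; apply: ler_sum.
  case: (leqP i j) => [ij|/ltnW ji]; last exact: aux.
  by rewrite (nipBC hsF)// (nipBC hF)//; exact: aux.
exists u; apply/TP; have hu := FH Fu.
have hzw : H (z *: u + w) by exact: (semi_ip_closed hs).
split => // v Fv; have hv := FH Fv.
have FP n : F (fproj n w) by exact: fproj_F.
have x1 := cvgH_ip hF FS (fun=> Fv) Fu Fv Sq (cvgH_cst hF Fv).
have x2 := cvgH_ip hs (fun n => FH (FS n)) (fun=> hv) hu hv Su (cvgH_cst hs hv).
have x3 := cvgH_ip hs (fun n => FH (FP n)) (fun=> hv) hw hv (fproj_cvg hw) (cvgH_cst hs hv).
apply: (cvg_unique (@Rhausdorff R) x1).
rewrite (semi_ip_linear hs)// (_ : (fun k => _) = (fun n => z * ip (S n) v + ip (fproj n w) v)).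
  by apply: cvgD => //; apply: cvgM => //; exact: cvg_cst.
apply/funext => n.
have FZ (a : R) i : F (a *: phi i) by exact: (sipZ hF).
have HZ (a : R) i : H (a *: phi i) by exact: (sipZ hs).
rewrite /S /fproj (ip_suml hF)// !(ip_suml hs)// mulr_sumr -big_split/=.
apply: eq_bigr => i _; rewrite (ipZl hF)// !(ipZl hs)// q_eigenvec// /c.
by have := dn i => dni; field.
Qed.

Lemma resolvent_bound z : (forall i, lam i != z) ->
  exists C : R, forall u w, T u w -> ip u u <= C * ip (w - z *: u) (w - z *: u).
Proof.
move=> hz; have [d d0 hd] := eigenval_gap hz.
exists ((d ^+ 2)^-1) => u w Tuw; have /TP [Fu Hw _] := Tuw.
have Hu := FH Fu; have Hd : H (w - z *: u) by apply: (sipB hs) => //; exact: (sipZ hs).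
apply: parseval_le => // n.
apply: (@le_trans _ _ ((d ^+ 2)^-1 * \sum_(i < n) ip (w - z *: u) (phi i) ^+ 2)); last first.
  apply: ler_wpM2l; last exact: bessel.
  by rewrite invr_ge0 exprn_ge0// ltW.
rewrite mulr_sumr; apply: ler_sum => i _.
rewrite (ipBl hs)// ?(ipZl hs)//; last exact: (sipZ hs).
rewrite (T_coef _ Tuw) -mulrBl exprMn mulrA ler_peMl ?sqr_ge0//.
rewrite mulrC ler_pdivlMr ?exprn_gt0// mul1r -(real_normK (num_real (lam i - z))).
by rewrite ler_pXn2r// nnegrE// ltW.
Qed.

Lemma eigen_spectrum : op_spectrum H ip T = range lam.
Proof.
apply/seteqP; split => z.
  move=> hz; apply: contrapT => nz; apply: hz.
  have hz i : lam i != z by apply/eqP => e; apply: nz; exists i.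
  by split; [move=> w hw; exact: resolvent_exists|exact: resolvent_bound].
move=> [i _ <-] [_ [C hC]]; have := hC _ _ (eigenvec_T i).
rewrite subrr (ip0l hs (semi_ip0 hs)) mulr0 eigenvec_orth eqxx.
by rewrite ler10.
Qed.

Lemma T_null u v : F u -> H v -> ip (v - u) (v - u) = 0 ->
  F v /\ forall w, F w -> q v w = q u w.
Proof.
move=> Fu Hv h; have [Fv qz] := Fnull Fu Hv h; split => // w Fw.
exact: (ip_eq_null hF).
Qed.

Lemma phi_seq_ip (A : seq nat) (a : nat -> R) j : uniq A ->
  ip (\sum_(k <- A) a k *: phi k) (phi j) = if j \in A then a j else 0.
Proof.
move=> uA; rewrite (ip_suml hsF)//; last by move=> k _; exact: (sipZ hF).
case: ifP => jA.
  rewrite (bigD1_seq j)//= (ipZl hsF)// eigenvec_orth eqxx mulr1 big1 ?addr0// => k kj.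
  by rewrite (ipZl hsF)// eigenvec_orth (negbTE kj) mulr0.
rewrite big_seq big1// => k kA; rewrite (ipZl hsF)// eigenvec_orth.
by case: eqP => [e|_]; rewrite ?mulr0//; move: jA; rewrite -e kA.
Qed.

Lemma phi_independent d (h : 'I_d -> nat) (a : 'I_d -> R) : injective h ->
  ip (\sum_i a i *: phi (h i)) (\sum_i a i *: phi (h i)) = 0 -> forall i, a i = 0.
Proof.
move=> hi z i; have HZ k : H (a k *: phi (h k)) by exact: (sipZ hs).
have Hs : H (\sum_i a i *: phi (h i)) by apply: (sip_sum hs).
have := ip_null hs Hs (phiH (h i)) z.
rewrite (ip_suml hs)// (bigD1 i)//= (ipZl hs)// eigenvec_orth eqxx mulr1 big1 ?addr0// => k ki.
rewrite (ipZl hs)// eigenvec_orth; case: eqP => [/hi e|_]; last by rewrite mulr0.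
by rewrite e eqxx in ki.
Qed.

(** [K] is any index past the last occurrence of z, so the sum counts how often z is repeated in the
    list of eigenvalues. By [T_coef] an eigenvector for z has no component along the eigenvectors of
    other eigenvalues. *)
Lemma eigenspace_dim z (K : nat) : (forall j, (K <= j)%N -> lam j != z) ->
  subspace_of_dim H ip (\sum_(j < K) (lam j == z))%N (op_eigenspace T z).
Proof.
move=> hK; pose A := [seq i <- iota 0 K | lam i == z].
have uA : uniq A by rewrite filter_uniq// iota_uniq.
have mA j : (j \in A) = (lam j == z).
  rewrite mem_filter mem_iota add0n; case: eqP => //= e.
  by rewrite ltnNge; apply/negP => /hK; rewrite e eqxx.
have sA : (\sum_(j < K) (lam j == z))%N = size A.
  rewrite size_filter -sum1_count -(big_mkord xpredT (fun j => nat_of_bool (lam j == z))).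
  by rewrite /index_iota subn0 [RHS]big_mkcond/=; apply: eq_bigr => i _; case: eqP.
rewrite sA.
have sumE (a : nat -> R) : \sum_(i < size A) a (nth 0%N A i) *: phi (nth 0%N A i) = \sum_(k <- A) a k *: phi k.
  by rewrite (big_nth 0%N) big_mkord.
exists (fun i => phi (nth 0%N A i)); split => //.
- move=> a; apply: phi_independent => i j /eqP; rewrite nth_uniq// => /eqP.
  exact: val_inj.
- apply/seteqP; split => u.
  + move=> /[dup] Tu /TP [Fu _ _]; have Hu := FH Fu; split => //.
    exists (fun i => ip u (phi (nth 0%N A i))).
    rewrite (sumE (fun k => ip u (phi k))).
    have FP : F (\sum_(k <- A) ip u (phi k) *: phi k).
      by apply: (sip_sum hF) => k _; exact: (sipZ hF).
    have Hr : H (u - \sum_(k <- A) ip u (phi k) *: phi k).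
      by apply: (sipB hs) => //; exact: FH.
    apply/eqP; rewrite eq_le (semi_ip_ge0 hs)// andbT.
    apply: parseval_le => // n; rewrite big1// => i _.
    apply/eqP; rewrite sqrf_eq0 (ipBl hs)//; last exact: FH.
    rewrite (phi_seq_ip (fun k => ip u (phi k)))// mA; case: (lam i =P z) => [_|/eqP ne]; first by rewrite subrr.
    rewrite subr0; have := T_coef i Tu; rewrite (ipZl hs)// => /eqP.
    rewrite eq_sym -subr_eq0 -mulrBl mulf_eq0 subr_eq0 (negbTE ne).
    by [].
  + move=> [Hu [a ha]]; set s := \sum_i _ in ha.
    have Fs : F s by apply: (sip_sum hF) => k _; exact: (sipZ hF).
    have [Fu qu] := T_null Fs Hu ha.
    apply/TP; split => //; first exact: (sipZ hs).
    move=> v Fv; have Hv := FH Fv; rewrite qu// (ipZl hs)//.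
    rewrite (ip_eq_null hs Hu (FH Fs) Hv ha) /s (ip_suml hF)//; last by move=> k _; exact: (sipZ hF).
    rewrite (ip_suml hs)//; last by move=> k _; exact: (sipZ hs).
    rewrite mulr_sumr; apply: eq_bigr => i _.
    rewrite (ipZl hF)// (ipZl hs)// q_eigenvec//.
    have : nth 0%N A i \in A by exact: mem_nth.
    by rewrite mA => /eqP ->; ring.
Qed.

(** Lower bound: a space of dimension j + 1 contains a non-null vector orthogonal to phi_0, ...,
    phi_(j-1). Upper bound: the span of phi_0, ..., phi_j. [W] and [Q] are abstract so that [W120]
    and the norm of the weak gradient can replace the form domain and the closed form. *)
Lemma eigenval_minmax (W : set V) (Q : V -> R) : W = F ->
  (forall v, F v -> Q v = q v v) -> forall j,
  (lam j)%:E = ereal_inf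
    [set ereal_sup [set (Q v / ip v v)%:E | v in E `&` [set v | ip v v != 0]]
     | E in [set E | subspace_of_dim H ip j.+1 E /\ E `<=` W]].
Proof.
move=> -> hQ j; apply/eqP; rewrite eq_le; apply/andP; split.
  apply: le_ereal_inf_tmp => _ [E [[b [Hb bi EE]] EF] <-].
  have Eb i : E (b i).
    rewrite EE; split => //; exists (fun k => (k == i)%:R).
    rewrite (bigD1 i)//= eqxx scale1r big1 ?addr0 => [|k /negbTE ->]; last by rewrite scale0r.
    by rewrite subrr (ip0l hs (semi_ip0 hs)).
  have [a [Fv vn hv]] := exists_orthogonal eigenvec_F (fun i => EF _ (Eb i)) bi.
  set v := \sum_i _ in Fv vn hv.
  have Ev : E v.
    rewrite EE; split; first exact: FH.
    by exists a; rewrite subrr (ip0l hs (semi_ip0 hs)).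
  apply: ereal_sup_ge; exists (Q v / ip v v)%:E; first by exists v.
  rewrite lee_fin hQ//; have [_ _ h] := eigenvec_min j.
  have vp : 0 < ip v v by rewrite lt_neqAle eq_sym vn (semi_ip_ge0 hsF).
  by rewrite ler_pdivlMr//; apply: h; split.
(* Null perturbations of the span are included, since [subspace_of_dim] describes spaces saturated
   under them. *)
pose E := [set v | H v /\ exists a : 'I_j.+1 -> R,
  ip (v - \sum_i a i *: phi i) (v - \sum_i a i *: phi i) = 0].
have EF v : E v -> F v /\ q v v <= lam j * ip v v.
  move=> [Hv [a ha]].
  have FZ k : F (a k *: phi k) by exact: (sipZ hF).
  have Fs : F (\sum_i a i *: phi i) by apply: (sip_sum hF).
  have [Fv _] := T_null Fs Hv ha; have [_ qz] := Fnull Fs Hv ha.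
  split => //; rewrite (nip_eq_null hF Fv Fs qz) (nip_eq_null hs Hv (FH Fs) ha).
  rewrite (ip_suml hF)// (ip_suml hsF)// mulr_sumr; apply: ler_sum => i _.
  rewrite (ipZl hF)// q_eigenvec// (ipZl hsF)// (semi_ipC hsF (phiF i) Fs).
  rewrite (ip_suml hsF)// (bigD1 i)//= (ipZl hsF)// eigenvec_orth eqxx mulr1 big1; last first.
    move=> k ki; rewrite (ipZl hsF)// eigenvec_orth.
    have -> : (val k == val i) = false by rewrite val_eqE; exact/negbTE.
    by rewrite mulr0.
  rewrite addr0 mulrA (mulrC (a i)) -mulrA; apply: ler_wpM2r; first by rewrite -expr2 sqr_ge0.
  by apply: eigenval_le; rewrite -ltnS.
apply: (@le_trans _ _ (ereal_sup [set (Q v / ip v v)%:E | v in E `&` [set v | ip v v != 0]])).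
  apply: ereal_inf_lbound; exists E => //; split; last by move=> v /EF [].
  exists (fun i => phi i); split => //.
  by move=> a; apply: phi_independent => x y; exact: val_inj.
apply: ge_ereal_sup => _ [v [Ev /= vn] <-].
have [Fv h] := EF v Ev; rewrite lee_fin hQ//.
have vp : 0 < ip v v by rewrite lt_neqAle eq_sym vn (semi_ip_ge0 hsF).
by rewrite ler_pdivrMr.
Qed.

Lemma eigenval0 e : F e -> ip e e != 0 -> q e e = 0 -> lam 0 = 0.
Proof.
move=> Fe en qe; apply/eqP; rewrite eq_le eigenval_ge0 andbT.
have [_ _ h] := eigenvec_min 0; have := h e; rewrite qe -/(lam 0) => h1.
have ep : 0 < ip e e by rewrite lt_neqAle eq_sym en (semi_ip_ge0 hsF).
by have := h1 ltac:(by split); rewrite pmulr_lle0.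
Qed.

(** If lam 1 vanished too, phi 0 and phi 1 would both be multiples of [e] up to null vectors, and
    two such unit vectors cannot be orthogonal. *)
Lemma eigenval1_gt0 e : F e ->
  (forall u, F u -> q u u = 0 -> exists c, ip (u - c *: e) (u - c *: e) = 0) ->
  lam 0 = 0 -> lam 0 < lam 1.
Proof.
move=> Fe h l0; rewrite l0 lt_neqAle eigenval_ge0 andbT eq_sym; apply/eqP => l1.
have [c hc] := h _ (phiF 0%N) l0; have [d hd] := h _ (phiF 1%N) l1.
have He := FH Fe; have Hc : H (c *: e) by exact: (sipZ hs).
have Hd : H (d *: e) by exact: (sipZ hs).
have x0 : ip (phi 0) (phi 1) = c * d * ip e e.
  rewrite (ip_eq_null hs (phiH 0) Hc (phiH 1) hc) (semi_ipC hs Hc (phiH 1)).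
  by rewrite (ip_eq_null hs (phiH 1) Hd Hc hd) (ipZl hs)// (ipZr hs)//; ring.
have x1 := nip_eq_null hs (phiH 0) Hc hc; have x2 := nip_eq_null hs (phiH 1) Hd hd.
rewrite !eigenvec_orth/= in x0 x1 x2; rewrite !(nipZ hs)// in x1 x2.
have : (1 : R) = 0.
  transitivity ((c * d * ip e e) ^+ 2); last by rewrite -x0 expr0n.
  have x3 : 1 = (c ^+ 2 * ip e e) * (d ^+ 2 * ip e e) by rewrite -x1 -x2 mulr1.
  by apply: etrans x3 _; ring.
by move/eqP; rewrite oner_eq0.
Qed.

End Spectral.

(** * Limits of test vectors with bounded energy *)

Section EnergyBounded.
Context {R : realType} {V : lmodType R} {H D : set V} {ip : V -> V -> R}
  {A : V -> V}.
Local Notation qD := (fun u v => ip (A u) v).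
Hypothesis hs : semi_ip H ip.
Hypothesis hq : semi_ip D qD.
Hypothesis DH : D `<=` H.

(* Points of almost minimal energy in the convex sets
   [{v | |v - u|^2 <= d, <A v, v> <= C}] form a Cauchy sequence as [d]
   decreases, by the parallelogram identity. *)
Lemma form_domain_bounded (C : R) (s : nat -> V) u : H u ->
  (forall k, D (s k)) -> cvgH ip s u -> (forall k, ip (A (s k)) (s k) <= C) ->
  form_domain H ip D A u.
Proof.
move=> Hu Ds su sC; split => //.
pose K (d : R) := [set v | [/\ D v, ip (v - u) (v - u) <= d & ip (A v) v <= C]].
pose E d := [set ip (A v) v | v in K d].
have Kmid d v w : K d v -> K d w -> K d (2^-1 *: (v + w)).
  move=> [Dv v1 v2] [Dw w1 w2].
  have Dm : D (2^-1 *: (v + w)) by apply: (sipZ hq); exact: (sipD hq).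
  have Hvu := sipB hs (DH Dv) Hu; have Hwu := sipB hs (DH Dw) Hu.
  split => //.
    have -> : 2^-1 *: (v + w) - u = 2^-1 *: ((v - u) + (w - u)).
      have e2 : u = 2^-1 *: (u + u) by rewrite -mulr2n -(scaler_nat _ u) scalerA mulVf// scale1r.
      by rewrite {1}e2 -scalerBr opprD addrACA.
    rewrite (nipZ hs); last exact: (sipD hs).
    have := nipD_le hs Hvu Hwu; lra.
  have -> := nipZ hq 2^-1 (sipD hq Dv Dw).
  have := nipD_le hq Dv Dw; rewrite /=; lra.
have Kne d : 0 < d -> exists v, K d v.
  move=> d0; move/cvgr0Pnorm_lt: su => /(_ _ d0) [n _ /(_ n (leqnn n))] h.
  by exists (s n); split => //; apply/ltW; apply: le_lt_trans h; exact: ler_norm.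
have Einf d : 0 < d -> has_inf (E d).
  move=> /Kne [v Kv]; split; first by exists (ip (A v) v); exists v.
  by exists 0 => _ [w [Dw _ _] <-]; exact: (semi_ip_ge0 hq).
pose d n : R := n.+1%:R^-1.
have d0 n : 0 < d n by rewrite invr_gt0.
pose a n := inf (E (d n)).
have KS i j v : (i <= j)%N -> K (d j) v -> K (d i) v.
  move=> ij [Dv v1 v2]; split => //; apply: le_trans v1 _.
  by rewrite /d lef_pV2 ?posrE// ler_nat.
have aK n v : K (d n) v -> a n <= ip (A v) v.
  by move=> Kv; apply: (ge_inf (Einf _ (d0 n)).2); exists v.
have and_ : nondecreasing_seq a.
  move=> i j ij; apply: lb_le_inf; first exact: (Einf _ (d0 j)).1.
  by move=> _ [v Kv <-]; apply: aK; exact: KS Kv.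
have aC n : a n <= C.
  by have [v Kv] := Kne _ (d0 n); apply: le_trans (aK _ _ Kv) _; case: Kv.
have acv : a @ \oo --> sup (range a).
  by apply: nondecreasing_cvgn => //; exists C => _ [n _ <-].
have /choice[v hv] : forall n, exists v, K (d n) v /\ ip (A v) v < a n + d n.
  move=> n; have [_ [v Kv <-] h] := inf_adherent (d0 n) (Einf _ (d0 n)).
  by exists v.
have Dv n : D (v n) by have [[]] := hv n.
exists v; split => //.
  apply/cvgr0Pnorm_lt => e e0; have [L hL] := invn_small e0; exists L => // n /= Ln.
  rewrite ger0_norm; last by apply: (semi_ip_ge0 hs); apply: (sipB hs) => //; exact: DH.
  by have [[_ h _] _] := hv n; apply: le_lt_trans h (hL n Ln).
move=> e e0; have e1 : 0 < e / 8 by rewrite divr_gt0.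
have [L1 hL1] := invn_small e1.
move/cvgrPdist_lt : acv => /(_ _ e1) [L2 _ hL2].
have asup n : a n <= sup (range a).
  by apply: ub_le_sup; [exists C => _ [k _ <-]|exists n].
exists (maxn L1 L2) => i j.
have Dij x y : D (v x - v y) by exact: (sipB hq).
wlog ij : i j / (i <= j)%N => [hw hi hj|].
  case: (leqP i j) => [h|/ltnW h]; first exact: hw.
  have -> := nipBC hq (Dv i) (Dv j); exact: hw.
rewrite !geq_max => /andP[i1 i2] /andP[j1 j2].
have [Ki ki] := hv i; have [Kj kj] := hv j.
have Km := Kmid _ _ _ Ki (KS _ _ _ ij Kj).
have := aK _ _ Km; have -> := nipZ hq 2^-1 (sipD hq (Dv i) (Dv j)).
have -> := nipB hq (Dv i) (Dv j); have -> := nipD hq (Dv i) (Dv j).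
have x1 : d i < e / 8 := hL1 i i1; have x2 : d j < e / 8 := hL1 j j1.
have := hL2 i i2; rewrite /= ger0_norm ?subr_ge0// => x3.
have := asup j; have := asup i; rewrite /=.
move: ki kj x1 x2; move: (d i) (d j) => di dj; lra.
Qed.

End EnergyBounded.

(** * Lebesgue measure on row vectors *)

Lemma open_fun_measurable (T : ptopologicalType) (d : measure_display)
    (T' : measurableType d) (G : set (set T')) (D : set T) (f : T -> T') :
  d.-measurable = <<s G >> -> (forall A, G A -> open (D `&` f @^-1` A)) ->
  measurable_fun (D : set (borel T)) (f : borel T -> T').
Proof.
move=> e h; apply: (measurability G e) => _ [A GA <-].
by apply: sub_sigma_algebra; exact: h.
Qed.

Lemma open_preimage (T T' : topologicalType) (D : set T) (f : T -> T')
    (A : set T') : open D -> (forall x, D x -> {for x, continuous f}) -> open A ->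
  open (D `&` f @^-1` A).
Proof.
move=> oD cf oA; rewrite openE => x [Dx Afx].
apply: filterI; first by move: oD; rewrite openE; exact.
by apply: (cf x Dx); move: oA; rewrite openE; exact.
Qed.

Lemma open_borel (T : ptopologicalType) (A : set T) :
  open A -> measurable (A : set (borel T)).
Proof. exact: sub_sigma_algebra. Qed.

Lemma continuous_borel_measurable (T T' : ptopologicalType) (D : set T)
    (f : T -> T') : open D -> (forall x, D x -> {for x, continuous f}) ->
  measurable_fun (D : set (borel T)) (f : borel T -> borel T').
Proof.
move=> oD cf; have h : @measurable _ (borel T') = <<s @open T' >> by [].
apply: (open_fun_measurable (T' := borel T') h) => A oA.
exact: open_preimage.
Qed.

Lemma cont_measurable (R : realType) (T : ptopologicalType) (D : set T)
    (f : T -> R) : open D -> (forall x, D x -> {for x, continuous f}) ->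
  measurable_fun (D : set (borel T)) (f : borel T -> R).
Proof.
move=> oD cf; apply: (open_fun_measurable (RGenOpens.measurableE R)).
move=> A [x [y ->]]; exact: open_preimage.
Qed.

Section RowVectors.
Context {R : realType}.

Definition obox n (a b : 'rV[R]_n) : set 'rV[R]_n :=
  [set x | forall i, a 0 i < x 0 i < b 0 i].

Lemma open_rat_box n (O : set 'rV[R]_n) x : open O -> O x ->
  exists a b : 'rV[rat]_n, obox (map_mx ratr a) (map_mx ratr b) x /\
    obox (map_mx ratr a) (map_mx ratr b) `<=` O.
Proof.
rewrite openE => oO Ox; have := oO _ Ox; rewrite /interior -nbhs_ballE => -[e /= e0 eO].
have /choice[a ha] : forall i : 'I_n, exists q : rat, x 0 i - e < ratr q < x 0 i.
  move=> i; have [q] := rat_in_itvoo (x := x 0 i - e) (y := x 0 i) ltac:(by rewrite ltrBlDr ltrDl).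
  by rewrite in_itv/= => h; exists q.
have /choice[b hb] : forall i : 'I_n, exists q : rat, x 0 i < ratr q < x 0 i + e.
  move=> i; have [q] := rat_in_itvoo (x := x 0 i) (y := x 0 i + e) ltac:(by rewrite ltrDl).
  by rewrite in_itv/= => h; exists q.
exists (\row_i a i), (\row_i b i); split.
  by move=> i; rewrite !mxE; have /andP[_ ->] := ha i; have /andP[-> _] := hb i.
move=> y hy; apply: eO; split => // i0 j; rewrite (ord1 i0).
have := hy j; rewrite !mxE => /andP[h1 h2].
have /andP[h3 h4] := ha j; have /andP[h5 h6] := hb j.
by rewrite /ball/= ltr_norml; apply/andP; split; lra.
Qed.

Lemma open_obox_bigcup n (O : set 'rV[R]_n) : open O ->
  O = \bigcup_(p in [set p : 'rV[rat]_n * 'rV[rat]_n |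
    obox (map_mx ratr p.1) (map_mx ratr p.2) `<=` O])
      obox (map_mx ratr p.1) (map_mx ratr p.2).
Proof.
move=> oO; apply/seteqP; split => [x Ox|x [[a b] /= h] /h//].
by have [a [b [h1 h2]]] := open_rat_box oO Ox; exists (a, b).
Qed.

(** An open set is the union of the rational boxes that it contains, a countable family, and the
    preimage of a box is a finite intersection of conditions on coordinates. *)
Lemma measurable_rV (d : measure_display) (T : measurableType d) n (D : set T)
    (f : T -> 'rV[R]_n) : (forall i, measurable_fun D (fun t => f t 0 i)) ->
  measurable_fun D (f : T -> borel 'rV[R]_n).
Proof.
move=> mf; have e : @measurable _ (borel 'rV[R]_n) = <<s @open 'rV[R]_n >> by [].
move=> mD; apply: (measurability (rT := borel 'rV[R]_n) _ e _ mD).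
move=> _ [Y oO <-].
rewrite (open_obox_bigcup oO) preimage_bigcup setI_bigcupr.
rewrite bigcup_mkcond; apply: countable_bigcupT_measurable; first exact: countableP.
move=> [a b]; case: ifP => _ //.
rewrite (_ : _ `&` _ = D `&` \bigcap_(i in [set: 'I_n]) (D `&` (fun t => f t 0 i) @^-1`
   `]ratr (a 0 i), ratr (b 0 i)[%classic)).
  apply: measurableI => //; apply: fin_bigcap_measurable => [|i _].
    exact: finite_finset.
  exact: mf.
apply/seteqP; split => [t [Dt h]|t [Dt h]]; split => // i.
  by move=> _; split => //=; rewrite in_itv/=; have := h i; rewrite !mxE.
by have [_] := h i I; rewrite /= in_itv/= !mxE.
Qed.

Lemma measurable_coord n (i : 'I_n) (D : set 'rV[R]_n) : measurable (D : set (borel 'rV[R]_n)) ->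
  measurable_fun (D : set (borel 'rV[R]_n)) (fun x : borel 'rV[R]_n => (x : 'rV[R]_n) 0 i).
Proof.
move=> mD; apply: measurable_funTS.
by apply: cont_measurable => [|x _]; [exact: openT|exact: coord_continuous].
Qed.

(** Half-open, so that the dyadic subcubes of a cube are disjoint and fill it exactly. *)
Definition hbox n (a b : 'rV[R]_n) : set 'rV[R]_n :=
  [set x | forall i, a 0 i <= x 0 i < b 0 i].

Lemma mhbox n (a b : 'rV[R]_n) : measurable (hbox a b : set (borel 'rV[R]_n)).
Proof.
rewrite (_ : hbox a b = \bigcap_(i in [set: 'I_n]) (setT `&` (fun x : 'rV[R]_n => x 0 i) @^-1`
   `[a 0 i, b 0 i[%classic)).
  apply: fin_bigcap_measurable => [|i _]; first exact: finite_finset.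
  by apply: (measurable_coord i) => //.
apply/seteqP; split => [t h i _|t h i]; first by split => //=; rewrite in_itv/=; exact: h.
by have [_] := h i Logic.I; rewrite /= in_itv.
Qed.

Definition cons_rV n (p : R * 'rV[R]_n) : 'rV[R]_n.+1 :=
  row_mx (p.1%:M : 'rV[R]_1) p.2.

Lemma cons_rV0 n t (y : 'rV[R]_n) : cons_rV (t, y) 0 ord0 = t.
Proof.
rewrite /cons_rV; have -> : (ord0 : 'I_(1 + n)) = lshift n ord0 by apply: val_inj.
by apply: etrans (row_mxEl _ _ _ _) _; rewrite mxE eqxx mulr1n.
Qed.

Lemma cons_rVS n t (y : 'rV[R]_n) i : cons_rV (t, y) 0 (lift ord0 i) = y 0 i.
Proof.
rewrite /cons_rV; have -> : (lift ord0 i : 'I_(1 + n)) = rshift 1 i by apply: val_inj.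
exact: row_mxEr.
Qed.

Lemma cons_rV_measurable n :
  measurable_fun setT (@cons_rV n : measurableTypeR R * borel 'rV[R]_n -> borel 'rV[R]_n.+1).
Proof.
apply: measurable_rV => i; case: (unliftP ord0 i) => [j ->|->].
  rewrite (_ : (fun t => _) = (fun x : borel 'rV[R]_n => (x : 'rV[R]_n) 0 j) \o snd).
    exact: (measurableT_comp (measurable_coord j measurableT)).
  by apply/funext => -[t y]; rewrite cons_rVS.
rewrite (_ : (fun t => _) = fst); first exact: measurable_fst.
by apply/funext => -[t y]; rewrite cons_rV0.
Qed.

End RowVectors.
Lemma pushforward_measureE (d1 d2 : measure_display) (T1 : measurableType d1)
    (T2 : measurableType d2) (R : realType) (m : {measure set T1 -> \bar R})
    (f : T1 -> T2) : measurable_fun [set: T1] f ->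
  exists mu : {measure set T2 -> \bar R}, (mu : set T2 -> \bar R) = pushforward m f.
Proof.
move=> mf.
by exists (measure_function_pushforward__canonical__measure_function_Measure m mf).
Qed.

(** The image of Lebesgue measure under a translation gives every interval its length, so it is
    Lebesgue measure by uniqueness. *)
Lemma ge0_integral_translation (R : realType) (G : R -> \bar R) (c : R) :
  measurable_fun [set: R] G -> (forall t, (0 <= G t)%E) ->
  (\int[@lebesgue_measure R]_t G (t + c)%R = \int[@lebesgue_measure R]_t G t)%E.
Proof.
move=> mG G0.
have mt : measurable_fun [set: R] (fun t : R => t + c : measurableTypeR R).
  by apply: measurable_funD => //; exact: measurable_cst.
transitivity (\int[pushforward (@lebesgue_measure R) (fun t : R => (t + c)%R : measurableTypeR R)]_t G t)%E.
  by rewrite ge0_integral_pushforward.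
apply: eq_measure_integral => //= A mA _.
apply/esym; apply: lebesgue_measure_unique => //= _ [[a b]] _ <-.
rewrite /pushforward; have -> : (fun t : R => t + c) @^-1` `]a, b]%classic = `]a - c, b - c]%classic.
  by apply/seteqP; split => x /=; rewrite !in_itv/= => /andP[h1 h2]; apply/andP; split; lra.
rewrite /= !lebesgue_measure_itv/= !lte_fin.
by rewrite ltrD2r; case: ifP => // _; rewrite -!EFinB; congr EFin; ring.
Qed.

(** An alias carrying a proof of sigma-finiteness: a measure for which it is known only as a
    proposition acquires the structure that Tonelli's theorem asks for. *)
Definition sigma_finite_of (d : measure_display) (T : measurableType d)
    (R : realType) (mu : {measure set T -> \bar R})
    (sf : sigma_finite [set: T] mu) : set T -> \bar R := mu.

HB.instance Definition _ (d : measure_display) (T : measurableType d)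
  (R : realType) (mu : {measure set T -> \bar R}) (sf : sigma_finite [set: T] mu) :=
  Measure.copy (sigma_finite_of sf) mu.

HB.instance Definition _ (d : measure_display) (T : measurableType d)
  (R : realType) (mu : {measure set T -> \bar R}) (sf : sigma_finite [set: T] mu) :=
  Measure_isSigmaFinite.Build _ _ _ (sigma_finite_of sf) sf.

Section LebesgueRowVectors.
Context {R : realType}.

Lemma rV_integral0 n : rV_integral (fun _ : 'rV[R]_n => 0%E) = 0%E.
Proof. by elim: n => //= n ih; under eq_integral do rewrite ih; rewrite integral0. Qed.

Lemma rV_integral_hbox n (a b : 'rV[R]_n) : (forall i, a 0 i <= b 0 i) ->
  rV_integral (fun x => (\1_(hbox a b) x)%:E) = (\prod_i (b 0 i - a 0 i))%:E.
Proof.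
move=> ab; elim: n a b ab => [|n ih] a b ab /=.
  by rewrite big_ord0 indicE (_ : _ \in _) ?inE// => -[].
rewrite big_ord_recl.
pose a' := \row_j a 0 (lift ord0 j); pose b' := \row_j b 0 (lift ord0 j).
have iE t (y : 'rV[R]_n) : \1_(hbox a b) (cons_rV (t, y)) =
    \1_(`[a 0 ord0, b 0 ord0[%classic) t * \1_(hbox a' b') y :> R.
  rewrite !indicE -natrM mulnb; congr (_%:R); congr nat_of_bool.
  apply/idP/andP => [|[]]; rewrite !inE /=.
    move=> h; split.
      by rewrite in_itv/=; have := h ord0; rewrite cons_rV0.
    by move=> j; have := h (lift ord0 j); rewrite cons_rVS !mxE.
  rewrite in_itv/= => h1 h2 i; case: (unliftP ord0 i) => [j ->|->].
    by rewrite cons_rVS; have := h2 j; rewrite !mxE.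
  by rewrite cons_rV0.
rewrite (_ : (fun t => _) = (fun t => ((\prod_i (b' 0 i - a' 0 i)) * \1_(`[a 0 ord0, b 0 ord0[%classic) t)%:E)).
  rewrite (_ : (fun t => _) = (fun t => (\prod_i (b' 0 i - a' 0 i))%:E * (\1_(`[a 0 ord0, b 0 ord0[%classic) t)%:E)%E); last first.
    by apply/funext => t; rewrite EFinM.
  rewrite ge0_integralZl//; last 2 first.
  - by apply/measurable_EFinP; exact: measurable_indic.
  - by rewrite lee_fin prodr_ge0// => i _; rewrite !mxE subr_ge0.
  rewrite integral_indic//= setIT lebesgue_measure_itv/= lte_fin.
  rewrite (_ : (if _ then _ else _) = (b 0 ord0 - a 0 ord0)%:E).
    rewrite -EFinM mulrC; congr (_ * _)%:E.
    by apply: eq_bigr => i _; rewrite !mxE.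
  have := ab ord0; rewrite le_eqVlt => /orP[/eqP ->|->]; last by rewrite EFinB.
  by rewrite ltxx subrr.
apply/funext => t.
rewrite (_ : (fun y => _) = (fun y => (\1_(`[a 0 ord0, b 0 ord0[%classic) t * \1_(hbox a' b') y)%:E)); last first.
  by apply/funext => y; congr EFin; exact: iE.
have [ht|ht] := pselect (`[a 0 ord0, b 0 ord0[%classic t).
  have e1 : \1_(`[a 0 ord0, b 0 ord0[%classic) t = 1 :> R by rewrite indicE mem_set.
  rewrite e1.
  under [X in rV_integral X]eq_fun do rewrite mul1r.
  rewrite mulr1 ih// => i; rewrite !mxE; exact: ab.
rewrite indicE memNset// mulr0.
under [X in rV_integral X]eq_fun do rewrite mul0r.
exact: rV_integral0.
Qed.

Lemma rV_integral_sigma_finite n (mu : {measure set (borel 'rV[R]_n) -> \bar R}) :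
  (forall h : borel 'rV[R]_n -> \bar R, measurable_fun setT h ->
    (forall x, (0 <= h x)%E) -> rV_integral h = (\int[mu]_x h x)%E) ->
  sigma_finite setT mu.
Proof.
move=> hmu; pose c k : 'rV[R]_n := const_mx k%:R.
exists (fun k => hbox (- c k) (c k)).
  apply/esym/seteqP; split => // x _.
  pose B := \sum_i `|x 0 i|; have B0 : 0 <= B by exact: sumr_ge0.
  exists (Num.truncn B).+1 => // i; rewrite !mxE.
  have h1 : `|x 0 i| <= B by rewrite /B (bigD1 i)//= lerDl sumr_ge0.
  have h2 : B < (Num.truncn B).+1%:R by exact: truncnS_gt.
  have := le_lt_trans h1 h2; rewrite ltr_norml => /andP[h3 ->].
  by rewrite (ltW h3).
move=> k; split; first exact: mhbox.
have -> : mu (hbox (- c k) (c k)) = rV_integral (fun x => (\1_(hbox (- c k) (c k)) x)%:E).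
  rewrite hmu.
  - by rewrite integral_indic// ?setIT//; exact: mhbox.
  - by apply/measurable_EFinP; apply: measurable_indic; exact: mhbox.
  - by move=> x; rewrite lee_fin.
rewrite rV_integral_hbox ?ltry// => i; rewrite !mxE.
by apply: (@le_trans _ _ 0); rewrite ?oppr_le0.
Qed.

(** By induction, the product of Lebesgue measure with the measure in dimension n is pushed forward
    along [cons_rV], and Tonelli's theorem identifies its integral with the iterated one. The limit
    theorems for measures then apply to [rV_integral]. *)
Lemma rV_integral_measure n : exists mu : {measure set (borel 'rV[R]_n) -> \bar R},
  forall h : borel 'rV[R]_n -> \bar R, measurable_fun setT h ->
    (forall x, (0 <= h x)%E) -> rV_integral h = (\int[mu]_x h x)%E.
Proof.
elim: n => [|n [mu hmu]].
  exists (@dirac _ (borel 'rV[R]_0) 0 R).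
  by move=> h mh h0 /=; rewrite integral_dirac// diracT mul1e.
have sf := rV_integral_sigma_finite hmu.
pose mu1 : {sigma_finite_measure set (borel 'rV[R]_n) -> \bar R} := sigma_finite_of sf.
have [nu nuE] := pushforward_measureE ((@lebesgue_measure R) \x mu1)%E (@cons_rV_measurable R n).
exists nu.
move=> h mh h0; rewrite nuE ge0_integral_pushforward//; last exact: cons_rV_measurable.
rewrite preimage_setT.
have mhc : measurable_fun setT (h \o (@cons_rV R n : measurableTypeR R * borel 'rV[R]_n -> borel 'rV[R]_n.+1)).
  exact: (measurableT_comp mh (@cons_rV_measurable R n)).
rewrite (fubini_tonelli1 (m2 := mu1))//=.
apply: eq_integral => t _; rewrite /fubini_F hmu//.
have := measurableT_comp mhc (pair1_measurable (T2 := borel 'rV[R]_n) (t : measurableTypeR R)).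
exact.
Qed.

Definition rV_measure n : set (borel 'rV[R]_n) -> \bar R :=
  projT1 (cid (rV_integral_measure n)).

HB.instance Definition _ n :=
  Measure.copy (@rV_measure n) (projT1 (cid (rV_integral_measure n))).

Arguments rV_measure n _ : clear implicits.

Lemma rV_integralE n (h : borel 'rV[R]_n -> \bar R) : measurable_fun setT h ->
  (forall x, (0 <= h x)%E) -> rV_integral h = (\int[rV_measure n]_x h x)%E.
Proof. by rewrite /rV_measure; case: cid => mu h' /= ? ?; exact: h'. Qed.

Lemma rV_measure_sigma_finite n : sigma_finite setT (rV_measure n).
Proof.
by apply: rV_integral_sigma_finite => h mh h0; exact: rV_integralE.
Qed.

HB.instance Definition _ n :=
  Measure_isSigmaFinite.Build _ _ _ (@rV_measure n) (rV_measure_sigma_finite n).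

Lemma rV_measureE n (A : set (borel 'rV[R]_n)) : measurable A ->
  rV_measure n A = rV_integral (fun x => (\1_A x)%:E).
Proof.
move=> mA; rewrite rV_integralE.
- by rewrite integral_indic// setIT.
- by apply/measurable_EFinP; exact: measurable_indic.
- by move=> x; rewrite lee_fin.
Qed.

Lemma rV_measure_hbox n (a b : 'rV[R]_n) : (forall i, a 0 i <= b 0 i) ->
  rV_measure n (hbox a b) = (\prod_i (b 0 i - a 0 i))%:E.
Proof.
by move=> ab; rewrite rV_measureE ?rV_integral_hbox//; exact: mhbox.
Qed.

Lemma rV_integral_translation n (h : borel 'rV[R]_n -> \bar R) (v : 'rV[R]_n) :
  measurable_fun setT h -> (forall x, (0 <= h x)%E) ->
  rV_integral (fun x : 'rV[R]_n => h (x + v)) = rV_integral h.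
Proof.
elim: n h v => [|n ih] h v mh h0 /=; first by congr h; apply/rowP => -[].
pose v' := \row_j v 0 (lift ord0 j).
pose G t := rV_integral (fun y : 'rV[R]_n => h (cons_rV (t, y))).
have mhc : measurable_fun setT (h \o (@cons_rV R n : measurableTypeR R * borel 'rV[R]_n -> borel 'rV[R]_n.+1)).
  exact: (measurableT_comp mh (@cons_rV_measurable R n)).
have mht t : measurable_fun setT (fun y : borel 'rV[R]_n => h (cons_rV (t, y))).
  exact: (measurableT_comp mhc (pair1_measurable (T2 := borel 'rV[R]_n) (t : measurableTypeR R))).
transitivity (\int[@lebesgue_measure R]_t G (t + v 0 ord0)%R)%E.
  apply: eq_integral => t _; rewrite /G -[RHS](ih _ v')//.
  congr rV_integral; apply/funext => y; congr h.
  apply/rowP => i; rewrite mxE; case: (unliftP ord0 i) => [j ->|->].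
    rewrite -[row_mx _ _]/(cons_rV (t, y)) !cons_rVS [RHS]mxE.
    by rewrite [v' 0 j]mxE.
  by rewrite -[row_mx _ _]/(cons_rV (t, y)) !cons_rV0.
rewrite ge0_integral_translation//.
  rewrite /G (_ : (fun t => _) = (fun t => \int[rV_measure n]_y h (cons_rV (t, y))))%E; last first.
    by apply/funext => t; rewrite rV_integralE.
  have hF := measurable_fun_fubini_tonelli_F (m2 := rV_measure n) _ mhc (fun p => h0 (cons_rV p)).
  by rewrite /fubini_F in hF; apply: hF.
by move=> t; rewrite /G rV_integralE//; exact: integral_ge0.
Qed.

Lemma integral_translation n (h : borel 'rV[R]_n -> \bar R) (v : 'rV[R]_n) :
  measurable_fun setT h -> (forall x, (0 <= h x)%E) ->
  (\int[rV_measure n]_x h (x + v)%R = \int[rV_measure n]_x h x)%E.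
Proof.
move=> mh h0.
have mt : measurable_fun setT (fun x : borel 'rV[R]_n => x + v : borel 'rV[R]_n).
  apply: measurable_rV => i; rewrite (_ : (fun t => _) = (fun x : 'rV[R]_n => x 0 i + v 0 i)).
    by apply: measurable_funD; [exact: measurable_coord|exact: measurable_cst].
  by apply/funext => x; rewrite mxE.
rewrite -[LHS]rV_integralE//; last exact: (measurableT_comp mh mt).
by rewrite -[RHS]rV_integralE//; exact: rV_integral_translation.
Qed.

End LebesgueRowVectors.
Arguments rV_measure {R} n _.

(** * Functions of class C^k *)

Section NearDifferentiable.
Context {R : realType} {V W : normedModType R}.

Lemma near0_differentiable (f : V -> W) (x : V) : (\near x, f x = 0) ->
  differentiable f x.
Proof.
move=> f0; have fx : f x = 0 by exact: nbhs_singleton f0.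
have dc : continuous (\0 : {linear V -> W}) by move=> y; exact: cvg_cst.
have e : f \o shift x = cst (f x) + (\0 : {linear V -> W}) +o_ 0 id.
  have f1 : \forall h \near (0 : V), f (h + x) = 0.
    by move: f0; rewrite (near_shift 0 x) subr0.
  apply/eqaddoP => eps eps0; near=> h; rewrite !fctE /= fx addr0 subr0.
  have -> : f (h + x) = 0 by near: h.
  by rewrite normr0 mulr_ge0// ltW.
have dE := diff_unique dc e.
by apply/diff_locallyP; rewrite dE; split.
Unshelve. all: by end_near. Qed.

(** Adds to [f] the difference [g - f], which vanishes near [x] and so has differential 0. *)
Lemma near_eq_differentiable (f g : V -> W) (x : V) : (\near x, f x = g x) ->
  differentiable f x -> differentiable g x.
Proof.
move=> fg df; have -> : g = f + (g - f) by rewrite addrC subrK.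
apply: differentiableD => //; apply: near0_differentiable.
by apply: filterS fg => y e; rewrite !fctE e subrr.
Qed.

End NearDifferentiable.

Lemma near_open (T : topologicalType) (A : set T) (P : T -> Prop) (x : T) :
  open A -> A x -> (forall y, A y -> P y) -> \near x, P x.
Proof. by rewrite openE => oA Ax AP; apply: filterS (oA _ Ax) => y; exact: AP. Qed.

Lemma near_open_continuous (T U : topologicalType) (A : set T) (F G : T -> U) (x : T) :
  open A -> A x -> (forall y, A y -> F y = G y) -> {for x, continuous F} ->
  {for x, continuous G}.
Proof.
move=> oA Ax FG; rewrite /prop_for /continuous_at -(FG x Ax).
apply: cvg_trans; apply: near_eq_cvg; exact: (near_open oA Ax).
Qed.

Lemma continuous_matrix (R : realType) (T : topologicalType) p q (F : T -> 'M[R]_(p, q)) x :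
  (forall i j, {for x, continuous (fun t => F t i j)}) -> {for x, continuous F}.
Proof.
move=> h; rewrite /prop_for /continuous_at; apply/cvg_ballP => e e0.
have : \forall y \near x, forall ij : 'I_p * 'I_q, ball (F x ij.1 ij.2) e (F y ij.1 ij.2).
  apply: filter_forall => -[i j] /=.
  by move: (h i j) => /cvg_ballP; exact.
by apply: filterS => y hy; split => // i j; exact: (hy (i, j)).
Qed.

Section CkFunctions.
Context {R : realType} {m : nat} {W : normedModType R}.
Implicit Types (A B : set 'rV[R]_m) (F G : 'rV[R]_m -> W).

Lemma Ck_ext k A F G : open A -> (forall x, A x -> F x = G x) ->
  Ck_on k A F -> Ck_on k A G.
Proof.
move=> oA; elim: k F G => [|k ih] F G FG /=.
  by move=> h x Ax; apply: (near_open_continuous oA Ax FG); exact: h.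
have nFG x : A x -> \near x, F x = G x by move=> Ax; exact: (near_open oA Ax).
move=> [dF hF]; split=> [x Ax|v]; first exact: near_eq_differentiable (nFG x Ax) (dF x Ax).
by apply: ih (hF v) => x Ax; apply: near_eq_derive; exact: nFG.
Qed.

Lemma Ck_sub k A B F : B `<=` A -> Ck_on k A F -> Ck_on k B F.
Proof.
move=> BA; elim: k F => [|k ih] F /=; first by move=> h x /BA; exact: h.
by move=> [dF hF]; split=> [x /BA|v]; [exact: dF|exact: ih].
Qed.

Lemma Ck_local k A F : (forall x, A x -> exists2 B : set 'rV[R]_m, B x & Ck_on k B F) ->
  Ck_on k A F.
Proof.
elim: k F => [|k ih] F /= h.
  by move=> x /h [B Bx]; exact.
split=> [x /h [B Bx [+ _]]|v]; first exact.
by apply: ih => x /h [B Bx [_ hB]]; exists B.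
Qed.

Lemma Ck_cont k A F : Ck_on k A F -> Ck_on 0 A F.
Proof.
by case: k => [//|k] [dF _] x Ax; apply: differentiable_continuous; exact: dF.
Qed.

Lemma CkW k A F : Ck_on k.+1 A F -> Ck_on k A F.
Proof.
elim: k F => [|k ih] F; first exact: Ck_cont.
by move=> [dF hF]; split => // v; exact: ih.
Qed.

Lemma Ck_cst k A (a : W) : Ck_on k A (fun=> a).
Proof.
elim: k a => [|k ih] a /=; first by move=> x _; exact: cst_continuous.
split=> [x _|v]; first exact: differentiable_cst.
by rewrite (_ : 'D_v _ = fun=> 0) ?ih//; apply/funext => x; rewrite (derive_cst a).
Qed.

Lemma CkD k A F G : open A -> Ck_on k A F -> Ck_on k A G -> Ck_on k A (F + G).
Proof.
move=> oA; elim: k F G => [|k ih] F G /=.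
  by move=> hF hG x Ax; apply: continuousD; [exact: (hF x Ax)|exact: (hG x Ax)].
move=> [dF hF] [dG hG]; split=> [x Ax|v].
  by apply: differentiableD; [exact: dF|exact: dG].
apply: (Ck_ext oA) (ih _ _ (hF v) (hG v)) => x Ax.
by rewrite !fctE deriveD//; apply: diff_derivable; [exact: dF|exact: dG].
Qed.

Lemma CkN k A F : open A -> Ck_on k A F -> Ck_on k A (- F).
Proof.
move=> oA; elim: k F => [|k ih] F /=.
  by move=> hF x Ax; apply: continuousN; exact: (hF x Ax).
move=> [dF hF]; split=> [x Ax|v].
  by apply: differentiableN; exact: dF.
apply: (Ck_ext oA) (ih _ (hF v)) => x Ax.
by rewrite !fctE deriveN//; apply: diff_derivable; exact: dF.
Qed.

Lemma CkB k A F G : open A -> Ck_on k A F -> Ck_on k A G -> Ck_on k A (F - G).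
Proof. by move=> oA hF hG; apply: CkD => //; exact: CkN. Qed.

Lemma Ck_sum k A (I : Type) (r : seq I) (F : I -> 'rV[R]_m -> W) : open A ->
  (forall i, Ck_on k A (F i)) -> Ck_on k A (fun x => \sum_(i <- r) F i x).
Proof.
move=> oA h; elim: r => [|a r ih].
  by apply: (Ck_ext oA) (Ck_cst k A 0) => x _; rewrite big_nil.
by apply: (Ck_ext oA) (CkD oA (h a) ih) => x _; rewrite big_cons.
Qed.

End CkFunctions.

Section CkScalar.
Context {R : realType} {m : nat}.
Implicit Types (A B : set 'rV[R]_m) (F G : 'rV[R]_m -> R).

Lemma CkM k A F G : open A -> Ck_on k A F -> Ck_on k A G ->
  Ck_on k A (fun x => F x * G x).
Proof.
move=> oA; elim: k F G => [|k ih] F G.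
  by move=> hF hG x Ax; apply: continuousM; [exact: (hF x Ax)|exact: (hG x Ax)].
move=> hF hG; have [dF hF'] := hF; have [dG hG'] := hG; split=> [x Ax|v].
  by apply: (differentiableM (f := F) (g := G)); [exact: dF|exact: dG].
apply: (Ck_ext oA) (CkD oA (ih _ _ (CkW hF) (hG' v)) (ih _ _ (CkW hG) (hF' v))) => x Ax.
by rewrite !fctE (deriveM (f := F) (g := G))//; apply: diff_derivable; [exact: dF|exact: dG].
Qed.

Lemma CkZ k A F (a : R) : open A -> Ck_on k A F -> Ck_on k A (fun x => a * F x).
Proof. by move=> oA hF; apply: CkM => //; exact: Ck_cst. Qed.

Lemma Ck_prod k A (I : Type) (r : seq I) (F : I -> 'rV[R]_m -> R) : open A ->
  (forall i, Ck_on k A (F i)) -> Ck_on k A (fun x => \prod_(i <- r) F i x).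
Proof.
move=> oA h; elim: r => [|a r ih].
  by apply: (Ck_ext oA) (Ck_cst k A (1 : R)) => x _; rewrite big_nil.
by apply: (Ck_ext oA) (CkM oA (h a) ih) => x _; rewrite big_cons.
Qed.

Lemma CkV k A F : open A -> (forall x, A x -> F x != 0) -> Ck_on k A F ->
  Ck_on k A (fun x => (F x)^-1).
Proof.
move=> oA F0; elim: k => [|k ih] hF.
  by move=> x Ax; apply: continuousV; [exact: F0|exact: (hF x Ax)].
have [dF hF'] := hF; split=> [x Ax|v].
  by apply: (differentiableV (f := F)); [exact: dF|exact: F0].
have iF := ih (CkW hF).
apply: (Ck_ext oA) (CkN oA (CkM oA (CkM oA iF iF) (hF' v))) => x Ax.
rewrite deriveV; [|exact: F0|by apply: diff_derivable; exact: dF].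
rewrite -[LHS]/(- ((F x)^-1 * (F x)^-1 * 'D_v F x)) -[RHS]/(- (F x ^- 2) * 'D_v F x).
by rewrite expr2 invfM mulNr.
Qed.

Lemma Ck_divr k A F G : open A -> (forall x, A x -> G x != 0) -> Ck_on k A F ->
  Ck_on k A G -> Ck_on k A (fun x => F x / G x).
Proof. by move=> oA G0 hF hG; apply: CkM => //; exact: CkV. Qed.

Lemma derive_comp1 (h : R -> R) F x v : differentiable F x -> derivable h (F x) 1 ->
  differentiable (h \o F) x /\ 'D_v (h \o F) x = 'D_1 h (F x) * 'D_v F x.
Proof.
move=> dF dh; have dh' := dh; move/derivable1_diffP : dh' => dh'.
have dc := differentiable_comp dF dh'; split => //.
rewrite !deriveE// diff_comp//= deriv1E//= derive1E deriveE//.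
by rewrite -[LHS]/(_ * _) scale1r mulrC.
Qed.

Lemma Ck_sqrt k A F : open A -> (forall x, A x -> 0 < F x) -> Ck_on k A F ->
  Ck_on k A (fun x => Num.sqrt (F x)).
Proof.
move=> oA F0; elim: k => [|k ih] hF.
  by move=> x Ax; apply: (continuous_comp (hF x Ax)); exact: sqrt_continuous.
have [dF hF'] := hF.
have D x v : A x -> differentiable (Num.sqrt \o F) x /\
    'D_v (Num.sqrt \o F) x = (2 * Num.sqrt (F x))^-1 * 'D_v F x.
  move=> Ax; have [dv e] := is_derive1_sqrt (F0 x Ax).
  have [d1 ->] := derive_comp1 v (dF x Ax) dv.
  by split => //; rewrite e.
split=> [x Ax|v]; first by have [] := D x 0 Ax.
have s0 x : A x -> 2 * Num.sqrt (F x) != 0.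
  by move=> Ax; rewrite mulf_neq0// sqrtr_eq0 -ltNge F0.
have iF := CkV oA s0 (CkZ 2 oA (ih (CkW hF))).
by apply: (Ck_ext oA) (CkM oA iF (hF' v)) => x Ax; have [_ ->] := D x v Ax.
Qed.

(** Induction on k cannot treat one function alone, whose derivative is another function, but it can
    treat a family closed under derivation. The relation is that of E_i(x) = x^(-i) exp(-1/x). *)
Lemma Ck_family k A F (E : nat -> R -> R) : open A ->
  (forall i x, derivable (E i) x 1) ->
  (forall i x, 'D_1 (E i) x = E i.+2 x - i%:R * E i.+1 x) ->
  Ck_on k A F -> forall i, Ck_on k A (fun x => E i (F x)).
Proof.
move=> oA dE E'; elim: k => [|k ih] hF i.
  move=> x Ax; apply: (continuous_comp (hF x Ax)).
  by apply: differentiable_continuous; apply/derivable1_diffP; exact: dE.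
have [dF hF'] := hF; split=> [x Ax|v].
  by have [] := derive_comp1 0 (dF x Ax) (dE i (F x)).
have iF := ih (CkW hF).
apply: (Ck_ext oA) (CkM oA (CkB oA (iF i.+2) (CkZ i%:R oA (iF i.+1))) (hF' v)) => x Ax.
by have [_ ->] := derive_comp1 v (dF x Ax) (dE i (F x)); rewrite E'.
Qed.

Lemma Ck_coord k A (i : 'I_m) : Ck_on k A (fun x : 'rV[R]_m => x 0 i).
Proof.
case: k => [|k]; first by move=> x _; exact: coord_continuous.
split=> [x _|v]; first exact: differentiable_coord.
rewrite (_ : 'D_v _ = fun=> v 0 i); first exact: Ck_cst.
apply/funext => x; have dx : derivable (id : 'rV[R]_m -> _) x v by exact: derivable_id.
by have /rowP/(_ i) := derive_mx dx; rewrite derive_id mxE.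
Qed.

End CkScalar.

Section CkMatrix.
Context {R : realType} {m p q : nat}.
Implicit Types (A : set 'rV[R]_m) (F : 'rV[R]_m -> 'M[R]_(p, q)).

Lemma Ck_entry k A F i j : open A -> Ck_on k A F -> Ck_on k A (fun x => F x i j).
Proof.
move=> oA; elim: k F => [|k ih] F hF.
  move=> x Ax; apply: (@continuous_comp _ _ _ F (fun N : 'M[R]_(p, q) => N i j)) (hF x Ax) _.
  exact: coord_continuous.
have [dF hF'] := hF; split=> [x Ax|v].
  apply: (differentiable_comp (g := fun N : 'M[R]_(p, q) => N i j)) (dF x Ax) _.
  exact: differentiable_coord.
apply: (Ck_ext oA) (ih _ (hF' v)) => x Ax.
by rewrite derive_mx ?mxE//; apply: diff_derivable; exact: dF.
Qed.

Lemma Ck_matrix k A F : open A -> (forall i j, Ck_on k A (fun x => F x i j)) ->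
  Ck_on k A F.
Proof.
move=> oA; elim: k F => [|k ih] F hF.
  move=> x Ax; have h := fun i j => hF i j x Ax.
  exact: continuous_matrix.
have dF x : A x -> differentiable F x.
  move=> Ax; have -> : F = fun x => \sum_(ij : 'I_p * 'I_q) F x ij.1 ij.2 *: delta_mx ij.1 ij.2.
    by apply/funext => y; rewrite [LHS]matrix_sum_delta pair_big.
  elim: (index_enum _) => [|a r ihr].
    apply: near_eq_differentiable (differentiable_cst 0 x).
    by near=> y; rewrite big_nil.
  apply: (near_eq_differentiable (f := (fun x => F x a.1 a.2 *: (delta_mx a.1 a.2 : 'M[R]_(p, q))) +
    (fun x => \sum_(ij <- r) F x ij.1 ij.2 *: delta_mx ij.1 ij.2))).
    by near=> y; rewrite !fctE big_cons.
  apply: differentiableD => //; apply: differentiableZl.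
  by have [d _] := hF a.1 a.2; exact: (d x Ax).
split=> // v; apply: ih => i j.
have [_ h] := hF i j; apply: (Ck_ext oA) (h v) => x Ax.
by rewrite derive_mx ?mxE//; apply: diff_derivable; exact: dF.
Unshelve. all: by end_near. Qed.

End CkMatrix.

Section CkComposition.
Context {R : realType} {m n : nat}.

Definition pderiv d (F : 'rV[R]_d -> R) (i : 'I_d) : 'rV[R]_d -> R :=
  'D_(delta_mx 0 i) F.

Lemma derive_pderiv d (F : 'rV[R]_d -> R) x v : differentiable F x ->
  'D_v F x = \sum_i v 0 i * pderiv F i x.
Proof.
move=> dF; rewrite deriveE// {1}(row_sum_delta v) linear_sum/=.
by apply: eq_bigr => i _; rewrite linearZ/= /pderiv deriveE.
Qed.

Lemma jacobianE (G : 'rV[R]_m -> 'rV[R]_n) x i j : differentiable G x ->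
  'J G x i j = pderiv (fun y => G y 0 j) i x.
Proof.
move=> dG; have : ('D_(delta_mx 0 i) G x) 0 j = 'J G x i j.
  by rewrite deriveEjacobian// -rowE mxE.
by rewrite derive_mx ?mxE//; exact: diff_derivable.
Qed.

Lemma derive_comp_rV (F : 'rV[R]_n -> R) (G : 'rV[R]_m -> 'rV[R]_n) x v :
  differentiable G x -> differentiable F (G x) ->
  'D_v (F \o G) x = \sum_i 'D_v (fun y => G y 0 i) x * pderiv F i (G x).
Proof.
move=> dG dF; have dc := differentiable_comp dG dF.
rewrite deriveE// diff_comp//= -deriveE// derive_pderiv//.
apply: eq_bigr => i _; congr (_ * _).
by rewrite -deriveE// derive_mx ?mxE//; exact: diff_derivable.
Qed.

Lemma Ck_comp k (A : set 'rV[R]_m) (B : set 'rV[R]_n) (F : 'rV[R]_n -> R)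
    (G : 'rV[R]_m -> 'rV[R]_n) : open A -> open B -> (forall x, A x -> B (G x)) ->
  Ck_on k B F -> (forall i, Ck_on k A (fun x => G x 0 i)) ->
  Ck_on k A (fun x => F (G x)).
Proof.
move=> oA oB AB; elim: k F => [|k ih] F hF hG.
  have cG : Ck_on 0 A G.
    by apply: Ck_matrix => // i j; rewrite (ord1 i); exact: hG.
  move=> x Ax; apply: (continuous_comp (cG x Ax)); apply: hF; exact: AB.
have dG x : A x -> differentiable G x.
  move=> Ax; have : Ck_on k.+1 A G.
    by apply: Ck_matrix => // i j; rewrite (ord1 i); exact: hG.
  by case=> + _; exact.
have [dF hF'] := hF.
split=> [x Ax|v].
  by apply: (differentiable_comp (dG x Ax)); apply: dF; exact: AB.
have h i : Ck_on k A (fun x => 'D_v (fun y => G y 0 i) x * pderiv F i (G x)).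
  apply: CkM => //; first by have [_] := hG i; exact.
  by apply: ih => [|j]; [exact: hF'|apply: CkW].
apply: (Ck_ext oA) (Ck_sum (index_enum _) oA h) => x Ax.
by rewrite (derive_comp_rV v (dG x Ax))//; apply: dF; exact: AB.
Qed.

End CkComposition.

(** * Smooth steps and bumps on R^m *)

Section FlatExponential.
Context {R : realType}.

Definition flat_exp (i : nat) (x : R) : R :=
  if 0 < x then (x^-1) ^+ i * expR (- x^-1) else 0.

Lemma flat_exp_le0 i x : x <= 0 -> flat_exp i x = 0.
Proof. by rewrite /flat_exp ltNge => ->. Qed.

Lemma flat_exp_gt0 i x : 0 < x -> 0 < flat_exp i x.
Proof. by move=> x0; rewrite /flat_exp x0 mulr_gt0 ?expR_gt0// exprn_gt0 ?invr_gt0. Qed.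

Lemma flat_exp_ge0 i x : 0 <= flat_exp i x.
Proof.
by case: (ltP 0 x) => [/flat_exp_gt0 /ltW|/flat_exp_le0 ->].
Qed.

(** Raise y/n <= exp(y/n) to the power n. *)
Lemma exprn_expRN_le n (y : R) : 0 <= y -> y ^+ n * expR (- y) <= n%:R ^+ n.
Proof.
move=> y0; case: n => [|n]; first by rewrite expr0 mul1r expr0 -expR0 ler_expR oppr_le0.
rewrite expRN ler_pdivrMr ?expR_gt0//.
have h : y / n.+1%:R <= expR (y / n.+1%:R).
  by apply: le_trans (expR_ge1Dx _); rewrite lerDr.
have : (y / n.+1%:R) ^+ n.+1 <= expR (y / n.+1%:R) ^+ n.+1.
  by rewrite ler_pXn2r// nnegrE ?divr_ge0 ?expR_ge0.
rewrite -expRM_natl mulrCA divff ?pnatr_eq0// mulr1 expr_div_n ler_pdivrMr ?exprn_gt0//.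
by rewrite mulrC.
Qed.

Lemma flat_expS i x : flat_exp i x = x * flat_exp i.+1 x.
Proof.
rewrite /flat_exp; case: ltP => [x0|_]; last by rewrite mulr0.
by rewrite exprS !mulrA mulfV ?mul1r// gt_eqF.
Qed.

Lemma flat_exp_bound i x : `|flat_exp i x| <= i.+1%:R ^+ i.+1 * `|x|.
Proof.
rewrite flat_expS normrM mulrC; apply: ler_wpM2r => //.
rewrite /flat_exp; case: ifP => [x0|_]; last by rewrite normr0 exprn_ge0.
rewrite ger0_norm ?mulr_ge0 ?expR_ge0 ?exprn_ge0 ?invr_ge0 ?(ltW x0)//.
by apply: exprn_expRN_le; rewrite invr_ge0 ltW.
Qed.

(** Only the point 0 is delicate: there the difference quotient of E_i at h is E_(i+1)(h), which
    tends to 0 by [flat_exp_bound]. *)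
Lemma flat_exp_derive i (x : R) : is_derive x 1 (flat_exp i)
  (flat_exp i.+2 x - i%:R * flat_exp i.+1 x).
Proof.
case: (ltgtP x 0) => [x0|x0|->].
- have e : \near x, cst 0 x = flat_exp i x.
    near=> y; rewrite flat_exp_le0//; apply: ltW; near: y; exact: lt_nbhsl.
  apply: (near_eq_is_derive (f := cst 0)) => //.
  apply: is_derive_eq; rewrite !flat_exp_le0 ?ltW//; ring.
- pose f : R -> R := (fun y : R => y^-1) ^+ i * (fun y => expR (- y^-1)).
  have e : \near x, f x = flat_exp i x.
    near=> y; have y0 : 0 < y by near: y; exact: lt_nbhsr.
    by rewrite /flat_exp y0 /f !fctE.
  apply: (near_eq_is_derive (f := f)) => //.
  have dV : is_derive x 1 (fun y : R => y^-1) (- x ^- 2).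
    have dx : derivable (id : R -> R) x 1 by exact: derivable_id.
    have xn : id x != 0 by rewrite gt_eqF.
    apply: DeriveDef; first exact: (derivableV xn dx).
    by rewrite (deriveV xn dx) derive_id -[LHS]/(_ * _) mulr1.
  have dE : is_derive x 1 (fun y => expR (- y^-1)) (expR (- x^-1) * (x ^- 2)).
    have dN : is_derive x 1 (fun y : R => - y^-1) (x ^- 2).
      by apply: is_derive_eq; rewrite opprK.
    exact: (is_derive1_comp (f := expR) (g := fun y : R => - y^-1)).
  apply: is_derive_eq; rewrite /f !fctE /flat_exp x0.
  rewrite -![_ *: _]/(_ * _).
  case: i {e f} => [|i]; rewrite ?expr0 ?mul0r /=; last rewrite !exprS.
    by rewrite -exprVn; ring.
  by rewrite expr0 mulr1 !invfM; ring.
- rewrite !flat_exp_le0// mulr0 subr0.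
  have c : h^-1 *: (flat_exp i (h *: 1 + 0) - flat_exp i 0) @[h --> 0^'] --> (0 : R).
    apply/cvgr0Pnorm_lt => e e0.
    pose C : R := i.+2%:R ^+ i.+2 + 1.
    have C0 : 0 < C by rewrite ltr_wpDl// exprn_ge0.
    have d0 : 0 < e / C by rewrite divr_gt0.
    near=> h; have hn : h != 0 by near: h; exact: nbhs_dnbhs_neq.
    have hs : `|h| < e / C.
      by near: h; apply: dnbhs0_lt.
    rewrite [h *: 1]mulr1 addr0 (flat_exp_le0 _ (lexx 0)) subr0 flat_expS.
    rewrite -[_ *: _]/(_ * _) mulrA mulVf// mul1r.
    apply: le_lt_trans (flat_exp_bound _ _) _.
    move: hs; rewrite ltr_pdivlMr// mulrC => hs; apply: le_lt_trans hs.
    by apply: ler_wpM2r => //; rewrite /C lerDl.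
  apply: DeriveDef; first by apply/cvg_ex; exists 0.
  by apply: cvg_lim => //; exact: Rhausdorff.
Unshelve. all: by end_near. Qed.

Definition step (t : R) : R := flat_exp 0 t / (flat_exp 0 t + flat_exp 0 (1 - t)).

Lemma step_den t : 0 < flat_exp 0 t + flat_exp 0 (1 - t).
Proof.
case: (ltP 0 t) => [t0|t0].
  by rewrite ltr_pwDl ?flat_exp_gt0 ?flat_exp_ge0.
by rewrite ltr_wpDl ?flat_exp_ge0// flat_exp_gt0//; lra.
Qed.

Lemma step_le0 t : t <= 0 -> step t = 0.
Proof. by move=> t0; rewrite /step flat_exp_le0// mul0r. Qed.

Lemma step_ge1 t : 1 <= t -> step t = 1.
Proof.
move=> t1; rewrite /step (flat_exp_le0 0 (x := 1 - t)) ?addr0; last by lra.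
by rewrite divff// gt_eqF// flat_exp_gt0//; lra.
Qed.

Lemma step_ge0 t : 0 <= step t.
Proof. by rewrite /step divr_ge0 ?flat_exp_ge0// ltW ?step_den. Qed.

Lemma step_le1 t : step t <= 1.
Proof. by rewrite /step ler_pdivrMr ?step_den// mul1r lerDl flat_exp_ge0. Qed.

Context {m : nat}.
Implicit Types (A : set 'rV[R]_m) (F : 'rV[R]_m -> R).

Lemma Ck_flat_exp k A F : open A -> Ck_on k A F ->
  Ck_on k A (fun x => flat_exp 0 (F x)).
Proof.
move=> oA hF; apply: (Ck_family (E := flat_exp)) => //.
  by move=> i x; have [] := flat_exp_derive i x.
by move=> i x; have [_ ->] := flat_exp_derive i x.
Qed.

Lemma Ck_step k A F : open A -> Ck_on k A F -> Ck_on k A (fun x => step (F x)).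
Proof.
move=> oA hF; have h1 := Ck_flat_exp oA hF.
have h2 := Ck_flat_exp oA (CkB oA (Ck_cst k A (1 : R)) hF).
apply: Ck_divr => //; last exact: CkD.
by move=> x _; rewrite gt_eqF// step_den.
Qed.

Definition box_bump (a b x : 'rV[R]_m) : R :=
  \prod_i (flat_exp 0 (x 0 i - a 0 i) * flat_exp 0 (b 0 i - x 0 i)).

Lemma box_bump_gt0 a b x : obox a b x -> 0 < box_bump a b x.
Proof.
move=> h; apply: prodr_gt0 => i _; have /andP[h1 h2] := h i.
by rewrite mulr_gt0// flat_exp_gt0// subr_gt0.
Qed.

Lemma box_bump_eq0 a b x : ~ obox a b x -> box_bump a b x = 0.
Proof.
move=> h; have [i hi] : exists i, ~~ (a 0 i < x 0 i < b 0 i).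
  by apply: contrapT => nh; apply: h => i; apply: contrapT => /negP hi; apply: nh; exists i.
rewrite /box_bump (bigD1 i)//=; move: hi; rewrite negb_and -!leNgt => /orP[h1|h1].
  by rewrite flat_exp_le0 ?mul0r// subr_le0.
by rewrite (flat_exp_le0 0 (x := b 0 i - x 0 i)) ?mulr0 ?mul0r// subr_le0.
Qed.

Lemma box_bump_ge0 a b x : 0 <= box_bump a b x.
Proof.
by have [/box_bump_gt0 /ltW|/box_bump_eq0 ->] := pselect (obox a b x).
Qed.

Lemma Ck_box_bump k a b : Ck_on k setT (box_bump a b).
Proof.
have oT : open [set: 'rV[R]_m] by exact: openT.
apply: Ck_prod => // i; apply: CkM => //; apply: Ck_flat_exp => //.
  by apply: CkB => //; [exact: Ck_coord|exact: Ck_cst].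
by apply: CkB => //; [exact: Ck_cst|exact: Ck_coord].
Qed.

End FlatExponential.

(** * Integrals of real-valued functions *)

Lemma bounded_intg (d : measure_display) (T : measurableType d) (R : realType)
    (mu : {measure set T -> \bar R}) (D : set T) (f : T -> R) (C : R) :
  measurable D -> (mu D < +oo)%E -> measurable_fun D f ->
  (forall x, D x -> `|f x| <= C) -> mu.-integrable D (EFin \o f).
Proof.
move=> mD fD mf fC; apply: measurable_bounded_integrable => //.
by exists C; split; [exact: num_real|move=> M CM x Dx; apply: le_trans (fC x Dx) (ltW CM)].
Qed.

Section RealIntegrable.
Context (d : measure_display) (T : measurableType d) (R : realType)
  (mu : {measure set T -> \bar R}) (D : set T).
Hypothesis mD : measurable D.
Local Notation intb f := (mu.-integrable D (EFin \o f)).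

Lemma intgD (f g : T -> R) : intb f -> intb g -> intb (fun x => f x + g x).
Proof.
move=> i j; rewrite (_ : EFin \o _ = (EFin \o f) \+ (EFin \o g))%E.
  exact: integrableD.
by apply/funext => x /=; rewrite EFinD.
Qed.

Lemma intgZ (c : R) (f : T -> R) : intb f -> intb (fun x => c * f x).
Proof.
move=> i; rewrite (_ : EFin \o _ = (fun x => c%:E * (EFin \o f) x)%E).
  exact: integrableZl.
by apply/funext => x /=; rewrite EFinM.
Qed.

Lemma integrable_realN (f : T -> R) : intb f -> intb (fun x => - f x).
Proof.
move=> i; rewrite (_ : (fun x => _) = (fun x => -1 * f x)); first exact: intgZ.
by apply/funext => x; rewrite mulN1r.
Qed.

Lemma intgB (f g : T -> R) : intb f -> intb g -> intb (fun x => f x - g x).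
Proof. by move=> i j; apply: intgD => //; exact: integrable_realN. Qed.

Lemma intg_measurable (f : T -> R) : intb f -> measurable_fun D f.
Proof. by case/integrableP => /measurable_EFinP. Qed.

Lemma intg_sum (I : Type) (r : seq I) (f : I -> T -> R) :
  (forall i, intb (f i)) -> intb (fun x => \sum_(i <- r) f i x).
Proof.
move=> h; rewrite (_ : EFin \o _ = (fun x => \sum_(i <- r) (EFin \o f i) x)%E).
  exact: integrable_sum.
by apply/funext => x /=; rewrite sumEFin.
Qed.

Lemma intg_le (f g : T -> R) : measurable_fun D f ->
  (forall x, D x -> `|f x| <= g x) -> intb g -> intb f.
Proof.
move=> mf fg ig; apply: (le_integrable mD (g := EFin \o g)) => //.
  exact/measurable_EFinP.
by move=> x Dx /=; rewrite lee_fin (le_trans (fg x Dx))// ler_norm.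
Qed.

End RealIntegrable.

Lemma integrable_mul_bounded (d : measure_display) (T : measurableType d) (R : realType)
    (mu : {measure set T -> \bar R}) (D : set T) (w f : T -> R) (C : R) :
  measurable D -> mu.-integrable D (EFin \o w) -> measurable_fun D f ->
  (forall x, D x -> `|f x| <= C) -> mu.-integrable D (EFin \o (fun x => w x * f x)).
Proof.
move=> mD iw mf fC; have mw : measurable_fun D w.
  by have /integrableP[/measurable_EFinP] := iw.
apply: (le_integrable mD (g := EFin \o (fun x => C * w x))).
- by apply/measurable_EFinP; exact: measurable_funM.
- move=> x Dx /=; rewrite lee_fin normrM normrM mulrC; apply: ler_wpM2r => //.
  by apply: (le_trans (fC x Dx)); exact: ler_norm.
- exact: intgZ.
Qed.

Lemma Rintegral_sum (d : measure_display) (T : measurableType d) (R : realType)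
    (mu : {measure set T -> \bar R}) (D : set T) (I : Type) (r : seq I) (f : I -> T -> R) :
  measurable D -> (forall i, mu.-integrable D (EFin \o f i)) ->
  \int[mu]_(x in D) (\sum_(i <- r) f i x) = \sum_(i <- r) \int[mu]_(x in D) f i x.
Proof.
move=> mD h; elim: r => [|a r ih].
  rewrite big_nil; under eq_Rintegral do rewrite big_nil.
  by rewrite Rintegral_cst// mul0r.
rewrite big_cons -ih; under eq_Rintegral do rewrite big_cons.
rewrite RintegralD//.
exact: intg_sum.
Qed.

Lemma le_Rintegral_dom (d : measure_display) (T : measurableType d) (R : realType)
    (mu : {measure set T -> \bar R}) (D E : set T) (f : T -> R) :
  measurable D -> measurable E -> D `<=` E -> mu.-integrable E (EFin \o f) ->
  (forall x, E x -> 0 <= f x) ->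
  \int[mu]_(x in D) f x <= \int[mu]_(x in E) f x.
Proof.
move=> mD mE DE iE f0; have mf : measurable_fun E f.
  by have /integrableP[/measurable_EFinP] := iE.
rewrite /Rintegral; apply: fine_le.
- by apply: integrable_fin_num => //; exact: integrableS iE.
- exact: integrable_fin_num.
- apply: ge0_subset_integral => //; exact/measurable_EFinP.
Qed.

(** The discriminant of the nonnegative polynomial that integrates (t f + 1)^2. *)
Lemma Rintegral_CS (d : measure_display) (T : measurableType d) (R : realType)
    (mu : {measure set T -> \bar R}) (D : set T) (f : T -> R) :
  measurable D -> (mu D < +oo)%E -> mu.-integrable D (EFin \o f) ->
  mu.-integrable D (EFin \o (fun x => f x ^+ 2)) ->
  (\int[mu]_(x in D) f x) ^+ 2 <= fine (mu D) * \int[mu]_(x in D) (f x ^+ 2).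
Proof.
move=> mD fD i1 i2; rewrite mulrC.
have ic (c : R) : mu.-integrable D (EFin \o (fun=> c)).
  by apply: (bounded_intg (C := `|c|)) => //; exact: measurable_cst.
apply: ler_sqr_disc.
- by apply: Rintegral_ge0 => x _; exact: sqr_ge0.
- by apply: fine_ge0.
move=> t.
have e : \int[mu]_(x in D) ((t * f x + 1) ^+ 2) =
   (\int[mu]_(x in D) (f x ^+ 2)) * t ^+ 2 + 2 * (\int[mu]_(x in D) f x) * t + fine (mu D).
  have j1 := intgZ mD (t ^+ 2) i2; have j2 := intgZ mD (2 * t) i1.
  have j3 := intgD mD j1 j2.
  transitivity (\int[mu]_(x in D) (t ^+ 2 * f x ^+ 2 + 2 * t * f x + 1)).
    by apply: eq_Rintegral => x _; ring.
  rewrite RintegralD// RintegralD// !RintegralZl// Rintegral_cst//; ring.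
by rewrite -e; apply: Rintegral_ge0 => x _; exact: sqr_ge0.
Qed.

Lemma Rintegral_dominated_cvg (d : measure_display) (T : measurableType d) (R : realType)
    (mu : {measure set T -> \bar R}) (D : set T) (f_ : nat -> T -> R) (f g : T -> R) :
  measurable D -> (forall n, measurable_fun D (f_ n)) ->
  (forall x, D x -> f_ ^~ x @ \oo --> f x) ->
  mu.-integrable D (EFin \o g) -> (forall n x, D x -> `|f_ n x| <= g x) ->
  mu.-integrable D (EFin \o f) /\ (fun n => \int[mu]_(x in D) f_ n x) @ \oo --> \int[mu]_(x in D) f x.
Proof.
move=> mD mf fcv ig fg.
have mlim : measurable_fun D f by apply: (measurable_fun_cvg mf).
have hE x : D x -> (f_ n x)%:E @[n --> \oo] --> (f x)%:E.
  by move=> Dx; apply: cvg_EFin; [exact: nearW|exact: fcv].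
have [i1 i2 i3] := @dominated_convergence _ _ R mu D mD (fun n => EFin \o f_ n)
  (EFin \o f) (EFin \o g) (fun n => proj2 (measurable_EFinP _ _) (mf n))
  (proj2 (measurable_EFinP _ _) mlim) (aeW _ hE) ig
  (aeW _ (fun x n Dx => fg n x Dx)).
split => //; apply: fine_cvg; rewrite fineK//.
exact: integrable_fin_num.
Qed.

(** * Derivatives along lines and their integrals *)

Section LineDerivative.
Context {R : realType} {m : nat}.
Implicit Types (F : 'rV[R]_m -> R) (x v : 'rV[R]_m).

Lemma line_is_derive F x v (s : R) : derivable F (x + s *: v) v ->
  is_derive s 1 (fun t : R => F (x + t *: v)) ('D_v F (x + s *: v)).
Proof.
move=> dF.
have e : (fun h : R => h^-1 *: (((fun t : R => F (x + t *: v)) \o shift s) (h *: 1) - F (x + s *: v))) =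
  (fun h : R => h^-1 *: ((F \o shift (x + s *: v)) (h *: v) - F (x + s *: v))).
  apply/funext => h /=; congr (_ *: (F _ - _)).
  by rewrite [h *: 1]mulr1 scalerDl addrCA addrA.
by apply: DeriveDef; rewrite /derivable /derive e.
Qed.

Lemma segment_lipschitz F x v (L : R) :
  (forall s : R, 0 <= s <= 1 -> differentiable F (x + s *: v)) ->
  (forall s : R, 0 <= s <= 1 -> `|'D_v F (x + s *: v)| <= L) ->
  `|F (x + v) - F x| <= L.
Proof.
move=> dF bF; pose g (t : R) := F (x + t *: v).
have dg (s : R) : 0 <= s <= 1 -> is_derive s 1 g ('D_v F (x + s *: v)).
  by move=> hs; apply: line_is_derive; apply: diff_derivable; exact: dF.
have h1 (s : R) : s \in `]0, 1[ -> is_derive s 1 g ('D_v F (x + s *: v)).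
  by rewrite in_itv/= => /andP[/ltW a1 /ltW a2]; apply: dg; rewrite a1.
have h2 : {within `[0, 1], continuous g}.
  rewrite continuous_subspace_in => s; rewrite inE/= in_itv/= => hs.
  apply: continuous_subspaceT_for; first by rewrite /= in_itv.
  apply: differentiable_continuous; apply/derivable1_diffP.
  by have [] := dg s hs.
have [c] := MVT ltr01 h1 h2; rewrite in_itv/= => /andP[/ltW c1 /ltW c2].
rewrite /g scale1r scale0r addr0 subr0 mulr1 => ->.
by apply: bF; rewrite c1.
Qed.

Definition cbox (a b : 'rV[R]_m) : set 'rV[R]_m := [set x | forall i, a 0 i <= x 0 i <= b 0 i].

Lemma compact_cbox a b : compact (cbox a b).
Proof.
have := @rV_compact R m (fun i => `[a 0 i, b 0 i]%classic) (fun i => @segment_compact _ _ _).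
rewrite (_ : [set v : 'rV[R]_m | _] = cbox a b)//.
Qed.

Lemma hbox_cbox a b : hbox a b `<=` cbox a b.
Proof. by move=> x h i; have /andP[-> /ltW ->] := h i. Qed.

Lemma rV_measure_cbox_fin a b : (rV_measure m (cbox a b) < +oo)%E.
Proof.
have mc : measurable (cbox a b : set (borel 'rV[R]_m)).
  rewrite (_ : cbox a b = \bigcap_(i in [set: 'I_m]) (setT `&` (fun x : 'rV[R]_m => x 0 i) @^-1`
     `[a 0 i, b 0 i]%classic)).
    apply: fin_bigcap_measurable => [|i _]; first exact: finite_finset.
    by apply: (measurable_coord i) => //.
  apply/seteqP; split => [t h i _|t h i]; first by split => //=; rewrite in_itv/=; exact: h.
  by have [_] := h i Logic.I; rewrite /= in_itv.
pose b' := \row_i (Num.max (a 0 i) (b 0 i + 1)).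
apply: (@le_lt_trans _ _ (rV_measure m (hbox a b'))).
  apply: le_measure; rewrite ?inE//; first exact: mhbox.
  move=> x h i; rewrite mxE; have /andP[-> h2] := h i.
  by rewrite lt_max; apply/orP; right; lra.
by rewrite rV_measure_hbox ?ltry// => i; rewrite mxE le_max lexx.
Qed.

Lemma compact_bnd (T : topologicalType) (K : set T) (F : T -> R) :
  compact K -> (forall t : T, K t -> {for t, continuous F}) ->
  exists2 C, 0 <= C & forall t : T, K t -> `|F t| <= C.
Proof.
move=> cK cF.
have : {within K, continuous F}.
  rewrite continuous_subspace_in => t; rewrite inE => Kt.
  by apply: continuous_subspaceT_for => //; exact: cF.
move=> /(continuous_compact) /(_ cK) /compact_bounded [M [_ hM]].
exists (`|M| + 1); first by rewrite addr_ge0.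
move=> x Kx; apply: hM; last by exists x.
by apply: le_lt_trans (ler_norm _) _; rewrite ltrDl.
Qed.

End LineDerivative.

Section EuclideanIntegrals.
Context {R : realType} {m : nat}.
Implicit Types (F u : 'rV[R]_m -> R) (x v a b : 'rV[R]_m).
Local Notation lam := (rV_measure (R := R) m).

Lemma translation_measurable v :
  measurable_fun setT (fun x : borel 'rV[R]_m => x + v : borel 'rV[R]_m).
Proof.
apply: measurable_rV => i; rewrite (_ : (fun t => _) = (fun x : 'rV[R]_m => x 0 i + v 0 i)).
  by apply: measurable_funD; [exact: measurable_coord|exact: measurable_cst].
by apply/funext => x; rewrite mxE.
Qed.

Lemma integral_real_translation F v : measurable_fun setT (F : borel 'rV[R]_m -> R) ->
  (\int[lam]_x (F (x + v)%R)%:E = \int[lam]_x (F x)%:E)%E.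
Proof.
move=> mF; rewrite [LHS]integralE [RHS]integralE; congr (_ - _)%E.
- etransitivity; last (apply: (integral_translation v)).
  + by apply: eq_integral => x _; rewrite !funeposE.
  + exact/measurable_funepos/measurable_EFinP.
  + by move=> x; exact: funepos_ge0.
- etransitivity; last (apply: (integral_translation v)).
  + by apply: eq_integral => x _; rewrite !funenegE.
  + exact/measurable_funeneg/measurable_EFinP.
  + by move=> x; exact: funeneg_ge0.
Qed.

(** One box contains the given box and its translates by -s v for 0 <= s <= 1, so that it supports
    all the difference quotients in direction [v] at once. *)
Lemma box_shift a b v : exists a' b', forall (s : R) x, 0 <= s <= 1 ->
  (cbox a b x -> cbox a' b' x) /\ (cbox a b (x + s *: v) -> cbox a' b' x).
Proof.
pose c : 'rV[R]_m := \row_i `|v 0 i|.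
exists (a - c), (b + c) => s x /andP[s0 s1]; split=> h i; have := h i; rewrite !mxE => /andP[h1 h2].
  by have := normr_ge0 (v 0 i); move=> h3; apply/andP; split; lra.
have : `|s * v 0 i| <= `|v 0 i| by rewrite normrM ler_piMl// ger0_norm.
by rewrite ler_norml => /andP[h3 h4]; apply/andP; split; lra.
Qed.

Lemma closed_cbox a b : closed (cbox a b).
Proof. exact: (compact_closed (@norm_hausdorff _ _) (@compact_cbox R m a b)). Qed.

Lemma measurable_cbox a b : measurable (cbox a b : set (borel 'rV[R]_m)).
Proof.
rewrite -[cbox a b]setCK; apply: measurableC; apply: open_borel.
exact/closed_openC/closed_cbox.
Qed.

Lemma derive_out_cbox F a b v x : (forall x, ~ cbox a b x -> F x = 0) ->
  ~ cbox a b x -> 'D_v F x = 0.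
Proof.
move=> F0 nx; rewrite -(derive_cst (0 : R) x v); apply: near_eq_derive.
have oC : open (~` cbox a b) by apply: closed_openC; exact: closed_cbox.
exact: (near_open oC nx F0).
Qed.

Lemma invSn_cvg0 : (fun n : nat => n.+1%:R^-1 : R) @ \oo --> (0 : R).
Proof.
apply/cvgr0Pnorm_lt => e e0; exists (Num.truncn e^-1) => // k /= hk.
rewrite ger0_norm ?invr_ge0// invf_plt ?posrE//; apply: lt_le_trans (truncnS_gt _) _.
by rewrite ler_nat.
Qed.

Lemma difference_quotient_cvg F x v : derivable F x v ->
  (fun n : nat => n.+1%:R * (F (x + n.+1%:R^-1 *: v) - F x)) @ \oo --> 'D_v F x.
Proof.
move=> dF; have c : h^-1 *: ((F \o shift x) (h *: v) - F x) @[h --> 0^'] --> 'D_v F x.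
  by move: dF => /cvg_ex[l hl]; rewrite /derive (cvg_lim (@Rhausdorff R) hl).
have c2 : (fun n : nat => n.+1%:R^-1 : R) @ \oo --> (0 : R)^'.
  move=> A A0; have h : \forall n \near \oo, n.+1%:R^-1 != 0 :> R -> A n.+1%:R^-1.
    exact: invSn_cvg0 A0.
  by apply: filterS h => n; apply; rewrite invr_neq0.
have := cvg_comp _ _ c2 c; apply: cvg_trans; apply: near_eq_cvg; near=> n.
by rewrite /= invrK (addrC _ x).
Unshelve. all: by end_near. Qed.

Lemma integrable_cbox (L : R) a b :
  lam.-integrable setT (EFin \o (fun x : borel 'rV[R]_m => L * \1_(cbox a b) x)).
Proof.
apply: intgZ => //.
apply/integrableP; split; first by apply/measurable_EFinP; apply: measurable_indic; exact: measurable_cbox.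
rewrite (_ : (\int[_]_(x in _) _)%E = lam (cbox a b)) ?rV_measure_cbox_fin//.
rewrite -[cbox a b in RHS]setIT -integral_indic//; last exact: measurable_cbox.
by apply: eq_integral => x _ /=; rewrite ger0_norm.
Qed.

(** Each difference quotient integrates to 0 by translation invariance. The quotients are bounded by
    the maximum of the derivative and vanish outside one box, so dominated convergence passes to the
    limit. *)
Lemma integral_derive0 F v a b : Ck_on 1 setT F -> (forall x, ~ cbox a b x -> F x = 0) ->
  \int[lam]_x 'D_v F x = 0.
Proof.
move=> C1F F0; have [dF hF] := C1F.
have dcont : forall x, {for x, continuous ('D_v F)} by move=> x; exact: (hF v x I).
have cF x : {for x, continuous F} by apply: differentiable_continuous; exact: dF.
have mF : measurable_fun setT (F : borel 'rV[R]_m -> R).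
  by apply: cont_measurable => //; exact: openT.
have mD : measurable_fun setT ('D_v F : borel 'rV[R]_m -> R).
  by apply: cont_measurable => //; exact: openT.
have [L0 _ hL0] := compact_bnd (@compact_cbox R m a b) (fun x _ => dcont x).
have [L1 L10 hL1] := compact_bnd (@compact_cbox R m a b) (fun x _ => cF x).
pose L := Num.max L0 0.
have hL x : `|'D_v F x| <= L.
  have [bx|nbx] := pselect (cbox a b x); first by rewrite le_max hL0.
  by rewrite (derive_out_cbox _ F0 nbx) normr0 le_max lexx orbT.
have [a' [b' hab]] := box_shift a b v.
pose g (x : 'rV[R]_m) : R := L * \1_(cbox a' b') x.
have ig := integrable_cbox L a' b'.
pose f n (x : 'rV[R]_m) : R := n.+1%:R * (F (x + n.+1%:R^-1 *: v) - F x).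
have sn n : 0 <= (n.+1%:R^-1 : R) <= 1 by rewrite invr_ge0 ler0n/= invf_le1// ler1n.
have mf n : measurable_fun setT (f n : borel 'rV[R]_m -> R).
  apply: measurable_funM; first exact: measurable_cst.
  apply: measurable_funB => //.
  exact: (measurableT_comp mF (translation_measurable (n.+1%:R^-1 *: v))).
have fg n x : `|f n x| <= g x.
  have dv (c : R) y : 'D_(c *: v) F y = c * 'D_v F y.
    by rewrite !deriveE ?linearZ//; exact: (dF y Logic.I).
  rewrite /f /g indicE; have [hx|hx] := pselect (cbox a' b' x).
    rewrite mem_set// mulr1 normrM ger0_norm// mulrC -ler_pdivlMr//.
    apply: segment_lipschitz => s hs; first exact: dF.
    by rewrite dv normrM ger0_norm ?invr_ge0// mulrC ler_wpM2r// invr_ge0.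
  rewrite memNset// mulr0; have [h1 h2] := hab _ x (sn n).
  by rewrite !F0 ?subrr ?mulr0 ?normr0// => [/h1|/h2].
have fcv x : f ^~ x @ \oo --> 'D_v F x.
  by apply: difference_quotient_cvg; apply: diff_derivable; exact: (dF x Logic.I).
have [_ cv] := Rintegral_dominated_cvg measurableT mf (fun x _ => fcv x) ig (fun n x _ => fg n x).
apply: cvg_unique cv _; first exact: Rhausdorff.
rewrite (_ : (fun n => _) = fun=> 0); first exact: cvg_cst.
apply/funext => n.
have hF1 x : `|F x| <= L1 * \1_(cbox a b) x.
  rewrite indicE; have [bx|nbx] := pselect (cbox a b x); first by rewrite mem_set// mulr1 hL1.
  by rewrite memNset// mulr0 F0// normr0.
have i1 : lam.-integrable setT (EFin \o F).
  exact: (intg_le measurableT mF (fun x _ => hF1 x) (integrable_cbox L1 a b)).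
have mFt : measurable_fun setT ((fun x => F (x + n.+1%:R^-1 *: v)) : borel 'rV[R]_m -> R).
  exact: (measurableT_comp mF (translation_measurable (n.+1%:R^-1 *: v))).
have hF2 x : `|F (x + n.+1%:R^-1 *: v)| <= L1 * \1_(cbox a' b') x.
  apply: (le_trans (hF1 _)); apply: ler_wpM2l => //; rewrite !indicE.
  have [h1 h2] := hab _ x (sn n).
  have [bx|nbx] := pselect (cbox a b (x + n.+1%:R^-1 *: v)); last by rewrite memNset.
  by rewrite !mem_set//; exact: h2.
have i2 := intg_le measurableT mFt (fun x _ => hF2 x) (integrable_cbox L1 a' b').
rewrite RintegralZl//; last exact: (intgB measurableT i2 i1).
by rewrite RintegralB// /Rintegral integral_real_translation// subrr mulr0.
Qed.

Lemma derive_integrable F v a b : Ck_on 1 setT F -> (forall x, ~ cbox a b x -> F x = 0) ->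
  lam.-integrable setT (EFin \o ('D_v F : borel 'rV[R]_m -> R)).
Proof.
move=> C1F F0; have [dF hF] := C1F.
have dcont : forall x, {for x, continuous ('D_v F)} by move=> x; exact: (hF v x I).
have mD : measurable_fun setT ('D_v F : borel 'rV[R]_m -> R).
  by apply: cont_measurable => //; exact: openT.
have [L L0 hL] := compact_bnd (@compact_cbox R m a b) (fun x _ => dcont x).
apply: (intg_le measurableT mD _ (integrable_cbox L a b)) => x _.
rewrite indicE; have [bx|nbx] := pselect (cbox a b x); first by rewrite mem_set// mulr1 hL.
by rewrite memNset// mulr0 (derive_out_cbox _ F0 nbx) normr0.
Qed.

End EuclideanIntegrals.

(** * Morrey estimates on cubes *)

(** Nonnegativity of the sum of the (a_i - mu)^2, with mu the average of the a_i. *)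
Lemma sqr_sum_le (R : realFieldType) (I : finType) (a : I -> R) :
  (\sum_i a i) ^+ 2 <= #|I|%:R * \sum_i a i ^+ 2.
Proof.
have [I0|I0] := posnP #|I|.
  rewrite I0 mul0r big_pred0 ?expr0n// => i.
  by have := card0_eq I0 i; rewrite !inE.
have n0 : 0 < #|I|%:R :> R by rewrite ltr0n.
pose s := \sum_i a i; pose mu := s / #|I|%:R.
have : 0 <= \sum_i (a i - mu) ^+ 2 by apply: sumr_ge0 => i _; exact: sqr_ge0.
have -> : \sum_i (a i - mu) ^+ 2 = \sum_i a i ^+ 2 - 2 * mu * s + #|I|%:R * mu ^+ 2.
  rewrite /s mulr_sumr -sumrN -(sumr_const) mulr_suml -!big_split/=.
  by apply: eq_bigr => i _; ring.
have e : #|I|%:R * mu = s by rewrite /mu mulrC divfK// gt_eqF.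
move=> /(mulr_ge0 (ltW n0)).
have -> : #|I|%:R * (\sum_i a i ^+ 2 - 2 * mu * s + #|I|%:R * mu ^+ 2) =
  #|I|%:R * (\sum_i a i ^+ 2) - 2 * (#|I|%:R * mu) * s + (#|I|%:R * mu) ^+ 2 by ring.
rewrite e -/s => h; lra.
Qed.

Lemma sumr_cst (R : pzSemiRingType) (I : finType) (x : R) : \sum_(i : I) x = #|I|%:R * x.
Proof. by rewrite sumr_const mulr_natl. Qed.

Section C1Bounded.
Context {R : realType} {m : nat}.
Implicit Types (u w : 'rV[R]_m -> R) (x z a : 'rV[R]_m) (Q : set 'rV[R]_m).
Local Notation lam := (rV_measure (R := R) m).

(** [L] is qualitative: it provides integrability and makes the remainder of the dyadic iteration
    vanish, but the final estimate is independent of it. The open set [B] gives a meaning to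
    derivatives at boundary points of [Q]. *)
Definition C1_bd Q u (L : R) := exists B, [/\ open B, Q `<=` B, Ck_on 1 B u &
  forall x, Q x -> `|u x| <= L /\ forall i, `|pderiv u i x| <= L].

Definition grad_sq u x : R := \sum_i pderiv u i x ^+ 2.

Lemma grad_sq_ge0 u x : 0 <= grad_sq u x.
Proof. by apply: sumr_ge0 => i _; exact: sqr_ge0. Qed.

Lemma C1_bd_ge0 Q u L x : C1_bd Q u L -> Q x -> 0 <= L.
Proof. by move=> [B [_ _ _ h]] /h [+ _]; apply: le_trans. Qed.

Lemma C1_bdS Q Q' u L : Q' `<=` Q -> C1_bd Q u L -> C1_bd Q' u L.
Proof.
move=> QQ [B [oB QB cu h]]; exists B; split => //; first exact: subset_trans QB.
by move=> x /QQ; exact: h.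
Qed.

Lemma C1_bd_measurable Q u L : measurable (Q : set (borel 'rV[R]_m)) ->
  C1_bd Q u L -> measurable_fun (Q : set (borel 'rV[R]_m)) (u : borel 'rV[R]_m -> R).
Proof.
move=> mQ [B [oB QB cu _]]; apply: (measurable_funS (open_borel oB) QB).
by apply: cont_measurable => // x Bx; exact: (Ck_cont cu).
Qed.

Lemma C1_bd_derive_measurable Q u L z : measurable (Q : set (borel 'rV[R]_m)) ->
  C1_bd Q u L -> measurable_fun (Q : set (borel 'rV[R]_m)) ('D_z u : borel 'rV[R]_m -> R).
Proof.
move=> mQ [B [oB QB [_ cu] _]]; apply: (measurable_funS (open_borel oB) QB).
by apply: cont_measurable => // x Bx; exact: cu.
Qed.

Lemma C1_bd_derive Q u L z x : C1_bd Q u L -> Q x ->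
  'D_z u x = \sum_i z 0 i * pderiv u i x.
Proof. by move=> [B [oB QB [du _] _]] Qx; apply: derive_pderiv; apply: du; exact: QB. Qed.

Lemma C1_bd_derive_sq Q u L z x (c : R) : C1_bd Q u L -> Q x ->
  (forall i, `|z 0 i| <= c) -> 'D_z u x ^+ 2 <= m%:R * c ^+ 2 * grad_sq u x.
Proof.
move=> hu Qx hz; rewrite (C1_bd_derive _ hu Qx).
apply: (le_trans (sqr_sum_le _)); rewrite card_ord -mulrA; apply: ler_wpM2l => //.
rewrite /grad_sq mulr_sumr; apply: ler_sum => i _; rewrite exprMn.
by apply: ler_wpM2r; rewrite ?sqr_ge0// -(real_normK (num_real (z 0 i))) lerXn2r ?nnegrE// (le_trans _ (hz i)).
Qed.

Lemma C1_bd_grad_sq Q u L x : C1_bd Q u L -> Q x ->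
  `|grad_sq u x| <= m%:R * L ^+ 2.
Proof.
move=> hu Qx; have L0 := C1_bd_ge0 hu Qx; have [B [_ _ _ h]] := hu.
rewrite ger0_norm ?grad_sq_ge0//.
have -> : m%:R * L ^+ 2 = \sum_(i < m) L ^+ 2 by rewrite sumr_const card_ord mulr_natl.
apply: ler_sum => i _; have [_ hi] := h x Qx.
by rewrite -(real_normK (num_real (pderiv u i x))) lerXn2r ?nnegrE.
Qed.

Lemma C1_bd_grad_sq_measurable Q u L : measurable (Q : set (borel 'rV[R]_m)) ->
  C1_bd Q u L -> measurable_fun (Q : set (borel 'rV[R]_m)) (grad_sq u : borel 'rV[R]_m -> R).
Proof.
move=> mQ hu; apply: measurable_sum => i; apply: measurable_funX.
exact: C1_bd_derive_measurable hu.
Qed.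

(** The fundamental theorem of calculus along the segment, followed by Cauchy-Schwarz on [0, 1]. *)
Lemma difference_sq_le u B x z : open B -> Ck_on 1 B u ->
  (forall s : R, 0 <= s <= 1 -> B (x + s *: z)) ->
  (((u (x + z) - u x) ^+ 2)%:E <=
   \int[lebesgue_measure]_(s in `[0%R, 1%R]) (('D_z u (x + s *: z)%R) ^+ 2)%:E)%E.
Proof.
move=> oB [du cu] hB.
pose G (t : R) := u (x + t *: z); pose G' (t : R) := 'D_z u (x + t *: z).
have dG (s : R) : 0 <= s <= 1 -> is_derive s 1 G (G' s).
  by move=> hs; apply: line_is_derive; apply: diff_derivable; apply: du; exact: hB.
have contl (s : R) : {for s, continuous (fun t : R => x + t *: z)}.
  apply: (@continuousD _ _ _ (fun=> x) (fun t : R => t *: z)); first exact: cst_continuous.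
  by apply: (@continuousZr_tmp); exact: cvg_id.
have cG' (s : R) : 0 <= s <= 1 -> {for s, continuous G'}.
  by move=> hs; apply: (@continuous_comp R 'rV[R]_m R (fun t : R => x + t *: z) ('D_z u) s (contl s)); apply: cu; exact: hB.
have wG' : {within `[0, 1], continuous G'}.
  rewrite continuous_subspace_in => s; rewrite inE/= in_itv/= => hs.
  by apply: continuous_subspaceT_for; [rewrite /= in_itv|exact: cG'].
have cG (s : R) : 0 <= s <= 1 -> {for s, continuous G}.
  by move=> hs; apply: differentiable_continuous; apply/derivable1_diffP; have [] := dG s hs.
have e : (\int[lebesgue_measure]_(s in `[0%R, 1%R]) (G' s)%:E)%E = (G 1 - G 0)%:E.
  rewrite (continuous_FTC2 (F := G))//.
  - split=> [s||].
    + by rewrite in_itv/= => /andP[/ltW s0 /ltW s1]; have [] := dG s; rewrite ?s0.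
    + by apply: cvg_at_right_filter; apply: cG; rewrite lexx ler01.
    + by apply: cvg_at_left_filter; apply: cG; rewrite lexx ler01.
  - move=> s; rewrite in_itv/= => /andP[/ltW s0 /ltW s1].
    by rewrite derive1E; have [|_ ->//] := dG s; rewrite s0.
have mI : measurable (`[0, 1]%classic : set (measurableTypeR R)) by exact: measurable_itv.
have I1 : lebesgue_measure (`[0, 1]%classic : set (measurableTypeR R)) = 1%E.
  by rewrite lebesgue_measure_itv/= lte01 sube0.
have I1f : (lebesgue_measure (`[0%R, 1%R]%classic : set (measurableTypeR R)) < +oo)%E by rewrite I1 ltry.
have [C _ hC] := @compact_bnd R R `[0, 1]%classic G' (@segment_compact _ 0 1)
  (fun s hs => cG' s ltac:(by move: hs; rewrite /= in_itv)).
have mG' : measurable_fun (`[0, 1]%classic : set (measurableTypeR R)) G'.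
  exact: subspace_continuous_measurable_fun.
have i1 : lebesgue_measure.-integrable (`[0, 1]%classic : set (measurableTypeR R)) (EFin \o G').
  exact: (bounded_intg mI I1f mG' hC).
have i2 : lebesgue_measure.-integrable (`[0, 1]%classic : set (measurableTypeR R))
    (EFin \o (fun s => G' s ^+ 2)).
  apply: (bounded_intg (C := C ^+ 2) mI I1f); first exact: measurable_funX.
  move=> s hs; rewrite normrX lerXn2r ?nnegrE ?(le_trans _ (hC s hs))//.
have := Rintegral_CS mI I1f i1 i2.
rewrite -[fine _]/(fine (lebesgue_measure (`[0%R, 1%R]%classic : set (measurableTypeR R)))) I1 mul1r.
rewrite -lee_fin fineK ?integrable_fin_num//.
by rewrite {1}/Rintegral e /= /G scale1r scale0r addr0.
Qed.

Lemma line_measurable z : measurable_fun setT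
  (fun p : borel 'rV[R]_m * measurableTypeR R => (p.1 : 'rV[R]_m) + p.2 *: z : borel 'rV[R]_m).
Proof.
apply: measurable_rV => i.
rewrite (_ : (fun t => _) = (fun p : 'rV[R]_m * R => p.1 0 i + p.2 * z 0 i)); last first.
  by apply/funext => p; rewrite !mxE.
apply: measurable_funD.
  apply: (measurableT_comp (f := fun x : borel 'rV[R]_m => (x : 'rV[R]_m) 0 i)) => //.
  exact: measurable_coord.
by apply: measurable_funM.
Qed.

(** Integrate the segment estimate over x and exchange the integrals: for each s, the integrand
    extended by 0 and translated by s z has the same integral over the whole space. *)
Lemma difference_integral_le Q Q' u L z : measurable (Q : set (borel 'rV[R]_m)) ->
  measurable (Q' : set (borel 'rV[R]_m)) -> C1_bd Q u L ->
  (forall x (s : R), Q' x -> 0 <= s <= 1 -> Q (x + s *: z)) ->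
  (\int[lam]_(x in Q') ((u (x + z)%R - u x) ^+ 2)%:E <=
   \int[lam]_(x in Q) (('D_z u x) ^+ 2)%:E)%E.
Proof.
move=> mQ mQ' hu hQ; have [B [oB QB cu _]] := hu.
pose w (x : borel 'rV[R]_m) : R := ('D_z u x) ^+ 2 * \1_Q x.
have mw : measurable_fun setT w.
  have := measurable_funX 2 (C1_bd_derive_measurable z mQ hu).
  move=> /(measurable_restrictT _ mQ) h.
  rewrite (_ : w = (fun x => ('D_z u x) ^+ 2) \_ Q); first by [].
  by apply/funext => x; rewrite /w patchE indicE; case: (x \in Q); rewrite ?mulr1 ?mulr0.
have w0 x : 0 <= w x by rewrite mulr_ge0// sqr_ge0.
pose h (p : borel 'rV[R]_m * measurableTypeR R) : \bar R :=
  (w ((p.1 : 'rV[R]_m) + p.2 *: z) * \1_(`[0%R, 1%R]%classic) p.2)%:E.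
have mh : measurable_fun setT h.
  apply/measurable_EFinP; apply: measurable_funM.
    exact: (measurableT_comp mw (line_measurable z)).
  have mi : measurable_fun setT (\1_(`[0, 1]%classic) : measurableTypeR R -> R).
    by apply: measurable_indic; exact: measurable_itv.
  exact: (measurableT_comp mi (@measurable_snd _ _ _ _)).
have h0 p : (0 <= h p)%E by rewrite lee_fin mulr_ge0.
have inner_le x : Q' x -> (((u (x + z)%R - u x) ^+ 2)%:E <= \int[lebesgue_measure]_s h (x, s))%E.
  move=> Q'x; apply: (le_trans (difference_sq_le oB cu (fun s hs => QB _ (hQ x s Q'x hs)))).
  rewrite integral_mkcond le_eqVlt; apply/orP; left; apply/eqP.
  apply: eq_integral => s _; rewrite patchE /h /w/= !indicE.
  case: ifPn => [|_]; last by rewrite mulr0.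
  rewrite inE/= in_itv/= => hs; rewrite mulr1 mem_set ?mulr1//; exact: hQ.
have mu' : measurable_fun (Q' : set (borel 'rV[R]_m)) (fun x : borel 'rV[R]_m => (u ((x : 'rV[R]_m) + z) - u x) ^+ 2).
  apply: measurable_funX; apply: measurable_funB.
    have mu1 := C1_bd_measurable mQ hu.
    have hz : Q' `<=` (fun x : 'rV[R]_m => x + z) @^-1` Q.
      by move=> x hx; have := hQ x 1 hx; rewrite scale1r ler01 lexx; exact.
    have mu2 : measurable_fun setT (u \_ Q : borel 'rV[R]_m -> R).
      exact/(measurable_restrictT _ mQ).
    have := measurable_funTS (D := (Q' : set (borel 'rV[R]_m))) (measurableT_comp mu2 (translation_measurable z)).
    by apply: eq_measurable_fun => x; rewrite inE => hx /=; rewrite patchE mem_set//; exact: hz.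
  apply: (measurable_funS mQ); last exact: C1_bd_measurable hu.
  by move=> x hx; have := hQ x 0 hx; rewrite scale0r addr0 ler01 lexx; exact.
have mF := measurable_fun_fubini_tonelli_F (m2 := @lebesgue_measure R) _ mh h0.
apply: (@le_trans _ _ (\int[lam]_(x in Q') \int[lebesgue_measure]_s h (x, s))%E).
  apply: ge0_le_integral => //.
  - by move=> x _; rewrite lee_fin sqr_ge0.
  - exact/measurable_EFinP.
  - exact: (measurable_funTS mF).
apply: (@le_trans _ _ (\int[lam]_x \int[lebesgue_measure]_s h (x, s))%E).
  apply: ge0_subset_integral => //.
  by move=> x _; exact: integral_ge0.
rewrite (fubini_tonelli (m2 := @lebesgue_measure R) _ mh h0).
have e s : (\int[lam]_x h (x, s) = (\int[lam]_x (w x)%:E) * (\1_(`[0%R, 1%R]%classic) s)%:E)%E.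
  rewrite /h /=; under eq_integral do rewrite EFinM.
  rewrite ge0_integralZr//.
  - congr (_ * _)%E; apply: (integral_translation (s *: z) (h := EFin \o w)) => //.
    exact/measurable_EFinP.
  - apply/measurable_EFinP; apply: (measurableT_comp mw); exact: translation_measurable.
  - by move=> x _; rewrite lee_fin.
under eq_integral do rewrite e.
have E1 : (\int[lebesgue_measure]_x (\1_(`[0%R, 1%R]%classic : set (measurableTypeR R)) x)%:E = 1)%E.
  by rewrite integral_indic//= setIT lebesgue_measure_itv/= lte01 sube0.
rewrite ge0_integralZl//.
- rewrite E1 mule1 [leRHS]integral_mkcond le_eqVlt; apply/orP; left; apply/eqP.
  apply: eq_integral => x _; rewrite patchE /w indicE.
  by case: ifPn; rewrite ?mulr1 ?mulr0.
- by apply/measurable_EFinP; apply: measurable_indic; exact: measurable_itv.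
- by apply: integral_ge0 => x _; rewrite lee_fin.
Qed.

End C1Bounded.

Section Cubes.
Context {R : realType} {m : nat}.
Implicit Types (u w : 'rV[R]_m -> R) (x z a : 'rV[R]_m) (h L : R).
Local Notation lam := (rV_measure (R := R) m).

Definition cube a h : set 'rV[R]_m := hbox a (a + const_mx h).

Lemma cubeP a h x : cube a h x <-> forall i, a 0 i <= x 0 i < a 0 i + h.
Proof. by split=> hx i; have := hx i; rewrite !mxE. Qed.

Lemma mcube a h : measurable (cube a h : set (borel 'rV[R]_m)).
Proof. exact: mhbox. Qed.

Lemma cube_volume a h : 0 <= h -> lam (cube a h) = (h ^+ m)%:E.
Proof.
move=> h0; rewrite rV_measure_hbox; last by move=> i; rewrite !mxE lerDl.
congr (_%:E); under eq_bigr do rewrite !mxE [_ + h]addrC addrK.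
by rewrite prodr_const card_ord.
Qed.

Lemma cube_fin a h : 0 <= h -> (lam (cube a h) < +oo)%E.
Proof. by move=> h0; rewrite cube_volume// ltry. Qed.

Definition subcorner a h (s : {ffun 'I_m -> bool}) : 'rV[R]_m :=
  \row_i (a 0 i + (s i)%:R * (h / 2)).

Lemma subcube_sub a h s : 0 <= h -> cube (subcorner a h s) (h / 2) `<=` cube a h.
Proof.
move=> h0 x /cubeP hx; apply/cubeP => i; have := hx i; rewrite mxE.
by case: (s i) => /=; rewrite ?mul1r ?mul0r => /andP[h1 h2]; apply/andP; split; lra.
Qed.

Lemma indic_subcubes a h x : 0 <= h ->
  \1_(cube a h) x = \sum_s \1_(cube (subcorner a h s) (h / 2)) x :> R.
Proof.
move=> h0; pose s0 := [ffun i => a 0 i + h / 2 <= x 0 i].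
have other s : s != s0 -> \1_(cube (subcorner a h s) (h / 2)) x = 0 :> R.
  move=> ss; rewrite indicE memNset// => /cubeP hx; move/negP: ss; apply; apply/eqP/ffunP => i.
  have := hx i; rewrite ffunE mxE; case: (s i) => /=; rewrite ?mul1r ?mul0r => /andP[h1 h2].
    by apply/esym.
  by apply/esym/negbTE; rewrite -ltNge; lra.
rewrite (bigD1 s0)//= [X in _ + X]big1 ?addr0//.
rewrite !indicE; have [hx|hx] := pselect (cube a h x).
  rewrite !mem_set//; apply/cubeP => i; move/cubeP : hx => /(_ i); rewrite mxE ffunE.
  by case: (leP (a 0 i + h / 2) (x 0 i)) => /= h1 /andP[h2 h3]; rewrite ?mul1r ?mul0r; apply/andP; split; lra.
by rewrite !memNset// => h1; apply: hx; apply: subcube_sub h1.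
Qed.

Lemma Rintegral_subcubes (f : borel 'rV[R]_m -> R) a h : 0 <= h ->
  lam.-integrable (cube a h) (EFin \o f) ->
  \int[lam]_(x in cube a h) f x = \sum_s \int[lam]_(x in cube (subcorner a h s) (h / 2)) f x.
Proof.
move=> h0 iF.
have e A : measurable (A : set (borel 'rV[R]_m)) -> A `<=` cube a h ->
    lam.-integrable setT (EFin \o (fun x => f x * \1_A x)) /\
    \int[lam]_(x in A) f x = \int[lam]_x (f x * \1_A x).
  move=> mA sA; have e1 : (fun x => f x * \1_A x) = f \_ A.
    by apply/funext => x; rewrite patchE indicE; case: (x \in A); rewrite ?mulr1 ?mulr0.
  rewrite e1; split; last by rewrite Rintegral_mkcond.
  have -> : EFin \o f \_ A = (EFin \o f) \_ A.
    by apply/funext => x; rewrite /= !patchE; case: ifP.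
  by apply/(integrable_mkcond _ mA); apply: integrableS iF => //; exact: mcube.
rewrite (e _ (mcube a h) (@subset_refl _ _)).2.
under eq_Rintegral do rewrite indic_subcubes// mulr_sumr.
have sub s := e _ (mcube (subcorner a h s) (h / 2)) (subcube_sub (s := s) h0).
rewrite Rintegral_sum//; last by move=> s; exact: (sub s).1.
by apply: eq_bigr => s _; rewrite (sub s).2.
Qed.

Definition mean u a h : R := (h ^+ m)^-1 * \int[lam]_(x in cube a h) u x.

Lemma C1_bd_intg u a h L : 0 <= h -> C1_bd (cube a h) u L ->
  lam.-integrable (cube a h) (EFin \o u).
Proof.
move=> h0 hu; apply: (bounded_intg (C := L)).
- exact: mcube.
- exact: cube_fin.
- exact: (C1_bd_measurable (mcube a h) hu).
- by have [B [_ _ _ hb]] := hu => x /hb [].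
Qed.

Lemma C1_bd_intg_grad u a h L : 0 <= h -> C1_bd (cube a h) u L ->
  lam.-integrable (cube a h) (EFin \o grad_sq u).
Proof.
move=> h0 hu; apply: (bounded_intg (C := m%:R * L ^+ 2)).
- exact: mcube.
- exact: cube_fin.
- exact: (C1_bd_grad_sq_measurable (mcube a h) hu).
- by move=> x hx; exact: C1_bd_grad_sq hu hx.
Qed.

Lemma mean_subcubes u a h L : 0 < h -> C1_bd (cube a h) u L ->
  mean u a h = (2 ^+ m)^-1 * \sum_s mean u (subcorner a h s) (h / 2).
Proof.
move=> h0 hu; rewrite /mean (Rintegral_subcubes (ltW h0) (C1_bd_intg (ltW h0) hu)).
rewrite -mulr_sumr mulrA -invfM -exprMn; congr (((_) ^+ _)^-1 * _); lra.
Qed.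

(** The two subcubes are translates of each other, so their means differ by the mean of u(x + z) -
    u(x). Convexity keeps the segments inside the large cube, and |z_i| <= h/2 bounds the derivative
    in direction z by the gradient. *)
Lemma mean_subcube_diff u a h L (s t : {ffun 'I_m -> bool}) : 0 < h -> C1_bd (cube a h) u L ->
  (mean u (subcorner a h t) (h / 2) - mean u (subcorner a h s) (h / 2)) ^+ 2 <=
  ((h / 2) ^+ m)^-1 * (m%:R * (h / 2) ^+ 2 * \int[lam]_(x in cube a h) grad_sq u x).
Proof.
move=> h0 hu; set k := h / 2; have k0 : 0 < k by rewrite divr_gt0.
pose z : 'rV[R]_m := subcorner a h t - subcorner a h s.
have zE i : z 0 i = ((t i)%:R - (s i)%:R) * k by rewrite !mxE -/k; ring.
set Q := cube a h; set Qs := cube (subcorner a h s) k; set Qt := cube (subcorner a h t) k.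
have mQ : measurable (Q : set (borel 'rV[R]_m)) by exact: mcube.
have mQs : measurable (Qs : set (borel 'rV[R]_m)) by exact: mcube.
have mQt : measurable (Qt : set (borel 'rV[R]_m)) by exact: mcube.
have sQ : Qs `<=` Q by apply: subcube_sub; exact: ltW.
have tQ : Qt `<=` Q by apply: subcube_sub; exact: ltW.
have zQ x : Qs x <-> Qt (x + z).
  by split=> /cubeP hx; apply/cubeP => i; have := hx i; rewrite !mxE -/k => /andP[h1 h2]; apply/andP; split; lra.
have segQ x (r : R) : Qs x -> 0 <= r <= 1 -> Q (x + r *: z).
  move=> hx hr; have hy := zQ x; move: hy => [/(_ hx) /tQ /cubeP hy _].
  move: hx => /sQ /cubeP hx; apply/cubeP => i; have := hx i; have := hy i.
  move: hr; rewrite mxE [in X in _ -> _ -> X]mxE [(r *: z) 0 i]mxE.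
  move=> /andP[r0 r1] /andP[h1 h2] /andP[h3 h4].
  have [z0|z0] := lerP 0 (z 0 i).
    by have := mulr_ge0 r0 z0; have := ler_wpM2r z0 r1; rewrite mul1r => h5 h6; apply/andP; split; lra.
  have := mulr_ge0_le0 r0 (ltW z0); have := ler_wnM2r (ltW z0) r1; rewrite mul1r => h5 h6.
  by apply/andP; split; lra.
have iu : lam.-integrable Q (EFin \o u) by exact: C1_bd_intg (ltW h0) hu.
have ius : lam.-integrable Qs (EFin \o u) by exact: integrableS iu.
have iut : lam.-integrable Qt (EFin \o u) by exact: integrableS iu.
pose ut (x : borel 'rV[R]_m) : R := u ((x : 'rV[R]_m) + z).
have [mut e] : measurable_fun (Qs : set (borel 'rV[R]_m)) ut /\ \int[lam]_(x in Qt) u x = \int[lam]_(x in Qs) ut x.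
  have mu1 : measurable_fun setT (u \_ Qt : borel 'rV[R]_m -> R).
    apply/(measurable_restrictT _ mQt); exact: intg_measurable iut.
  have e x : (ut \_ Qs) x = (u \_ Qt) ((x : 'rV[R]_m) + z).
    rewrite !patchE; have [hx|hx] := pselect (Qs x).
      by rewrite !mem_set//; apply/zQ.
    by rewrite !memNset// => /zQ.
  split.
    apply/(measurable_restrictT _ mQs); rewrite (funext e).
    exact: (measurableT_comp mu1 (translation_measurable z)).
  rewrite Rintegral_mkcond [RHS]Rintegral_mkcond (funext e) /Rintegral.
  by rewrite (integral_real_translation z mu1).
have utL x : Qs x -> `|ut x| <= L.
  by move=> /zQ /tQ hx; have [B [_ _ _ /(_ _ hx) []]] := hu.
have fin : (lam Qs < +oo)%E by rewrite cube_volume ?ltry// ltW.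
have iut' : lam.-integrable Qs (EFin \o ut).
  exact: (bounded_intg mQs fin mut utL).
have uL x : Qs x -> `|u x| <= L.
  by move=> /sQ hx; have [B [_ _ _ /(_ _ hx) []]] := hu.
have id1 : lam.-integrable Qs (EFin \o (fun x => ut x - u x)) by exact: intgB.
have id2 : lam.-integrable Qs (EFin \o (fun x => (ut x - u x) ^+ 2)).
  apply: (bounded_intg (C := (L + L) ^+ 2)) => //.
    by apply: measurable_funX; exact: intg_measurable id1.
  move=> x hx; rewrite normrX lerXn2r ?nnegrE//.
    by rewrite (le_trans _ (lerD (utL x hx) (uL x hx))) ?addr_ge0.
  by apply: (le_trans (ler_normB _ _)); apply: lerD; [exact: utL|exact: uL].
have -> : mean u (subcorner a h t) k - mean u (subcorner a h s) k =
    (k ^+ m)^-1 * \int[lam]_(x in Qs) (ut x - u x).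
  by rewrite RintegralB// -e /mean mulrBr.
rewrite exprMn; have kp : 0 < k ^+ m by rewrite exprn_gt0.
have V : fine (lam Qs) = k ^+ m by rewrite /Qs cube_volume ?ltW.
have := Rintegral_CS mQs fin id1 id2; rewrite -[fine _]/(fine (lam Qs)) V => hCS.
apply: (@le_trans _ _ ((k ^+ m)^-1 * \int[lam]_(x in Qs) ((ut x - u x) ^+ 2))).
  have -> : (k ^+ m)^-1 ^+ 2 * (\int[lam]_(x in Qs) (ut x - u x)) ^+ 2 =
    (k ^+ m)^-1 * ((k ^+ m)^-1 * (\int[lam]_(x in Qs) (ut x - u x)) ^+ 2) by rewrite expr2 mulrA.
  by rewrite ler_pM2l ?invr_gt0// ler_pdivrMl.
rewrite ler_pM2l ?invr_gt0//.
have ig := C1_bd_intg_grad (ltW h0) hu.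
have hz i : `|z 0 i| <= k.
  rewrite zE; case: (t i); case: (s i) => /=; rewrite ?subrr ?subr0 ?sub0r ?mul0r ?mul1r ?mulN1r ?normr0 ?normrN ?gtr0_norm//; exact: ltW.
have iD : lam.-integrable Q (EFin \o (fun x => ('D_z u x) ^+ 2)).
  apply: (@intg_le _ _ _ lam Q mQ _ (fun x => m%:R * k ^+ 2 * grad_sq u x)) => //.
  - by apply: measurable_funX; exact: (C1_bd_derive_measurable z mQ hu).
  - by move=> x hx; rewrite ger0_norm ?sqr_ge0//; exact: C1_bd_derive_sq hu hx hz.
  - exact: intgZ.
apply: (@le_trans _ _ (\int[lam]_(x in Q) (('D_z u x) ^+ 2))).
  apply: fine_le; rewrite ?integrable_fin_num//.
  exact: difference_integral_le hu segQ.
rewrite -RintegralZl//; apply: le_Rintegral => //.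
- exact: intgZ.
- by move=> x hx; exact: C1_bd_derive_sq hu hx hz.
Qed.

End Cubes.

Lemma sqr_split_le (R : realFieldType) (t x y : R) : 0 < t ->
  (x + y) ^+ 2 <= (1 + t) * x ^+ 2 + (1 + t^-1) * y ^+ 2.
Proof.
move=> t0; rewrite -subr_ge0.
have -> : (1 + t) * x ^+ 2 + (1 + t^-1) * y ^+ 2 - (x + y) ^+ 2 = t^-1 * (t * x - y) ^+ 2.
  by field; rewrite gt_eqF.
by rewrite mulr_ge0 ?sqr_ge0// invr_ge0 ltW.
Qed.

Section MorreyPoincare.
Context {R : realType} {m : nat}.
Implicit Types (u : 'rV[R]_m -> R) (x z a : 'rV[R]_m) (h L : R).
Local Notation lam := (rV_measure (R := R) m).

Lemma mean_subcube u a h L (s : {ffun 'I_m -> bool}) : 0 < h -> C1_bd (cube a h) u L ->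
  (mean u (subcorner a h s) (h / 2) - mean u a h) ^+ 2 <=
  ((h / 2) ^+ m)^-1 * (m%:R * (h / 2) ^+ 2 * \int[lam]_(x in cube a h) grad_sq u x).
Proof.
move=> h0 hu; set E := (X in _ <= X).
have card : #|{ffun 'I_m -> bool}|%:R = 2 ^+ m :> R by rewrite card_ffun card_bool card_ord natrX.
have p0 : 0 < (2 : R) ^+ m by rewrite exprn_gt0.
have -> : mean u (subcorner a h s) (h / 2) - mean u a h =
   (2 ^+ m)^-1 * \sum_t (mean u (subcorner a h s) (h / 2) - mean u (subcorner a h t) (h / 2)).
  rewrite (mean_subcubes h0 hu) sumrB mulrBr; congr (_ - _).
  by rewrite sumr_cst card mulKf// gt_eqF.
rewrite exprMn; apply: (@le_trans _ _ ((2 ^+ m)^-1 ^+ 2 * (2 ^+ m * \sum_(t : {ffun 'I_m -> bool}) E))).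
  apply: ler_wpM2l; first exact: sqr_ge0.
  apply: (le_trans (sqr_sum_le _)); rewrite card; apply: ler_wpM2l; first exact: ltW.
  by apply: ler_sum => t _; exact: mean_subcube_diff hu.
rewrite sumr_cst card le_eqVlt; apply/orP; left; apply/eqP.
by field; rewrite gt_eqF.
Qed.

Variable w : borel 'rV[R]_m -> R.
Hypothesis w0 : forall x, 0 <= w x.

Definition oscillation u a h : R := \int[lam]_(x in cube a h) (w x * (u x - mean u a h) ^+ 2).

Lemma intg_weight_sq u a h L (c : R) : 0 <= h -> C1_bd (cube a h) u L ->
  lam.-integrable (cube a h) (EFin \o w) ->
  lam.-integrable (cube a h) (EFin \o (fun x => w x * (u x - c) ^+ 2)).
Proof.
move=> h0 hu iw; have mQ := mcube a h.
apply: (integrable_mul_bounded (C := (L + `|c|) ^+ 2) (f := fun x : borel 'rV[R]_m => (u x - c) ^+ 2)) => //.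
  apply: measurable_funX; apply: measurable_funB; last exact: measurable_cst.
  exact: C1_bd_measurable hu.
move=> x hx; have [B [_ _ _ /(_ _ hx) [ux _]]] := hu.
have L0 := C1_bd_ge0 hu hx.
rewrite normrX lerXn2r ?nnegrE ?addr_ge0//.
by apply: (le_trans (ler_normB _ _)); apply: lerD.
Qed.

(** Passing from the mean on the cube to the means on its subcubes costs a factor 1 + t on the
    oscillation, with t as small as desired; the jump of the means is paid by the Dirichlet integral
    times the weight of the cube. *)
Lemma oscillation_step u a h L (t : R) : 0 < h -> 0 < t -> C1_bd (cube a h) u L ->
  lam.-integrable (cube a h) (EFin \o w) ->
  oscillation u a h <= (1 + t) * \sum_s oscillation u (subcorner a h s) (h / 2) +
    (1 + t^-1) * (((h / 2) ^+ m)^-1 * (m%:R * (h / 2) ^+ 2 * \int[lam]_(x in cube a h) grad_sq u x)) *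
    \int[lam]_(x in cube a h) w x.
Proof.
move=> h0 t0 hu iw; have h2 : 0 <= h / 2 by rewrite divr_ge0 ?ltW.
set E := ((h / 2) ^+ m)^-1 * _.
have sub s := subcube_sub (a := a) (s := s) (ltW h0).
have mQ := mcube a h; have mQs s := mcube (subcorner a h s) (h / 2).
have iws s : lam.-integrable (cube (subcorner a h s) (h / 2)) (EFin \o w).
  exact: integrableS iw.
have hus s : C1_bd (cube (subcorner a h s) (h / 2)) u L := C1_bdS (sub s) hu.
rewrite /oscillation (Rintegral_subcubes (ltW h0) (intg_weight_sq _ (ltW h0) hu iw)).
rewrite (Rintegral_subcubes (ltW h0) iw) !mulr_sumr -big_split/=.
apply: ler_sum => s _.
have i1 := intg_weight_sq (mean u (subcorner a h s) (h / 2)) h2 (hus s) (iws s).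
have iz1 := intgZ (mQs s) (1 + t) i1.
have iz2 := intgZ (mQs s) ((1 + t^-1) * E) (iws s).
apply: (@le_trans _ _ (\int[lam]_(x in cube (subcorner a h s) (h / 2))
  ((1 + t) * (w x * (u x - mean u (subcorner a h s) (h / 2)) ^+ 2) + (1 + t^-1) * E * w x))); last first.
  rewrite (RintegralD _ iz1 iz2)//.
  rewrite (RintegralZl _ _ i1)//.
  by rewrite (RintegralZl _ _ (iws s)).
apply: (le_Rintegral (mQs s) (intg_weight_sq _ h2 (hus s) (iws s)) (intgD (mQs s) iz1 iz2)).
move=> x hx; have := mean_subcube s h0 hu; rewrite -/E.
set p := mean u (subcorner a h s) (h / 2); set q := mean u a h => hE.
have hb : (u x - q) ^+ 2 <= (1 + t) * (u x - p) ^+ 2 + (1 + t^-1) * (p - q) ^+ 2.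
  by rewrite -(subrKA p) sqr_split_le.
have t1 : 0 <= 1 + t^-1 by rewrite addr_ge0 ?invr_ge0// ltW.
have h3 : (u x - q) ^+ 2 <= (1 + t) * (u x - p) ^+ 2 + (1 + t^-1) * E.
  by apply: (le_trans hb); rewrite lerD2l ler_wpM2l.
have := ler_wpM2l (w0 x) h3; rewrite mulrDr => h4; apply: (le_trans h4).
by rewrite le_eqVlt; apply/orP; left; apply/eqP; ring.
Qed.

Lemma cube_segment a h x z (s : R) : cube a h x -> cube a h z -> 0 <= s <= 1 ->
  cube a h (x + s *: (z - x)).
Proof.
move=> /cubeP hx /cubeP hz /andP[s0 s1]; apply/cubeP => i.
have := hx i; have := hz i; rewrite !mxE => /andP[h1 h2] /andP[h3 h4].
have [d0|d0] := lerP 0 (z 0 i - x 0 i).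
  by have := mulr_ge0 s0 d0; have := ler_wpM2r d0 s1; rewrite mul1r => h5 h6; apply/andP; split; lra.
have := mulr_ge0_le0 s0 (ltW d0); have := ler_wnM2r (ltW d0) s1; rewrite mul1r => h5 h6.
by apply/andP; split; lra.
Qed.

Lemma C1_bd_lipschitz u a h L x z : 0 <= h -> C1_bd (cube a h) u L ->
  cube a h x -> cube a h z -> `|u z - u x| <= m%:R * (L * h).
Proof.
move=> h0 hu hx hz; have L0 := C1_bd_ge0 hu hx.
have -> : u z - u x = u (x + (z - x)) - u x by congr (u _ - _); rewrite addrC subrK.
have [B [oB QB [du _] hb]] := hu.
apply: segment_lipschitz => s hs; have hc := cube_segment hx hz hs; first by apply: du; exact: QB.
rewrite (C1_bd_derive _ hu hc); apply: (le_trans (ler_norm_sum _ _ _)).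
have -> : m%:R * (L * h) = \sum_(i < m) L * h by rewrite sumr_const card_ord mulr_natl.
apply: ler_sum => i _; rewrite normrM mulrC; apply: ler_pM => //.
  by have [_] := hb _ hc; exact.
move/cubeP: hx => /(_ i) /andP[h1 h2]; move/cubeP: hz => /(_ i) /andP[h3 h4].
by rewrite !mxE ler_norml; apply/andP; split; lra.
Qed.

Lemma mean_lipschitz u a h L x : 0 < h -> C1_bd (cube a h) u L -> cube a h x ->
  (u x - mean u a h) ^+ 2 <= (m%:R * (L * h)) ^+ 2.
Proof.
move=> h0 hu hx; have L0 := C1_bd_ge0 hu hx.
have iu := C1_bd_intg (ltW h0) hu.
have mQ := mcube a h; have fQ := cube_fin a (ltW h0).
have ic (c : R) : lam.-integrable (cube a h) (EFin \o (fun=> c)).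
  by apply: (bounded_intg (C := `|c|)) => //; exact: measurable_cst.
have p0 : 0 < h ^+ m by rewrite exprn_gt0.
have V : fine (lam (cube a h)) = h ^+ m by rewrite cube_volume ?ltW.
have b1 : mean u a h <= u x + m%:R * (L * h).
  rewrite /mean ler_pdivrMl// mulrC -V -Rintegral_cst//; apply: le_Rintegral => // z hz.
  have := C1_bd_lipschitz (ltW h0) hu hx hz; rewrite ler_norml => /andP[_ h1]; lra.
have b2 : u x - m%:R * (L * h) <= mean u a h.
  rewrite /mean ler_pdivlMl// mulrC -V -Rintegral_cst//; apply: le_Rintegral => // z hz.
  have := C1_bd_lipschitz (ltW h0) hu hx hz; rewrite ler_norml => /andP[h1 _]; lra.
rewrite -(real_normK (num_real (u x - _))) lerXn2r ?nnegrE ?mulr_ge0 ?(ltW h0)//.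
by rewrite ler_norml; apply/andP; split; lra.
Qed.

(** The bound that ends the descent: it is of second order in h, which outweighs the factors 1 + t
    accumulated on the way. *)
Lemma oscillation_crude u a h L : 0 < h -> C1_bd (cube a h) u L ->
  lam.-integrable (cube a h) (EFin \o w) ->
  oscillation u a h <= (m%:R * (L * h)) ^+ 2 * \int[lam]_(x in cube a h) w x.
Proof.
move=> h0 hu iw; have mQ := mcube a h.
rewrite -RintegralZl//; apply: le_Rintegral => //.
- exact: intg_weight_sq (ltW h0) hu iw.
- exact: intgZ.
- by move=> x hx; rewrite mulrC ler_wpM2r//; exact: mean_lipschitz hu hx.
Qed.

(** Under the Morrey hypothesis, one subdivision at scale r costs at most K th^r times the Dirichlet
    integral. Since (1 + t) th < 1, the costs of all further subdivisions add up geometrically to B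
    th^r, while the remainder vanishes at infinite depth. *)
Lemma morrey_poincare (a0 : 'rV[R]_m) (h0 A th : R) : 0 < h0 ->
  lam.-integrable (cube a0 h0) (EFin \o w) -> 0 <= A -> 1 <= 2 * th -> th < 1 ->
  (forall (r : nat) a, cube a (h0 / 2 ^+ r) `<=` cube a0 h0 ->
    (h0 / 2 ^+ r) ^+ 2 * \int[lam]_(x in cube a (h0 / 2 ^+ r)) w x <= A * th ^+ r * (h0 / 2 ^+ r) ^+ m) ->
  exists2 B : R, 0 <= B & forall u L (r : nat) a,
    C1_bd (cube a0 h0) u L -> cube a (h0 / 2 ^+ r) `<=` cube a0 h0 ->
    oscillation u a (h0 / 2 ^+ r) <=
      B * th ^+ r * \int[lam]_(x in cube a (h0 / 2 ^+ r)) grad_sq u x.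
Proof.
move=> h0gt0 iw0 A0 th2 th1 morrey.
have th0 : 0 < th by lra.
(* This t turns (1 + t) th into (1 + th)/2, halfway between th and 1. *)
pose t := (1 - th) / (2 * th); have t0 : 0 < t by rewrite divr_gt0//; lra.
have t1E : (1 + t) * th = (1 + th) / 2 by rewrite /t; field; lra.
have t1 : 1 + t <= 2.
  by rewrite -lerBrDl /t ler_pdivrMr ?mulr_gt0//; lra.
have t1' : (1 + t) * (1 / 2) <= (1 + th) / 2 by rewrite -t1E ler_wpM2l//; lra.
(* K bounds the cost of one subdivision, and B is the fixed point of the map sending B to (1 + t) th
   B + K. *)
pose K := (1 + t^-1) * (2 ^+ m * m%:R * A); pose B := K / (1 - (1 + t) * th).
have K0 : 0 <= K by rewrite !mulr_ge0 ?exprn_ge0// addr_ge0// invr_ge0 ltW.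
have d0 : 0 < 1 - (1 + t) * th by rewrite t1E; lra.
have B0 : 0 <= B by rewrite divr_ge0// ltW.
have BE : (1 + t) * th * B + K = B by rewrite /B; field; rewrite gt_eqF.
exists B => // u L r a hu.
pose hr r := h0 / 2 ^+ r; have hr0 k : 0 < hr k by rewrite divr_gt0// exprn_gt0.
have hrS k : hr k / 2 = hr k.+1 by rewrite /hr exprSr invfM mulrA.
have iw k b : cube b (hr k) `<=` cube a0 h0 -> lam.-integrable (cube b (hr k)) (EFin \o w).
  by move=> h; apply: integrableS iw0 => //; exact: mcube.
(* d is the number of subdivisions made before the crude bound is used; the claim covers cubes of
   every size because the induction applies it to subcubes. *)
have ind d : forall k b, cube b (hr k) `<=` cube a0 h0 ->
    oscillation u b (hr k) <= B * th ^+ k * \int[lam]_(x in cube b (hr k)) grad_sq u x +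
      (1 + t) ^+ d * (m%:R * (L * hr (k + d)%N)) ^+ 2 * \int[lam]_(x in cube b (hr k)) w x.
  elim: d => [|d ih] k b hb; have hub := C1_bdS hb hu; have iwb := iw _ _ hb.
    rewrite addn0 expr0 mul1r; apply: (le_trans (oscillation_crude (hr0 k) hub iwb)).
    rewrite lerDr; apply: mulr_ge0; first by rewrite mulr_ge0// exprn_ge0// ltW.
    by apply: Rintegral_ge0 => x _; exact: grad_sq_ge0.
  have hs s : cube (subcorner b (hr k) s) (hr k.+1) `<=` cube a0 h0.
    by rewrite -hrS; apply: subset_trans hb; apply: subcube_sub; exact: ltW.
  have ig := C1_bd_intg_grad (ltW (hr0 k)) hub.
  apply: (le_trans (oscillation_step (hr0 k) t0 hub iwb)); rewrite hrS.
  set D := \int[lam]_(x in cube b (hr k)) grad_sq u x.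
  set W := \int[lam]_(x in cube b (hr k)) w x.
  have D0 : 0 <= D by apply: Rintegral_ge0 => x _; exact: grad_sq_ge0.
  have W0 : 0 <= W by apply: Rintegral_ge0.
  pose X := (m%:R * (L * hr (k.+1 + d)%N)) ^+ 2.
  have s1 : \sum_s oscillation u (subcorner b (hr k) s) (hr k.+1) <=
     B * th ^+ k.+1 * D + (1 + t) ^+ d * X * W.
    apply: (@le_trans _ _ (\sum_s (B * th ^+ k.+1 * \int[lam]_(x in cube (subcorner b (hr k) s) (hr k.+1)) grad_sq u x +
       (1 + t) ^+ d * X * \int[lam]_(x in cube (subcorner b (hr k) s) (hr k.+1)) w x))).
      by apply: ler_sum => s _; exact: ih.
    by rewrite big_split/= -!mulr_sumr -hrS -!Rintegral_subcubes// ltW.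
  have s2 : (1 + t^-1) * ((hr k.+1 ^+ m)^-1 * (m%:R * hr k.+1 ^+ 2 * D)) * W <= K * th ^+ k * D.
    have p0 : 0 < hr k.+1 ^+ m by rewrite exprn_gt0.
    have hk2 : hr k = 2 * hr k.+1 by rewrite -hrS; field.
    have hm : hr k ^+ 2 * W <= A * th ^+ k * (2 ^+ m * hr k.+1 ^+ m).
      by rewrite -exprMn -hk2; exact: morrey hb.
    have hm' : hr k.+1 ^+ 2 * W <= A * th ^+ k * (2 ^+ m * hr k.+1 ^+ m).
      apply: le_trans hm; rewrite ler_wpM2r// lerXn2r ?nnegrE ?(ltW (hr0 _))//.
      by rewrite hk2 ler_peMl ?(ltW (hr0 _)) ?ler1n.
    have -> : (1 + t^-1) * ((hr k.+1 ^+ m)^-1 * (m%:R * hr k.+1 ^+ 2 * D)) * W =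
      ((1 + t^-1) * m%:R * (hr k.+1 ^+ m)^-1 * D) * (hr k.+1 ^+ 2 * W) by ring.
    apply: (@le_trans _ _ ((1 + t^-1) * m%:R * (hr k.+1 ^+ m)^-1 * D * (A * th ^+ k * (2 ^+ m * hr k.+1 ^+ m)))).
      apply: ler_wpM2l => //; rewrite !mulr_ge0// ?invr_ge0 ?(ltW p0)//.
      by rewrite addr_ge0// invr_ge0 ltW.
    rewrite le_eqVlt; apply/orP; left; apply/eqP; rewrite /K; set q := hr k.+1 ^+ m; set c := 2 ^+ m; set v := th ^+ k.
    by field; rewrite /q !gt_eqF.
  apply: (le_trans (lerD (ler_wpM2l _ s1) s2)); first by lra.
  rewrite -{2}BE addnS -addSn -/X !exprS le_eqVlt; apply/orP; left; apply/eqP; ring.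
move=> hb; apply/ler_addgt0Pr => e e0.
set D := \int[lam]_(x in cube a _) grad_sq u x.
set W := \int[lam]_(x in cube a (hr r)) w x.
pose c := (m%:R * (L * hr r)) ^+ 2 * W.
(* The remainder at depth d is at most c q^d: the squared side contributes 4^(-d), and one of its
   factors 2^(-d) absorbs (1 + t)^d, as (1 + t)/2 <= q. *)
pose q := (1 + th) / 2.
have cv : (fun d => c * q ^+ d) @ \oo --> (0 : R).
  rewrite -(mulr0 c); apply: cvgMr; apply: cvg_expr.
  by rewrite ger0_norm /q; lra.
have [d hd] : exists d, c * q ^+ d < e.
  have [N _ hN] := cvgr_lt 0 cv e e0.
  by exists N; exact: (hN N (leqnn N)).
apply: (le_trans (ind d r a hb)); rewrite lerD2l; apply: le_trans (ltW hd).
have c0 : 0 <= c by rewrite mulr_ge0 ?sqr_ge0//; exact: Rintegral_ge0.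
have -> : (1 + t) ^+ d * (m%:R * (L * hr (r + d)%N)) ^+ 2 * W = c * (((1 + t) * (1 / 2)) ^+ d * (1 / 2) ^+ d).
  rewrite /c /hr exprD invfM !mul1r !exprMn exprVn; set x := 2 ^- d; ring.
apply: ler_wpM2l => //; apply: (@le_trans _ _ (((1 + t) * (1 / 2)) ^+ d)).
  rewrite ler_piMr ?exprn_ge0 ?exprn_ile1//; lra.
by rewrite lerXn2r ?nnegrE//; rewrite /q; lra.
Qed.

End MorreyPoincare.

(** * Calculus on manifolds *)

Opaque jacobian.

Lemma row_jacobian (R : realType) (m n : nat) (F : 'rV[R]_m -> 'rV[R]_n) x i :
  differentiable F x -> row i ('J F x) = 'D_(delta_mx 0 i) F x.
Proof. by move=> dF; rewrite rowE deriveEjacobian. Qed.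

Lemma jacobian_comp (R : realType) (m n p : nat) (F : 'rV[R]_m -> 'rV[R]_n)
    (G : 'rV[R]_n -> 'rV[R]_p) x : differentiable F x -> differentiable G (F x) ->
  'J (G \o F) x = 'J F x *m 'J G (F x).
Proof.
move=> dF dG; have dc := differentiable_comp dF dG.
apply/row_matrixP => i; rewrite row_mul (row_jacobian _ dc) (row_jacobian _ dF).
rewrite -(deriveEjacobian _ dG) (deriveE _ dc) (deriveE _ dF) (deriveE _ dG).
by rewrite (diff_comp dF dG).
Qed.

Lemma near_eq_jacobian (R : realType) (m n : nat) (F G : 'rV[R]_m -> 'rV[R]_n) x :
  (\near x, F x = G x) -> differentiable F x -> 'J F x = 'J G x.
Proof.
move=> FG dF; have dG := near_eq_differentiable FG dF.
apply/row_matrixP => i; apply: (etrans (row_jacobian i dF)).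
apply: (etrans _ (esym (row_jacobian i dG))); exact: near_eq_derive FG.
Qed.

Lemma jacobian_near_id (R : realType) (m : nat) (F : 'rV[R]_m -> 'rV[R]_m) x :
  (\near x, x = F x) -> 'J F x = 1%:M.
Proof.
move=> h; have di : differentiable (fun y : 'rV[R]_m => y) x.
  by case: (@Ck_matrix R m 1 m 1 setT (fun y => y) openT) => [i j|d _]; [rewrite (ord1 i); exact: Ck_coord|exact: d].
rewrite -(near_eq_jacobian h di); apply/row_matrixP => i.
by apply: (etrans (row_jacobian i di)); rewrite derive_id row1.
Qed.

Lemma mx_form_change (R : comPzRingType) (m : nat) (x y x' y' : 'rV[R]_m) (T G G' : 'M[R]_m) :
  x' = x *m T -> y' = y *m T -> G = T *m G' *m T^T ->
  x' *m G' *m y'^T = x *m G *m y^T.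
Proof. by move=> -> -> ->; rewrite trmx_mul !mulmxA. Qed.

Lemma mx_grad_change (R : comUnitRingType) (m : nat) (v v' : 'rV[R]_m) (T T' G G' : 'M[R]_m) :
  T *m T' = 1%:M -> T' *m T = 1%:M -> G' \in unitmx -> v' = v *m T^T -> G = T' *m G' *m T'^T ->
  v' *m invmx G' *m T = v *m invmx G.
Proof.
move=> TT' T'T uG -> eG; have [uT uT'] := mulmx1_unit TT'.
have uG' : G \in unitmx by rewrite eG !unitmx_mul unitmx_tr uT' uG.
apply: (canRL (mulmxK uG')); rewrite eG !mulmxA -(mulmxA _ T T') TT' mulmx1.
by rewrite mulmxKV// -mulmxA -trmx_mul T'T trmx1 mulmx1.
Qed.

Section Transitions.
Context {R : realType} {m : nat} {M : ptopologicalType} (S : manifold R M m).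
Implicit Types (U N K V : set M) (c d e : chart R M m) (u f : M -> R)
  (X Y : M -> 'rV[R]_m) (g h : M -> 'M[R]_m) (p q : M).

Lemma cmap_inj c p q : cdom c p -> cdom c q -> cmap c p = cmap c q -> p = q.
Proof. by move=> hp hq /(congr1 (cinv c)); rewrite !cmapK ?inE. Qed.

Lemma cinvK c p : cdom c p -> cinv c (cmap c p) = p.
Proof. by move=> hp; rewrite cmapK ?inE. Qed.

Definition cimg c V : set 'rV[R]_m := cmap c @` (cdom c `&` V).

Lemma cimgE c V x : cimg c V x <-> [/\ (cmap c @` cdom c) x, cdom c (cinv c x), V (cinv c x) &
  cmap c (cinv c x) = x].
Proof.
split=> [[p [cp Vp] <-]|[_ h1 h2 h3]]; last by exists (cinv c x).
by rewrite cinvK//; split => //; exists p.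
Qed.

Lemma open_cimg c V : open V -> open (cimg c V).
Proof.
move=> oV; rewrite (_ : cimg c V = (cmap c @` cdom c) `&` (cinv c @^-1` V)).
  by apply: open_preimage => //; [exact: cimg_open|exact: cinv_cont].
apply/seteqP; split=> [x /cimgE[h1 h2 h3 h4]//|x [[p cp <-]]]; rewrite /= cinvK// => Vp.
by exists p.
Qed.

Lemma cimg_mem c V p : cdom c p -> V p -> cimg c V (cmap c p).
Proof. by move=> cp Vp; exists p. Qed.

Definition trans c d p : 'M[R]_m := 'J (cmap d \o cinv c) (cmap c p).

Lemma transition_smooth k c d : atlas S c -> atlas S d ->
  Ck_on k (cimg c (cdom d)) (cmap d \o cinv c).
Proof. by move=> hc hd; exact: (atlas_compatible hc hd). Qed.

Lemma transition_diff c d p : atlas S c -> atlas S d -> cdom c p -> cdom d p ->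
  differentiable (cmap d \o cinv c) (cmap c p).
Proof.
by move=> hc hd cp dp; have [h _] := transition_smooth 1 hc hd; apply: h; exact: cimg_mem.
Qed.

Lemma transM c d e p : atlas S c -> atlas S d -> atlas S e -> cdom c p -> cdom d p -> cdom e p ->
  trans c d p *m trans d e p = trans c e p.
Proof.
move=> hc hd he cp dp ep; rewrite /trans.
have E : (cmap d \o cinv c) (cmap c p) = cmap d p by rewrite /= cinvK.
rewrite -{1}E -jacobian_comp; last 2 first.
- exact: transition_diff.
- by rewrite E; exact: transition_diff.
have oc := open_cimg (c := c) (cdom_open d).
apply: near_eq_jacobian.
  by apply: (near_open oc (cimg_mem cp dp)) => x /cimgE[_ h1 h2 h3] /=; rewrite cinvK.
apply: differentiable_comp; first exact: transition_diff.
by rewrite E; exact: transition_diff.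
Qed.

Lemma trans1 c p : atlas S c -> cdom c p -> trans c c p = 1%:M.
Proof.
move=> hc cp; apply: jacobian_near_id.
apply: (near_open (open_cimg (cdom_open c)) (cimg_mem cp cp)).
by move=> x /cimgE[_ _ _ h3].
Qed.

Lemma transK c d p : atlas S c -> atlas S d -> cdom c p -> cdom d p ->
  trans c d p *m trans d c p = 1%:M.
Proof. by move=> *; rewrite transM// trans1. Qed.

Lemma trans_unit c d p : atlas S c -> atlas S d -> cdom c p -> cdom d p ->
  trans c d p \in unitmx.
Proof. move=> hc hd cp dp; exact: (mulmx1_unit (transK hc hd cp dp)).1. Qed.

Let at0 p := atlas_chart_at S p.
Let in0 p := cdom_chart_at S p.

Lemma field_inE c X p : field_in S c X p = X p *m trans (chart_at S p) c p.
Proof. by []. Qed.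

Lemma metric_inE c g p : metric_in S c g p =
  trans c (chart_at S p) p *m g p *m (trans c (chart_at S p) p)^T.
Proof. by []. Qed.

Opaque trans field_in metric_in.

Lemma field_in_trans c d X p : atlas S c -> atlas S d -> cdom c p -> cdom d p ->
  field_in S d X p = field_in S c X p *m trans c d p.
Proof.
by move=> hc hd cp dp; rewrite !field_inE -mulmxA (transM (at0 p) hc hd (in0 p) cp dp).
Qed.

Lemma field_in_at X p : field_in S (chart_at S p) X p = X p.
Proof. by rewrite field_inE (trans1 (at0 p) (in0 p)) mulmx1. Qed.

Lemma field_in_eq0 c X p : atlas S c -> cdom c p -> field_in S c X p = 0 -> X p = 0.
Proof.
by move=> hc cp h; rewrite -field_in_at (field_in_trans X hc (at0 p) cp (in0 p)) h mul0mx.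
Qed.

Lemma metric_in_trans c d g p : atlas S c -> atlas S d -> cdom c p -> cdom d p ->
  metric_in S c g p = trans c d p *m metric_in S d g p *m (trans c d p)^T.
Proof.
move=> hc hd cp dp; rewrite !metric_inE -(transM hc hd (at0 p) cp dp (in0 p)).
by rewrite trmx_mul !mulmxA.
Qed.

Lemma metric_in_at g p : metric_in S (chart_at S p) g p = g p.
Proof. by rewrite metric_inE (trans1 (at0 p) (in0 p)) trmx1 mulmx1 mul1mx. Qed.

Lemma inner_trans c d g X Y p : atlas S c -> atlas S d -> cdom c p -> cdom d p ->
  field_in S d X p *m metric_in S d g p *m (field_in S d Y p)^T =
  field_in S c X p *m metric_in S c g p *m (field_in S c Y p)^T.
Proof.
move=> hc hd cp dp.
exact: mx_form_change (field_in_trans X hc hd cp dp) (field_in_trans Y hc hd cp dp)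
  (metric_in_trans g hc hd cp dp).
Qed.

Lemma inner_in c g X Y p : atlas S c -> cdom c p ->
  inner g X Y p = (field_in S c X p *m metric_in S c g p *m (field_in S c Y p)^T) 0 0.
Proof.
move=> hc cp; rewrite -(inner_trans g X Y hc (at0 p) cp (in0 p)).
by rewrite !field_in_at metric_in_at.
Qed.

Lemma metric_in_unit c g p : atlas S c -> cdom c p -> g p \in unitmx ->
  metric_in S c g p \in unitmx.
Proof.
move=> hc cp gu; rewrite metric_inE !unitmx_mul gu unitmx_tr.
by rewrite (trans_unit hc (at0 p) cp (in0 p)).
Qed.

Definition dloc c u p : 'rV[R]_m := \row_i pderiv (u \o cinv c) i (cmap c p).

Definition MCk (k : nat) V u := forall c, atlas S c -> Ck_on k (cimg c V) (u \o cinv c).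

(** The chain rule. In the row convention differentials transform by the transposed Jacobian, in the
    direction opposite to vectors. *)
Lemma dloc_trans c d u p : atlas S c -> atlas S d -> cdom c p -> cdom d p ->
  differentiable (u \o cinv d) (cmap d p) ->
  differentiable (u \o cinv c) (cmap c p) /\ dloc c u p = dloc d u p *m (trans c d p)^T.
Proof.
move=> hc hd cp dp du.
have E : (cmap d \o cinv c) (cmap c p) = cmap d p by rewrite /= cinvK.
have dt := transition_diff hc hd cp dp.
have n : \forall x \near cmap c p, ((u \o cinv d) \o (cmap d \o cinv c)) x = (u \o cinv c) x.
  apply: (near_open (open_cimg (cdom_open d)) (cimg_mem cp dp)).
  by move=> x /cimgE[_ h1 h2 h3] /=; rewrite cinvK.
have du' : differentiable (u \o cinv d) ((cmap d \o cinv c) (cmap c p)) by rewrite E.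
split; first by apply: near_eq_differentiable n _; exact: differentiable_comp.
Transparent trans.
apply/rowP => i; rewrite !mxE /trans /pderiv -(near_eq_derive _ n) derive_comp_rV// E.
by apply: eq_bigr => j _; rewrite [dloc _ _ _ 0 j]mxE [(_^T) j i]mxE mulrC (jacobianE _ _ dt).
Qed.

Opaque trans.
Lemma grad_in c g u p : atlas S c -> cdom c p -> differentiable (u \o cinv c) (cmap c p) ->
  g p \in unitmx ->
  field_in S c (grad S g u) p = dloc c u p *m invmx (metric_in S c g p).
Proof.
move=> hc cp du gu; have [_ e] := dloc_trans (at0 p) hc (in0 p) cp du.
exact: mx_grad_change (transK (at0 p) hc (in0 p) cp) (transK hc (at0 p) cp (in0 p)) gu e
  (metric_inE c g p).
Qed.

(** The metric cancels against its inverse: pairing with a gradient is applying the differential. *)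
Lemma inner_grad_in c g u Y p : atlas S c -> cdom c p -> differentiable (u \o cinv c) (cmap c p) ->
  g p \in unitmx ->
  inner g (grad S g u) Y p = \sum_i dloc c u p 0 i * field_in S c Y p 0 i.
Proof.
move=> hc cp du gu; rewrite (inner_in _ _ _ hc cp) (grad_in hc cp du gu).
rewrite mulmxKV; last exact: metric_in_unit.
by rewrite mxE; apply: eq_bigr => i _; rewrite [in X in _ * X]mxE.
Qed.

Lemma grad_cst g (a : R) p : grad S g (fun=> a) p = 0.
Proof.
rewrite /grad (_ : \row_i _ = 0) ?mul0mx//.
by apply/rowP => i; rewrite !mxE -[_ \o _]/(fun _ : 'rV[R]_m => a) (derive_cst a).
Qed.

End Transitions.

(** * Riemannian integrals in charts *)

Section IntegralTransfer.
Import HBNNSimple.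

(** The measures are compared on subsets of [D] only, as a chart describes the Riemannian measure
    only on its domain. For a simple function vanishing off [D], the level sets of nonzero values
    lie in [D]; monotone convergence does the rest. *)
Lemma integral_transfer (d1 d2 : measure_display) (X : measurableType d1) (Y : measurableType d2)
    (R : realType) (mu : {measure set X -> \bar R}) (nu : {measure set Y -> \bar R})
    (D : set X) (phi : Y -> X) (w : Y -> R) (h : X -> \bar R) :
  measurable_fun setT phi -> measurable_fun setT w -> (forall y, 0 <= w y) ->
  (forall A, measurable A -> A `<=` D -> mu A = (\int[nu]_y (w y * \1_A (phi y))%:E)%E) ->
  measurable_fun setT h -> (forall x, (0 <= h x)%E) -> (forall x, ~ D x -> h x = 0%E) ->
  (\int[mu]_x h x = \int[nu]_y ((w y)%:E * h (phi y)))%E.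
Proof.
move=> mphi mw w0 hmu mh h0 hD.
have simple (g : {nnsfun X >-> R}) : (forall x, ~ D x -> g x = 0) ->
    (\int[mu]_x (g x)%:E = \int[nu]_y (w y * g (phi y))%:E)%E.
  move=> gD; rewrite integralT_nnsfun sintegralE fsbig_finite//=.
  have mg (r : R) : measurable_fun setT (fun y => w y * \1_(g @^-1` [set r]) (phi y)).
    apply: measurable_funM => //; apply: (measurableT_comp (f := \1_(g @^-1` [set r]) : X -> R)) => //.
  transitivity (\sum_(r <- finmap.enum_fset (fset_set (range g))) \int[nu]_y (r * (w y * \1_(g @^-1` [set r]) (phi y)))%:E)%E.
    apply: eq_big_seq => r; rewrite in_fset_set// inE => -[x _ <-].
    have [r0|r0] := eqVneq (g x) 0.
      by rewrite r0 mul0e integral0_eq// => y _; rewrite mul0r.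
    under [RHS]eq_integral do rewrite EFinM.
    rewrite ge0_integralZl//.
    - rewrite hmu// => y /= gy; apply: contrapT => /gD; rewrite gy; exact/eqP.
    - exact/measurable_EFinP.
    - by move=> y _; rewrite lee_fin mulr_ge0.
    - by rewrite lee_fin.
  rewrite -ge0_integral_sum//.
  - apply: eq_integral => y _; rewrite sumEFin [in RHS]fimfunE fsbig_finite//= mulr_sumr; congr (_%:E).
    by apply: eq_bigr => r _; rewrite mulrCA.
  - by move=> r; apply/measurable_EFinP; exact: measurable_funM.
  - move=> r y _; rewrite lee_fin; have [r0|r0] := leP 0 r; first by rewrite !mulr_ge0.
    by rewrite preimage_nnfun0// indicE in_set0 !mulr0.
pose g := nnsfun_approx measurableT mh.
have gD n x : ~ D x -> g n x = 0.
  move=> /hD hx; apply/eqP; rewrite eq_le fun_ge0 andbT -lee_fin.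
  have gh' := cvg_nnsfun_approx measurableT mh (fun y _ => h0 y) (Logic.I : [set: X] x).
  have -> : 0%:E = h x by rewrite hx.
  rewrite -(cvg_lim (@ereal_hausdorff _) gh'); apply: lime_ge; first by apply/cvg_ex; exists (h x).
  by exists n => // k /= nk; rewrite lee_fin; exact/lefP/nd_nnsfun_approx.
have gh x : EFin \o g ^~ x @ \oo --> h x by exact: cvg_nnsfun_approx.
transitivity (limn (fun n => \int[mu]_x (g n x)%:E)%E).
  rewrite -monotone_convergence//.
  - by apply: eq_integral => x _; apply/esym/cvg_lim => //; exact: gh.
  - by move=> n; exact/measurable_EFinP.
  - by move=> n x _; rewrite lee_fin; exact: fun_ge0.
  - by move=> x _ a b ab; rewrite lee_fin; exact/lefP/nd_nnsfun_approx.
transitivity (limn (fun n => \int[nu]_y (w y * g n (phi y))%:E)%E).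
  by congr (limn _); apply/funext => n; rewrite simple// => x; exact: gD.
rewrite -monotone_convergence//.
- apply: eq_integral => y _; apply/cvg_lim => //.
  under eq_fun do rewrite EFinM.
  by apply: cvgeZl => //; exact: gh.
- by move=> n; apply/measurable_EFinP; apply: measurable_funM => //; exact: measurableT_comp.
- by move=> n y _; rewrite lee_fin mulr_ge0.
- by move=> y _ a b ab; rewrite lee_fin ler_wpM2l//; exact/lefP/nd_nnsfun_approx.
Qed.

End IntegralTransfer.

Lemma posdef_unit (R : realType) n (G : 'M[R]_n) : (forall v : 'rV[R]_n, v != 0 -> 0 < (v *m G *m v^T) 0 0) ->
  G \in unitmx.
Proof.
move=> h; rewrite -row_free_unit; apply: inj_row_free => v vG.
by apply: contrapT => /eqP v0; have := h v v0; rewrite vG mul0mx mxE ltxx.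
Qed.

(** Deform the identity into G. The matrix (1 - t) I + t G stays positive definite, hence
    invertible, so its determinant, a polynomial in t equal to 1 at 0, cannot be nonpositive at t =
    1. *)
Lemma posdef_det (R : realType) n (G : 'M[R]_n) :
  (forall v : 'rV[R]_n, v != 0 -> 0 < (v *m G *m v^T) 0 0) -> 0 < \det G.
Proof.
move=> h; pose P := \matrix_(i, j) ((1 - 'X) * (i == j)%:R + 'X * (G i j)%:P) : 'M[{poly R}]_n.
have e t : (\det P).[t] = \det ((1 - t) *: 1%:M + t *: G).
  rewrite -[LHS]/(horner_eval t (\det P)) -det_map_mx; congr (\det _); apply/matrixP => i j.
  by rewrite !mxE /= /horner_eval !hornerE; case: (i == j); rewrite ?hornerE ?mulr1 ?mulr0.
have pd t : t \in `[0, 1] -> (\det P).[t] != 0.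
  rewrite in_itv/= => /andP[t0 t1]; rewrite e -unitfE -[_ \is a _]/(_ \in unitmx).
  apply: posdef_unit => v v0.
  rewrite mulmxDr mulmxDl -!scalemxAr -!scalemxAl mulmx1 mxE [X in X + _]mxE [X in _ + X]mxE.
  have vv : 0 < (v *m v^T) 0 0.
    rewrite mxE lt_neqAle; apply/andP; split; last by apply: sumr_ge0 => i _; rewrite !mxE -expr2 sqr_ge0.
    apply: contra v0; rewrite eq_sym psumr_eq0 => [/allP z|i _]; last by rewrite !mxE -expr2 sqr_ge0.
    apply/eqP/rowP => i; rewrite mxE; have := z i (mem_index_enum _).
    by rewrite [v^T _ _]mxE mulf_eq0 orbb => /eqP.
  have := h v v0; have [t1'|t1'] := eqVneq t 1; first by rewrite t1' subrr mul0r add0r mul1r.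
  by move=> hv; apply: ltr_wpDr; [rewrite mulr_ge0// ltW|rewrite mulr_gt0// subr_gt0 lt_neqAle t1'].
rewrite ltNge; apply/negP => d0.
have [||t ht] := @poly_ivt R (- \det P) 0 1; first exact: ler01.
  rewrite !hornerN !e subr0 !scale1r scale0r addr0 det1 subrr scale0r add0r.
  by rewrite oppr_le0 ler01 oppr_ge0.
by rewrite rootE hornerN oppr_eq0 => /eqP z; have := pd t ht; rewrite z eqxx.
Qed.

Section ChartIntegrals.
Context {R : realType} {m : nat} {M : ptopologicalType} (S : manifold R M m).
Local Notation lam := (rV_measure (R := R) m).
Variables (U : set M) (g : M -> 'M[R]_m) (mu : {measure set (borel M) -> \bar R}).
Hypothesis oU : open U.
Hypothesis hg : riemannian_metric S U g.
Hypothesis hmu : riemannian_measure S U g mu.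

Definition dens c (x : 'rV[R]_m) : R := Num.sqrt (\det (metric_in S c g (cinv c x))).

Lemma Ck_det (n : nat) k (A : set 'rV[R]_m) (F : 'rV[R]_m -> 'M[R]_n) : open A ->
  (forall i j, Ck_on k A (fun x => F x i j)) -> Ck_on k A (fun x => \det (F x)).
Proof.
move=> oA hF; apply: Ck_sum => // s; apply: CkM => //; first exact: Ck_cst.
exact: Ck_prod.
Qed.

Lemma metric_smooth k c i j : atlas S c ->
  Ck_on k (cimg c U) (fun x => metric_in S c g (cinv c x) i j).
Proof.
move=> hc; have [_ _ h] := hg; apply: (Ck_entry i j (open_cimg oU)); exact: (h c hc k).
Qed.

Lemma metric_pos c p (v : 'rV[R]_m) : atlas S c -> cdom c p -> U p -> v != 0 ->
  0 < (v *m metric_in S c g p *m v^T) 0 0.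
Proof.
move=> hc cp Up v0; have [_ h _] := hg.
have tu := trans_unit hc (atlas_chart_at S p) cp (cdom_chart_at S p).
rewrite metric_inE; set T := trans _ _ _ in tu *.
have -> : v *m (T *m g p *m T^T) *m v^T = (v *m T) *m g p *m (v *m T)^T by rewrite trmx_mul !mulmxA.
by apply: h => //; apply: contra v0 => /eqP e; rewrite -(mulmxK tu v) e mul0mx.
Qed.

Lemma metric_sym c p : U p -> (metric_in S c g p)^T = metric_in S c g p.
Proof.
move=> Up; have [h _ _] := hg; rewrite metric_inE; set T := trans _ _ _.
by rewrite !trmx_mul trmxK h// mulmxA.
Qed.

Lemma metric_in_unitmx c p : atlas S c -> cdom c p -> U p -> metric_in S c g p \in unitmx.
Proof. by move=> hc cp Up; apply: posdef_unit => v; exact: metric_pos. Qed.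

Lemma metric_unitmx p : U p -> g p \in unitmx.
Proof. by move=> Up; apply: posdef_unit => v v0; have [_ h _] := hg; exact: h. Qed.

Lemma dens_gt0 c p : atlas S c -> cdom c p -> U p -> 0 < dens c (cmap c p).
Proof.
move=> hc cp Up; rewrite sqrtr_gt0 cinvK//.
by apply: posdef_det => v; exact: metric_pos.
Qed.

Lemma dens_smooth k c : atlas S c -> Ck_on k (cimg c U) (dens c).
Proof.
move=> hc; have oc := open_cimg (c := c) oU; apply: Ck_sqrt => //.
  move=> x /cimgE[_ cx Ux _]; apply: posdef_det => v; exact: metric_pos.
by apply: Ck_det => // i j; exact: metric_smooth.
Qed.

(** The inverse chart made total and Borel measurable: outside the image of [U] it takes a default
    point, where [cweight] vanishes. *)
Definition cpoint c (x : 'rV[R]_m) : M := if x \in cimg c U then cinv c x else point.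

Lemma cpoint_measurable c : measurable_fun setT (cpoint c : borel 'rV[R]_m -> borel M).
Proof.
have oc := open_cimg (c := c) oU.
have cc x : cimg c U x -> {for x, continuous (cinv c)}.
  by move=> /cimgE[h _ _ _]; exact: cinv_cont.
have mc := continuous_borel_measurable oc cc.
move=> _ B mB; rewrite setTI.
rewrite (_ : _ @^-1` _ = (cimg c U `&` cinv c @^-1` B) `|` (~` cimg c U `&` [set _ | B point])).
  apply: measurableU; first exact: mc (open_borel oc) _ mB.
  apply: measurableI; first by apply: measurableC; exact: open_borel.
  have [Bp|Bp] := pselect (B point).
    by rewrite (_ : [set _ | _] = setT)//; apply/seteqP; split.
  by rewrite (_ : [set _ | _] = set0)//; apply/seteqP; split.
apply/seteqP; split=> x; rewrite /= /cpoint.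
  by have [hx|hx] := pselect (cimg c U x); [rewrite mem_set//; left|rewrite memNset//; right].
by move=> [[hx Bx]|[hx Bx]]; [rewrite mem_set|rewrite memNset].
Qed.

(** The indicator lets a coordinate cube meet the complement of [U], which carries no mass. *)
Definition cweight c (x : 'rV[R]_m) : R := \1_(cimg c U) x * dens c x.

Lemma cweight_measurable c : atlas S c ->
  measurable_fun setT (cweight c : borel 'rV[R]_m -> R).
Proof.
move=> hc; have oc := open_cimg (c := c) oU.
rewrite (_ : cweight c = dens c \_ (cimg c U)).
  apply/(measurable_restrictT _ (open_borel oc)).
  by apply: cont_measurable => // x hx; exact: (dens_smooth 0 hc).
by apply/funext => x; rewrite patchE /cweight indicE; case: ifP => _; rewrite ?mul1r ?mul0r.
Qed.

Lemma cweight_ge0 c x : 0 <= cweight c x.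
Proof. by rewrite mulr_ge0// sqrtr_ge0. Qed.

Lemma measure_cimg c (A : set (borel M)) : atlas S c -> measurable A -> A `<=` cdom c `&` U ->
  mu A = (\int[lam]_x (cweight c x * \1_A (cpoint c x))%:E)%E.
Proof.
move=> hc mA AD; have [_ /(_ c A hc mA AD) ->] := hmu.
have e x : (\1_(cmap c @` A) x * Num.sqrt (\det (metric_in S c g (cinv c x))))%:E =
    (cweight c x * \1_A (cpoint c x))%:E.
  congr (_%:E); rewrite /cweight /cpoint !indicE; have [hx|hx] := pselect (cimg c U x).
    have [_ cx Ux xx] := (cimgE _ _ _).1 hx.
    rewrite (mem_set hx) mul1r mulrC /dens; congr (_ * _%:R).
    have [Ax|Ax] := pselect (A (cinv c x)); first by rewrite !mem_set//; exists (cinv c x).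
    rewrite !memNset// => -[p Ap px]; apply: Ax; rewrite -px cinvK//.
    by have [] := AD _ Ap.
  rewrite !(memNset hx) !mul0r memNset ?mul0r// => -[p Ap px]; apply: hx.
  by have [cp Up] := AD _ Ap; exists p.
have mE : measurable_fun setT (fun x : borel 'rV[R]_m => (cweight c x * \1_A (cpoint c x))%:E).
  apply/measurable_EFinP; apply: measurable_funM; first exact: cweight_measurable.
  by apply: (measurableT_comp (f := \1_A : borel M -> R)) => //; exact: cpoint_measurable.
rewrite (funext e); apply: (rV_integralE mE) => x.
by rewrite lee_fin mulr_ge0// cweight_ge0.
Qed.

Lemma chart_integral c (A : set (borel M)) (h : borel M -> R) : atlas S c -> measurable A ->
  A `<=` cdom c `&` U -> measurable_fun A h ->
  (\int[mu]_(p in A) (h p)%:E = \int[lam]_(x in cmap c @` A) (dens c x * h (cinv c x))%:E)%E.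
Proof.
move=> hc mA AD mh.
have mk : measurable_fun setT (h \_ A : borel M -> R) by exact/(measurable_restrictT _ mA).
have key (k : borel M -> R) : measurable_fun setT k -> (forall p, 0 <= k p) -> (forall p, ~ A p -> k p = 0) ->
   (\int[mu]_p (k p)%:E = \int[lam]_x (cweight c x * k (cpoint c x))%:E)%E.
  move=> mk' k0 kA.
  apply: (@integral_transfer _ _ (borel M) _ R mu lam (cdom c `&` U) (cpoint c) (cweight c) (EFin \o k)).
  - exact: cpoint_measurable.
  - exact: cweight_measurable.
  - exact: cweight_ge0.
  - by move=> B mB BD; exact: measure_cimg.
  - exact/measurable_EFinP.
  - by move=> p; rewrite lee_fin.
  - by move=> p np; rewrite /= kA// => /AD.
rewrite integral_mkcond [RHS]integral_mkcond.
transitivity (\int[mu]_p ((h \_ A) p)%:E)%E.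
  by apply: eq_integral => p _; rewrite !patchE; case: ifP.
transitivity (\int[lam]_x (cweight c x * (h \_ A) (cpoint c x))%:E)%E; last first.
  apply: eq_integral => x _; rewrite !patchE /cweight /cpoint indicE; have [hx|hx] := pselect (cimg c U x).
    rewrite (mem_set hx) mul1r; have [_ cx Ux xx] := (cimgE _ _ _).1 hx.
    have [Ax|Ax] := pselect (A (cinv c x)).
      by rewrite !mem_set//; exists (cinv c x).
    rewrite (memNset Ax) mulr0 memNset// => -[p Ap px]; apply: Ax; rewrite -px cinvK//.
    by have [] := AD _ Ap.
  rewrite (memNset hx) !mul0r memNset// => -[p Ap px]; apply: hx.
  by have [cp Up] := AD _ Ap; exists p.
have kA p : ~ A p -> (h \_ A) p = 0 by move=> nA; rewrite patchE memNset.
rewrite [LHS]integralE [RHS]integralE; congr (_ - _)%E.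
- transitivity (\int[mu]_p (Num.max ((h \_ A) p) 0)%:E)%E.
    by apply: eq_integral => p _; rewrite funeposE EFin_max.
  rewrite key.
  + apply: eq_integral => x _; rewrite funeposE -EFin_max; congr (_%:E).
    by rewrite maxr_pMr ?mulr0// cweight_ge0.
  + by apply: measurable_maxr => //; exact: measurable_cst.
  + by move=> p; rewrite le_max lexx orbT.
  + by move=> p /kA ->; rewrite maxxx.
- transitivity (\int[mu]_p (Num.max (- (h \_ A) p) 0)%:E)%E.
    by apply: eq_integral => p _; rewrite funenegE EFin_max.
  rewrite key.
  + apply: eq_integral => x _; rewrite funenegE -EFinN -EFin_max; congr (_%:E).
    by rewrite maxr_pMr ?mulr0 ?mulrN// cweight_ge0.
  + by apply: measurable_maxr => //; exact: measurableT_comp.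
  + by move=> p; rewrite le_max lexx orbT.
  + by move=> p /kA ->; rewrite oppr0 maxxx.
Qed.

Lemma chart_Rintegral c (A : set (borel M)) (h : borel M -> R) : atlas S c -> measurable A ->
  A `<=` cdom c `&` U -> measurable_fun A h ->
  \int[mu]_(p in A) h p = \int[lam]_(x in cmap c @` A) (dens c x * h (cinv c x)).
Proof. by move=> hc mA AD mh; rewrite /Rintegral (chart_integral hc mA AD mh). Qed.

End ChartIntegrals.

(** * Smooth functions and bumps on the manifold *)

Lemma compact_sub_cbox (R : realType) (m : nat) (C : set 'rV[R]_m) : compact C ->
  exists a b, C `<=` cbox a b.
Proof.
move=> cC; have /choice[B hB] : forall i : 'I_m, exists B : R, forall x, C x -> `|x 0 i| <= B.
  move=> i; have [B _ hB] := compact_bnd cC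
    (fun t _ => @coord_continuous R 1 m 0 i t).
  by exists B.
exists (- \row_i B i), (\row_i B i) => x Cx i; rewrite !mxE.
by have := hB i x Cx; rewrite ler_norml.
Qed.

Lemma small_cbox (R : realType) (m : nat) (A : set 'rV[R]_m) x : open A -> A x ->
  exists2 e : R, 0 < e & cbox (x - const_mx e) (x + const_mx e) `<=` A.
Proof.
rewrite openE => oA /oA /nbhs_ballP[e /= e0 he]; exists (e / 2); first by rewrite divr_gt0.
move=> y hy; apply: he; split=> // i j; rewrite (ord1 i).
have := hy j; rewrite !mxE => /andP[h1 h2]; rewrite /ball/= ltr_norml.
by apply/andP; split; lra.
Qed.

Lemma compact_image_for (T T' : topologicalType) (f : T -> T') (K : set T) : compact K ->
  (forall t, K t -> {for t, continuous f}) -> compact (f @` K).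
Proof.
move=> cK cf; apply: (continuous_compact _ cK).
rewrite continuous_subspace_in => t; rewrite inE => Kt.
by apply: continuous_subspaceT_for => //; exact: cf.
Qed.

Section Bumps.
Context {R : realType} {m : nat} {M : ptopologicalType} (S : manifold R M m).
Implicit Types (K V W : set M) (c d e : chart R M m) (u v : M -> R) (p q : M).

Lemma manifold_compact_closed K : compact K -> closed K.
Proof. exact: compact_closed (manifold_hausdorff S). Qed.

Lemma cimg_sub c V W : V `<=` W -> cimg c V `<=` cimg c W.
Proof. by move=> VW x [p [cp /VW Wp] <-]; exists p. Qed.

Lemma MCk_cont V u p : open V -> MCk S 0 V u -> V p -> {for p, continuous u}.
Proof.
move=> oV hu Vp; pose c := chart_at S p.
have cp : cdom c p := cdom_chart_at S p.
apply: (@near_open_continuous _ _ (cdom c) ((u \o cinv c) \o cmap c) u p (cdom_open c) cp).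
  by move=> q cq; rewrite /= cinvK.
apply: (@continuous_comp _ _ _ (cmap c) (u \o cinv c) p); first exact: cmap_cont.
by apply: (hu c (atlas_chart_at S p)); exact: cimg_mem.
Qed.

(** One chart around each point is enough: every other chart is reached by composing with a smooth
    transition. *)
Lemma MCk_local k V u : (forall p, V p -> exists c W, [/\ atlas S c, open W, W p, W `<=` cdom c &
  Ck_on k (cimg c W) (u \o cinv c)]) -> MCk S k V u.
Proof.
move=> h d hd; apply: Ck_local => _ [p [dp Vp] <-].
have [c [W [hc oW Wp Wc hu]]] := h p Vp.
exists (cimg d W); first exact: cimg_mem.
have od : open (cimg d W) by exact: open_cimg.
have tr x : cimg d W x -> cimg c W ((cmap c \o cinv d) x).
  by move=> /cimgE[_ _ Wx _] /=; apply: cimg_mem => //; exact: Wc.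
have ht i : Ck_on k (cimg d W) (fun x => (cmap c \o cinv d) x 0 i).
  by apply: (Ck_entry 0 i od); apply: Ck_sub (transition_smooth k hd hc); exact: cimg_sub.
apply: (Ck_ext od) (Ck_comp od (open_cimg oW) tr hu ht) => x /cimgE[_ _ Wx _] /=.
by rewrite cinvK//; exact: Wc.
Qed.

Lemma MCk_sub k V W u : V `<=` W -> MCk S k W u -> MCk S k V u.
Proof. by move=> VW h c hc; apply: Ck_sub (h c hc); exact: cimg_sub. Qed.

Lemma MCk_cst k V (a : R) : MCk S k V (fun=> a).
Proof. by move=> c hc; exact: Ck_cst. Qed.

Lemma MCk_ext k V u v : open V -> (forall p, V p -> u p = v p) -> MCk S k V u -> MCk S k V v.
Proof.
move=> oV uv hu c hc; apply: (Ck_ext (open_cimg oV)) (hu c hc) => x /cimgE[_ _ Vx _].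
exact: uv.
Qed.

Lemma MCkD k V u v : open V -> MCk S k V u -> MCk S k V v -> MCk S k V (u + v).
Proof. by move=> oV hu hv c hc; exact: (CkD (open_cimg oV) (hu c hc) (hv c hc)). Qed.

Lemma MCkM k V u v : open V -> MCk S k V u -> MCk S k V v -> MCk S k V (fun p => u p * v p).
Proof. by move=> oV hu hv c hc; exact: (CkM (open_cimg oV) (hu c hc) (hv c hc)). Qed.

Lemma MCkV k V u : open V -> (forall p, V p -> u p != 0) -> MCk S k V u ->
  MCk S k V (fun p => (u p)^-1).
Proof.
move=> oV u0 hu c hc; apply: (CkV (open_cimg oV) _ (hu c hc)) => x /cimgE[_ _ Vx _].
exact: u0.
Qed.

Lemma MCk_sum k V (I : Type) (r : seq I) (u : I -> M -> R) : open V ->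
  (forall i, MCk S k V (u i)) -> MCk S k V (fun p => \sum_(i <- r) u i p).
Proof. by move=> oV hu c hc; exact: (Ck_sum r (open_cimg oV) (fun i => hu i c hc)). Qed.

Definition transplant c (F : 'rV[R]_m -> R) p : R := if p \in cdom c then F (cmap c p) else 0.

Lemma transplantE c F p : cdom c p -> transplant c F p = F (cmap c p).
Proof. by move=> cp; rewrite /transplant mem_set. Qed.

Lemma compact_cinv c (C : set 'rV[R]_m) : compact C -> C `<=` cmap c @` cdom c ->
  compact (cinv c @` C).
Proof. by move=> cC Cc; apply: compact_image_for => // x /Cc; exact: cinv_cont. Qed.

Lemma transplant_eq0 c F (C : set 'rV[R]_m) p : (forall x, ~ C x -> F x = 0) ->
  ~ (cinv c @` C) p -> transplant c F p = 0.
Proof.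
move=> F0 np; rewrite /transplant; have [cp|cp] := pselect (cdom c p); last by rewrite memNset.
by rewrite mem_set// F0// => h; apply: np; exists (cmap c p); rewrite ?cinvK.
Qed.

Lemma transplant_smooth k c F (C : set 'rV[R]_m) : atlas S c -> compact C ->
  C `<=` cmap c @` cdom c -> (forall x, ~ C x -> F x = 0) -> Ck_on k setT F ->
  MCk S k setT (transplant c F).
Proof.
move=> hc cC Cc F0 hF; apply: MCk_local => p _.
have cK := manifold_compact_closed (compact_cinv cC Cc).
have [cp|cp] := pselect (cdom c p).
  exists c, (cdom c); split => //; first exact: cdom_open.
  have oc : open (cimg c (cdom c)) by apply: open_cimg; exact: cdom_open.
  apply: (Ck_ext oc) (Ck_sub (@subsetT _ _) hF) => x /cimgE[_ cx _ xx].
  by rewrite /= transplantE// xx.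
have np : ~ (cinv c @` C) p.
  by move=> [x /Cc [q cq <-]]; rewrite cinvK// => e; apply: cp; rewrite -e.
exists (chart_at S p), (cdom (chart_at S p) `&` ~` (cinv c @` C)); split => //.
- exact: atlas_chart_at.
- by apply: openI; [exact: cdom_open|exact: closed_openC].
- by split => //; exact: cdom_chart_at.
- have oW : open (cdom (chart_at S p) `&` ~` (cinv c @` C)).
    by apply: openI; [exact: cdom_open|exact: closed_openC].
  apply: (Ck_ext (open_cimg oW)) (Ck_cst k _ (0 : R)) => x /cimgE[_ _ [_ nx] _] /=.
  by rewrite (transplant_eq0 F0).
Qed.

Lemma bump_exists V p : open V -> V p -> exists psi K,
  [/\ forall k, MCk S k setT psi, forall q, 0 <= psi q, 0 < psi p, compact K &
      K `<=` V /\ forall q, ~ K q -> psi q = 0].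
Proof.
move=> oV Vp; pose c := chart_at S p.
have cp : cdom c p := cdom_chart_at S p.
have [e e0 he] := small_cbox (open_cimg (c := c) oV) (cimg_mem cp Vp).
set a := cmap c p - const_mx e in he; set b := cmap c p + const_mx e in he.
have F0 x : ~ cbox a b x -> box_bump a b x = 0.
  move=> nx; apply: box_bump_eq0 => h; apply: nx => i.
  by have /andP[/ltW -> /ltW ->] := h i.
have Cc : cbox a b `<=` cmap c @` cdom c by move=> x /he /cimgE[].
exists (transplant c (box_bump a b)), (cinv c @` cbox a b); split.
- move=> k; apply: transplant_smooth F0 (Ck_box_bump k a b) => //; first exact: atlas_chart_at.
  exact: compact_cbox.
- by move=> q; rewrite /transplant; case: ifP => // _; exact: box_bump_ge0.
- rewrite transplantE//; apply: box_bump_gt0 => i; rewrite !mxE.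
  by apply/andP; split; lra.
- by apply: compact_cinv => //; exact: compact_cbox.
- split=> [_ [x /he /cimgE[_ _ Vx _] <-]//|q nq]; exact: transplant_eq0 F0 nq.
Qed.

End Bumps.

(** * The divergence theorem on an open subset *)

Lemma Rintegral_sub_eq0 (d : measure_display) (T : measurableType d) (R : realType)
    (mu : {measure set T -> \bar R}) (D : set T) (f a b : T -> R) : measurable D ->
  mu.-integrable D (EFin \o f) -> mu.-integrable D (EFin \o a) -> mu.-integrable D (EFin \o b) ->
  \int[mu]_(x in D) (f x + a x) = 0 -> \int[mu]_(x in D) (f x + b x) = 0 ->
  \int[mu]_(x in D) (a x - b x) = 0.
Proof.
move=> mD i1 i2 i3; rewrite (RintegralD mD i1 i2) (RintegralD mD i1 i3) (RintegralB mD i2 i3).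
lra.
Qed.

Section Divergence.
Context {R : realType} {m : nat} {M : ptopologicalType} (S : manifold R M m).
Local Notation lam := (rV_measure (R := R) m).
Variables (U : set M) (g : M -> 'M[R]_m) (mu : {measure set (borel M) -> \bar R}).
Hypothesis oU : open U.
Hypothesis hg : riemannian_metric S U g.
Hypothesis hmu : riemannian_measure S U g mu.
Local Notation dens := (dens S g).

(** The coordinate expression of the divergence in an arbitrary chart, whereas [divergence] uses the
    preferred chart of each point. Their agreement is obtained by duality in [chart_divc_eq]. *)
Definition divc c Y p : R := (dens c (cmap c p))^-1 *
  \sum_i pderiv (fun x => dens c x * field_in S c Y (cinv c x) 0 i) i (cmap c p).

Lemma divergenceE Y p : divergence S g Y p = divc (chart_at S p) Y p.
Proof.
have e : Num.sqrt (\det (metric_in S (chart_at S p) g p)) = dens (chart_at S p) (cmap (chart_at S p) p).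
  by rewrite /dens (cinvK (cdom_chart_at S p)).
by rewrite /divc -e.
Qed.

Definition C1_field Y := forall c i, atlas S c ->
  Ck_on 1 (cimg c U) (fun x => field_in S c Y (cinv c x) 0 i).

Lemma near_eq0_derive (F : 'rV[R]_m -> R) (v : 'rV[R]_m) x : (\forall y \near x, F y = 0) -> 'D_v F x = 0.
Proof. by move=> h; rewrite -(derive_cst (0 : R) x v); exact: near_eq_derive. Qed.

Lemma dloc_eq0 (c : chart R M m) V u p : open V -> cdom c p -> V p -> (forall q, V q -> u q = 0) -> dloc c u p = 0.
Proof.
move=> oV cp Vp u0; apply/rowP => i; rewrite !mxE /pderiv; apply: near_eq0_derive.
apply: (near_open (open_cimg (c := c) oV) (cimg_mem cp Vp)) => x /cimgE[_ _ Vx _] /=.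
exact: u0.
Qed.

Lemma grad_eq0 V u p : open V -> V p -> (forall q, V q -> u q = 0) -> grad S g u p = 0.
Proof.
move=> oV Vp u0; rewrite -[grad S g u p]/(dloc (chart_at S p) u p *m invmx (g p)).
by rewrite (dloc_eq0 oV (cdom_chart_at S p) Vp u0) mul0mx.
Qed.

Lemma divc_eq0 c V Y p : open V -> cdom c p -> V p -> (forall q, V q -> Y q = 0) -> divc c Y p = 0.
Proof.
move=> oV cp Vp Y0; rewrite /divc big1 ?mulr0// => i _; apply: near_eq0_derive.
apply: (near_open (open_cimg (c := c) oV) (cimg_mem cp Vp)) => x /cimgE[_ _ Vx _].
by rewrite field_inE Y0// mul0mx mxE mulr0.
Qed.

(** As u is supported in the chart, the integrand times the density is the Euclidean divergence of
    the compactly supported field u sqrt(det g) Y, whose integral is 0 by [integral_derive0]. It is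
    stated with [divc] because chart independence is deduced from it. *)
Lemma chart_divergence_theorem c V K K1 u Y : atlas S c -> open V -> V `<=` U -> MCk S 1 V u ->
  C1_field Y -> compact K -> K `<=` V -> (forall p, ~ K p -> Y p = 0) ->
  compact K1 -> K1 `<=` cdom c -> (forall p, ~ K1 p -> u p = 0) ->
  \int[mu]_(p in U) (inner g (grad S g u) Y p + u p * divc c Y p) = 0.
Proof.
move=> hc oV VU hu hY cK KV Y0 cK1 K1c u0.
pose h (p : borel M) : R := inner g (grad S g u) Y p + u p * divc c Y p.
pose A : set (borel M) := cdom c `&` V.
have oA : open (A : set M) by apply: openI => //; exact: cdom_open.
have oC := open_cimg (c := c) oV.
have cU x : cimg c V x -> cimg c U x by exact: cimg_sub.
have clK := manifold_compact_closed S cK; have clK1 := manifold_compact_closed S cK1.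
pose F i (x : 'rV[R]_m) : R := if x \in cimg c V then
  u (cinv c x) * (dens c x * field_in S c Y (cinv c x) 0 i) else 0.
pose C := cmap c @` (K `&` K1).
have cC : compact C.
  apply: compact_image_for => [|p [_ /K1c cp]]; last exact: cmap_cont.
  by apply: compact_closedI.
have clC : closed C by exact: (compact_closed (@norm_hausdorff _ _) cC).
have F0 i x : ~ C x -> F i x = 0.
  move=> nC; rewrite /F; case: ifP => //; rewrite inE => /cimgE[_ cx Vx xx].
  have [Kx|Kx] := pselect (K (cinv c x)); last by rewrite field_inE Y0// mul0mx mxE !mulr0.
  have [K1x|K1x] := pselect (K1 (cinv c x)); last by rewrite u0// mul0r.
  by case: nC; exists (cinv c x).
have dY i : Ck_on 1 (cimg c V) (fun x => dens c x * field_in S c Y (cinv c x) 0 i).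
  apply: CkM => //; first exact: Ck_sub cU (dens_smooth oU hg 1 hc).
  exact: Ck_sub cU (hY c i hc).
have CF i : Ck_on 1 setT (F i).
  apply: Ck_local => x _; have [hx|hx] := pselect (cimg c V x).
    exists (cimg c V) => //; apply: (Ck_ext oC) (CkM oC (hu c hc) (dY i)) => y hy.
    by rewrite /F mem_set.
  have nx : ~ C x by move=> [p [Kp K1p] px]; apply: hx; exists p => //; split; [exact: K1c|exact: KV].
  exists (~` C) => //; have oC' : open (~` C) by exact: closed_openC.
  by apply: (Ck_ext oC') (Ck_cst 1 _ (0 : R)) => y hy; rewrite F0.
have FE p : A p -> h p = (dens c (cmap c p))^-1 * \sum_i pderiv (F i) i (cmap c p).
  move=> [cp Vp]; have Up := VU _ Vp; have d0 := dens_gt0 hg hc cp Up.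
  have [du _] := hu c hc; have dup := du _ (cimg_mem cp Vp).
  rewrite /h (inner_grad_in Y hc cp dup (metric_unitmx hg Up)) /divc.
  have e i : pderiv (F i) i (cmap c p) =
     u p * pderiv (fun x => dens c x * field_in S c Y (cinv c x) 0 i) i (cmap c p) +
     dens c (cmap c p) * (dloc c u p 0 i * field_in S c Y p 0 i).
    have [dYp _] := dY i; have dYi := dYp _ (cimg_mem cp Vp).
    have n : \forall x \near cmap c p,
       (u \o cinv c) x * (dens c x * field_in S c Y (cinv c x) 0 i) = F i x.
      by apply: (near_open oC (cimg_mem cp Vp)) => x hx; rewrite /F mem_set.
    rewrite /pderiv -(near_eq_derive _ n).
    rewrite (deriveM (f := u \o cinv c) (g := fun x => dens c x * field_in S c Y (cinv c x) 0 i)); last 2 first.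
    - exact: diff_derivable.
    - exact: diff_derivable.
    rewrite [dloc _ _ _ _ _]mxE /pderiv /= cinvK//.
    rewrite -[X in X + _]/(u p * _) -[X in _ + X]/(_ * _ * _); congr (_ + _).
    by rewrite -[_ * _ * _]mulrA; congr (_ * _); rewrite mulrC.
  rewrite (eq_bigr _ (fun i _ => e i)) big_split/= -!mulr_sumr mulrDr.
  by rewrite [_^-1 * (dens _ _ * _)]mulrA mulVf ?gt_eqF// mul1r addrC mulrCA.
have AD : A `<=` cdom c `&` U by move=> p [cp /VU Up].
have mA : measurable A by exact: open_borel.
have mU : measurable (U : set (borel M)) by exact: open_borel.
have mh : measurable_fun A h.
  pose G x := (dens c x)^-1 * \sum_i pderiv (F i) i x.
  have cG : Ck_on 0 (cimg c V) G.
    apply: CkM => //; last first.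
      apply: Ck_sum => // i; have hF : Ck_on 0 setT (pderiv (F i) i) by case: (CF i) => _; exact.
      exact: Ck_sub (@subsetT _ _) hF.
    apply: CkV => //; last exact: Ck_sub cU (dens_smooth oU hg 0 hc).
    by move=> _ [p [cp Vp] <-]; rewrite gt_eqF//; apply: (dens_gt0 hg) => //; exact: VU.
  have mG : measurable_fun A (G \o cmap c : borel M -> R).
    apply: (cont_measurable (D := (A : set M))) => // p [cp Vp].
    by apply: continuous_comp; [exact: cmap_cont|exact: (cG _ (cimg_mem cp Vp))].
  by move: mG; apply: eq_measurable_fun => p; rewrite inE => Ap; rewrite FE.
have hA p : U p -> ~ A p -> h p = 0.
  move=> Up nA; have [cp|cp] := pselect (cdom c p).
    have nK : ~ K p by move=> /KV Vp; apply: nA.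
    rewrite /h (divc_eq0 (V := ~` K) (closed_openC clK) cp nK Y0) mulr0 addr0.
    by rewrite /inner Y0// trmx0 mulmx0 mxE.
  have nK1 : ~ K1 p by move=> /K1c.
  rewrite /h u0// mul0r addr0 /inner (grad_eq0 (V := ~` K1) (closed_openC clK1) nK1 u0).
  by rewrite !mul0mx mxE.
transitivity (\int[mu]_(p in A) h p).
  rewrite Rintegral_mkcond [RHS]Rintegral_mkcond; congr (Rintegral _ _ _); apply/funext => p.
  rewrite !patchE; have [Ap|Ap] := pselect (A p).
    by rewrite (mem_set Ap) mem_set//; have [] := AD _ Ap.
  by rewrite (memNset Ap); case: ifP => //; rewrite inE => Up; exact: hA.
rewrite (chart_Rintegral oU hg hmu hc mA AD mh).
transitivity (\int[lam]_x (\sum_i pderiv (F i) i x)).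
  rewrite Rintegral_mkcond; congr (Rintegral _ _ _); apply/funext => x.
  rewrite patchE; have [hx|hx] := pselect ((cmap c @` A) x).
    rewrite mem_set//; case: hx => p [cp Vp] <-.
    by rewrite cinvK// (FE p)// mulVKf// gt_eqF//; apply: (dens_gt0 hg) => //; exact: VU.
  rewrite memNset// big1// => i _; apply: near_eq0_derive.
  have nC : ~ C x by move=> [p [Kp /K1c K1p] px]; apply: hx; exists p => //; split => //; exact: KV.
  by apply: (near_open (closed_openC clC) nC) => y; exact: F0.
have [a [b Cab]] := compact_sub_cbox cC.
have F0' i x : ~ cbox a b x -> F i x = 0 by move=> nx; apply: F0 => /Cab.
rewrite Rintegral_sum//; last by move=> i; exact: derive_integrable (CF i) (F0' i).
by rewrite big1// => i _; exact: integral_derive0 (CF i) (F0' i).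
Qed.

Lemma integral_pos_null (d : measure_display) (T : measurableType d)
    (nu : {measure set T -> \bar R}) (D E : set T) (h : T -> R) :
  measurable D -> measurable E -> E `<=` D -> measurable_fun D h -> (forall x, D x -> 0 <= h x) ->
  (forall x, E x -> 0 < h x) -> (\int[nu]_(x in D) (h x)%:E = 0)%E -> nu E = 0%E.
Proof.
move=> mD mE ED mh h0 hE i0.
have /ae_eq_integral_abs : (\int[nu]_(x in D) `|(h x)%:E| = 0)%E.
  by rewrite -[RHS]i0; apply: eq_integral => x; rewrite inE => Dx; rewrite abse_EFin ger0_norm ?h0.
move=> /(_ mD ((measurable_EFinP _ _).2 mh)) [B [mB B0 hB]].
apply/eqP; rewrite -measure_le0 -B0; apply: le_measure; rewrite ?inE// => x Ex.
apply: hB => /= /(_ (ED _ Ex)) [e]; by have := hE _ Ex; rewrite e ltxx.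
Qed.

Lemma measure_open_gt0 V p : open V -> V `<=` U -> V p -> (0 < mu V)%E.
Proof.
move=> oV VU Vp; pose c := chart_at S p; have hc : atlas S c := atlas_chart_at S p.
have cp : cdom c p := cdom_chart_at S p.
pose A : set (borel M) := cdom c `&` V.
have oA : open (A : set M) by apply: openI => //; exact: cdom_open.
have mA : measurable A by exact: open_borel.
have mV : measurable (V : set (borel M)) by exact: open_borel.
rewrite lt0e measure_ge0 andbT; apply/negP => /eqP mV0.
have mA0 : mu A = 0%E by apply: subset_measure0 mV0 => // q [].
have AD : A `<=` cdom c `&` U by move=> q [cq /VU Uq].
have oC := open_cimg (c := c) oV.
have := chart_integral oU hg hmu hc mA AD (measurable_cst (1 : R)).
rewrite (_ : (\int[mu]_(q in A) _)%E = mu A); last first.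
  by transitivity (\int[mu]_(q in A) (cst 1%E q))%E => //; rewrite integral_cst// mul1e.
rewrite mA0 => /esym i0.
have [e e0 he] := small_cbox oC (cimg_mem cp Vp).
set a := _ - _ in he; set b := _ + _ in he.
have hb : hbox a b `<=` cimg c V by apply: subset_trans he; exact: hbox_cbox.
have cV x : cimg c V x -> 0 < dens c x * 1.
  by move=> [q [cq Vq] <-]; rewrite mulr1; apply: (dens_gt0 hg) => //; exact: VU.
have : lam (hbox a b) = 0%E.
  apply: (integral_pos_null (nu := lam) (h := fun x => dens c x * 1) (open_borel oC) (mhbox a b) hb) => //.
- apply: cont_measurable => // x hx.
  apply: (near_open_continuous oC hx (F := dens c)) => [y _|]; first by rewrite mulr1.
  by apply: (dens_smooth oU hg 0 hc); apply: cimg_sub hx.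
- by move=> x /cV /ltW.
- by move=> x /hb; exact: cV.
rewrite rV_measure_hbox => [|i]; last by rewrite !mxE; lra.
by move=> [] /eqP /prodf_eq0[i _]; rewrite !mxE => /eqP; lra.
Qed.

Hypothesis mu_fin : (mu U < +oo)%E.
Let mU : measurable (U : set (borel M)) := open_borel oU.

Lemma compact_intg V K (w : M -> R) : open V -> V `<=` U -> compact K -> K `<=` V ->
  MCk S 0 V w -> (forall p, ~ K p -> w p = 0) ->
  mu.-integrable U (EFin \o (w : borel M -> R)).
Proof.
move=> oV VU cK KV hw w0.
have cw p : {for p, continuous w}.
  have [Vp|Vp] := pselect (V p); first exact: (MCk_cont oV hw).
  have nK : ~ K p by move=> /KV.
  apply: (near_open_continuous (closed_openC (manifold_compact_closed S cK)) nK (F := fun=> 0)).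
    by move=> q /w0.
  exact: cst_continuous.
have [C _ hC] := compact_bnd cK (fun t _ => cw t).
apply: (bounded_intg (C := Num.max C 0)) => //.
  by apply: (cont_measurable oU) => p _; exact: cw.
move=> p _; have [Kp|Kp] := pselect (K p); first by rewrite le_max hC.
by rewrite w0// normr0 le_max lexx orbT.
Qed.

(** The fundamental lemma of the calculus of variations. A bump placed where s w > 0 would have a
    positive integral against s w, because nonempty open sets have positive measure. *)
Lemma weak_eq0 V (w : M -> R) : open V -> V `<=` U -> MCk S 0 V w ->
  (forall psi K, (forall k, MCk S k setT psi) -> compact K -> K `<=` V -> (forall p, ~ K p -> psi p = 0) ->
     \int[mu]_(p in U) (psi p * w p) = 0) -> forall p, V p -> w p = 0.
Proof.
move=> oV VU hw hpsi.
suff key (s : R) p : V p -> ~ 0 < s * w p.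
  move=> p Vp; apply/eqP; rewrite eq_le !leNgt; apply/andP; split; apply/negP => h.
    by apply: (key 1 p Vp); rewrite mul1r.
  by apply: (key (-1) p Vp); rewrite mulN1r oppr_gt0.
move=> Vp sw; pose W := V `&` (fun q => s * w q) @^-1` [set r | 0 < r].
have csw q : V q -> {for q, continuous (fun q => s * w q)}.
  by move=> Vq; apply: continuousM; [exact: cst_continuous|exact: (MCk_cont oV hw)].
have oW : open W by apply: open_preimage => //; exact: open_gt.
have [psi [K [spsi psi0 psip cK [KW psiK]]]] := bump_exists S oW (conj Vp sw).
have KV : K `<=` V by move=> q /KW [].
pose h q := psi q * (s * w q).
have hW : MCk S 0 V h.
  by apply: MCkM => //; [exact: MCk_sub (spsi 0%N)|apply: MCkM => //; exact: MCk_cst].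
have hK q : ~ K q -> h q = 0 by move=> nK; rewrite /h psiK// mul0r.
have ih := compact_intg oV VU cK KV hW hK.
have h0 q : 0 <= h q.
  have [Kq|Kq] := pselect (K q); last by rewrite hK.
  by rewrite mulr_ge0//; have [_ /ltW] := KW _ Kq.
have i0 : \int[mu]_(q in U) h q = 0.
  rewrite /h; under eq_Rintegral do rewrite mulrCA.
  rewrite RintegralZl//; first by rewrite (hpsi psi K)// mulr0.
  apply: (compact_intg oV VU cK KV); last by move=> q nK; rewrite psiK// mul0r.
  by apply: MCkM => //; exact: MCk_sub (spsi 0%N).
pose E := V `&` h @^-1` [set r | 0 < r].
have oE : open E.
  by apply: open_preimage => // q Vq; exact: (MCk_cont oV hW).
have Ep : E p by split => //=; exact: mulr_gt0.
have EU : E `<=` U by move=> q [/VU].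
have := measure_open_gt0 oE EU Ep.
rewrite (integral_pos_null mU (open_borel oE) EU (intg_measurable ih))//.
- by rewrite ltxx.
- by move=> q [].
- by rewrite -[LHS]fineK ?integrable_fin_num//; congr (_%:E); exact: i0.
Qed.

Lemma divc_smooth c Y : atlas S c -> C1_field Y ->
  Ck_on 0 (cimg c U) (fun x => divc c Y (cinv c x)).
Proof.
move=> hc hY; have oC := open_cimg (c := c) oU.
have dc k := dens_smooth oU hg k hc.
have h : Ck_on 0 (cimg c U) (fun x => (dens c x)^-1 *
    \sum_i pderiv (fun y => dens c y * field_in S c Y (cinv c y) 0 i) i x).
  apply: CkM => //.
    apply: CkV => // _ [p [cp Up] <-]; rewrite gt_eqF//; exact: (dens_gt0 hg).
  by apply: Ck_sum => // i; have [_] := CkM oC (dc 1%N) (hY c i hc); exact.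
by apply: (Ck_ext oC) h => x /cimgE[_ _ _ xx]; rewrite /divc xx.
Qed.

Opaque divc divergence.

Lemma inner_grad_smooth V u Y : open V -> V `<=` U -> MCk S 1 V u -> C1_field Y ->
  MCk S 0 V (inner g (grad S g u) Y).
Proof.
move=> oV VU hu hY c hc; have oC := open_cimg (c := c) oV.
have [du hu'] := hu c hc.
have hT (i : 'I_m) : Ck_on 0 (cimg c V) (fun x => pderiv (u \o cinv c) i x * field_in S c Y (cinv c x) 0 i).
  apply: CkM => //; first exact: hu'.
  exact: Ck_sub (cimg_sub (c := c) VU) (CkW (hY c i hc)).
apply: (Ck_ext oC) (Ck_sum (index_enum _) oC hT).
move=> x hx; have [_ cx Vx xx] := (cimgE _ _ _).1 hx.
rewrite /= (inner_grad_in Y hc cx) ?xx; last 2 first.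
- exact: du.
- by apply: (metric_unitmx hg); exact: VU.
by apply: eq_bigr => i _; rewrite [dloc _ _ _ _ _]mxE xx.
Qed.

(** Both expressions satisfy the same integration by parts against bumps supported in the common
    domain, so their difference is orthogonal to all of these and vanishes. No Jacobian of a
    transition has to be differentiated. *)
Lemma chart_divc_eq c d Y : atlas S c -> atlas S d -> C1_field Y ->
  (exists2 K, compact K & K `<=` U /\ forall p, ~ K p -> Y p = 0) ->
  forall p, cdom c p -> cdom d p -> U p -> divc c Y p = divc d Y p.
Proof.
move=> hc hd hY [K cK [KU Y0]] p cp dp Up.
pose W := cdom c `&` cdom d `&` U.
have oW : open W by apply: openI => //; apply: openI; exact: cdom_open.
have WU : W `<=` U by move=> q [].
have hW e : atlas S e -> (W `<=` cdom e) -> MCk S 0 W (divc e Y).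
  move=> he We; apply: MCk_local => q Wq; exists e, W; split => //.
  exact: Ck_sub (cimg_sub (c := e) WU) (divc_smooth he hY).
have hWc := hW c hc (fun q h => h.1.1); have hWd := hW d hd (fun q h => h.1.2).
apply/eqP; rewrite -subr_eq0; apply/eqP.
have hWB : MCk S 0 W (fun q => divc c Y q - divc d Y q).
  by move=> e he; apply: (CkB (open_cimg oW)); [exact: hWc|exact: hWd].
apply: (weak_eq0 oW WU hWB) => // psi K1 spsi cK1 K1W psi0.
have psi1 : MCk S 1 U psi by exact: MCk_sub (spsi 1%N).
have T e : atlas S e -> (W `<=` cdom e) ->
    \int[mu]_(q in U) (inner g (grad S g psi) Y q + psi q * divc e Y q) = 0.
  move=> he We; apply: (chart_divergence_theorem he oU _ psi1 hY cK KU Y0 cK1 _ psi0) => //.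
  exact: subset_trans We.
have I e : atlas S e -> (W `<=` cdom e) -> mu.-integrable U (EFin \o (fun q => psi q * divc e Y q)).
  move=> he We; apply: (compact_intg oW WU cK1 K1W).
    exact: (MCkM oW (MCk_sub (@subsetT _ W) (spsi 0%N)) (hW e he We)).
  by move=> q nq; rewrite psi0// mul0r.
have i0 : mu.-integrable U (EFin \o inner g (grad S g psi) Y).
  apply: (compact_intg oU _ cK KU) => //.
    exact: inner_grad_smooth.
  by move=> q nq; rewrite /inner Y0// trmx0 mulmx0 mxE.
have hcI := I c hc (fun q h => h.1.1); have hdI := I d hd (fun q h => h.1.2).
have Tc := T c hc (fun q h => h.1.1); have Td := T d hd (fun q h => h.1.2).
rewrite -[RHS](Rintegral_sub_eq0 mU i0 hcI hdI Tc Td).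
by apply: eq_Rintegral => q _; exact: mulrBr.
Qed.

Lemma divergence_divc c Y p : atlas S c -> C1_field Y ->
  (exists2 K, compact K & K `<=` U /\ forall p, ~ K p -> Y p = 0) ->
  cdom c p -> U p -> divergence S g Y p = divc c Y p.
Proof.
move=> hc hY hK cp Up; rewrite divergenceE.
exact: (chart_divc_eq (atlas_chart_at S p) hc hY hK (cdom_chart_at S p) cp Up).
Qed.

Lemma divergence_smooth Y : C1_field Y ->
  (exists2 K, compact K & K `<=` U /\ forall p, ~ K p -> Y p = 0) ->
  MCk S 0 U (divergence S g Y).
Proof.
move=> hY hK c hc; apply: (Ck_ext (open_cimg oU)) (divc_smooth hc hY) => x /cimgE[_ cx Ux _] /=.
by rewrite (divergence_divc hc hY hK).
Qed.

Lemma divergence_eq0 V Y p : open V -> V p -> (forall q, V q -> Y q = 0) -> divergence S g Y p = 0.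
Proof.
by move=> oV Vp Y0; rewrite divergenceE (divc_eq0 oV (cdom_chart_at S p) Vp Y0).
Qed.

Lemma dloc_sum V c p (I : eqType) (r : seq I) (u : I -> M -> R) : atlas S c -> cdom c p -> open V -> V p ->
  (forall i, MCk S 1 V (u i)) ->
  dloc c (fun q => \sum_(i <- r) u i q) p = \sum_(i <- r) dloc c (u i) p.
Proof.
move=> hc cp oV Vp hu; elim: r => [|i r ih].
  rewrite big_nil; apply: (dloc_eq0 (V := setT)) => //; first exact: openT.
  by move=> q _; rewrite big_nil.
rewrite big_cons -ih; apply/rowP => j; rewrite mxE [RHS]mxE !mxE /pderiv.
have [di _] := hu i c hc; have dip := di _ (cimg_mem cp Vp).
have [dr _] := MCk_sum r oV hu hc; have drp := dr _ (cimg_mem cp Vp).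
rewrite -(deriveD (diff_derivable dip) (diff_derivable drp)).
have -> : (fun q => \sum_(i0 <- i :: r) u i0 q) \o cinv c =
    (u i \o cinv c) + ((fun q => \sum_(i0 <- r) u i0 q) \o cinv c).
  by apply/funext => x; rewrite fctE /= big_cons.
by [].
Qed.

(** The support of Y is covered by finitely many bumps that live in charts; u is the sum of the u
    psi_p / sig near this support, and each summand is handled in its own chart. *)
Theorem divergence_theorem V K u Y : open V -> V `<=` U -> MCk S 1 V u -> C1_field Y ->
  compact K -> K `<=` V -> (forall p, ~ K p -> Y p = 0) ->
  \int[mu]_(p in U) (inner g (grad S g u) Y p + u p * divergence S g Y p) = 0.
Proof.
move=> oV VU hu hY cK KV Y0.
have clK := manifold_compact_closed S cK.
have hK : exists2 K, compact K & K `<=` U /\ forall p, ~ K p -> Y p = 0.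
  by exists K => //; split => //; exact: subset_trans VU.
have /choice[psi /choice[k hpsi]] : forall p, exists psi, exists K, V p ->
  [/\ forall k, MCk S k setT psi, forall q, 0 <= psi q, 0 < psi p, compact K &
      K `<=` V `&` cdom (chart_at S p) /\ forall q, ~ K q -> psi q = 0].
  move=> p; have [Vp|Vp] := pselect (V p); last by exists (fun=> 0), set0.
  have oW : open (V `&` cdom (chart_at S p)) by apply: openI => //; exact: cdom_open.
  have [psi [K1 h]] := bump_exists S oW (conj Vp (cdom_chart_at S p)).
  by exists psi, K1.
have oP p : V p -> open [set q | 0 < psi p q].
  move=> Vp; have [h _ _ _ _] := hpsi p Vp.
  rewrite (_ : [set q | _] = setT `&` psi p @^-1` [set r | 0 < r]); last by rewrite setTI.
  apply: open_preimage => [|q _|]; [exact: openT| |exact: open_gt].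
  exact: (MCk_cont openT (h 0%N)).
have : cover_compact K by rewrite -compact_cover.
move=> /(_ M V (fun p => [set q | 0 < psi p q]) oP).
have cov : K `<=` cover V (fun p => [set q | 0 < psi p q]).
  by move=> p /KV Vp; exists p => //=; have [] := hpsi p Vp.
move=> /(_ cov) [D DV covD]; pose r := finmap.enum_fset D.
have rV p : p \in r -> V p by move=> pD; have := DV p pD; rewrite inE.
(* The bump attached to p is under control only for p in [V]; the test [p \in r] makes every summand
   smooth without a side condition, as lemmas on sums require. *)
pose sig q := \sum_(p <- r) (if p \in r then psi p q else 0).
have ssig j : MCk S j setT sig.
  apply: MCk_sum => [|p]; first exact: openT.
  case pr: (p \in r); last exact: MCk_cst.
  by have [h _ _ _ _] := hpsi p (rV p pr).
have sig0 p q : p \in r -> psi p q <= sig q.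
  move=> pr; rewrite /sig (big_rem p pr)/= pr lerDl; apply: sumr_ge0 => i _.
  by case: ifP => // ir; have [_ + _ _ _] := hpsi i (rV i ir).
(* The neighbourhood of K on which dividing by [sig] is legitimate. *)
pose W := V `&` sig @^-1` [set r | 0 < r].
have oW : open W.
  apply: open_preimage => // q _.
  exact: (MCk_cont openT (ssig 0%N)).
have KW : K `<=` W.
  move=> q Kq; split; first exact: KV.
  have [p pD /= pq] := covD q Kq; apply: lt_le_trans pq _; exact: sig0.
have WU : W `<=` U by move=> q [/VU].
pose w p q := u q * (sig q)^-1 * (if p \in r then psi p q else 0).
have hw p : MCk S 1 W (w p).
  apply: MCkM => //; first apply: MCkM => //.
  - by apply: MCk_sub hu => q [].
  - apply: MCkV => //; first by move=> q [_ /= s0]; rewrite gt_eqF.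
    by apply: MCk_sub (ssig 1%N).
  - case pr: (p \in r); last exact: MCk_cst.
    by have [h _ _ _ _] := hpsi p (rV p pr); apply: MCk_sub (h 1%N).
pose h p q := inner g (grad S g (w p)) Y q + w p q * divergence S g Y q.
have hK0 p q : ~ K q -> h p q = 0.
  move=> nK; rewrite /h (divergence_eq0 (closed_openC clK) nK Y0) mulr0 addr0.
  by rewrite /inner Y0// trmx0 mulmx0 mxE.
have hint p : mu.-integrable U (EFin \o h p).
  apply: (compact_intg oW WU cK KW); last exact: hK0.
  apply: MCkD => //; first exact: inner_grad_smooth.
  apply: MCkM => //; first by move=> c hc; exact: CkW (hw p c hc).
  exact: MCk_sub WU (divergence_smooth hY hK).
have h0 p : \int[mu]_(q in U) h p q = 0.
  case pr: (p \in r); last first.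
    rewrite (_ : h p = fun=> 0); first by rewrite Rintegral_cst// mul0r.
    apply/funext => q; have z q' : w p q' = 0 by rewrite /w pr mulr0.
    rewrite /h z mul0r addr0 /inner (grad_eq0 openT (Logic.I : [set: M] q) (fun q' _ => z q')).
    by rewrite !mul0mx mxE.
  have [_ _ _ ck [kV k0]] := hpsi p (rV p pr).
  have kc : k p `<=` cdom (chart_at S p) by move=> q /kV [].
  have w0 q : ~ k p q -> w p q = 0 by move=> nk; rewrite /w pr k0// mulr0.
  rewrite -[RHS](chart_divergence_theorem (atlas_chart_at S p) oW WU (hw p) hY cK KW Y0 ck kc w0).
  apply: eq_Rintegral => q; rewrite inE => Uq; apply: (congr1 (fun z => inner g (grad S g (w p)) Y q + z)).
  have [kq|kq] := pselect (k p q); last first.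
    by rewrite (w0 q kq); apply: (etrans (mul0r _)); apply: esym; exact: mul0r.
  by rewrite (divergence_divc (atlas_chart_at S p) hY hK)//; exact: kc.
transitivity (\int[mu]_(q in U) \sum_(p <- r) h p q); last first.
  by rewrite Rintegral_sum// big1// => p _; exact: h0.
apply: eq_Rintegral => q; rewrite inE => Uq.
have [Kq|nK] := pselect (K q); last first.
  rewrite [RHS]big1 => [|p _]; last exact: hK0.
  rewrite (divergence_eq0 (closed_openC clK) nK Y0) mulr0 addr0.
  by rewrite /inner Y0// trmx0 mulmx0 mxE.
have Wq := KW _ Kq.
have wu q' : W q' -> \sum_(p <- r) w p q' = u q'.
  by move=> [_ /= s0]; rewrite -mulr_sumr -[X in _ * X]/(sig q') mulfVK// gt_eqF.
rewrite big_split/= -mulr_suml wu//; congr (_ + _).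
pose c := chart_at S q; have hc : atlas S c := atlas_chart_at S q; have cq : cdom c q := cdom_chart_at S q.
have Vq : V q by case: Wq.
have gq := metric_unitmx hg Uq.
have [duV _] := hu c hc.
rewrite (inner_grad_in Y hc cq (duV _ (cimg_mem cq Vq)) gq).
under [RHS]eq_bigr => p _.
  have [dw _] := hw p c hc.
  rewrite (inner_grad_in Y hc cq (dw _ (cimg_mem cq Wq)) gq).
  over.
rewrite exchange_big/=; apply: eq_bigr => i _; rewrite -mulr_suml; congr (_ * _).
have -> : dloc c u q = dloc c (fun q' => \sum_(p <- r) w p q') q.
  apply/rowP => j; rewrite !mxE /pderiv; apply: near_eq_derive.
  apply: (near_open (open_cimg (c := c) oW) (cimg_mem cq Wq)) => x /cimgE[_ _ Wx _] /=.
  by rewrite wu.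
by rewrite (dloc_sum _ hc cq oW Wq hw) summxE.
Qed.

End Divergence.

(** * Spaces of square-integrable functions and fields *)

Section SquareIntegrable.
Context (d : measure_display) (T : measurableType d) (R : realType)
  (mu : {measure set T -> \bar R}) (D : set T) (E : lmodType R)
  (b : T -> E -> E -> R) (Pm : set (T -> E)).
Hypothesis mD : measurable D.
Hypothesis hb : forall t, D t -> semi_ip setT (b t).
Hypothesis Pm0 : Pm 0.
Hypothesis Pm_lin : forall a X Y, Pm X -> Pm Y -> Pm (a *: X + Y).
Hypothesis Pm_b : forall X Y, Pm X -> Pm Y -> measurable_fun D (fun t => b t (X t) (Y t)).

(** Functions and vector fields are treated at once: [b t] is the scalar product of the fibre over t
    and [Pm] the measurability condition, so one completeness proof serves both L2 spaces. *)
Definition sqi (X : T -> E) : Prop := Pm X /\ (\int[mu]_(t in D) (b t (X t) (X t))%:E < +oo)%E.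

Definition sqip (X Y : T -> E) : R := \int[mu]_(t in D) b t (X t) (Y t).

Let b_ge0 t x : D t -> 0 <= b t x x.
Proof. by move=> Dt; exact: (semi_ip_ge0 (hb Dt)). Qed.

Lemma sqi_intg_sq X : sqi X -> mu.-integrable D (EFin \o (fun t => b t (X t) (X t))).
Proof.
move=> [PX iX]; apply/integrableP; split; first by apply/measurable_EFinP; exact: Pm_b.
rewrite (_ : (\int[mu]_(x in D) _)%E = (\int[mu]_(t in D) (b t (X t) (X t))%:E)%E)//.
by apply: eq_integral => t; rewrite inE => Dt /=; rewrite ger0_norm// b_ge0.
Qed.

Lemma sqi_intg X Y : sqi X -> sqi Y ->
  mu.-integrable D (EFin \o (fun t => b t (X t) (Y t))).
Proof.
move=> hX hY; have [PX _] := hX; have [PY _] := hY.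
apply: (intg_le mD (Pm_b PX PY) _ (intgD mD (sqi_intg_sq hX) (sqi_intg_sq hY))).
move=> t Dt; have ht := hb Dt.
have := b_ge0 (X t + Y t) Dt; have := b_ge0 (X t - Y t) Dt.
rewrite (nipB ht)// (nipD ht)// => h1 h2.
by have := b_ge0 (X t) Dt; have := b_ge0 (Y t) Dt; rewrite ler_norml => h3 h4; apply/andP; split; lra.
Qed.

Lemma sqi_semi_ip : semi_ip sqi sqip.
Proof.
split.
- split; first exact: Pm0.
  rewrite integral0_eq// => t Dt; congr (_%:E).
  exact: (ip0l (hb Dt)).
- move=> a X Y hX hY; have [PX _] := hX; have [PY _] := hY.
  split; first exact: Pm_lin.
  have i1 := intgZ mD (2 * a ^+ 2) (sqi_intg_sq hX).
  have i2 := intgZ mD 2 (sqi_intg_sq hY).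
  have i := intgD mD i1 i2.
  have /integrableP[_] : mu.-integrable D (EFin \o (fun t => b t ((a *: X + Y) t) ((a *: X + Y) t))).
    apply: (intg_le mD _ _ i); first by apply: Pm_b; exact: Pm_lin.
    move=> t Dt; rewrite ger0_norm ?b_ge0//; have ht := hb Dt.
    have := b_ge0 (a *: X t - Y t) Dt.
    rewrite -[(a *: X + Y) t]/(a *: X t + Y t) (nipB ht)// (nipD ht)// (nipZ ht)//; lra.
  apply: le_lt_trans; apply: ge0_le_integral => //.
  + by move=> t Dt; rewrite lee_fin b_ge0.
  + by apply/measurable_EFinP; apply: Pm_b; exact: Pm_lin.
  + by apply: measurableT_comp => //; apply/measurable_EFinP; apply: Pm_b; exact: Pm_lin.
  + by move=> t Dt; rewrite lee_fin ler_norm.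
- by move=> X Y _ _; apply: eq_Rintegral => t; rewrite inE => Dt; exact: (semi_ipC (hb Dt)).
- move=> a X Y Z hX hY hZ; rewrite /sqip.
  rewrite -(RintegralZl _ mD (sqi_intg hX hZ)).
  rewrite -(RintegralD mD (intgZ mD a (sqi_intg hX hZ)) (sqi_intg hY hZ)).
  by apply: eq_Rintegral => t; rewrite inE => Dt; exact: (semi_ip_linear (hb Dt)).
- by move=> X _; apply: Rintegral_ge0 => t Dt; exact: b_ge0.
Qed.

Hypothesis hlim : forall t (x : nat -> E), D t ->
  (exists C : R, forall k, 4 ^+ k * b t (x k.+1 - x k) (x k.+1 - x k) <= C) ->
  exists y, cvgH (b t) x y.
Hypothesis Pm_lim : forall (X_ : nat -> T -> E) X B, measurable B -> B `<=` D ->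
  (forall k, Pm (X_ k)) -> (forall t, B t -> cvgH (b t) (X_^~ t) (X t)) ->
  (forall t, ~ B t -> X t = 0) -> Pm X.

Lemma rapid_cauchy_subseq (V : lmodType R) (ip : V -> V -> R) (s : nat -> V) (e : nat -> R) :
  (forall k, 0 < e k) ->
  (forall r : R, 0 < r -> exists K, forall i j, (K <= i)%N -> (K <= j)%N -> ip (s i - s j) (s i - s j) < r) ->
  exists n : nat -> nat, (forall k, (k <= n k)%N) /\
    forall k, ip (s (n k.+1) - s (n k)) (s (n k.+1) - s (n k)) < e k.
Proof.
move=> e0 cs; have /choice[N hN] := fun k => cs _ (e0 k).
pose n k := (\sum_(i < k.+1) (N i).+1)%N.
have nN k : (N k <= n k)%N by rewrite /n big_ord_recr/=; apply: leq_trans (leq_addl _ _); exact: leqnSn.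
have nS k : (n k <= n k.+1)%N by rewrite /n [leqRHS]big_ord_recr/= leq_addr.
exists n; split=> k; last by apply: hN => //; exact: leq_trans (nN k) (nS k).
rewrite /n -[leqLHS]subn0 -[leqLHS]/(k - 0)%N.
have : (\sum_(i < k.+1) 1 <= \sum_(i < k.+1) (N i).+1)%N by apply: leq_sum.
by rewrite sum1_card card_ord subn0; apply: leq_trans.
Qed.

(** Riesz-Fischer. Along a rapid subsequence the sum of the 4^k |X_(k+1) - X_k|^2 is integrable,
    hence finite almost everywhere, which yields pointwise limits by [hlim]; Fatou's lemma turns the
    Cauchy bounds into convergence. *)
Lemma sqi_complete (s : nat -> T -> E) : (forall k, sqi (s k)) ->
  (forall e : R, 0 < e -> exists K, forall i j, (K <= i)%N -> (K <= j)%N ->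
    sqip (s i - s j) (s i - s j) < e) -> exists2 u, sqi u & cvgH sqip s u.
Proof.
move=> hs cs; have hsq := sqi_semi_ip.
(* The factor 4^(-k) pays for the weight 4^k of the series, and the remaining 2^(-(k+1)) sum to
   1. *)
pose e k : R := (4 ^+ k)^-1 * (1 / (2 ^ (k + 1))%:R).
have p4 k : 0 < (4 : R) ^+ k by rewrite exprn_gt0.
have e0 k : 0 < e k by rewrite mulr_gt0 ?invr_gt0// divr_gt0// ltr0n expn_gt0.
have [n [nk hn]] := rapid_cauchy_subseq e0 cs.
pose X k := s (n k); have hX k : sqi (X k) by exact: hs.
have PX k : Pm (X k) by have [] := hX k.
pose a k t := b t (X k.+1 t - X k t) (X k.+1 t - X k t).
have hd k : sqi (X k.+1 - X k) by apply: (sipB hsq).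
have a0 k t : D t -> 0 <= a k t by exact: b_ge0.
have ia k : mu.-integrable D (EFin \o a k) by exact: sqi_intg_sq (hd k).
have ma k : measurable_fun D (fun t => (4 ^+ k * a k t)%:E).
  by apply/measurable_EFinP; apply: measurable_funM => //; exact: intg_measurable (ia k).
have pos k t : D t -> (0 <= (4 ^+ k * a k t)%:E)%E by move=> Dt; rewrite lee_fin mulr_ge0 ?a0// ltW.
pose G t := (\big[+%E/0%E]_(0 <= k <oo) (4 ^+ k * a k t)%:E)%E.
have G0 t : D t -> (0 <= G t)%E by move=> Dt; apply: nneseries_ge0 => k _ _; exact: pos.
have mG : measurable_fun D G.
  by apply: ge0_emeasurable_sum => [k t Dt _|k _]; [exact: pos|exact: ma].
have iG : (\int[mu]_(t in D) G t < +oo)%E.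
  rewrite /G integral_nneseries//.
  apply: (@le_lt_trans _ _ (\big[+%E/0%E]_(0 <= k <oo) (1 / (2 ^ (k + 0.+1))%:R)%:E)%E).
    apply: lee_nneseries => [k _ _|k _].
      by apply: integral_ge0 => t Dt; exact: pos.
    have -> : (\int[mu]_(t in D) (4 ^+ k * a k t)%:E = (4 ^+ k * sqip (X k.+1 - X k) (X k.+1 - X k))%:E)%E.
      rewrite /sqip -(RintegralZl _ mD (ia k)) /Rintegral fineK//.
      apply: integrable_fin_num => //; exact: (intgZ mD _ (ia k)).
    rewrite lee_fin; apply: (@le_trans _ _ (4 ^+ k * e k)).
      by rewrite ler_pM2l//; apply: ltW; exact: hn.
    by rewrite /e mulVKf ?gt_eqF.
  rewrite (cvg_lim (@ereal_hausdorff R) (@cvg_geometric_eseries_half R 1 0)).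
  by rewrite expr0 divr1 ltry.
have integG : mu.-integrable D G.
  apply/integrableP; split => //; rewrite (_ : (\int[mu]_(t in D) _)%E = (\int[mu]_(t in D) G t)%E)//.
  by apply: eq_integral => t; rewrite inE => Dt; rewrite gee0_abs ?G0.
have [N [mN N0 hN]] := integrable_ae mD integG.
pose B := D `\` N; have mB : measurable B by exact: measurableD.
have BD : B `<=` D by move=> t [].
have BG t : B t -> G t \is a fin_num.
  by move=> [Dt nN]; apply: contrapT => h; apply: nN; apply: hN => /= /(_ Dt).
(* The limit is set to 0 on the exceptional set, as [Pm_lim] requires for its measurability. *)
have /choice[Y hY] : forall t, exists y, (B t -> cvgH (b t) (X^~ t) y) /\ (~ B t -> y = 0).
  move=> t; have [Bt|nB] := pselect (B t); last by exists 0.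
  have [|y hy] := hlim (x := X^~ t) (BD _ Bt); last by exists y.
  exists (fine (G t)) => k; rewrite -lee_fin fineK ?BG//.
  apply: (le_trans _ (@nneseries_lim_ge _ (fun k => (4 ^+ k * a k t)%:E) xpredT 0 k.+1 _)).
    rewrite big_nat_recr//= leeDr//; apply: sume_ge0 => i _; exact: pos (BD _ Bt).
  by move=> i _ _; exact: pos (BD _ Bt).
have PY : Pm Y.
  by apply: (Pm_lim mB BD PX) => t; have [h1 h2] := hY t.
(* Fatou's lemma: a bound on the distances from s_i to X_k, valid for all large k, passes to the
   limit Y. *)
have key i C : (exists K, forall k, (K <= k)%N -> sqip (s i - X k) (s i - X k) <= C) ->
    (\int[mu]_(t in D) (b t (s i t - Y t) (s i t - Y t))%:E <= C%:E)%E.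
  move=> [K hK].
  have mf k : measurable_fun D (fun t => (b t ((s i - X k) t) ((s i - X k) t))%:E).
    by apply/measurable_EFinP; apply: Pm_b; have [] : sqi (s i - X k) by exact: (sipB hsq).
  have PsY : Pm (s i - Y).
    have [Ps _] := hs i; have := Pm_lin (-1) PY Ps.
    by rewrite scaleN1r addrC.
  rewrite (ge0_negligible_integral mN mD _ _ N0); last 2 first.
  - by apply/measurable_EFinP; exact: (Pm_b PsY PsY).
  - by move=> t Dt; rewrite lee_fin b_ge0.
  have -> : (\int[mu]_(t in D `\` N) (b t (s i t - Y t) (s i t - Y t))%:E =
     \int[mu]_(t in B) limn_einf (fun k => (b t ((s i - X k) t) ((s i - X k) t))%:E))%E.
    apply: eq_integral => t; rewrite inE => Bt; apply/esym.
    have [hc _] := hY t; have ht := hb (BD _ Bt).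
    have c1 : cvgH (b t) (fun k => s i t - X k t) (s i t - Y t).
      have := hc Bt; rewrite /cvgH; apply: cvg_trans; apply: near_eq_cvg; near=> k.
      have -> : s i t - X k t - (s i t - Y t) = Y t - X k t by rewrite opprB [LHS]addrC subrKA.
      exact: (nipBC ht).
    have := cvgH_ip ht (fun _ => I) (fun _ => I) I I c1 c1 => c2.
    have c3 : (b t ((s i - X k) t) ((s i - X k) t))%:E @[k --> \oo] --> (b t (s i t - Y t) (s i t - Y t))%:E.
      by apply: cvg_EFin; [exact: nearW|exact: c2].
    by rewrite (cvg_limn_einf_sup c3).1.
  apply: (le_trans (fatou _ _ _ _)) => //.
  - by move=> k; apply: measurable_funS (mf k).
  - by move=> k t /BD Dt; rewrite lee_fin b_ge0.
  rewrite limn_einf_lim; apply: lime_le; first exact: is_cvg_einfs.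
  exists K => // k /= Kk; apply: (le_trans (ereal_inf_lbound _)); first by exists k => /=.
  apply: (@le_trans _ _ (\int[mu]_(t in D) (b t ((s i - X k) t) ((s i - X k) t))%:E)%E).
    apply: ge0_subset_integral => //.
    by move=> t Dt; rewrite lee_fin b_ge0.
  have hik : sqi (s i - X k) by exact: (sipB hsq).
  have -> : (\int[mu]_(t in D) (b t ((s i - X k) t) ((s i - X k) t))%:E = (sqip (s i - X k) (s i - X k))%:E)%E.
    by rewrite /sqip /Rintegral fineK//; apply: integrable_fin_num => //; exact: (sqi_intg_sq hik).
  by rewrite lee_fin; exact: hK.
have hsY i C : (exists K, forall k, (K <= k)%N -> sqip (s i - X k) (s i - X k) <= C) -> sqi (s i - Y).
  move=> /key h; split; last by apply: le_lt_trans h _; rewrite ltry.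
  by have [Ps _] := hs i; have := Pm_lin (-1) PY Ps; rewrite scaleN1r addrC.
have cK (r : R) : 0 < r -> exists K, forall i, (K <= i)%N -> exists K', forall k, (K' <= k)%N -> sqip (s i - X k) (s i - X k) <= r.
  move=> r0; have [K hK] := cs r r0; exists K => i Ki; exists K => k Kk.
  by apply: ltW; apply: hK => //; exact: leq_trans Kk (nk k).
have hYs : sqi Y.
  have [K hK] := cK 1 ltr01; have h := hsY K 1 (hK K (leqnn K)).
  by have := sipB hsq (hs K) h; rewrite opprB addrC subrK.
exists Y => //; apply/cvgr0Pnorm_le => r r0; have [K hK] := cK r r0.
exists K => // i /= Ki; have h := hsY i r (hK i Ki); rewrite ger0_norm ?(semi_ip_ge0 hsq)//.
rewrite -lee_fin /sqip /Rintegral fineK; first exact: key (hK i Ki).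
by apply: integrable_fin_num => //; exact: (sqi_intg_sq h).
Unshelve. all: by end_near. Qed.

End SquareIntegrable.

(** The increments are at most B 2^(-k). B = C + 1 stands for the square root of C, which it
    dominates. *)
Lemma rapid_cvg (R : realType) (x : nat -> R) (C : R) :
  (forall k, 4 ^+ k * (x k.+1 - x k) ^+ 2 <= C) -> exists y : R, x @ \oo --> y.
Proof.
move=> hC; have C0 : 0 <= C by apply: le_trans (hC 0%N); rewrite mulr_ge0 ?sqr_ge0.
pose B := C + 1; have B0 : 0 < B by rewrite ltr_pwDr.
pose h : R := 2^-1; have h0 : 0 < h by rewrite invr_gt0.
have hp k : 0 < h ^+ k by rewrite exprn_gt0.
have step k : `|x k.+1 - x k| <= B * h ^+ k.
  have B0k : 0 <= B * h ^+ k by rewrite mulr_ge0// ltW.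
  rewrite -(@ler_pXn2r _ 2)// ?nnegrE// real_normK ?num_real//.
  rewrite -(@ler_pM2l _ (4 ^+ k)) ?exprn_gt0//; apply: (le_trans (hC k)).
  have -> : 4 ^+ k * (B * h ^+ k) ^+ 2 = B ^+ 2.
    have e : 4 ^+ k * h ^+ k ^+ 2 = 1.
      by rewrite exprAC -exprMn (_ : 4 * h ^+ 2 = 1) ?expr1n// /h; field.
    by rewrite exprMn mulrCA e mulr1.
  by rewrite /B; nra.
have tail i j : `|x (i + j)%N - x i| <= 2 * B * (h ^+ i - h ^+ (i + j)).
  elim: j => [|j ih]; first by rewrite addn0 !subrr normr0 mulr0.
  rewrite addnS -(subrKA (x (i + j)%N)); apply: (le_trans (ler_normD _ _)).
  apply: (le_trans (lerD (step _) ih)); rewrite exprS /h; lra.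
apply: seq_cauchy_cvg => e e0.
have cv : (fun k => 2 * B * h ^+ k) @ \oo --> (0 : R).
  rewrite -[X in _ --> X](mulr0 (2 * B)); apply: cvgMr; apply: cvg_expr.
  by rewrite ger0_norm /h; lra.
have [K _ hK] := cvgr_lt 0 cv (e / 2) (divr_gt0 e0 (ltr0Sn _ 1)).
exists K => i j Ki Kj.
have hi k : (K <= k)%N -> `|x k - x K| < e / 2.
  move=> Kk; apply: le_lt_trans (hK K (leqnn K)); rewrite -(subnKC Kk).
  apply: (le_trans (tail _ _)); rewrite ler_wpM2l ?mulr_ge0 ?(ltW B0)// gerBl; exact: ltW.
rewrite -(subrKA (x K)) (le_lt_trans (ler_normD _ _))//.
by have := hi i Ki; have := hi j Kj; rewrite (distrC (x j) (x K)); lra.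
Qed.

Lemma cvg_fin_sum (R : realType) (I : Type) (r : seq I) (x : I -> nat -> R) (l : I -> R) :
  (forall i, x i @ \oo --> l i) ->
  (fun k => \sum_(i <- r) x i k) @ \oo --> \sum_(i <- r) l i.
Proof.
move=> h; elim: r => [|a r ih].
  by rewrite big_nil; under eq_fun do rewrite big_nil; exact: cvg_cst.
by rewrite big_cons; under eq_fun do rewrite big_cons; exact: cvgD.
Qed.

Lemma measurable_mul_indic d (T : measurableType d) (R : realType) (D B : set T) (h : T -> R) :
  measurable B -> measurable_fun D h -> measurable_fun D (fun p => h p * \1_B p).
Proof. by move=> mB mh; apply: measurable_funM => //; exact: measurable_indic. Qed.

Section HilbertSpaces.
Context {R : realType} {m : nat} {M : ptopologicalType} (S : manifold R M m).
Variables (U : set M) (g : M -> 'M[R]_m) (mu : {measure set (borel M) -> \bar R}).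
Hypothesis hM : compact [set: M].
Hypothesis oU : open U.
Hypothesis hg : riemannian_metric S U g.
Let mU : measurable (U : set (borel M)) := open_borel oU.

Definition fun_form (p : borel M) (x y : R^o) : R := x * y.

Definition fun_measurable (u : borel M -> R^o) : Prop :=
  measurable_fun (U : set (borel M)) (u : borel M -> R).

Lemma L2E : L2 U mu = sqi mu U fun_form fun_measurable.
Proof.
apply/funext => u; apply: propext; rewrite /L2 /Lp /sqi.
have -> : (\int[mu]_(x in U) (`|u x| `^ 2)%:E = \int[mu]_(x in U) (fun_form x (u x) (u x))%:E)%E.
  apply: eq_integral => x _; congr (_%:E).
  by rewrite powR_mulrn// real_normK ?num_real// expr2.
by [].
Qed.

Lemma fun_form_semi_ip p : semi_ip setT (fun_form p).
Proof.
split=> // [x y _ _|a x y z _ _ _|x _]; rewrite /fun_form.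
- exact: mulrC.
- by rewrite mulrDl -[a *: x]/(a * x) mulrA.
- by rewrite -expr2 sqr_ge0.
Qed.

Lemma fun_measurable_lin a u (v : M -> R) : fun_measurable u -> fun_measurable v -> fun_measurable (a *: u + v).
Proof.
move=> hu hv; have h1 : measurable_fun (U : set (borel M)) (fun p : borel M => a * u p).
  by apply: measurable_funM => //; exact: measurable_cst.
exact: (measurable_funD h1 hv).
Qed.

Lemma fun_measurable0 : fun_measurable 0. Proof. exact: measurable_cst. Qed.

Lemma fun_measurable_form u (v : M -> R) : fun_measurable u -> fun_measurable v ->
  measurable_fun (U : set (borel M)) (fun t => fun_form t (u t) (v t)).
Proof. by move=> hu hv; exact: measurable_funM. Qed.

Lemma L2_semi_ip : semi_ip (L2 U mu) (ipL2 U mu).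
Proof.
rewrite L2E; apply: (@sqi_semi_ip _ _ R mu U R^o fun_form fun_measurable mU) => //.
- by move=> t _; exact: fun_form_semi_ip.
- exact: fun_measurable0.
- exact: fun_measurable_lin.
- exact: fun_measurable_form.
Qed.

Lemma L2_intg u (v : M -> R) : L2 U mu u -> L2 U mu v ->
  mu.-integrable U (EFin \o (fun p => u p * v p)).
Proof.
rewrite L2E; apply: (@sqi_intg _ _ R mu U R^o fun_form fun_measurable mU) => //.
- by move=> t _; exact: fun_form_semi_ip.
- exact: fun_measurable_form.
Qed.

Lemma L2_complete (s : nat -> M -> R) : (forall k, L2 U mu (s k)) ->
  (forall e : R, 0 < e -> exists K : nat, forall i j, (K <= i)%N -> (K <= j)%N ->
    ipL2 U mu (s i - s j) (s i - s j) < e) -> exists2 u, L2 U mu u & cvgH (ipL2 U mu) s u.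
Proof.
rewrite L2E; apply: (@sqi_complete _ _ R mu U R^o fun_form fun_measurable mU) => //.
- by move=> t _; exact: fun_form_semi_ip.
- exact: fun_measurable0.
- exact: fun_measurable_lin.
- exact: fun_measurable_form.
- move=> t x _ [C hC]; have [y hy] := rapid_cvg (x := x) (C := C) hC.
  exists y; rewrite /cvgH /fun_form -[X in _ --> X](mulr0 (0 : R)).
  have h : (fun k => x k - y) @ \oo --> (0 : R) by rewrite -(subrr y); apply: cvgB => //; exact: cvg_cst.
  exact: cvgM.
- move=> X_ X B mB BU hX cX X0.
  have hlim := @measurable_fun_cvg _ (borel M) R (U : set (borel M)) (fun k p => (X_ k p : R) * \1_B p) (X : borel M -> R).
  apply: hlim => [k|p Up].
    have h1 : measurable_fun (U : set (borel M)) (X_ k : borel M -> R) by exact: hX.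
    exact: (measurable_mul_indic mB h1).
  have [Bp|Bp] := pselect (B p).
    rewrite indicE mem_set//; under eq_fun do rewrite mulr1.
    have := cX p Bp; rewrite /cvgH /fun_form => h.
    apply/cvgrPdist_lt => e e0.
    have e2 : 0 < e ^+ 2 by rewrite exprn_gt0.
    have hh : \forall k \near \oo, (X_ k p - X p) * (X_ k p - X p) < e ^+ 2 by exact: cvgr_lt h _ e2.
    apply: filterS hh => k; rewrite -expr2 distrC => hk.
    by rewrite -(@ltr_pXn2r _ 2) ?nnegrE ?(ltW e0)// real_normK ?num_real.
  rewrite X0// indicE memNset//; under eq_fun do rewrite mulr0.
  exact: (cvg_cst (0 : R)).
Qed.

Definition field_form (p : borel M) (v w : 'rV[R]_m) : R := (v *m g p *m w^T) 0 0.

Definition field_measurable (X : borel M -> 'rV[R]_m) : Prop := forall c (i : 'I_m), atlas S c ->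
  measurable_fun (cdom c `&` U : set (borel M)) (fun p : borel M => field_in S c X p 0 i).

Lemma field_form_ip p : U p -> semi_ip setT (field_form p).
Proof.
have [sg pg _] := hg; move=> Up; split=> // [x y _ _|a x y z _ _ _|x _]; rewrite /field_form.
- rewrite -[RHS]/((y *m g p *m x^T) 0 0) -[in LHS](sg p Up) -[LHS]/((_ : 'M[R]_1) 0 0).
  have -> : x *m (g p)^T *m y^T = (y *m g p *m x^T)^T by rewrite !trmx_mul trmxK mulmxA.
  by rewrite mxE.
- by rewrite !mulmxDl -!scalemxAl mxE [in X in X + _]mxE.
- have [->|x0] := eqVneq x 0; first by rewrite !mul0mx mxE.
  by rewrite ltW// pg.
Qed.

(** Compactness of M leaves finitely many chart domains to patch. *)
Lemma measurable_fun_charts (h : borel M -> R) :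
  (forall c, atlas S c -> measurable_fun (cdom c `&` U : set (borel M)) h) ->
  measurable_fun (U : set (borel M)) h.
Proof.
move=> hc; have : cover_compact [set: M] by rewrite -compact_cover.
move=> /(_ M setT (fun p => cdom (chart_at S p)) (fun p _ => cdom_open _)) [].
  by move=> p _; exists p => //; exact: cdom_chart_at.
move=> D _ cov _ Y mY; pose r := finmap.enum_fset D.
rewrite (_ : U `&` h @^-1` Y = \bigcup_(p in [set` r]) (cdom (chart_at S p) `&` U `&` h @^-1` Y)).
  apply: fin_bigcup_measurable => [|p _]; first exact: finite_seq.
  apply: (hc _ (atlas_chart_at S p)) => //.
  by apply: open_borel; apply: openI => //; exact: cdom_open.
apply/seteqP; split=> [q [Uq hq]|q [p _ [[_ Uq] hq]]//].
by have [p Dp cq] := cov q I; exists p.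
Qed.

Lemma field_in_lin c a (X Y : M -> 'rV[R]_m) p : field_in S c (a *: X + Y) p = a *: field_in S c X p + field_in S c Y p.
Proof. by rewrite !field_inE -[(a *: X + Y) p]/(a *: X p + Y p) mulmxDl scalemxAl. Qed.

Lemma field_measurable_lin a (X Y : M -> 'rV[R]_m) : field_measurable X -> field_measurable Y ->
  field_measurable (a *: X + Y).
Proof.
move=> hX hY c i hc.
rewrite (_ : (fun p => _) = (fun p : borel M => a * field_in S c X p 0 i + field_in S c Y p 0 i)).
  apply: measurable_funD; last exact: hY.
  by apply: measurable_funM; [exact: measurable_cst|exact: hX].
by apply/funext => p; rewrite field_in_lin mxE [in X in X + _]mxE.
Qed.

Lemma field_measurable0 : field_measurable 0.
Proof.
move=> c i hc; rewrite (_ : (fun p => _) = fun=> 0); first exact: measurable_cst.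
by apply/funext => p; rewrite field_inE mul0mx mxE.
Qed.

Lemma field_form_in c (X Y : M -> 'rV[R]_m) p : atlas S c -> cdom c p ->
  field_form p (X p) (Y p) =
  \sum_j (\sum_i field_in S c X p 0 i * metric_in S c g p i j) * field_in S c Y p 0 j.
Proof.
move=> hc cp; rewrite -[LHS]/(inner g X Y p) (inner_in g X Y hc cp) mxE.
by apply: eq_bigr => j _; rewrite [in X in X * _]mxE [(_^T) j 0]mxE.
Qed.

Lemma field_measurable_form (X Y : M -> 'rV[R]_m) : field_measurable X -> field_measurable Y ->
  measurable_fun (U : set (borel M)) (fun t => field_form t (X t) (Y t)).
Proof.
move=> hX hY; apply: measurable_fun_charts => c hc.
have oc : open (cdom c `&` U) by apply: openI => //; exact: cdom_open.
have mG i j : measurable_fun (cdom c `&` U : set (borel M)) (fun p : borel M => metric_in S c g p i j).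
  apply: (cont_measurable oc) => p [cp Up].
  apply: (@near_open_continuous _ _ (cdom c) ((fun x => metric_in S c g (cinv c x) i j) \o cmap c) _ p (cdom_open c) cp).
    by move=> q cq; rewrite /= cinvK.
  apply: continuous_comp; first exact: cmap_cont.
  exact: (metric_smooth oU hg 0 i j hc _ (cimg_mem cp Up)).
pose F p := \sum_j (\sum_i field_in S c X p 0 i * metric_in S c g p i j) * field_in S c Y p 0 j.
have mF : measurable_fun (cdom c `&` U : set (borel M)) (F : borel M -> R).
  apply: measurable_sum => j; apply: measurable_funM; last exact: hY.
  apply: measurable_sum => i; apply: measurable_funM; last exact: mG.
  exact: hX.
by move: mF; apply: eq_measurable_fun => p; rewrite inE => -[cp _]; rewrite (field_form_in X Y hc cp).
Qed.

Lemma field_semi_ip : semi_ip (L2_field S U g mu) (fun X Y => \int[mu]_(p in U) inner g X Y p).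
Proof.
apply: (@sqi_semi_ip _ _ R mu U 'rV[R]_m field_form field_measurable mU) => //.
- exact: field_form_ip.
- exact: field_measurable0.
- exact: field_measurable_lin.
- exact: field_measurable_form.
Qed.

Lemma field_intg (X Y : M -> 'rV[R]_m) : L2_field S U g mu X -> L2_field S U g mu Y ->
  mu.-integrable U (EFin \o inner g X Y).
Proof.
apply: (@sqi_intg _ _ R mu U 'rV[R]_m field_form field_measurable mU) => //.
- exact: field_form_ip.
- exact: field_measurable_form.
Qed.

(** The i-th coordinate of v is its scalar product with e_i g^(-1), so Cauchy-Schwarz applies.
    Convergence in a fibre is thereby convergence of the coordinates. *)
Lemma coord_le_form p (i : 'I_m) : U p -> exists2 C, 0 <= C & forall v : 'rV[R]_m, v 0 i ^+ 2 <= C * field_form p v v.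
Proof.
move=> Up; have [sg pg _] := hg; have hs := field_form_ip Up.
pose w := (delta_mx 0 i : 'rV[R]_m) *m invmx (g p); exists (field_form p w w); first exact: (semi_ip_ge0 hs).
move=> v; have -> : v 0 i = field_form p v w.
  have gu := metric_unitmx hg Up.
  by rewrite /field_form /w trmx_mul trmx_inv (sg p Up) -mulmxA (mulKVmx gu) trmx_delta -colE mxE.
by rewrite mulrC; apply: (ip_CS hs).
Qed.

Lemma field_form_cvg p (x : nat -> 'rV[R]_m) (y : 'rV[R]_m) : (forall i, (fun k => x k 0 i) @ \oo --> y 0 i) ->
  cvgH (field_form p) x y.
Proof.
move=> h; rewrite /cvgH /field_form.
have z i : (fun k => (x k - y) 0 i) @ \oo --> (0 : R).
  rewrite -(subrr (y 0 i)); apply: cvg_trans (_ : (fun k => x k 0 i - y 0 i) @ \oo --> _).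
    by apply: near_eq_cvg; near=> k; rewrite !mxE.
  by apply: cvgB => //; exact: cvg_cst.
have e k : ((x k - y) *m g p *m (x k - y)^T) 0 0 =
   \sum_j (\sum_i (x k - y) 0 i * g p i j) * (x k - y) 0 j.
  by rewrite mxE; apply: eq_bigr => j _; rewrite [in X in X * _]mxE [(_^T) j 0]mxE.
rewrite (funext e) -[X in _ --> X](_ : \sum_(j < m) (\sum_(i < m) 0 * g p i j) * 0 = 0); last first.
  by rewrite big1// => j _; rewrite mulr0.
apply: cvg_fin_sum => j; apply: cvgM; last exact: z.
by apply: cvg_fin_sum => i; apply: cvgMl; exact: z.
Unshelve. all: by end_near. Qed.

Lemma field_form_coord p (x : nat -> 'rV[R]_m) (y : 'rV[R]_m) i : U p -> cvgH (field_form p) x y ->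
  (fun k => x k 0 i) @ \oo --> y 0 i.
Proof.
move=> Up h; have [C C0 hC] := coord_le_form i Up.
apply/cvgrPdist_lt => e e0.
have ce : 0 < e ^+ 2 / (C + 1) by rewrite divr_gt0 ?exprn_gt0// ltr_wpDl.
have hh : \forall k \near \oo, field_form p (x k - y) (x k - y) < e ^+ 2 / (C + 1) by exact: cvgr_lt h _ ce.
apply: filterS hh => k hk; rewrite distrC -(@ltr_pXn2r _ 2) ?nnegrE ?(ltW e0)// real_normK ?num_real//.
have := hC (x k - y); rewrite !mxE => h1; apply: (le_lt_trans h1).
have f0 := semi_ip_ge0 (field_form_ip Up) (u := x k - y) I.
move: hk; rewrite ltr_pdivlMr ?ltr_wpDl// mulrDr mulr1 mulrC => hk.
by apply: le_lt_trans hk; rewrite lerDl.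
Qed.

Lemma field_complete (s : nat -> M -> 'rV[R]_m) : (forall k, L2_field S U g mu (s k)) ->
  (forall e : R, 0 < e -> exists K : nat, forall i j, (K <= i)%N -> (K <= j)%N ->
    \int[mu]_(p in U) inner g (s i - s j) (s i - s j) p < e) ->
  exists2 X, L2_field S U g mu X & cvgH (fun X Y => \int[mu]_(p in U) inner g X Y p) s X.
Proof.
apply: (@sqi_complete _ _ R mu U 'rV[R]_m field_form field_measurable mU) => //.
- exact: field_form_ip.
- exact: field_measurable0.
- exact: field_measurable_lin.
- exact: field_measurable_form.
- move=> p x Up [C hC].
  have /choice[y hy] : forall i, exists y : R, (fun k => x k 0 i) @ \oo --> y.
    move=> i; have [B B0 hB] := coord_le_form i Up.
    apply: (rapid_cvg (C := B * C)) => k; have := hB (x k.+1 - x k); rewrite !mxE => h1.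
    have p4 : 0 < (4 : R) ^+ k by rewrite exprn_gt0.
    apply: (@le_trans _ _ (B * (4 ^+ k * field_form p (x k.+1 - x k) (x k.+1 - x k)))).
      by rewrite [leRHS]mulrCA ler_pM2l.
    by rewrite ler_wpM2l.
  by exists (\row_i y i); apply: field_form_cvg => i; rewrite mxE.
- move=> X_ X B mB BU hX cX X0 c i hc.
  have mc : measurable (cdom c `&` U : set (borel M)).
    by apply: open_borel; apply: openI => //; exact: cdom_open.
  apply: (@measurable_fun_cvg _ _ R _ (fun k (p : borel M) => field_in S c (X_ k) p 0 i * \1_B p)) => [k|p [cp Up]].
    exact: (measurable_mul_indic mB (hX k c i hc)).
  have [Bp|Bp] := pselect (B p); last first.
    rewrite field_inE X0// mul0mx mxE indicE memNset//.
    by under eq_fun do rewrite mulr0; exact: cvg_cst.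
  rewrite indicE mem_set//; under eq_fun do rewrite mulr1.
  have e (Y : M -> 'rV[R]_m) : field_in S c Y p 0 i = \sum_j Y p 0 j * trans (chart_at S p) c p j i.
    by rewrite field_inE mxE.
  rewrite e (funext (fun k => e (X_ k))).
  apply: cvg_fin_sum => j; apply: cvgMl; exact: field_form_coord (cX p Bp).
Unshelve. all: by end_near. Qed.

End HilbertSpaces.

(** * Test functions and their density *)

Section TestFunctions.
Context {R : realType} {m : nat} {M : ptopologicalType} (S : manifold R M m).

Lemma MCk_zero_ext k V K u : open V -> compact K -> K `<=` V -> (forall p, ~ K p -> u p = 0) ->
  MCk S k V u -> MCk S k setT u.
Proof.
move=> oV cK KV u0 hu; apply: MCk_local => p _; pose c := chart_at S p; pose W' := cdom c.
have oc := @cdom_open _ _ _ c; have cp := cdom_chart_at S p; have hc := atlas_chart_at S p.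
have [Vp|Vp] := pselect (V p).
  exists c, (cdom c `&` V); split; [by []|exact: openI|by []|by move=> q []|].
  exact: Ck_sub (cimg_sub (c := c) (@subIsetr _ _ _)) (hu c hc).
have oK := closed_openC (manifold_compact_closed S cK).
exists c, (cdom c `&` ~` K); split; [by []|exact: openI|by split=> // /KV|by move=> q []|].
apply: (Ck_ext (open_cimg (c := c) (openI oc oK))) (Ck_cst k _ 0) => x /cimgE[_ _ [_ Kx] _].
by rewrite /= u0.
Qed.

Lemma test_functionP U u : open U -> test_function S U u <->
  (forall k, MCk S k setT u) /\ exists K, [/\ compact K, K `<=` U & forall p, ~ K p -> u p = 0].
Proof.
move=> oU; split=> -[h1 [K [cK KU h2]]].
  split; last by exists K.
  by move=> k; apply: (MCk_zero_ext oU cK KU h2) => c hc; exact: h1.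
split; last by exists K.
by move=> c hc k; exact: MCk_sub (@subsetT _ U) (h1 k) c hc.
Qed.

Lemma MCk_mul_cst k V u (a : R) : open V -> MCk S k V u -> MCk S k V (a *: u).
Proof. by move=> oV hu; exact: (MCkM oV (MCk_cst k V a) hu). Qed.

Lemma test_function_lin U a u v : open U -> test_function S U u -> test_function S U v ->
  test_function S U (a *: u + v).
Proof.
move=> oU /(test_functionP _ oU)[hu [K [cK KU u0]]] /(test_functionP _ oU)[hv [L [cL LU v0]]].
apply/(test_functionP _ oU); split=> [k|].
  exact: (MCkD openT (MCk_mul_cst a openT (hu k)) (hv k)).
exists (K `|` L); split; [exact: compactU|by move=> p [/KU|/LU]|].
move=> p nKL; rewrite -[LHS]/(a * u p + v p) u0 ?v0 ?mulr0 ?addr0// => h; apply: nKL; [right|left]; exact: h.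
Qed.

Lemma test_function0 U : open U -> test_function S U 0.
Proof.
move=> oU; apply/(test_functionP _ oU); split=> [k|]; first exact: (MCk_cst k setT 0).
by exists set0; split => //; exact: compact0.
Qed.

(** Bumps are indexed by a countable base, through an injection f of the base into the integers: at
    each index, a bump positive on the corresponding basic set is chosen if there is one, and 0
    otherwise. A point of O has a bump positive at it, hence positive on a basic set around it, so
    some chosen bump is positive there. *)
Lemma bump_step O : open O -> exists psi : nat -> M -> R,
  (forall n, [/\ forall k, MCk S k setT (psi n), forall q, 0 <= psi n q &
     exists K, [/\ compact K, K `<=` O & forall q, ~ K q -> psi n q = 0]]) /\
  forall p, O p -> exists n, 0 < psi n p.
Proof.
move=> oO; have [B cB [Bo Bb]] := manifold_second_countable S.
have [f finj] := elimT (@countable_injP _ B) cB.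
pose good n (psi : M -> R) := [/\ forall k, MCk S k setT psi, forall q, 0 <= psi q,
  exists K, [/\ compact K, K `<=` O & forall q, ~ K q -> psi q = 0] &
  exists V, [/\ B V, f V = n & forall q, V q -> 0 < psi q]].
pose ok (psi : M -> R) := [/\ forall k, MCk S k setT psi, forall q, 0 <= psi q &
  exists K, [/\ compact K, K `<=` O & forall q, ~ K q -> psi q = 0]].
have ok0 : ok 0.
  split=> //; first by move=> k; exact: (MCk_cst k setT 0).
  by exists set0; split => //; exact: compact0.
exists (fun n => xget 0 (good n)); split=> [n|p Op].
  by case: xgetP => [psi _ []|_].
have [psi [K [spsi psi0 psip cK [KO psiK]]]] := bump_exists S oO Op.
pose P := [set q | 0 < psi q].
have oP : open P.
  have : open ([set: M] `&` psi @^-1` [set r | 0 < r]).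
    apply: open_preimage => //; first exact: openT.
    by move=> q _; exact: (MCk_cont openT (spsi 0%N)).
  by rewrite setTI.
have [V [BV Vp] VP] := Bb p P (open_nbhs_nbhs (conj oP psip)).
exists (f V); have gV : good (f V) psi.
  by split=> //; [exists K|exists V].
case: xgetP => [psi' _ [_ _ _ [V' [BV' fV hV]]]|/(_ psi)//].
by apply: hV; have -> : V' = V by apply: finj => //; rewrite inE.
Qed.

(** Take d_n = s_n / (s_n + 1), where s_n = (n + 1)(psi_0 + ... + psi_(n-1)) has compact support in
    O and tends to infinity at every point of O. *)
Lemma open_exhaustion O : open O -> exists d : nat -> M -> R,
  (forall n, [/\ test_function S O (d n), forall k, MCk S k setT (d n) & forall p, 0 <= d n p <= 1]) /\
  forall p, O p -> (fun n => d n p) @ \oo --> (1 : R).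
Proof.
move=> oO; have [psi [hpsi ppsi]] := bump_step oO.
pose s n p : R := n.+1%:R * \sum_(i < n) psi i p.
have s0 n p : 0 <= s n p.
  by rewrite mulr_ge0// sumr_ge0// => i _; have [_ + _] := hpsi i.
have s1 n p : 0 < s n p + 1 by rewrite ltr_wpDl.
have dE n p : s n p * (s n p + 1)^-1 = 1 - (s n p + 1)^-1.
  by have := s1 n p => h; field; rewrite gt_eqF.
pose d n p := s n p * (s n p + 1)^-1.
have sm k n : MCk S k setT (s n).
  apply: (MCkM openT (MCk_cst k setT n.+1%:R)).
  by apply: (MCk_sum _ openT) => i; have [+ _ _] := hpsi i.
have dm k n : MCk S k setT (d n).
  apply: (MCkM openT (sm k n)); apply: (MCkV openT) => [p _|]; first by rewrite gt_eqF.
  exact: (MCkD openT (sm k n) (MCk_cst k setT 1)).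
have /choice[K hK] : forall i, exists K, [/\ compact K, K `<=` O & forall q, ~ K q -> psi i q = 0].
  by move=> i; have [_ _] := hpsi i.
exists d; split=> [n|p Op].
  split=> [|k|p]; [|exact: dm|].
    apply/(test_functionP _ oO); split=> [k|]; first exact: dm.
    exists (\big[setU/set0]_(i < n) K i); split.
    - by apply: big_ind => [|A B|i _]; [exact: compact0|exact: compactU|have [] := hK i].
    - by rewrite -bigcup_mkord => p [i _]; have [_ + _] := hK i; exact.
    - move=> p; rewrite -bigcup_mkord => np; rewrite /d /s big1 ?mulr0 ?mul0r// => i _.
      by have [_ _ h] := hK i; apply: h => Kp; apply: np; exists i => //=.
  by rewrite /d divr_ge0 ?(ltW (s1 n p))//= ler_pdivrMr// mul1r lerDl.
have [i pi] := ppsi p Op.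
apply/cvgrPdist_lt => e e0.
have [K0 hK0] := invn_small (e := e * psi i p) (mulr_gt0 e0 pi).
exists (maxn K0 i.+1) => // n /=; rewrite geq_max => /andP[Kn ni].
rewrite /d dE opprB addrC subrK ger0_norm ?invr_ge0 ?(ltW (s1 n p))//.
have h1 : n.+1%:R * psi i p <= s n p.
  rewrite ler_pM2l// (bigD1 (Ordinal ni))//= lerDl sumr_ge0// => j _.
  by have [_ + _] := hpsi j.
have n0 : 0 < n.+1%:R :> R by [].
have h2 := hK0 n Kn.
rewrite -[ltRHS]invrK ltf_pV2 ?posrE ?invr_gt0//.
apply: (lt_le_trans _ (le_trans h1 _)); last by rewrite lerDl.
rewrite -ltr_pdivrMl// mulrC -(@ltr_pM2r _ e)// mulrAC mulVf ?gt_eqF// mul1r.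
by rewrite mulrC.
Qed.

Section Density.
Variables (U : set M) (g : M -> 'M[R]_m) (mu : {measure set (borel M) -> \bar R}).
Hypothesis oU : open U.
Hypothesis mu_fin : (mu U < +oo)%E.
Let mU : measurable (U : set (borel M)) := open_borel oU.

(** Exhausting an open set by test functions, dominated convergence shows that w integrates to 0
    over it; by Dynkin's theorem the same holds for Borel sets. This is applied to the sets where w
    is positive and where it is negative. *)
Lemma weak_ae_eq0 (w : M -> R) : mu.-integrable U (EFin \o (w : borel M -> R)) ->
  (forall v, test_function S U v -> \int[mu]_(p in U) (v p * w p) = 0) ->
  exists N : set (borel M), [/\ measurable N, mu N = 0%E & forall p, U p -> ~ N p -> w p = 0].
Proof.
move=> iw hw; pose P (A : set (borel M)) := (\int[mu]_(x in A `&` U) (w x)%:E = 0)%E.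
have iA (A : set (borel M)) : measurable A -> mu.-integrable (A `&` U) (EFin \o (w : borel M -> R)).
  by move=> mA; apply: integrableS iw => //; exact: measurableI.
have PO (O : set M) : open O -> P O.
  move=> oO; have mO : measurable (O : set (borel M)) by exact: open_borel.
  have oOU := openI oO oU; have [d [hd cd]] := open_exhaustion oOU.
  suff : \int[mu]_(x in O `&` U) w x = 0.
    rewrite /Rintegral /P => h; rewrite -[LHS]fineK ?h//.
    by apply: integrable_fin_num; [exact: measurableI|exact: iA].
  have md n : measurable_fun (O `&` U : set (borel M)) (d n : borel M -> R).
    apply: (cont_measurable oOU) => p _; have [_ h _] := hd n.
    exact: (MCk_cont openT (h 0%N)).
  have mOU : measurable (O `&` U : set (borel M)) by exact: measurableI.
  have mwO := intg_measurable (iA O mO).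
  have [] := @Rintegral_dominated_cvg _ (borel M) R mu (O `&` U) (fun n p => d n p * w p) w (fun p => `|w p|) mOU.
  - by move=> n; apply: measurable_funM; [exact: md|exact: mwO].
  - move=> p Op; rewrite -[X in _ --> X]mul1r; exact: (cvgM (cd p Op) (cvg_cst (w p))).
  - exact: (integrable_norm (iA O mO)).
  - move=> n p Op; have [_ _ /(_ p)/andP[d0 d1]] := hd n.
    by rewrite normrM ger0_norm// ler_piMl.
  move=> _ h; apply/esym; move: h; under eq_fun => n.
    have -> : \int[mu]_(x in O `&` U) (d n x * w x) = 0.
      have [td _ _] := hd n; have [_ [K [cK KOU d0]]] := td.
      rewrite -(hw (d n)); last first.
        apply/(test_functionP _ oU); split; first by have [_ + _] := hd n.
        by exists K; split => // p /KOU[].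
      rewrite [RHS](_ : _ = \int[mu]_(x in U) ((fun x => d n x * w x) \_ O) x).
        by rewrite -Rintegral_mkcondr setIC.
      apply: eq_Rintegral => x; rewrite inE => Ux; rewrite patchE; case: ifPn => //.
      rewrite notin_setE => nO; rewrite d0 ?mul0r// => /KOU[]//.
    over.
  by move=> h; apply: (cvg_unique _ (cvg_cst 0)) h.
have PA (A : set (borel M)) : measurable A -> P A.
  apply: (@dynkin_induction _ (borel M) (@open M)) => //.
  - by move=> ? ?; exact: openI.
  - exact: PO openT.
  - move=> {}A mA PA; have := PO _ openT; rewrite {1}/P setTI.
    have -> : (U : set (borel M)) = (A `&` U) `|` (~` A `&` U) by rewrite -setIUl setUv setTI.
    rewrite integral_setU; last first.
    - by apply/disj_setPS => p [[Ap _] [nAp _]].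
    - by rewrite -setIUl setUv setTI; exact: (measurable_int _ iw).
    - by apply: measurableI => //; exact: measurableC.
    - exact: measurableI.
    by rewrite PA add0e.
  - move=> F mF tF PF; rewrite /P setI_bigcupl integral_bigcup.
    + by apply: eseries0 => n _ _; exact: PF.
    + by move=> i j _ _ [p [[Fi _] [Fj _]]]; apply: tF => //; exists p.
    + by move=> k; exact: measurableI.
    + by rewrite -setI_bigcupl; apply: iA; exact: bigcup_measurable.
have mwr := intg_measurable iw.
pose Ap : set (borel M) := U `&` (w : borel M -> R) @^-1` `]0, +oo[.
pose An : set (borel M) := U `&` (w : borel M -> R) @^-1` `]-oo, 0[.
have mAp : measurable Ap by exact: mwr.
have mAn : measurable An by exact: mwr.
have np : mu Ap = 0%E.
  apply: (@integral_pos_null R _ (borel M) mu Ap Ap w mAp mAp (@subset_refl _ Ap)).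
  - by apply: measurable_funS mwr => // p [].
  - by move=> p [_] /=; rewrite in_itv/= andbT => /ltW.
  - by move=> p [_] /=; rewrite in_itv/= andbT.
  - by have := PA _ mAp; rewrite /P (_ : Ap `&` U = Ap)//; apply/setIidPl => p [].
have nn : mu An = 0%E.
  apply: (@integral_pos_null R _ (borel M) mu An An (fun p => - w p) mAn mAn (@subset_refl _ An)).
  - by apply: measurableT_comp => //; apply: measurable_funS mwr => // p [].
  - by move=> p [_] /=; rewrite in_itv/= oppr_ge0 => /ltW.
  - by move=> p [_] /=; rewrite in_itv/= oppr_gt0.
  - have := PA _ mAn; rewrite /P (_ : An `&` U = An); last by apply/setIidPl => p [].
    have iAn : mu.-integrable An (EFin \o (w : borel M -> R)).
      by apply: integrableS iw => // p [].
    by move=> h; rewrite (@integralN _ (borel M) R mu An (EFin \o w)) ?h ?oppe0//; exact: integrable_add_def.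
exists (Ap `|` An); split; first exact: measurableU.
  apply/eqP; rewrite -measure_le0; apply: (le_trans (measureU2 mu mAp mAn)).
  by move: np nn => /= -> ->; rewrite adde0.
move=> p Up nA; apply/eqP; rewrite eq_le !leNgt; apply/andP; split; apply/negP => h; apply: nA.
  by left; split => //=; rewrite in_itv/= h.
by right; split => //=; rewrite in_itv/= h.
Qed.

Lemma L2_L1 w : L2 U mu w -> mu.-integrable U (EFin \o (w : borel M -> R)).
Proof.
move=> hw; have [mw _] := hw.
have i1 := bounded_intg (f := cst (1 : R)) (C := 1) mU mu_fin (measurable_cst _) (fun _ _ => ltac:(by rewrite normr1)).
apply: (intg_le mU mw _ (intgD mU i1 (L2_intg oU hw hw))) => p _.
rewrite /cst /=; have := sqr_ge0 (w p - 1); have := sqr_ge0 (w p + 1).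
by rewrite ler_norml => h1 h2; apply/andP; split; nra.
Qed.

Lemma test_function_dense w : L2 U mu w ->
  (forall v, test_function S U v -> ipL2 U mu w v = 0) -> ipL2 U mu w w = 0.
Proof.
move=> hw h; have [N [mN N0 wN]] : exists N : set (borel M),
    [/\ measurable N, mu N = 0%E & forall p, U p -> ~ N p -> w p = 0].
  apply: weak_ae_eq0; first exact: L2_L1.
  by move=> v /h; rewrite /ipL2 => <-; apply: eq_Rintegral => p _; exact: mulrC.
rewrite /ipL2 /Rintegral (negligible_integral mN mU (L2_intg oU hw hw) N0).
by rewrite integral0_eq// => p [Up Np]; rewrite /= wN// mul0r.
Qed.

Lemma cst_L2 (k : R) : L2 U mu (fun=> k).
Proof.
split; first exact: measurable_cst.
have -> : (\int[mu]_(x in U) (`|k| `^ 2)%:E = \int[mu]_(x in U) (cst (`|k| `^ 2)%:E x))%E by [].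
rewrite (integral_cst mu mU).
have muU : mu U \is a fin_num by rewrite ge0_fin_numE.
by rewrite -(fineK muU) -EFinM ltry.
Qed.

End Density.

End TestFunctions.

(** * The Dirichlet form *)

Lemma derive_coord (R : realType) (m : nat) (i : 'I_m) (v x : 'rV[R]_m) :
  'D_v (fun y : 'rV[R]_m => y 0 i) x = v 0 i.
Proof.
have dx : derivable (id : 'rV[R]_m -> _) x v by exact: derivable_id.
by have /rowP/(_ i) := derive_mx dx; rewrite derive_id mxE.
Qed.

Lemma quarters_lt (R : realFieldType) (a b x y e : R) : a < e / 4 -> b < e / 4 -> x <= a -> y <= b ->
  2 * y + 2 * x < e.
Proof. by move=> *; lra. Qed.

Lemma inner0l (R : realType) (m : nat) (M : ptopologicalType) (g : M -> 'M[R]_m) (X Y : M -> 'rV[R]_m) p :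
  X p = 0 -> inner g X Y p = 0.
Proof. by rewrite /inner => ->; rewrite !mul0mx mxE. Qed.

(** By the adjugate formula, cofactors being polynomials in the entries. *)
Lemma Ck_invmx (R : realType) (m n k : nat) (A : set 'rV[R]_m) (F : 'rV[R]_m -> 'M[R]_n) i j : open A ->
  (forall x, A x -> F x \in unitmx) -> (forall i j, Ck_on k A (fun x => F x i j)) ->
  Ck_on k A (fun x => invmx (F x) i j).
Proof.
move=> oA uF hF.
have dF : Ck_on k A (fun x => (\det (F x))^-1).
  by apply: CkV => // [x Ax|]; [have := uF x Ax; rewrite unitmxE unitfE|exact: Ck_det].
have cF : Ck_on k A (fun x => (-1) ^+ (j + i) * \det (row' j (col' i (F x)))).
  apply: CkM => //; first exact: Ck_cst.
  apply: Ck_det => // a b; apply: (Ck_ext oA) (hF (lift j a) (lift i b)) => x _.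
  by rewrite !mxE.
apply: (Ck_ext oA) (CkM oA dF cF) => x Ax.
by rewrite /invmx uF// mxE [in RHS]mxE.
Qed.

(** * Weak gradients and the closed Dirichlet form *)

Section WeakGradients.
Context {R : realType} {m : nat} {M : ptopologicalType} (S : manifold R M m).
Variables (U : set M) (g : M -> 'M[R]_m) (mu : {measure set (borel M) -> \bar R}).
Hypothesis hM : compact [set: M].
Hypothesis oU : open U.
Hypothesis hg : riemannian_metric S U g.
Hypothesis hmu : riemannian_measure S U g mu.
Hypothesis mu_fin : (mu U < +oo)%E.
Let mU : measurable (U : set (borel M)) := open_borel oU.
Local Notation B X Y := (\int[mu]_(p in U) inner g X Y p).
Local Notation D := (test_function S U).
Local Notation A := (laplacian S g).
Local Notation L2f := (L2_field S U g mu).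

Lemma grad_smooth k c u i : atlas S c -> MCk S k.+1 U u ->
  Ck_on k (cimg c U) (fun x => field_in S c (grad S g u) (cinv c x) 0 i).
Proof.
move=> hc hu; have oC := open_cimg (c := c) oU; have [du hu'] := hu c hc.
have hi j : Ck_on k (cimg c U) (fun x => invmx (metric_in S c g (cinv c x)) j i).
  apply: Ck_invmx => // [x /cimgE[_ cx Ux _]|a b]; first exact: (metric_in_unitmx hg).
  exact: (metric_smooth oU hg).
have hT j : Ck_on k (cimg c U) (fun x => pderiv (u \o cinv c) j x * invmx (metric_in S c g (cinv c x)) j i).
  by apply: (CkM oC _ (hi j)); exact: hu'.
apply: (Ck_ext oC) (Ck_sum (index_enum _) oC hT) => x hx.
have [_ cx Ux xx] := (cimgE _ _ _).1 hx.
rewrite (grad_in hc cx) ?xx; last 2 first.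
- exact: du.
- exact: (metric_unitmx hg).
by rewrite mxE; apply: eq_bigr => j _; rewrite [dloc _ _ _ _ _]mxE xx.
Qed.

Lemma test_field_smooth k Y c i : test_field S U Y -> atlas S c ->
  Ck_on k (cimg c U) (fun x => field_in S c Y (cinv c x) 0 i).
Proof. by move=> [hY _] hc; apply: Ck_entry (hY c hc k); exact: open_cimg. Qed.

Lemma test_field_intro Y : (forall k c i, atlas S c -> Ck_on k (cimg c U) (fun x => field_in S c Y (cinv c x) 0 i)) ->
  (exists K, [/\ compact K, K `<=` U & forall p, ~ K p -> Y p = 0]) -> test_field S U Y.
Proof.
move=> h hK; split=> // c hc k; apply: Ck_matrix; first exact: open_cimg.
by move=> i j; rewrite (ord1 i); exact: h.
Qed.

Lemma test_scale_grad u v : D u -> (forall k, MCk S k setT v) -> test_field S U (fun p => v p *: grad S g u p).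
Proof.
move=> /(test_functionP _ _ oU)[hu [K [cK KU u0]]] hv; apply: test_field_intro => [k c i hc|].
  have oC := open_cimg (c := c) oU.
  have h1 := Ck_sub (cimg_sub (c := c) (@subsetT _ U)) (hv k c hc).
  have h2 := grad_smooth i hc (MCk_sub (@subsetT _ U) (hu k.+1)).
  apply: (Ck_ext oC) (CkM oC h1 h2) => x _.
  by rewrite [in RHS]field_inE -scalemxAl [RHS]mxE -field_inE.
exists K; split=> // p nK.
by rewrite (grad_eq0 S g (closed_openC (manifold_compact_closed S cK)) nK) ?scaler0.
Qed.

Lemma test_grad u : D u -> test_field S U (grad S g u).
Proof.
move=> hu; have := test_scale_grad hu (fun k => MCk_cst k setT 1).
by congr test_field; apply/funext => p; rewrite scale1r.
Qed.

Lemma compact_L2 K w : compact K -> K `<=` U -> MCk S 0 U w -> (forall p, ~ K p -> w p = 0) -> L2 U mu w.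
Proof.
move=> cK KU hw w0; rewrite L2E; split.
  by apply: (cont_measurable oU) => p Up; exact: (MCk_cont oU hw).
have hww : MCk S 0 U (fun p => w p * w p) by exact: MCkM.
have ww0 p : ~ K p -> w p * w p = 0 by move=> /w0 ->; rewrite mul0r.
have iw := compact_intg oU mu_fin oU (fun _ h => h) cK KU hww ww0.
move/integrableP: iw => [_]; apply: le_lt_trans; apply: ge0_le_integral => //.
- by move=> p _; rewrite lee_fin /fun_form -expr2 sqr_ge0.
- by apply/measurable_EFinP; apply: (cont_measurable oU) => p Up; exact: (MCk_cont oU hww).
- by apply: measurableT_comp => //; apply/measurable_EFinP; apply: (cont_measurable oU) => p Up; exact: (MCk_cont oU hww).
- by move=> p _; rewrite lee_fin ler_norm.
Qed.

Lemma test_L2 u : D u -> L2 U mu u.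
Proof.
move=> /(test_functionP _ _ oU)[hu [K [cK KU u0]]].
exact: (compact_L2 cK KU (MCk_sub (@subsetT _ U) (hu 0%N)) u0).
Qed.

Lemma test_field_C1 Y : test_field S U Y -> C1_field S U Y.
Proof. by move=> hY c i hc; exact: test_field_smooth. Qed.

Lemma test_field_support Y : test_field S U Y ->
  exists2 K, compact K & K `<=` U /\ forall p, ~ K p -> Y p = 0.
Proof. by move=> [_ [K [cK KU Y0]]]; exists K. Qed.

Lemma divergence_L2 Y : test_field S U Y -> L2 U mu (divergence S g Y).
Proof.
move=> hY; have [K cK [KU Y0]] := test_field_support hY.
apply: (compact_L2 cK KU); first exact: (divergence_smooth oU hg hmu mu_fin (test_field_C1 hY) (test_field_support hY)).
by move=> p nK; exact: (divergence_eq0 S g (closed_openC (manifold_compact_closed S cK)) nK).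
Qed.

Lemma laplacian_L2 u : D u -> L2 U mu (A u).
Proof.
move=> hu; have := sipN (L2_semi_ip mu oU) (divergence_L2 (test_grad hu)).
by [].
Qed.

Lemma inner_smooth X Y : (forall c i, atlas S c -> Ck_on 0 (cimg c U) (fun x => field_in S c X (cinv c x) 0 i)) ->
  (forall c i, atlas S c -> Ck_on 0 (cimg c U) (fun x => field_in S c Y (cinv c x) 0 i)) ->
  MCk S 0 U (inner g X Y).
Proof.
move=> hX hY c hc; have oC := open_cimg (c := c) oU.
have h i j := metric_smooth oU hg 0 i j hc.
have hT j : Ck_on 0 (cimg c U) (fun x =>
   (\sum_i field_in S c X (cinv c x) 0 i * metric_in S c g (cinv c x) i j) * field_in S c Y (cinv c x) 0 j).
  by apply: CkM => //; [apply: Ck_sum => // i; apply: CkM => //; exact: hX|exact: hY].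
apply: (Ck_ext oC) (Ck_sum (index_enum _) oC hT) => x /cimgE[_ cx _ _].
by rewrite -(field_form_in g X Y hc cx).
Qed.

Lemma test_field_L2 Y : test_field S U Y -> L2f Y.
Proof.
move=> hY; have [K cK [KU Y0]] := test_field_support hY; split.
  move=> c i hc; have oc : open (cdom c `&` U) by apply: openI => //; exact: cdom_open.
  apply: (cont_measurable oc) => p [cp Up].
  apply: (@near_open_continuous _ _ (cdom c) ((fun x => field_in S c Y (cinv c x) 0 i) \o cmap c) _ p (cdom_open c) cp).
    by move=> q cq; rewrite /= cinvK.
  apply: continuous_comp; first exact: cmap_cont.
  exact: (test_field_smooth 0 i hY hc _ (cimg_mem cp Up)).
have hi : MCk S 0 U (inner g Y Y) by apply: inner_smooth => c i hc; exact: test_field_smooth.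
have i0 p : ~ K p -> inner g Y Y p = 0 by move=> nK; rewrite /inner Y0// !mul0mx mxE.
have := compact_intg oU mu_fin oU (fun _ h => h) cK KU hi i0.
move/integrableP => [_]; apply: le_lt_trans; apply: ge0_le_integral => //.
- by move=> p Up; rewrite lee_fin; exact: (semi_ip_ge0 (field_form_ip hg Up)).
- by apply/measurable_EFinP; apply: (cont_measurable oU) => p Up; exact: (MCk_cont oU hi).
- by apply: measurableT_comp => //; apply/measurable_EFinP; apply: (cont_measurable oU) => p Up; exact: (MCk_cont oU hi).
- by move=> p _; rewrite lee_fin ler_norm.
Qed.

Lemma test_weak_gradient u : D u -> weak_gradient S U g mu u (grad S g u).
Proof.
move=> hu Y hY; have [K cK [KU Y0]] := test_field_support hY.
have /(test_functionP _ _ oU)[su _] := hu.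
have := divergence_theorem oU hg hmu mu_fin oU (fun _ h => h) (MCk_sub (@subsetT _ U) (su 1%N)) (test_field_C1 hY) cK KU Y0.
have i1 := field_intg hM oU hg (test_field_L2 (test_grad hu)) (test_field_L2 hY).
have i2 := L2_intg oU (test_L2 hu) (divergence_L2 hY).
by rewrite (RintegralD mU i1 i2) => h; apply/eqP; rewrite -addr_eq0; apply/eqP.
Qed.

Lemma field_ip_sym X Y : B X Y = B Y X.
Proof. by apply: eq_Rintegral => p; rewrite inE => Up; exact: (semi_ipC (field_form_ip hg Up)). Qed.

(** Green's formula: the gradient of [v] is its weak gradient, tested here against the field grad
    u. *)
Lemma laplacian_form u v : D u -> D v -> ipL2 U mu (A u) v = B (grad S g u) (grad S g v).
Proof.
move=> hu hv; rewrite field_ip_sym (test_weak_gradient hv (test_grad hu)).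
have i2 := L2_intg oU (divergence_L2 (test_grad hu)) (test_L2 hv).
rewrite /ipL2 -mulN1r -(RintegralZl _ mU); last first.
  exact: (L2_intg oU (test_L2 hv) (divergence_L2 (test_grad hu))).
by apply: eq_Rintegral => p _; rewrite /A mulN1r [in RHS]mulrC mulNr.
Qed.

Lemma grad_lin a u v : D u -> D v -> grad S g (a *: u + v) = a *: grad S g u + grad S g v.
Proof.
move=> /(test_functionP _ _ oU)[su _] /(test_functionP _ _ oU)[sv _]; apply/funext => p.
rewrite -[RHS]/(a *: grad S g u p + grad S g v p) /grad scalemxAl -mulmxDl; congr (_ *m _).
have cp := cdom_chart_at S p; have hc := atlas_chart_at S p.
have [du _] := su 1%N _ hc; have [dv _] := sv 1%N _ hc.
have {}du := du _ (cimg_mem cp I); have {}dv := dv _ (cimg_mem cp I).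
apply/rowP => i; rewrite !mxE.
have -> : (a *: u + v) \o cinv (chart_at S p) = a *: (u \o cinv (chart_at S p)) + (v \o cinv (chart_at S p)) by [].
rewrite deriveD; [|exact: derivableZ (diff_derivable du)|exact: diff_derivable].
by rewrite deriveZ//; exact: diff_derivable.
Qed.

Lemma dirichlet_semi_ip : semi_ip D (fun u v => ipL2 U mu (A u) v).
Proof.
have hf := field_semi_ip mu hM oU hg.
have LG u : D u -> L2f (grad S g u) by move=> hu; exact: (test_field_L2 (test_grad hu)).
split=> [|a u v hu hv|u v hu hv|a u v w hu hv hw|u hu].
- exact: test_function0.
- exact: test_function_lin.
- exact: (etrans (laplacian_form hu hv) (etrans (field_ip_sym _ _) (esym (laplacian_form hv hu)))).
- have huv := test_function_lin a oU hu hv.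
  apply: (etrans (laplacian_form huv hw)); rewrite (grad_lin a hu hv).
  apply: (etrans (semi_ip_linear hf a (LG _ hu) (LG _ hv) (LG _ hw))).
  exact: (esym (f_equal2 (fun x y => a * x + y) (laplacian_form hu hw) (laplacian_form hv hw))).
- apply: (le_trans (semi_ip_ge0 hf (LG _ hu))); exact: (eqbRL (le_eqVlt _ _) (introT orP (or_introl (introT eqP (esym (laplacian_form hu hu)))))).
Qed.

Local Notation Bi := (fun X Y => \int[mu]_(p in U) inner g X Y p).
Local Notation ip := (ipL2 U mu).
Local Notation H := (L2 U mu).
Local Notation weak := (weak_gradient S U g mu).
Let hf := field_semi_ip mu hM oU hg.
Let hs := L2_semi_ip mu oU.
Let hq := dirichlet_semi_ip.

Lemma cutoff_coord_test c i u : atlas S c -> test_function S (cdom c `&` U) u ->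
  D (fun p => u p * cmap c p 0 i).
Proof.
have oc := openI (@cdom_open _ _ _ c) oU.
move=> hc /(test_functionP _ _ oc)[su [K [cK KU u0]]]; apply/(test_functionP _ _ oU); split=> [k|]; last first.
  by exists K; split => // [p /KU[]|p nK] //; rewrite u0// mul0r.
apply: (MCk_zero_ext oc cK KU) => [p nK|]; first by rewrite u0// mul0r.
apply: MCk_local => p [cp Up]; exists c, (cdom c `&` U); split; [by []|by []|by []|by move=> q []|].
have oC := open_cimg (c := c) oc.
apply: (Ck_ext oC) (CkM oC (Ck_sub (cimg_sub (c := c) (@subsetT _ _)) (su k c hc)) (Ck_coord k _ i)).
by move=> x /cimgE[_ _ _ xx]; rewrite /= xx.
Qed.

(** Multiplying Y by arbitrary smooth functions localizes the orthogonality and turns it into a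
    pointwise identity. *)
Lemma field_null_ae X Y : L2f X -> (forall Z, test_field S U Z -> Bi X Z = 0) ->
  (forall v, (forall k, MCk S k setT v) -> test_field S U (fun p => v p *: Y p)) ->
  \forall p \ae mu, U p -> inner g X Y p = 0.
Proof.
move=> hX h hY; have hY1 : test_field S U Y.
  have := hY _ (fun k => MCk_cst k setT 1).
  by congr test_field; apply/funext => p; rewrite scale1r.
have iXY := field_intg hM oU hg hX (test_field_L2 hY1).
have [N [mN N0 hN]] : exists N : set (borel M),
    [/\ measurable N, mu N = 0%E & forall p, U p -> ~ N p -> inner g X Y p = 0].
  apply: (weak_ae_eq0 oU iXY) => v hv.
  have [sv _] := (test_functionP S v oU).1 hv; rewrite -(h _ (hY v sv)).
  by apply: eq_Rintegral => p _; rewrite /inner linearZ/= -scalemxAr [in RHS]mxE.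
exists N; split => // p /= /not_implyP[Up xp]; apply: contrapT => nN; exact/xp/hN.
Qed.

(** In a chart, test against the gradients of d_n and of d_n x_i, where d_n exhausts the chart
    domain. Since <X, grad d_n> and <X, grad (d_n x_i)> both vanish almost everywhere, the product
    rule leaves d_n X^i = 0, and some d_n is nonzero at each point. Hence weak gradients are unique
    up to null fields. *)
Lemma test_fields_total X : L2f X -> (forall Z, test_field S U Z -> Bi X Z = 0) -> Bi X X = 0.
Proof.
move=> hX h.
have hgr u : D u -> \forall p \ae mu, U p -> inner g X (grad S g u) p = 0.
  move=> hu; apply: (field_null_ae hX h) => v sv; exact: (test_scale_grad hu sv).
have hc c : atlas S c -> \forall p \ae mu, (cdom c `&` U) p -> X p = 0.
  move=> hc; have oc := openI (@cdom_open _ _ _ c) oU.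
  have [d [hd cd]] := open_exhaustion S oc.
  have td n : D (d n).
    have [/(test_functionP _ _ oc)[sd [K [cK KU d0]]] _ _] := hd n.
    by apply/(test_functionP _ _ oU); split => //; exists K; split => // p /KU[].
  have h1 : \forall p \ae mu, forall n, U p -> inner g X (grad S g (d n)) p = 0.
    by apply: ae_foralln => n; exact: hgr.
  have h2 : \forall p \ae mu, forall n (i : 'I_m), U p -> inner g X (grad S g (fun q => d n q * cmap c q 0 i)) p = 0.
    apply: ae_foralln => n; apply: filter_forall => i; apply: hgr; apply: cutoff_coord_test => //.
    by have [] := hd n.
  have FF : Filter (nbhs (almost_everywhere mu)) by exact: (ae_filter_ringOfSetsType mu).
  apply: filterS2 h1 h2 => p h1 h2 [cp Up].
  have [n dn] : exists n, d n p != 0.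
    apply: contrapT => hn; have := cd p (conj cp Up).
    have -> : (fun n => d n p) = fun=> 0.
      by apply/funext => n; apply/eqP; apply: contrapT => /negP ?; apply: hn; exists n.
    move=> /(cvg_unique (@Rhausdorff R) (cvg_cst 0)) /esym/eqP; by rewrite oner_eq0.
  apply: (field_in_eq0 hc cp); apply/rowP => i; rewrite [RHS]mxE.
  have [_ sd _] := hd n; have [dd _] := sd 1%N c hc; have {}dd := dd _ (cimg_mem cp I).
  have gu := metric_unitmx hg Up.
  have dx : differentiable (fun x : 'rV[R]_m => x 0 i) (cmap c p).
    have [+ _] := Ck_coord 1 [set: 'rV[R]_m] i; exact.
  have cx : \forall y \near cmap c p, (d n \o cinv c) y * y 0 i = ((fun q => d n q * cmap c q 0 i) \o cinv c) y.
    apply: (near_open (open_cimg (c := c) oc) (cimg_mem cp (conj cp Up))) => y /cimgE[_ _ _ yy].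
    by rewrite /= yy.
  have dm : differentiable (fun y : 'rV[R]_m => (d n \o cinv c) y * y 0 i) (cmap c p) by exact: differentiableM.
  have sy Z : inner g X Z p = inner g Z X p by exact: (semi_ipC (field_form_ip hg Up)).
  have := h2 n i Up; rewrite sy.
  rewrite (inner_grad_in X hc cp (near_eq_differentiable cx dm) gu) => hs2.
  have := h1 n Up; rewrite sy (inner_grad_in X hc cp dd gu) => hs1.
  have key j : dloc c (fun q => d n q * cmap c q 0 i) p 0 j =
      cmap c p 0 i * dloc c (d n) p 0 j + d n p * (i == j)%:R.
    rewrite [LHS]mxE [in X in _ * X + _]mxE /pderiv -(near_eq_derive _ cx).
    have -> : (fun y : 'rV[R]_m => (d n \o cinv c) y * y 0 i) = (d n \o cinv c) * (fun y : 'rV[R]_m => y 0 i) by [].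
    rewrite deriveM; [|exact: diff_derivable|exact: diff_derivable].
    rewrite /= (cinvK cp) addrC; congr (_ + _); congr (_ * _).
    by rewrite derive_coord mxE eqxx.
  have : d n p * field_in S c X p 0 i = 0.
    rewrite -{}hs2 (eq_bigr _ (fun j _ => f_equal (fun z => z * _) (key j))).
    under eq_bigr do rewrite mulrDl -mulrA.
    rewrite big_split/= -mulr_sumr hs1 mulr0 add0r (bigD1 i)//= eqxx mulr1 big1 ?addr0// => j ji.
    by rewrite eq_sym (negbTE ji) mulr0 mul0r.
  by move=> /eqP; rewrite mulf_eq0 (negbTE dn) => /eqP.
have : \forall p \ae mu, U p -> X p = 0.
  have : cover_compact [set: M] by rewrite -compact_cover.
  move=> /(_ M setT (fun p => cdom (chart_at S p)) (fun p _ => cdom_open _)) [].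
    by move=> p _; exists p => //; exact: cdom_chart_at.
  move=> E _ cov.
  have : \forall p \ae mu, forall q, q \in finmap.enum_fset E -> (cdom (chart_at S q) `&` U) p -> X p = 0.
    elim: (finmap.enum_fset E) => [|a r ih]; first exact: nearW.
    have FF : Filter (nbhs (almost_everywhere mu)) by exact: (ae_filter_ringOfSetsType mu).
    apply: filterS2 (hc _ (atlas_chart_at S a)) ih => p h1 h2 q.
    by rewrite inE => /orP[/eqP ->|/h2].
  have FF : Filter (nbhs (almost_everywhere mu)) by exact: (ae_filter_ringOfSetsType mu).
  apply: filterS => p hp Up; have [q Eq cq] := cov p I.
  by apply: (hp q).
move=> [N [mN N0 hN]].
rewrite /Rintegral (negligible_integral mN mU (field_intg hM oU hg hX hX) N0).
rewrite integral0_eq// => p [Up Np]; congr (_%:E).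
apply: inner0l; apply: contrapT => Xp; apply: Np; apply: hN => /(_ Up); exact: Xp.
Qed.

Lemma weak_gradient_lin a u v X Y : H u -> H v -> L2f X -> L2f Y -> weak u X -> weak v Y ->
  weak (a *: u + v) (a *: X + Y).
Proof.
move=> hu hv hX hY wu wv Z hZ; have LZ := test_field_L2 hZ.
have dZ := divergence_L2 hZ.
have e2 := semi_ip_linear hs a hu hv dZ.
apply: (etrans (semi_ip_linear hf a hX hY LZ)); apply: (etrans _ (f_equal -%R (esym e2))).
apply: (etrans (f_equal2 (fun x y => a * x + y) (wu Z hZ) (wv Z hZ))).
by rewrite opprD mulrN.
Qed.

Lemma wgrad_norm u X : H u -> L2f X -> weak u X ->
  [/\ L2f (wgrad S U g mu u), weak u (wgrad S U g mu u) & Bi (wgrad S U g mu u - X) (wgrad S U g mu u - X) = 0].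
Proof.
move=> hu hX wX; rewrite /wgrad; case: xgetP => [Z _ [hZ wZ]|/(_ X)]; last by case.
split => //; have hZX : L2f (Z - X) by exact: (sipB hf).
apply: test_fields_total => // Y hY; have LY := test_field_L2 hY.
by apply: (etrans (ipBl hf hZ hX LY)); rewrite (wZ Y hY) (wX Y hY) subrr.
Qed.

Lemma gradL2sqE u X : H u -> L2f X -> weak u X -> gradL2sq S U g mu u = Bi X X.
Proof.
by move=> hu hX wX; have [h1 h2 h3] := wgrad_norm hu hX wX; exact: (nip_eq_null hf h1 hX h3).
Qed.

(** By Green's formula the gradients of an approximating sequence form a Cauchy sequence; the weak
    gradient identity is continuous in both of its terms and passes to the limit. *)
Lemma form_domain_gradient u (s : nat -> M -> R) : H u -> form_approx (D := D) (ip := ip) (A := A) s u ->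
  exists2 X, L2f X & weak u X /\ cvgH Bi (fun k => grad S g (s k)) X.
Proof.
move=> hu [sD su sc]; have LG k := test_field_L2 (test_grad (sD k)).
have [X hX cX] : exists2 X, L2f X & cvgH Bi (fun k => grad S g (s k)) X.
  apply: (field_complete hM oU hg LG) => e e0; have [K hK] := sc e e0; exists K => i j Ki Kj.
  apply: le_lt_trans (hK i j Ki Kj).
  have hij : D (s i - s j) by exact: (sipB hq).
  rewrite (laplacian_form hij hij).
  have -> : grad S g (s i - s j) = grad S g (s i) - grad S g (s j).
    have := grad_lin (-1) (sD j) (sD i); rewrite !scaleN1r [- s j + _]addrC => ->.
    by rewrite addrC.
  exact: lexx.
exists X => //; split=> // Y hY; have LY := test_field_L2 hY.
have dY := divergence_L2 hY.
have c1 := cvgH_ip hf LG (fun _ => LY) hX LY cX (cvgH_cst hf LY).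
have c2 := cvgH_ip hs (fun k => test_L2 (sD k)) (fun _ => dY) hu dY su (cvgH_cst hs dY).
have e k : Bi (grad S g (s k)) Y = - ip (s k) (divergence S g Y) by exact: (test_weak_gradient (sD k) hY).
have c3 : (fun k => - ip (s k) (divergence S g Y)) @ \oo --> - ip u (divergence S g Y) by exact: cvgN.
move: c1; rewrite (funext e) => c1.
exact: (cvg_unique (@Rhausdorff R) c1 c3).
Qed.

Lemma gradL2sq_test_sub u X v : H u -> L2f X -> weak u X -> D v ->
  gradL2sq S U g mu (u - v) = Bi (grad S g v - X) (grad S g v - X).
Proof.
move=> hu hX wX hv.
have LG := test_field_L2 (test_grad hv).
have Hv := test_L2 hv.
have := weak_gradient_lin (-1) Hv hu LG hX (test_weak_gradient hv) wX.
rewrite !scaleN1r [- v + u]addrC [- grad S g v + X]addrC => w1.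
rewrite (gradL2sqE (sipB hs hu Hv) (sipB hf hX LG) w1).
exact: (nipBC hf hX LG).
Qed.

(** Both are closures of the test functions. Green's formula identifies the two norms on test
    functions, and uniqueness of weak gradients allows [wgrad] of a difference to be computed from
    any representative. *)
Lemma W120_form_domain : W120 S U g mu = form_domain H ip D A.
Proof.
apply/seteqP; split=> u.
  move=> [[hu [X [hX wX]]] hd]; split => //.
  have /choice[s hsk] : forall k : nat, exists v, D v /\ normW12sq S U g mu (u - v) < (k.+1%:R)^-1.
    by move=> k; have [|v dv hv] := hd (k.+1%:R)^-1; [rewrite invr_gt0|exists v].
  have sD k : D (s k) by have [] := hsk k.
  have LG k := test_field_L2 (test_grad (sD k)).
  have HD k := test_L2 (sD k).
  have bnd k : ip (s k - u) (s k - u) <= (k.+1%:R)^-1 /\ Bi (grad S g (s k) - X) (grad S g (s k) - X) <= (k.+1%:R)^-1.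
    have [_] := hsk k; rewrite /normW12sq (gradL2sq_test_sub hu hX wX (sD k)) /normL2sq (nipBC hs hu (HD k)).
    have := semi_ip_ge0 hs (sipB hs (HD k) hu); have := semi_ip_ge0 hf (sipB hf (LG k) hX).
    move=> h1 h2 h3; split; apply: ltW; apply: le_lt_trans h3; first by rewrite lerDl; exact: h1.
    by rewrite lerDr; exact: h2.
  exists s; split => //.
    apply/cvgrPdist_lt => e e0; have [K hK] := invn_small e0; exists K => // k /= Kk.
    rewrite sub0r normrN ger0_norm ?(semi_ip_ge0 hs (sipB hs (HD k) hu))//.
    exact: (le_lt_trans (bnd k).1 (hK k Kk)).
  move=> e e0; have [K hK] := invn_small (e := e / 4) (divr_gt0 e0 (ltr0Sn _ 3)).
  exists K => i j Ki Kj; have hij : D (s i - s j) by exact: (sipB hq).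
  apply: (@le_lt_trans _ _ (Bi (grad S g (s i) - grad S g (s j)) (grad S g (s i) - grad S g (s j)))).
    rewrite (laplacian_form hij hij).
    have -> : grad S g (s i - s j) = grad S g (s i) - grad S g (s j).
      have := grad_lin (-1) (sD j) (sD i); rewrite !scaleN1r [- s j + _]addrC => ->.
      by rewrite addrC.
    exact: lexx.
  apply: (le_lt_trans (nipB_le2 hf (LG i) (LG j) hX)).
  have := (bnd i).2; have := (bnd j).2; have := hK i Ki; have := hK j Kj.
  by move=> h1 h2 h3 h4; exact: (quarters_lt h1 h2 h3 h4).
move=> [hu [s hsu]]; have [X hX [wX cX]] := form_domain_gradient hu hsu.
have [sD su _] := hsu.
split; first by split => //; exists X.
move=> e e0.
have h1 : \forall k \near \oo, ip (s k - u) (s k - u) < e / 2 by exact: (cvgr_lt 0 su _ (divr_gt0 e0 (ltr0Sn _ 1))).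
have h2 : \forall k \near \oo, Bi (grad S g (s k) - X) (grad S g (s k) - X) < e / 2.
  exact: (cvgr_lt 0 cX _ (divr_gt0 e0 (ltr0Sn _ 1))).
have [k [k1 k2]] : exists k, ip (s k - u) (s k - u) < e / 2 /\ Bi (grad S g (s k) - X) (grad S g (s k) - X) < e / 2.
  by have [k hk] := filter_ex (filterI h1 h2); exists k.
exists (s k) => //; rewrite /normW12sq (gradL2sq_test_sub hu hX wX (sD k)) /normL2sq.
by rewrite (nipBC hs hu (test_L2 (sD k))) [ltRHS]splitr; exact: (ltrD k1 k2).
Qed.

Lemma gradL2sq_form_ext u : form_domain H ip D A u ->
  gradL2sq S U g mu u = form_ext (D := D) (ip := ip) (A := A) u u.
Proof.
move=> [hu [s hsu]]; have [X hX [wX cX]] := form_domain_gradient hu hsu.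
have [sD su _] := hsu; have LG k := test_field_L2 (test_grad (sD k)).
rewrite (gradL2sqE hu hX wX).
have c1 := cvgH_ip hf LG LG hX hX cX cX.
have c2 := form_ext_cvg hs hq (fun v => test_L2 (u := v)) (fun v => laplacian_L2 (u := v)) hu hu hsu hsu.
have e k : Bi (grad S g (s k)) (grad S g (s k)) = ip (A (s k)) (s k) by rewrite (laplacian_form (sD k) (sD k)).
move: c1; rewrite (funext e) => c1.
exact: (cvg_unique (@Rhausdorff R) c1 c2).
Qed.

Lemma form_domain_W12 u : form_domain H ip D A u -> W12 S U g mu u.
Proof. by rewrite -W120_form_domain => -[]. Qed.

End WeakGradients.

(** * Good cubes *)

Lemma mean_sq_bound (R : realFieldType) (i1 i2 o k1 k2 k3 : R) : i2 <= 2 * i1 + 2 * o -> i1 <= k3 ->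
  o <= k1 * k2 -> 0 <= k3 -> 0 <= k2 -> 0 <= k1 -> 2 * i2 <= (4 + 4 * k1) * (k3 + k2).
Proof. by move=> h1 h2 h3 p3 p2 p1; have := mulr_ge0 p1 p3; nra. Qed.

Lemma geometric_small (R : realType) (K th e : R) : 0 <= th -> th < 1 -> 0 < e -> exists n, K * th ^+ n < e.
Proof.
move=> th0 th1 e0; have cv : (fun n => K * th ^+ n) @ \oo --> (0 : R).
  rewrite -[X in _ --> X](mulr0 K); apply: cvgMr; apply: cvg_expr.
  by rewrite ger0_norm.
have [n _ hn] := cvgr_lt 0 cv e e0; exists n; exact: (hn n (leqnn n)).
Qed.

Lemma cover_Rintegral_le (d : measure_display) (T : measurableType d) (R : realType)
    (mu : {measure set T -> \bar R}) (D : set T) (I : eqType) (r : seq I) (W : I -> set T) (f : T -> R) :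
  measurable D -> (forall i, measurable (W i)) -> (forall x, D x -> exists2 i, i \in r & W i x) ->
  mu.-integrable D (EFin \o f) -> (forall x, D x -> 0 <= f x) ->
  \int[mu]_(x in D) f x <= \sum_(i <- r) \int[mu]_(x in W i `&` D) f x.
Proof.
move=> mD mW cov intf f0.
have iW i : mu.-integrable D (EFin \o (f \_ (W i))).
  apply: (intg_le mD _ _ intf).
    have -> : f \_ (W i) = fun x => f x * \1_(W i) x.
      apply/funext => x; rewrite patchE indicE; case: ifP => _; first by rewrite mulr1.
      by rewrite mulr0.
    exact: (measurable_mul_indic (mW i) (intg_measurable intf)).
  by move=> x Dx; rewrite patchE; case: ifP => _; rewrite ?normr0 ?f0// ger0_norm ?f0.
have e i : \int[mu]_(x in W i `&` D) f x = \int[mu]_(x in D) (f \_ (W i)) x.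
  by rewrite setIC Rintegral_mkcondr.
rewrite (eq_bigr _ (fun i _ => e i)) -(Rintegral_sum _ mD iW).
apply: le_Rintegral => //; first exact: intg_sum.
move=> x Dx; have [i ir Wi] := cov x Dx.
have h j : 0 <= (f \_ (W j)) x by rewrite patchE; case: ifP => _ //; exact: f0.
have -> : f x = (f \_ (W i)) x by rewrite patchE mem_set.
rewrite (big_rem i ir)/= lerDl; apply: sumr_ge0 => j _; exact: h.
Qed.

Section FiniteRank.
Context {R : realType} {V : lmodType R} (D : set V) (ip : V -> V -> R) (q : V -> R).
Hypothesis pos : forall u, D u -> 0 <= ip u u + q u.

(** The hypothesis [hfin] of the compactness argument, relativized to parts of the norm: [phi] is
    controlled by [psi] up to finitely many squares of functionals bounded in the form norm. Such
    controls add up over cubes and cells. *)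
Definition finite_rank_le (phi psi : V -> R) := exists (d : nat) (L : 'I_d -> V -> R) (C : R),
  [/\ forall i u v, D u -> D v -> L i (u - v) = L i u - L i v,
      forall i u, D u -> (L i u) ^+ 2 <= C * (ip u u + q u)
    & forall u, D u -> phi u <= psi u + \sum_i (L i u) ^+ 2].

Lemma finite_rank_leS (phi psi phi' psi' : V -> R) : (forall u, D u -> phi' u <= phi u) ->
  (forall u, D u -> psi u <= psi' u) -> finite_rank_le phi psi -> finite_rank_le phi' psi'.
Proof.
move=> h1 h2 [d [L [C [hL hC h]]]]; exists d, L, C; split => // u Du.
by apply: (le_trans (h1 u Du)); apply: (le_trans (h u Du)); rewrite lerD2r h2.
Qed.

Lemma finite_rank_leD (phi psi phi' psi' : V -> R) : finite_rank_le phi psi -> finite_rank_le phi' psi' ->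
  finite_rank_le (fun u => phi u + phi' u) (fun u => psi u + psi' u).
Proof.
move=> [d [L [C [hL hC h]]]] [d' [L' [C' [hL' hC' h']]]].
exists (d + d')%N, (fun i => match fintype.split i with inl a => L a | inr b => L' b end), (`|C| + `|C'|); split.
- by move=> i u v Du Dv; case: (fintype.split i) => a; [exact: hL|exact: hL'].
- move=> i u Du; case: (fintype.split i) => a.
    apply: (le_trans (hC a u Du)); rewrite ler_wpM2r ?pos//; have := ler_norm C; have := normr_ge0 C'; lra.
  apply: (le_trans (hC' a u Du)); rewrite ler_wpM2r ?pos//; have := ler_norm C'; have := normr_ge0 C; lra.
- move=> u Du; rewrite big_split_ord/=.
  have -> : \sum_(i < d) (match fintype.split (lshift d' i) with inl a => L a | inr b => L' b end) u ^+ 2 = \sum_(i < d) L i u ^+ 2.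
    by apply: eq_bigr => i _; rewrite (unsplitK (inl i)).
  have -> : \sum_(i < d') (match fintype.split (rshift d i) with inl a => L a | inr b => L' b end) u ^+ 2 = \sum_(i < d') L' i u ^+ 2.
    by apply: eq_bigr => i _; rewrite (unsplitK (inr i)).
  have := h u Du; have := h' u Du; lra.
Qed.

Lemma finite_rank_le_sum (I : Type) (r : seq I) (phi psi : I -> V -> R) :
  (forall i, finite_rank_le (phi i) (psi i)) ->
  finite_rank_le (fun u => \sum_(i <- r) phi i u) (fun u => \sum_(i <- r) psi i u).
Proof.
move=> h; elim: r => [|i r ih].
  exists 0%N, (fun i _ => 0), 0; split; [by case|by case|].
  by move=> u _; rewrite !big_nil big_ord0 addr0.
apply: finite_rank_leS (finite_rank_leD (h i) ih) => u _; by rewrite big_cons.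
Qed.

End FiniteRank.

Lemma lerD_2e (R : realFieldType) (x y K e : R) : x <= e -> y <= K * e -> 2 * x + 2 * y <= (2 + 2 * K) * e.
Proof. by move=> *; lra. Qed.

Lemma sqr_sub_le2 (R : realFieldType) (x y k : R) :
  (x - k) ^+ 2 <= 2 * ((y - x) * (y - x)) + 2 * (y - k) ^+ 2.
Proof. by have := sqr_ge0 (y - x + (y - k)); nra. Qed.

Lemma open_obox (R : realType) (m : nat) (a b : 'rV[R]_m) : open (obox a b).
Proof.
rewrite openE => x hx.
have hn : nbhs x (fun y : 'rV[R]_m => forall i, a 0 i < y 0 i < b 0 i).
  apply: (@filter_forall _ 'I_m (fun i (y : 'rV[R]_m) => a 0 i < y 0 i < b 0 i) (nbhs x) _) => i; have /andP[ha hb] := hx i.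
  have cx := @coord_continuous R 1 m 0 i x.
  near=> y; apply/andP; split; near: y; [exact: (cvgr_gt _ cx _ ha)|exact: (cvgr_lt _ cx _ hb)].
exact: hn.
Unshelve. all: by end_near. Qed.

Section GoodCubes.
Context {R : realType} {m : nat} {M : ptopologicalType} (S : manifold R M m).
Implicit Types (c : chart R M m) (a : 'rV[R]_m) (u : M -> R) (p q : M).
Local Notation lam := (rV_measure (R := R) m).
Variables (U : set M) (g : M -> 'M[R]_m) (mu : {measure set (borel M) -> \bar R}).
Hypothesis hM : compact [set: M].
Hypothesis oU : open U.
Hypothesis hg : riemannian_metric S U g.
Hypothesis hmu : riemannian_measure S U g mu.
Let mU : measurable (U : set (borel M)) := open_borel oU.
Local Notation w c := (cweight S U g c : borel 'rV[R]_m -> R).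

(* Cubes in which the weighted Poincare inequality holds, with a constant that
   decays geometrically on dyadic subcubes, and in which the Dirichlet form
   dominates the Euclidean one. *)
Record good_cube c a (h : R) : Prop := GoodCube {
  good_atlas : atlas S c;
  good_gt0 : 0 < h;
  good_sub : cbox a (a + const_mx h) `<=` cmap c @` cdom c;
  good_int : lam.-integrable (cube a h) (EFin \o w c);
  good_osc : exists B th : R, [/\ 0 <= B, 0 <= th, th < 1 & forall (f : 'rV[R]_m -> R) L (r : nat) b,
    C1_bd (cube a h) f L -> cube b (h / 2 ^+ r) `<=` cube a h ->
    oscillation (w c) f b (h / 2 ^+ r) <=
      B * th ^+ r * \int[lam]_(x in cube b (h / 2 ^+ r)) grad_sq f x];
  good_ell : exists2 kap : R, 0 < kap & forall p (v : 'rV[R]_m), cdom c p -> U p -> cube a h (cmap c p) ->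
    kap * (\sum_i v 0 i ^+ 2) <= dens S g c (cmap c p) * (v *m invmx (metric_in S c g p) *m v^T) 0 0 }.

Definition cell c a (h : R) : set M := [set p | cdom c p /\ cube a h (cmap c p)].

Lemma cell_measurable c a h : measurable (cell c a h : set (borel M)).
Proof.
have mc : measurable_fun (cdom c : set (borel M)) (cmap c : borel M -> borel 'rV[R]_m).
  by apply: continuous_borel_measurable; [exact: cdom_open|exact: cmap_cont].
exact: (mc (open_borel (@cdom_open _ _ _ c)) _ (mcube a h)).
Qed.

Lemma cell_image c a h : cmap c @` (cell c a h `&` U) = cube a h `&` cimg c U.
Proof.
apply/seteqP; split=> [_ [p [[cp ap] Up] <-]|x [ax /cimgE[_ cx Ux xx]]].
  by split => //; exact: cimg_mem.
by exists (cinv c x) => //; split => //; split => //; rewrite xx.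
Qed.

Lemma cell_integral c a h (f : borel M -> R) : good_cube c a h -> measurable_fun (U : set (borel M)) f ->
  (\int[mu]_(p in cell c a h `&` U) (f p)%:E = \int[lam]_(x in cube a h) (w c x * f (cinv c x))%:E)%E.
Proof.
move=> hc mf; have mA : measurable (cell c a h `&` U : set (borel M)).
  by apply: measurableI => //; exact: cell_measurable.
have AU : cell c a h `&` U `<=` cdom c `&` U by move=> p [[]].
have mf' : measurable_fun (cell c a h `&` U : set (borel M)) f by apply: measurable_funS mf => // p [].
rewrite (chart_integral oU hg hmu (good_atlas hc) mA AU mf') cell_image integral_mkcondr.
apply: eq_integral => x _; rewrite patchE /cweight indicE; case: ifPn => _; first by rewrite mul1r.
by rewrite !mul0r.
Qed.

Lemma cell_Rintegral c a h (f : borel M -> R) : good_cube c a h -> measurable_fun (U : set (borel M)) f ->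
  \int[mu]_(p in cell c a h `&` U) f p = \int[lam]_(x in cube a h) (w c x * f (cinv c x)).
Proof. by move=> hc mf; rewrite /Rintegral (cell_integral hc mf). Qed.

Lemma cell_measure_fin c a h : good_cube c a h -> (mu (cell c a h `&` U) < +oo)%E.
Proof.
move=> hc; have mA : measurable (cell c a h `&` U : set (borel M)).
  by apply: measurableI => //; exact: cell_measurable.
have := cell_integral hc (measurable_cst (1 : R)).
rewrite -[X in X = _ -> _]/(\int[mu]_(p in cell c a h `&` U) cst 1%E p)%E.
rewrite (integral_cst mu mA) mul1e => ->.
have /integrableP[_] := good_int hc; apply: le_lt_trans.
rewrite le_eqVlt; apply/orP; left; apply/eqP; apply: eq_integral => x _.
by rewrite /= mulr1 ger0_norm// cweight_ge0.
Qed.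

Lemma test_C1_bd c a h u : good_cube c a h -> MCk S 1 setT u ->
  exists L : R, C1_bd (cube a h) (u \o cinv c) L.
Proof.
move=> hc hu; have [sub hcu] := (good_sub hc, hu c (good_atlas hc)).
have sub' : cbox a (a + const_mx h) `<=` cimg c setT.
  by move=> x /sub [p cp <-]; exact: cimg_mem.
have [C0 C00 hC0] := compact_bnd (@compact_cbox R m a (a + const_mx h)) (fun x hx => Ck_cont hcu (sub' x hx)).
have /choice[C hC] : forall i : 'I_m, exists C : R, 0 <= C /\ forall x, cbox a (a + const_mx h) x ->
    `|pderiv (u \o cinv c) i x| <= C.
  move=> i; have [_ du] := hcu.
  have [C C0' hC] := compact_bnd (@compact_cbox R m a (a + const_mx h)) (fun x hx => du (delta_mx 0 i) _ (sub' x hx)).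
  by exists C.
exists (C0 + \sum_i C i), (cimg c setT); split.
- by apply: open_cimg; exact: openT.
- by move=> x /hbox_cbox/sub'.
- exact: hcu.
- move=> x /hbox_cbox hx; split.
    by apply: (le_trans (hC0 x hx)); rewrite lerDl sumr_ge0// => i _; have [] := hC i.
  move=> i; have [_ h2] := hC i; apply: (le_trans (h2 x hx)).
  rewrite (bigD1 i)//= addrCA lerDl addr_ge0// sumr_ge0// => j _.
  by have [] := hC j.
Qed.

Lemma cell_continuous_integrable c a h f : good_cube c a h -> MCk S 0 setT f ->
  lam.-integrable (cube a h) (EFin \o (fun x => w c x * f (cinv c x))).
Proof.
move=> hc hf; have [sub hcf] := (good_sub hc, hf c (good_atlas hc)).
have sub' : cbox a (a + const_mx h) `<=` cimg c setT.
  by move=> x /sub [p cp <-]; exact: cimg_mem.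
have [C _ hC] := compact_bnd (@compact_cbox R m a (a + const_mx h)) (fun x hx => hcf _ (sub' x hx)).
apply: (integrable_mul_bounded (C := C) (mcube a h) (good_int hc)).
  have mf : measurable_fun (cimg c setT : set (borel 'rV[R]_m)) (f \o cinv c : borel 'rV[R]_m -> R).
    by apply: cont_measurable => //; apply: open_cimg; exact: openT.
  apply: measurable_funS mf; first by apply: open_borel; apply: open_cimg; exact: openT.
  by move=> x /hbox_cbox/sub'.
by move=> x /hbox_cbox hx; exact: hC.
Qed.

Lemma grad_norm_smooth u : test_function S U u -> MCk S 0 setT (inner g (grad S g u) (grad S g u)).
Proof.
move=> hu; have hY := test_grad oU hg hu; have [K cK [KU Y0]] := test_field_support hY.
apply: (MCk_zero_ext oU cK KU) => [p nK|]; first by rewrite /inner Y0// !mul0mx mxE.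
by apply: (inner_smooth oU hg) => c i hc; exact: test_field_smooth.
Qed.

(** Where the cube leaves the image of [U] the weight is 0, but so is the gradient of a test
    function, whose support is compact in [U]; elsewhere [kap] is the ellipticity constant. *)
Lemma cell_energy c a h kap u : good_cube c a h ->
  (forall p (v : 'rV[R]_m), cdom c p -> U p -> cube a h (cmap c p) ->
    kap * (\sum_i v 0 i ^+ 2) <= dens S g c (cmap c p) * (v *m invmx (metric_in S c g p) *m v^T) 0 0) ->
  test_function S U u ->
  kap * \int[lam]_(x in cube a h) grad_sq (u \o cinv c) x <=
  \int[mu]_(p in cell c a h `&` U) inner g (grad S g u) (grad S g u) p.
Proof.
move=> hc hkap hu; have hsm := grad_norm_smooth hu.
have /(test_functionP _ _ oU)[su [K [cK KU u0]]] := hu.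
have [L hL] := test_C1_bd hc (su 1%N).
have mI : measurable_fun (U : set (borel M)) (inner g (grad S g u) (grad S g u) : borel M -> R).
  by apply: (cont_measurable oU) => p _; exact: (MCk_cont openT hsm).
have h0 := ltW (good_gt0 hc).
rewrite (cell_Rintegral hc mI) -(RintegralZl _ (mcube a h) (C1_bd_intg_grad h0 hL)).
apply: le_Rintegral => //.
- exact: mcube.
- exact: (intgZ (mcube a h) _ (C1_bd_intg_grad h0 hL)).
- exact: cell_continuous_integrable.
move=> x ax; have [p cp px] := good_sub hc (hbox_cbox ax).
rewrite -px (cinvK cp).
have dE i : pderiv (u \o cinv c) i (cmap c p) = dloc c u p 0 i by rewrite mxE.
have [Up|nU] := pselect (U p); last first.
  have nK : ~ K p by move=> /KU.
  rewrite /cweight indicE memNset ?mul0r; last first.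
    by move=> [q [cq Uq] qp]; apply: nU; rewrite -(cmap_inj cq cp qp).
  rewrite /grad_sq big1 ?mulr0// => i _.
  rewrite dE (dloc_eq0 (closed_openC (manifold_compact_closed S cK)) cp nK); last by move=> q /u0.
  by rewrite mxE expr0n.
have [du _] := su 1%N c (good_atlas hc); have {}du := du _ (cimg_mem cp I).
have gu := metric_unitmx hg Up.
rewrite /cweight indicE mem_set; last exact: cimg_mem.
rewrite mul1r (inner_in _ _ _ (good_atlas hc) cp) (grad_in (good_atlas hc) cp du gu).
rewrite trmx_mul trmx_inv (metric_sym hg) // -[X in X *m (_ *m _)]mulmxA (mulVmx (metric_in_unitmx hg (good_atlas hc) cp Up)) mulmx1 mulmxA.
rewrite -px in ax; apply: le_trans (hkap p (dloc c u p) cp Up ax).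
by rewrite /grad_sq (eq_bigr (fun i => dloc c u p 0 i ^+ 2))// => i _; rewrite dE.
Qed.

Hypothesis Hgood : forall p, exists c a h,
  [/\ good_cube c a h, cdom c p & obox a (a + const_mx h) (cmap c p)].

Lemma finite_good_cover : exists (r : seq M) (cc : M -> chart R M m) (aa : M -> 'rV[R]_m) (hh : M -> R),
  (forall q, good_cube (cc q) (aa q) (hh q)) /\
  forall p, exists2 q, q \in r & cell (cc q) (aa q) (hh q) p.
Proof.
have /choice[cc /choice[aa /choice[hh H]]] := Hgood.
pose O q : set M := cdom (cc q) `&` cmap (cc q) @^-1` (obox (aa q) (aa q + const_mx (hh q))).
have oO q : open (O q).
  apply: open_preimage; [exact: cdom_open|exact: cmap_cont|exact: open_obox].
have : cover_compact [set: M] by rewrite -compact_cover.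
move=> /(_ M setT O (fun p _ => oO p)) [].
  by move=> p _; exists p => //; have [_ cp ap] := H p.
move=> E _ cov; exists (finmap.enum_fset E), cc, aa, hh; split=> [q|p]; first by have [] := H q.
have [q Eq [cp ap]] := cov p I; exists q => //; split => //= i.
by have /andP[h1 h2] := ap i; rewrite (ltW h1) h2.
Qed.

(** M is covered by finitely many cells, each of finite mass because the weight is integrable on
    good cubes. *)
Lemma good_measure_fin : (mu U < +oo)%E.
Proof.
have [r [cc [aa [hh [H cov]]]]] := finite_good_cover.
pose C (s : seq M) : set (borel M) := [set p | exists2 q, q \in s & cell (cc q) (aa q) (hh q) p] `&` U.
have CS q s : C (q :: s) = (cell (cc q) (aa q) (hh q) `&` U) `|` C s.
  rewrite /C -setIUl; congr (_ `&` _); apply/seteqP; split=> p.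
    by move=> [q']; rewrite inE => /orP[/eqP ->|h1 h2]; [left|right; exists q'].
  move=> [h1|[q' h1 h2]]; first by exists q => //; rewrite mem_head.
  by exists q' => //; rewrite inE h1 orbT.
have mcell q : measurable (cell (cc q) (aa q) (hh q) `&` U : set (borel M)).
  by apply: measurableI => //; exact: cell_measurable.
have mC s : measurable (C s).
  elim: s => [|q s ih]; last by rewrite CS; apply: measurableU => //; exact: mcell.
  by rewrite /C (_ : [set p | _] = set0) ?set0I//; apply/seteqP; split=> [p [q]|].
have -> : (U : set (borel M)) = C r.
  by apply/seteqP; split=> [p Up|p [_ Up]//]; split => //; exact: cov.
elim: {cov}r => [|q s ih].
  rewrite /C (_ : [set p | _] = set0) ?set0I ?measure0 ?ltry//.
  by apply/seteqP; split=> [p [q]|].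
rewrite CS; apply: (le_lt_trans (measureU2 mu (mcell q) (mC s))).
by rewrite lte_add_pinfty// cell_measure_fin.
Qed.

Let mu_fin : (mu U < +oo)%E := good_measure_fin.
Let hs := L2_semi_ip mu oU.
Let hq := dirichlet_semi_ip hM oU hg hmu mu_fin.
Local Notation D := (test_function S U).
Local Notation A := (laplacian S g).
Local Notation ip := (ipL2 U mu).
Local Notation H := (L2 U mu).

Section Compactness.
Local Notation q := (fun u => ip (A u) u).
Local Notation FR := (finite_rank_le D ip q).

Lemma cell_sq_le c a h u : good_cube c a h -> D u ->
  \int[lam]_(x in cube a h) (w c x * (u (cinv c x) - 0) ^+ 2) <= ip u u.
Proof.
move=> hc hu; have Hu := test_L2 oU mu_fin hu.
have i2 := L2_intg oU Hu Hu; have m2 := intg_measurable i2.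
have -> : \int[lam]_(x in cube a h) (w c x * (u (cinv c x) - 0) ^+ 2) =
    \int[lam]_(x in cube a h) (w c x * (fun p => u p * u p) (cinv c x)).
  by apply: eq_Rintegral => x _; rewrite subr0 expr2.
rewrite -(cell_Rintegral hc m2); apply: le_Rintegral_dom => //.
- by apply: measurableI => //; exact: cell_measurable.
- by move=> p _; rewrite -expr2 sqr_ge0.
Qed.

Lemma cell_grad_le c a h : good_cube c a h -> exists2 kap : R, 0 < kap & forall u, D u ->
  kap * \int[lam]_(x in cube a h) grad_sq (u \o cinv c) x <= q u.
Proof.
move=> hc; have [kap k0 hk] := good_ell hc; exists kap => // u hu.
apply: (le_trans (cell_energy hc hk hu)).
apply: (@le_trans _ _ (\int[mu]_(p in U) inner g (grad S g u) (grad S g u) p)); last first.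
  have := laplacian_form hM oU hg hmu mu_fin hu hu => e.
  exact: (eqbRL (le_eqVlt _ _) (introT orP (or_introl (introT eqP (esym e))))).
have LG := test_field_L2 oU hg mu_fin (test_grad oU hg hu).
apply: le_Rintegral_dom => //.
- by apply: measurableI => //; exact: cell_measurable.
- exact: (field_intg hM oU hg LG LG).
- by move=> p Up; exact: (semi_ip_ge0 (field_form_ip hg Up)).
Qed.

Lemma q_ge0 u : D u -> 0 <= q u. Proof. by move=> hu; exact: (semi_ip_ge0 hq hu). Qed.

(** Induction on the number j of levels above the finest one. On a cube of depth N the weighted
    square integral is at most twice the oscillation plus twice the weight times the squared mean,
    and the mean is the only functional needed. A coarser cube collects the functionals of its
    subcubes. *)
Lemma finite_rank_level c a h B th (N : nat) : good_cube c a h -> 0 <= B -> 0 <= th ->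
  (forall (f : 'rV[R]_m -> R) L (r : nat) b,
    C1_bd (cube a h) f L -> cube b (h / 2 ^+ r) `<=` cube a h ->
    oscillation (w c) f b (h / 2 ^+ r) <=
      B * th ^+ r * \int[lam]_(x in cube b (h / 2 ^+ r)) grad_sq f x) ->
  forall j r b, (r + j)%N = N -> cube b (h / 2 ^+ r) `<=` cube a h ->
  FR (fun u => \int[lam]_(x in cube b (h / 2 ^+ r)) (w c x * (u (cinv c x) - 0) ^+ 2))
     (fun u => 2 * (B * th ^+ N) * \int[lam]_(x in cube b (h / 2 ^+ r)) grad_sq (u \o cinv c) x).
Proof.
move=> hc B0 th0 hosc; have [kap k0 hk] := cell_grad_le hc; have h0 := good_gt0 hc.
have CB u : D u -> exists L, C1_bd (cube a h) (u \o cinv c) L.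
  by move=> /(test_functionP _ _ oU)[su _]; exact: (test_C1_bd hc (su 1%N)).
elim=> [|j ih] r b.
  rewrite addn0 => rN sub; subst r; pose hr := h / 2 ^+ N.
  have hr0 : 0 < hr by rewrite divr_gt0// exprn_gt0.
  have iw : lam.-integrable (cube b hr) (EFin \o w c).
    by apply: integrableS (good_int hc) => //; exact: mcube.
  pose W := \int[lam]_(x in cube b hr) w c x.
  have W0 : 0 <= W by apply: Rintegral_ge0 => x _; exact: cweight_ge0.
  have iS u L (k : R) (hL : C1_bd (cube a h) (u \o cinv c) L) :=
    intg_weight_sq k (ltW hr0) (C1_bdS sub hL) iw.
  (* Normalized so that its square is the mean term of [sq_le]. *)
  pose L u := Num.sqrt (2 * W) * mean (u \o cinv c) b hr.
  have Lsq u : L u ^+ 2 = 2 * (W * mean (u \o cinv c) b hr ^+ 2).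
    by rewrite exprMn sqr_sqrtr ?mulr_ge0// mulrA.
  have Wm u : W * mean (u \o cinv c) b hr ^+ 2 = \int[lam]_(x in cube b hr) (mean (u \o cinv c) b hr ^+ 2 * w c x).
    by rewrite (RintegralZl _ (mcube b hr) iw) mulrC.
  have osc u : D u -> oscillation (w c) (u \o cinv c) b hr <= B * th ^+ N * \int[lam]_(x in cube b hr) grad_sq (u \o cinv c) x.
    by move=> Du; have [l hl] := CB u Du; exact: hosc hl sub.
  have Bt0 : 0 <= B * th ^+ N by rewrite mulr_ge0// exprn_ge0.
  have sq_le u l : C1_bd (cube a h) (u \o cinv c) l ->
      \int[lam]_(x in cube b hr) (w c x * (u (cinv c x) - 0) ^+ 2) <=
      2 * oscillation (w c) (u \o cinv c) b hr + 2 * (W * mean (u \o cinv c) b hr ^+ 2).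
    move=> hl; set mm := mean (u \o cinv c) b hr.
    rewrite Wm -/mm /oscillation -(RintegralZl _ (mcube b hr) (iS u l mm hl)).
    have i3 := intgZ (mcube b hr) (mm ^+ 2) iw.
    rewrite -(RintegralZl _ (mcube b hr) i3).
    have i4 := intgZ (mcube b hr) 2 i3.
    have i5 := intgZ (mcube b hr) 2 (iS u l mm hl).
    rewrite -(RintegralD (mcube b hr) i5 i4).
    apply: le_Rintegral; [exact: mcube|exact: (iS u l 0 hl)|exact: (intgD (mcube b hr) i5 i4)|].
    move=> x _; have := cweight_ge0 S U g c x; move: (cweight S U g c x) => ww w0 /=.
    rewrite -/mm subr0; have -> : 2 * (ww * (u (cinv c x) - mm) ^+ 2) + 2 * (mm ^+ 2 * ww) = ww * (2 * (u (cinv c x) - mm) ^+ 2 + 2 * mm ^+ 2) by ring.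
    rewrite ler_wpM2l//; have := sqr_ge0 (u (cinv c x) - 2 * mm); nra.
  have mean_le u l : C1_bd (cube a h) (u \o cinv c) l ->
      W * mean (u \o cinv c) b hr ^+ 2 <= 2 * \int[lam]_(x in cube b hr) (w c x * (u (cinv c x) - 0) ^+ 2) + 2 * oscillation (w c) (u \o cinv c) b hr.
    move=> hl; set mm := mean (u \o cinv c) b hr.
    rewrite Wm -/mm /oscillation -(RintegralZl _ (mcube b hr) (iS u l mm hl)) -(RintegralZl _ (mcube b hr) (iS u l 0 hl)).
    have i3 := intgZ (mcube b hr) (mm ^+ 2) iw.
    have i4 := intgZ (mcube b hr) 2 (iS u l 0 hl).
    have i5 := intgZ (mcube b hr) 2 (iS u l mm hl).
    rewrite -(RintegralD (mcube b hr) i4 i5).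
    apply: le_Rintegral; [exact: mcube|exact: i3|exact: (intgD (mcube b hr) i4 i5)|].
    move=> x _; have := cweight_ge0 S U g c x; move: (cweight S U g c x) => ww w0 /=.
    rewrite -/mm subr0; have -> : 2 * (ww * u (cinv c x) ^+ 2) + 2 * (ww * (u (cinv c x) - mm) ^+ 2) = (2 * u (cinv c x) ^+ 2 + 2 * (u (cinv c x) - mm) ^+ 2) * ww by ring.
    rewrite ler_wpM2r//; have := sqr_ge0 (2 * u (cinv c x) - mm); nra.
  exists 1%N, (fun _ => L), (4 + 4 * (B * th ^+ N / kap)); split.
  - move=> _ u v Du Dv; have [l hl] := CB u Du; have [l' hl'] := CB v Dv.
    rewrite /L /mean -mulrBr -mulrBr.
    rewrite -(RintegralB (mcube b hr) (C1_bd_intg (ltW hr0) (C1_bdS sub hl)) (C1_bd_intg (ltW hr0) (C1_bdS sub hl'))).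
    by [].
  - move=> _ u Du; have [l hl] := CB u Du; rewrite Lsq.
    have h1 := mean_le u l hl.
    have h2 : \int[lam]_(x in cube b hr) (w c x * (u (cinv c x) - 0) ^+ 2) <= ip u u.
      apply: le_trans (cell_sq_le hc Du); apply: le_Rintegral_dom => //; [exact: mcube|exact: mcube| |].
        exact: (intg_weight_sq 0 (ltW h0) hl (good_int hc)).
      by move=> x _; rewrite mulr_ge0 ?cweight_ge0 ?sqr_ge0.
    have h3 : \int[lam]_(x in cube b hr) grad_sq (u \o cinv c) x <= kap^-1 * q u.
      rewrite -(@ler_pM2l _ kap)// mulVKf ?gt_eqF//; apply: le_trans (hk u Du).
      rewrite ler_pM2l//; apply: le_Rintegral_dom => //; [exact: mcube|exact: mcube| |].
        exact: (C1_bd_intg_grad (ltW h0) hl).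
      by move=> x _; exact: grad_sq_ge0.
    have h4 := le_trans (osc u Du) (ler_wpM2l Bt0 h3).
    have p1 := semi_ip_ge0 hs (test_L2 oU mu_fin Du); have p2 := q_ge0 Du.
    have p3 : 0 <= B * th ^+ N * kap^-1 by rewrite mulr_ge0 ?invr_ge0 ?(ltW k0).
    rewrite [X in _ <= X](mulrA _ kap^-1) in h4; exact: (mean_sq_bound h1 h2 h4 p1 p2 p3).
  - move=> u Du; have [l hl] := CB u Du; rewrite big_ord1 Lsq.
    apply: (le_trans (sq_le u l hl)); rewrite lerD2r -mulrA ler_pM2l//; exact: osc.
move=> rN sub; pose hr := h / 2 ^+ r.
have hr0 : 0 < hr by rewrite divr_gt0// exprn_gt0.
have e2 : hr / 2 = h / 2 ^+ r.+1 by rewrite /hr exprSr invfM mulrA.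
have iw : lam.-integrable (cube b hr) (EFin \o w c).
  by apply: integrableS (good_int hc) => //; exact: mcube.
have hsum := finite_rank_le_sum (fun u Du => addr_ge0 (semi_ip_ge0 hs (test_L2 oU mu_fin Du)) (q_ge0 Du)) (index_enum _)
  (fun s : {ffun 'I_m -> bool} => ih r.+1 (subcorner b hr s) (etrans (addSnnS r j) rN) _).
have {}hsum := hsum (fun s => subset_trans (eq_ind _ (fun z => cube (subcorner b hr s) z `<=` cube b hr) (subcube_sub (ltW hr0)) _ e2) sub).
apply: finite_rank_leS hsum => u Du; have [l hl] := CB u Du.
  rewrite -e2 -(Rintegral_subcubes (ltW hr0)); first exact: lexx.
  exact: (intg_weight_sq 0 (ltW hr0) (C1_bdS sub hl) iw).
rewrite -mulr_sumr -e2 -(Rintegral_subcubes (ltW hr0)); first exact: lexx.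
exact: (C1_bd_intg_grad (ltW hr0) (C1_bdS sub hl)).
Qed.

Lemma finite_rank_cell c a h (e : R) : good_cube c a h -> 0 < e ->
  FR (fun u => \int[mu]_(p in cell c a h `&` U) (u p * u p)) (fun u => e * q u).
Proof.
move=> hc e0; have [B [th [B0 th0 th1 hosc]]] := good_osc hc.
have [kap k0 hk] := cell_grad_le hc.
(* The depth at which the factor 2 B th^N of the Dirichlet integral, divided by the ellipticity
   constant, falls below e. *)
have [N hN] := geometric_small (2 * B / kap) th0 th1 e0.
have e1 : h / 2 ^+ 0 = h by rewrite expr0 divr1.
have sub0 : cube a (h / 2 ^+ 0) `<=` cube a h by rewrite e1.
apply: finite_rank_leS (finite_rank_level hc B0 th0 hosc (add0n N) sub0) => u Du.
  have Hu := test_L2 oU mu_fin Du.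
  rewrite (cell_Rintegral hc (intg_measurable (L2_intg oU Hu Hu))) e1.
  by rewrite le_eqVlt; apply/orP; left; apply/eqP; apply: eq_Rintegral => x _; rewrite subr0 expr2.
rewrite e1; have h1 := hk u Du; have h2 := q_ge0 Du.
have B1 : 0 <= 2 * B / kap * th ^+ N by rewrite !mulr_ge0// ?invr_ge0 ?exprn_ge0// ltW.
apply: (@le_trans _ _ (2 * B / kap * th ^+ N * q u)).
  apply: le_trans (ler_wpM2l B1 h1); rewrite le_eqVlt; apply/orP; left; apply/eqP.
  by field; rewrite gt_eqF.
by rewrite ler_wpM2r// ltW.
Qed.

Lemma good_finite_rank (e : R) : 0 < e ->
  exists (d : nat) (L : 'I_d -> (M -> R) -> R) (C : R),
    [/\ forall i u v, D u -> D v -> L i (u - v) = L i u - L i v,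
        forall i u, D u -> (L i u) ^+ 2 <= C * (ip u u + ip (A u) u)
      & forall u, D u ->
          ip u u <= e * (ip u u + ip (A u) u) + \sum_i (L i u) ^+ 2].
Proof.
move=> e0; have [r [cc [aa [hh [gd cov]]]]] := finite_good_cover.
pose e1 := e / (size r).+1%:R; have e10 : 0 < e1 by rewrite divr_gt0.
have := finite_rank_le_sum (fun u Du => addr_ge0 (semi_ip_ge0 hs (test_L2 oU mu_fin Du)) (q_ge0 Du)) r
  (fun p => finite_rank_cell (gd p) e10).
apply: finite_rank_leS => u Du; have Hu := test_L2 oU mu_fin Du.
  apply: cover_Rintegral_le; [exact: mU|by move=> p; exact: cell_measurable|by move=> p _; exact: cov| |].
  - exact: (L2_intg oU Hu Hu).
  - by move=> p _; rewrite -expr2 sqr_ge0.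
have q0 := q_ge0 Du; have p0 := semi_ip_ge0 hs Hu.
apply: (@le_trans _ _ (e * q u)); last by rewrite ler_pM2l// lerDr.
rewrite big_const_seq count_predT iter_addr_0 -mulr_natl mulrA ler_wpM2r//.
rewrite /e1 mulrCA ger_pMr// ler_pdivrMr// mul1r ler_nat; exact: leqnSn.
Qed.

End Compactness.

Section ConstantKernel.
Hypothesis hMc : connected [set: M].
Hypothesis Udense : forall V, open V -> V !=set0 -> V `&` U !=set0.
Local Notation F := (form_domain H ip D A).
Local Notation q := (form_ext (D := D) (ip := ip) (A := A)).
Let DH u (h : D u) : H u := test_L2 oU mu_fin h.
Let AH u (h : D u) : H (A u) := laplacian_L2 oU hg hmu mu_fin h.

Lemma cell_mean c a h : good_cube c a h -> exists2 K : R, 0 <= K & forall v, D v -> exists k : R,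
  \int[mu]_(p in cell c a h `&` U) (v p - k) ^+ 2 <= K * ip (A v) v.
Proof.
move=> hc; have [kap k0 hk] := cell_grad_le hc.
have [B [th [B0 th0 th1 hosc]]] := good_osc hc.
exists (B / kap); first by rewrite divr_ge0// ltW.
move=> v Dv; pose k := mean (v \o cinv c) a h; exists k.
have /(test_functionP _ _ oU)[sv _] := Dv.
have [L hL] := test_C1_bd hc (sv 1%N).
have e1 : h / 2 ^+ 0 = h by rewrite expr0 divr1.
have sub0 : cube a (h / 2 ^+ 0) `<=` cube a h by rewrite e1.
have := hosc _ _ 0%N a hL sub0; rewrite e1 expr0 mulr1 => h1.
have hv : MCk S 0 setT (fun p => (v p - k) * (v p - k)).
  have hvk : MCk S 0 setT (v + (fun=> - k)) by exact: (MCkD openT (sv 0%N) (MCk_cst 0 setT (- k))).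
  exact: (MCkM openT hvk hvk).
have mv : measurable_fun (U : set (borel M)) (fun p : borel M => (v p - k) * (v p - k)).
  by apply: (cont_measurable oU) => p _; exact: (MCk_cont openT hv).
have -> : \int[mu]_(p in cell c a h `&` U) (v p - k) ^+ 2 = \int[mu]_(p in cell c a h `&` U) ((v p - k) * (v p - k)).
  by apply: eq_Rintegral => p _; rewrite expr2.
rewrite (cell_Rintegral hc mv).
have -> : \int[lam]_(x in cube a h) (w c x * ((v (cinv c x) - k) * (v (cinv c x) - k))) = oscillation (w c) (v \o cinv c) a h.
  by apply: eq_Rintegral => x _; rewrite expr2.
apply: (le_trans h1); rewrite -mulrA ler_wpM2l// -(@ler_pM2l _ kap)// mulVKf ?gt_eqF//.
exact: hk.
Qed.

(** Test functions v close to u have small energy, so by [cell_mean] each is close in mean square to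
    a constant depending on v. The squared distance from u to k is a quadratic polynomial in k,
    minimal at the mean of u, so it vanishes there. *)
Lemma cell_constant c a h u : good_cube c a h -> F u -> q u u = 0 ->
  exists k : R, \int[mu]_(p in cell c a h `&` U) (u p - k) ^+ 2 = 0.
Proof.
move=> hc Fu qu; have [K K0 hK] := cell_mean hc.
pose C : set (borel M) := cell c a h `&` U.
have mC : measurable C by apply: measurableI => //; exact: cell_measurable.
have CU : C `<=` U by move=> p [].
have Hu : H u by have [] := Fu.
have hF := form_ext_semi_ip hs hq DH AH.
have iC (f : borel M -> R) : mu.-integrable U (EFin \o f) -> mu.-integrable C (EFin \o f).
  by move=> h1; exact: integrableS h1.
have iu := iC _ (L2_L1 oU mu_fin Hu).
have iuu := iC _ (L2_intg oU Hu Hu).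
have i1 := iC _ (L2_L1 oU mu_fin (cst_L2 oU mu_fin 1)).
have isub v (k : R) : H v -> mu.-integrable C (EFin \o (fun p => (v p - k) ^+ 2)).
  move=> Hv; have := iC _ (L2_intg oU (sipB hs Hv (cst_L2 oU mu_fin k)) (sipB hs Hv (cst_L2 oU mu_fin k))).
  by apply: eq_integrable => // p _ /=; rewrite expr2.
have small (e : R) : 0 < e -> exists k : R, \int[mu]_(p in C) (u p - k) ^+ 2 <= (2 + 2 * K) * e.
  move=> e0; have [v Dv [h1 h2]] := form_approxP hs hq DH AH Fu e0.
  have [k hk] := hK v Dv; exists k.
  have Hv := DH Dv; have Fv := form_domain_D hs hq DH AH Dv.
  have qv : q v v = q (v - u) (v - u) by rewrite (nip_nullB hF Fv Fu qu).
  have hA : ip (A v) v <= e by rewrite -(form_ext_D hs hq DH AH Dv Dv) qv ltW.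
  have i2 : mu.-integrable C (EFin \o (fun p => (v p - u p) * (v p - u p))).
    exact: iC _ (L2_intg oU (sipB hs Hv Hu) (sipB hs Hv Hu)).
  apply: (@le_trans _ _ (\int[mu]_(p in C) (2 * ((v p - u p) * (v p - u p)) + 2 * (v p - k) ^+ 2))).
    apply: (le_Rintegral mC (isub u k Hu) (intgD mC (intgZ mC 2 i2) (intgZ mC 2 (isub v k Hv)))).
    by move=> p _; exact: sqr_sub_le2.
  rewrite (RintegralD mC (intgZ mC 2 i2) (intgZ mC 2 (isub v k Hv))).
  rewrite (RintegralZl _ mC i2) (RintegralZl _ mC (isub v k Hv)).
  have h3 : \int[mu]_(p in C) ((v p - u p) * (v p - u p)) <= e.
    apply: le_trans (ltW h1).
    apply: (le_Rintegral_dom mC mU CU (L2_intg oU (sipB hs Hv Hu) (sipB hs Hv Hu))) => p _.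
    rewrite -[leRHS]expr2; exact: sqr_ge0.
  have h4 := le_trans hk (ler_wpM2l K0 hA).
  exact: (lerD_2e h3 h4).
have muC : mu C \is a fin_num.
  by rewrite ge0_fin_numE//; apply: le_lt_trans mu_fin; apply: le_measure => //; rewrite inE.
pose W := fine (mu C); pose I := \int[mu]_(p in C) u p; pose J := \int[mu]_(p in C) (u p * u p).
have expand (k : R) : \int[mu]_(p in C) (u p - k) ^+ 2 = J - 2 * k * I + k ^+ 2 * W.
  have -> : \int[mu]_(p in C) (u p - k) ^+ 2 = \int[mu]_(p in C) ((u p * u p - 2 * k * u p) + k ^+ 2 * 1).
    by apply: eq_Rintegral => p _; ring.
  have i3 := intgZ mC (2 * k) iu.
  rewrite (RintegralD mC (intgB mC iuu i3) (intgZ mC (k ^+ 2) i1)).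
  rewrite (RintegralB mC iuu i3) (RintegralZl _ mC iu) (RintegralZl _ mC i1).
  by congr (_ + _ * _); rewrite Rintegral_cst// mul1r.
have W0 : 0 <= W by exact: fine_ge0.
have nn k : 0 <= \int[mu]_(p in C) (u p - k) ^+ 2 by apply: Rintegral_ge0 => p _; exact: sqr_ge0.
(* On a cell of measure 0 there is no mean, and any constant will do. *)
have [W00|Wn0] := eqVneq W 0.
  exists 0; apply/eqP; rewrite eq_le nn andbT.
  have muC0 : mu C = 0%E by rewrite -(fineK muC) -/W W00.
  rewrite /Rintegral null_set_integral//; exact: measurable_int (isub u 0 Hu).
have Wp : 0 < W by rewrite lt_def Wn0.
exists (I / W); apply/eqP; rewrite eq_le nn andbT; apply/ler_addgt0Pr => e e0; rewrite add0r.
have K2 : 0 < 2 + 2 * K by rewrite ltr_pwDl// mulr_ge0.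
have [k hk] := small (e / (2 + 2 * K)) (divr_gt0 e0 K2).
apply: (@le_trans _ _ (\int[mu]_(p in C) (u p - k) ^+ 2)); last first.
  by apply: (le_trans hk); rewrite mulrCA mulfV ?mulr1// gt_eqF.
rewrite !expand; have -> : I = (I / W) * W by rewrite divfK.
by rewrite mulfK//; move: (I / W) => z; have := mulr_ge0 W0 (sqr_ge0 (z - k)); nra.
Qed.

(** For each k, the points near which u equals k almost everywhere form an open set. Distinct values
    give disjoint sets, since an overlap would meet [U] in positive measure; as these sets cover M,
    connectedness leaves one value. *)
Lemma kernel_constant u : F u -> q u u = 0 -> exists k : R, ip (u - k *: (fun=> 1)) (u - k *: (fun=> 1)) = 0.
Proof.
move=> Fu qu; have Hu : H u by have [] := Fu.
pose nul (k : R) (V : set M) := open V /\ \int[mu]_(p in V `&` U) (u p - k) ^+ 2 = 0.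
have isub (k : R) : mu.-integrable U (EFin \o (fun p => (u p - k) ^+ 2)).
  have := L2_intg oU (sipB hs Hu (cst_L2 oU mu_fin k)) (sipB hs Hu (cst_L2 oU mu_fin k)).
  by apply: eq_integrable => // p _ /=; rewrite expr2.
have loc p : exists k V, nul k V /\ V p.
  have [c [a [h [hc cp ap]]]] := Hgood p.
  have [k hk] := cell_constant hc Fu qu.
  exists k, (cdom c `&` cmap c @^-1` (obox a (a + const_mx h))); split => //.
  have oV : open (cdom c `&` cmap c @^-1` (obox a (a + const_mx h))).
    by apply: open_preimage; [exact: cdom_open|exact: cmap_cont|exact: open_obox].
  split => //; apply/eqP; rewrite eq_le; apply/andP; split; last by apply: Rintegral_ge0 => x _; exact: sqr_ge0.
  rewrite -hk; apply: le_Rintegral_dom.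
  - by apply: open_borel; exact: openI.
  - by apply: measurableI => //; exact: cell_measurable.
  - move=> x [[cx ax] Ux]; split => //; split => // i.
    by have /andP[h1 h2] := ax i; rewrite (ltW h1) h2.
  - by apply: integrableS (isub k) => //; apply: measurableI => //; exact: cell_measurable.
  - by move=> x _; exact: sqr_ge0.
(* On the overlap (u - k)^2 + (u - l)^2 has integral 0, yet it is at least (k - l)^2 / 2 and the
   overlap contains a nonempty open subset of [U]. *)
have uniq k l V V' x : nul k V -> nul l V' -> V x -> V' x -> k = l.
  move=> [oV hV] [oV' hV'] Vx V'x; apply: contrapT => kl.
  have oO : open (V `&` V' `&` U) by apply: openI => //; exact: openI.
  have [y Oy] : V `&` V' `&` U !=set0.
    by apply: Udense; [exact: openI|exists x].
  have OU : V `&` V' `&` U `<=` U by move=> z [].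
  have mO : measurable (V `&` V' `&` U : set (borel M)) by exact: open_borel.
  have := measure_open_gt0 oU hg hmu oO OU Oy.
  have z0 (k' : R) (W : set M) : open W -> V `&` V' `&` U `<=` W `&` U ->
      \int[mu]_(p in W `&` U) (u p - k') ^+ 2 = 0 -> \int[mu]_(p in V `&` V' `&` U) (u p - k') ^+ 2 = 0.
    move=> oW sub h0; apply/eqP; rewrite eq_le; apply/andP; split; last by apply: Rintegral_ge0 => ? _; exact: sqr_ge0.
    rewrite -h0; apply: le_Rintegral_dom => //.
    - by apply: open_borel; exact: openI.
    - by apply: integrableS (isub k') => //; apply: open_borel; exact: openI.
    - by move=> ? _; exact: sqr_ge0.
  have i1 (k' : R) : mu.-integrable (V `&` V' `&` U) (EFin \o (fun p => (u p - k') ^+ 2)).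
    exact: integrableS (isub k').
  have s0 : \int[mu]_(p in V `&` V' `&` U) ((u p - k) ^+ 2 + (u p - l) ^+ 2) = 0.
    rewrite (RintegralD mO (i1 k) (i1 l)) (z0 k V) ?(z0 l V') ?addr0//; by move=> ? [[]].
  rewrite (@integral_pos_null R _ (borel M) mu (V `&` V' `&` U) (V `&` V' `&` U) (fun p => (u p - k) ^+ 2 + (u p - l) ^+ 2) mO mO (@subset_refl _ _)) ?ltxx//.
  - exact: intg_measurable (intgD mO (i1 k) (i1 l)).
  - by move=> ? _; rewrite addr_ge0// sqr_ge0.
  - move=> p _; have : 0 < (k - l) ^+ 2 by rewrite exprn_even_gt0//= subr_eq0; apply/eqP.
    by have := sqr_ge0 (2 * u p - k - l); nra.
  - rewrite -[LHS]fineK; first by congr (_%:E); exact: s0.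
    by apply: integrable_fin_num => //; exact: (intgD mO (i1 k) (i1 l)).
pose E k : set M := [set p | exists V, nul k V /\ V p].
have oE k : open (E k).
  rewrite openE => p [V [nV Vp]]; have [oV _] := nV.
  by apply: filterS (open_nbhs_nbhs (conj oV Vp)) => x Vx; exists V.
have [k [V0 [nV0 V0p]]] := loc point.
have Ek : E k = setT.
  apply: hMc; first by exists point, V0.
    by exists (E k) => //; rewrite setTI.
  exists (E k); last by rewrite setTI.
  rewrite -openC openE => p nE; have [l [V [nV Vp]]] := loc p.
  have [oV _] := nV; apply: filterS (open_nbhs_nbhs (conj oV Vp)) => x Vx [V' [nV' V'x]].
  by apply: nE; exists V; rewrite (uniq _ _ _ _ _ nV' nV V'x Vx).
have : forall p, exists V, nul k V /\ V p by move=> p; have : E k p by rewrite Ek.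
move=> /choice[V hV].
have : cover_compact [set: M] by rewrite -compact_cover.
move=> /(_ M setT V) [].
- by move=> p _; have [[oV _] _] := hV p.
- by move=> p _; exists p => //; have [] := hV p.
move=> G _ cov; exists k.
apply/eqP; rewrite eq_le; apply/andP; split; last by apply: Rintegral_ge0 => p _; rewrite -expr2 sqr_ge0.
have -> : ip (u - k *: (fun=> 1)) (u - k *: (fun=> 1)) = \int[mu]_(p in U) (u p - k) ^+ 2.
  apply: eq_Rintegral => p _; rewrite expr2.
  have e0 : (u - k *: (fun=> 1)) p = u p - k by rewrite -[LHS]/(u p - k * 1) mulr1.
  by rewrite e0.
apply: (le_trans (@cover_Rintegral_le _ (borel M) R mu U _ (finmap.enum_fset G) V (fun p => (u p - k) ^+ 2) mU _ _ (isub k) _)).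
- by move=> p; apply: open_borel; have [[oV _] _] := hV p.
- by move=> p _; have [x Gx Vx] := cov p I; exists x.
- by move=> p _; exact: sqr_ge0.
by rewrite big1// => p _; have [[_ h] _] := hV p.
Qed.

End ConstantKernel.

End GoodCubes.

(** * Morrey decay from integrability *)

Lemma powR2_lt (R : realType) (x y : R) : x < y -> 2 `^ x < 2 `^ y.
Proof. by move=> xy; rewrite /powR !pnatr_eq0/= ltr_expR ltr_pM2r// ln_gt0// ltr1n. Qed.

(** Below the threshold t, x^k <= t^k; above it, (x/t)^(p-k) >= 1. This takes the place of Hoelder's
    inequality, with a threshold to be adapted to each scale. *)
Lemma young_powR (R : realType) (x t p : R) (k : nat) : 0 <= x -> 0 < t -> k%:R <= p ->
  x ^+ k <= t ^+ k + x `^ p * t `^ (k%:R - p).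
Proof.
move=> x0 t0 kp; have [xt|tx] := leP x t.
  apply: (@le_trans _ _ (t ^+ k)); first by rewrite lerXn2r// nnegrE// ltW.
  by rewrite lerDl mulr_ge0// powR_ge0.
have xp : 0 < x by exact: lt_trans tx.
apply: (@le_trans _ _ (x `^ p * t `^ (k%:R - p))); last by rewrite lerDr exprn_ge0// ltW.
have -> : x `^ p = x ^+ k * x `^ (p - k%:R).
  rewrite -powR_mulrn ?ltW// -powRD; first by rewrite addrC subrK.
  by apply/implyP => _; rewrite gt_eqF.
have h : 1 <= x `^ (p - k%:R) * t `^ (k%:R - p).
  have tp : 0 < t `^ (p - k%:R) by rewrite powR_gt0.
  rewrite -(opprB p) powRN ler_pdivlMr// mul1r.
  by apply: ge0_ler_powR; rewrite ?subr_ge0 ?nnegrE ?(ltW t0) ?(ltW xp) ?(ltW tx).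
by rewrite -mulrA ler_peMr// exprn_ge0// ltW.
Qed.

(** [s] is the growth rate of the threshold t = s^r at scale 2^(-r). The factor 4^(-r) coming from
    h^2 must beat s^(rk) for values below the threshold and s^(r(k-p)) 2^(rm) for values above it,
    with p = mk/2 + eps; [th] is the larger of the two ratios, raised to 1/2 if necessary. *)
Lemma morrey_exponents (R : realType) (m k : nat) (eps : R) : 0 < eps -> (0 < k)%N -> (2 <= m)%N ->
  exists s th : R, [/\ 0 < s, 1 <= 2 * th, th < 1, s ^+ k <= 4 * th &
    s `^ (k%:R - ((m * k)%:R / 2 + eps)) * 2 ^+ m <= 4 * th].
Proof.
move=> e0 k0 m2; have k0' : 0 < k%:R :> R by rewrite ltr0n.
pose e' := 2 * eps / k%:R; have e'0 : 0 < e' by rewrite divr_gt0// mulr_gt0.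
have m2' : 2 <= m%:R :> R by rewrite ler_nat.
pose den := m%:R - 2 + e' + 1; have den0 : 0 < den by rewrite /den; lra.
(* With s^k = 2^(2(1 - eta)), the second quantity is 2 to the power m - (1 - eta)(m - 2 + e'), and
   this exponent is below 2 exactly when eta (m - 2 + e') < e'; the 1 added in [den] makes this
   strict. *)
pose eta := e' / den.
have eta0 : 0 < eta by rewrite divr_gt0.
have eden : eta * den = e' by rewrite /eta divfK ?gt_eqF.
have eta1 : eta * (m%:R - 2 + e') < e' by move: eden; rewrite /den; nra.
have eta2 : eta < 1 by rewrite /eta ltr_pdivrMr// mul1r /den; lra.
pose al := 2 / k%:R * (1 - eta).
pose s := 2 `^ al; have s0 : 0 < s by rewrite powR_gt0.
have sk : s ^+ k < 4.
  rewrite /s -powR_mulrn ?powR_ge0// -powRrM.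
  have -> : (4 : R) = 2 `^ 2%:R by rewrite powR_mulrn//; ring.
  apply: powR2_lt; rewrite /al mulrAC divfK ?gt_eqF//; lra.
have sp : s `^ (k%:R - ((m * k)%:R / 2 + eps)) * 2 ^+ m < 4.
  rewrite /s -powRrM -powR_mulrn// -powRD; last by rewrite pnatr_eq0 implybT.
  have -> : (4 : R) = 2 `^ 2%:R by rewrite powR_mulrn//; ring.
  apply: powR2_lt; rewrite natrM.
  have -> : al * (k%:R - (m%:R * k%:R / 2 + eps)) = (1 - eta) * (2 - m%:R - e').
    by rewrite /al /e'; field; rewrite gt_eqF.
  nra.
pose th := Num.max (1 / 2) (Num.max (s ^+ k / 4) (s `^ (k%:R - ((m * k)%:R / 2 + eps)) * 2 ^+ m / 4)).
exists s, th; split => //.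
- have : 1 / 2 <= th by rewrite /th le_max lexx.
  lra.
- by rewrite /th !gt_max; apply/and3P; split; lra.
- have : s ^+ k / 4 <= th by rewrite /th !le_max lexx orbT.
  by move=> hh; lra.
- have : s `^ (k%:R - ((m * k)%:R / 2 + eps)) * 2 ^+ m / 4 <= th by rewrite /th !le_max lexx !orbT.
  by move=> hh; lra.
Qed.

(** On a cube of side h = h0 / 2^r apply [young_powR] with t = s^r. The first term contributes t^k
    times the volume, the second t^(k-p) times the total integral J of F^p; after multiplication by
    h^2 each is at most a constant times th^r h^m. *)
Lemma morrey_condition (R : realType) (m k : nat) (w F : borel 'rV[R]_m -> R) (a0 : 'rV[R]_m) (h0 A p s th : R) :
  0 < h0 -> 0 <= A -> (forall x, 0 <= F x) -> (forall x, 0 <= w x) -> k%:R <= p -> 0 < s ->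
  s ^+ k <= 4 * th -> s `^ (k%:R - p) * 2 ^+ m <= 4 * th ->
  (rV_measure m).-integrable (cube a0 h0) (EFin \o (fun x => F x `^ p)) ->
  (rV_measure m).-integrable (cube a0 h0) (EFin \o w) ->
  (forall x, cube a0 h0 x -> w x <= A * F x ^+ k) ->
  exists2 A', 0 <= A' & forall (r : nat) a, cube a (h0 / 2 ^+ r) `<=` cube a0 h0 ->
    (h0 / 2 ^+ r) ^+ 2 * \int[rV_measure m]_(x in cube a (h0 / 2 ^+ r)) w x <=
    A' * th ^+ r * (h0 / 2 ^+ r) ^+ m.
Proof.
move=> h0p A0 F0 w0 kp s0 sk sp iF iw wF; set lam := rV_measure m in iF iw *.
pose J := \int[lam]_(x in cube a0 h0) (F x `^ p).
have J0 : 0 <= J by apply: Rintegral_ge0 => x _; exact: powR_ge0.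
have hm0 : 0 < h0 ^+ m by rewrite exprn_gt0.
exists (A * h0 ^+ 2 * (1 + J / h0 ^+ m)).
  by rewrite !mulr_ge0 ?exprn_ge0 ?(ltW h0p)// addr_ge0// divr_ge0// ltW.
move=> r a sub; pose hr := h0 / 2 ^+ r; have p2 : 0 < 2 ^+ r :> R by rewrite exprn_gt0.
have hr0 : 0 < hr by rewrite divr_gt0.
pose t := s ^+ r; have t0 : 0 < t by rewrite exprn_gt0.
have mQ := mcube a hr; have mQ0 := mcube a0 h0.
have iFr : lam.-integrable (cube a hr) (EFin \o (fun x => F x `^ p)) by exact: integrableS iF.
have iwr : lam.-integrable (cube a hr) (EFin \o w) by exact: integrableS iw.
have i1 : lam.-integrable (cube a hr) (EFin \o cst (t ^+ k)).
  apply: (bounded_intg (C := `|t ^+ k|)) => //; exact: cube_fin (ltW hr0).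
have i2 := intgZ mQ (t `^ (k%:R - p)) iFr.
have i3 := intgD mQ i1 i2.
have le1 : \int[lam]_(x in cube a hr) w x <= A * (t ^+ k * hr ^+ m + t `^ (k%:R - p) * J).
  apply: (@le_trans _ _ (\int[lam]_(x in cube a hr) (A * (t ^+ k + t `^ (k%:R - p) * F x `^ p)))).
    apply: le_Rintegral => //; first exact: (intgZ mQ A i3).
    move=> x /sub Qx; apply: (le_trans (wF x Qx)); rewrite ler_wpM2l// mulrC.
    by rewrite [in X in _ + X]mulrC mulrC; exact: young_powR.
  rewrite (RintegralZl _ mQ i3) ler_wpM2l// (RintegralD mQ i1 i2) (RintegralZl _ mQ iFr).
  apply: lerD.
    by rewrite Rintegral_cst// -[X in _ * X]/(fine (rV_measure m (cube a hr))) cube_volume// ltW.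
  rewrite ler_wpM2l ?powR_ge0//; apply: le_Rintegral_dom => // x _; exact: powR_ge0.
apply: (le_trans (ler_wpM2l (exprn_ge0 2 (ltW hr0)) le1)).
have th0 : 0 <= th by have : 0 <= s ^+ k := exprn_ge0 k (ltW s0); lra.
have tk : t ^+ k <= (4 * th) ^+ r.
  by rewrite /t exprAC lerXn2r ?nnegrE ?exprn_ge0 ?(ltW s0)// (le_trans _ sk)// exprn_ge0// ltW.
have tp : t `^ (k%:R - p) * (2 ^+ m) ^+ r <= (4 * th) ^+ r.
  have -> : t `^ (k%:R - p) = (s `^ (k%:R - p)) ^+ r.
    by rewrite /t -(powR_mulrn r (ltW s0)) -powRrM mulrC powRrM powR_mulrn// powR_ge0.
  by rewrite -exprMn lerXn2r ?nnegrE ?mulr_ge0 ?powR_ge0 ?exprn_ge0.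
have h2 : hr ^+ 2 * (4 * th) ^+ r = h0 ^+ 2 * th ^+ r.
  rewrite /hr expr_div_n exprMn -[X in _ / X]exprM mulnC exprM.
  by have -> : (2 : R) ^+ 2 = 4; [ring|field; rewrite ?expf_neq0].
have hm : hr ^+ m * (2 ^+ m) ^+ r = h0 ^+ m by rewrite /hr expr_div_n [in X in _ * X]exprAC divfK// expf_neq0// expf_neq0.
have hrm0 : 0 < hr ^+ m by rewrite exprn_gt0.
have b1 : hr ^+ 2 * (t ^+ k * hr ^+ m) <= h0 ^+ 2 * th ^+ r * hr ^+ m.
  by rewrite -h2 mulrA ler_pM2r// ler_pM2l ?exprn_gt0.
have b2 : hr ^+ 2 * (t `^ (k%:R - p) * J) <= h0 ^+ 2 * th ^+ r * (J / h0 ^+ m) * hr ^+ m.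
  have -> : t `^ (k%:R - p) * J = (t `^ (k%:R - p) * (2 ^+ m) ^+ r) * (J / h0 ^+ m * hr ^+ m).
    have q2 : ((2 : R) ^+ m) ^+ r != 0 by rewrite !expf_neq0.
    by rewrite -hm invfM; field; rewrite q2 gt_eqF.
  have -> : h0 ^+ 2 * th ^+ r * (J / h0 ^+ m) * hr ^+ m = hr ^+ 2 * ((4 * th) ^+ r * (J / h0 ^+ m * hr ^+ m)).
    by rewrite -h2 !mulrA.
  apply: ler_wpM2l; first by rewrite exprn_ge0// ltW.
  by apply: ler_wpM2r; [rewrite mulr_ge0 ?divr_ge0 ?(ltW hm0)// ltW|exact: tp].
have -> : hr ^+ 2 * (A * (t ^+ k * hr ^+ m + t `^ (k%:R - p) * J)) = A * (hr ^+ 2 * (t ^+ k * hr ^+ m) + hr ^+ 2 * (t `^ (k%:R - p) * J)) by ring.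
have -> : A * h0 ^+ 2 * (1 + J / h0 ^+ m) * th ^+ r * (h0 / 2 ^+ r) ^+ m =
   A * (h0 ^+ 2 * th ^+ r * hr ^+ m + h0 ^+ 2 * th ^+ r * (J / h0 ^+ m) * hr ^+ m).
  rewrite -/hr; move: (J / h0 ^+ m) => z; ring.
by rewrite ler_wpM2l// lerD.
Qed.

(** * Bounds for metrics and block scaling *)

Section MatrixBounds.
Context {R : realType} {m : nat}.
Implicit Types (G : 'M[R]_m) (v : 'rV[R]_m).

Lemma mx_formE G v : (v *m G *m v^T) 0 0 = \sum_j \sum_i v 0 i * G i j * v 0 j.
Proof. by rewrite mxE; apply: eq_bigr => j _; rewrite [(_^T) j 0]mxE [in LHS]mxE mulr_suml. Qed.

Lemma mx_form_le G v (C : R) : 0 <= C -> (forall i j, `|G i j| <= C) -> (v *m G *m v^T) 0 0 <= C * m%:R * \sum_i v 0 i ^+ 2.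
Proof.
move=> C0 hC.
apply: (@le_trans _ _ (C * (\sum_i `|v 0 i|) ^+ 2)).
  rewrite mx_formE expr2 mulr_sumr mulr_sumr; apply: ler_sum => j _.
  rewrite mulr_suml mulr_sumr; apply: ler_sum => i _; apply: (le_trans (ler_norm _)).
  rewrite !normrM [leRHS]mulrA; apply: ler_wpM2r => //.
  by rewrite mulrC; apply: ler_wpM2r.
rewrite -mulrA ler_wpM2l//; apply: (le_trans (sqr_sum_le _)); rewrite card_ord ler_wpM2l//.
by apply: ler_sum => i _; rewrite real_normK ?num_real.
Qed.

(** Cauchy-Schwarz for G between v G^(-1) and v gives |v|^4 <= (v G^(-1) v^T)(v G v^T), and the last
    factor is at most C m |v|^2. Upper bounds on the entries of G thus bound its inverse from
    below. *)
Lemma mx_form_ge G v (C : R) : (forall v : 'rV[R]_m, v != 0 -> 0 < (v *m G *m v^T) 0 0) -> G^T = G ->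
  0 <= C -> (forall i j, `|G i j| <= C) -> \sum_i v 0 i ^+ 2 <= C * m%:R * (v *m invmx G *m v^T) 0 0.
Proof.
move=> pG sG C0 hC; have uG := posdef_unit pG.
have hs : semi_ip setT (fun x y : 'rV[R]_m => (x *m G *m y^T) 0 0).
  split=> // [x y _ _|a x y z _ _ _|x _].
  - have -> : (x *m G *m y^T) 0 0 = ((y *m G *m x^T)^T) 0 0 by rewrite !trmx_mul trmxK sG mulmxA.
    by rewrite mxE.
  - by rewrite !mulmxDl -!scalemxAl mxE [in X in X + _]mxE.
  - have [->|x0] := eqVneq x 0; first by rewrite !mul0mx mxE.
    by rewrite ltW// pG.
have := ip_CS hs (u := v *m invmx G) (v := v) I I.
have vv : (v *m v^T) 0 0 = \sum_i v 0 i ^+ 2.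
  by rewrite mxE; apply: eq_bigr => i _; rewrite mxE expr2.
have e1 : (v *m invmx G *m G *m v^T) 0 0 = \sum_i v 0 i ^+ 2 by rewrite (mulmxKV uG) vv.
have e2 : (v *m invmx G *m G *m (v *m invmx G)^T) 0 0 = (v *m invmx G *m v^T) 0 0.
  by rewrite (mulmxKV uG) trmx_mul trmx_inv sG mulmxA.
rewrite e1 e2; set X := (v *m invmx G *m v^T) 0 0; set Y := (v *m G *m v^T) 0 0.
have X0 : 0 <= X by have := semi_ip_ge0 hs (u := v *m invmx G) I; rewrite e2.
have YC : Y <= C * m%:R * \sum_i v 0 i ^+ 2 by exact: mx_form_le.
have s0 : 0 <= \sum_i v 0 i ^+ 2 by apply: sumr_ge0 => i _; exact: sqr_ge0.
move: YC s0; move: (\sum_i v 0 i ^+ 2) => s YC s0 h1.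
have [->|sn0] := eqVneq s 0.
  by rewrite !mulr_ge0.
have sp : 0 < s by rewrite lt_def sn0.
rewrite -(@ler_pM2r _ s)// -expr2 (le_trans h1)// mulrAC [leRHS]mulrC.
by rewrite ler_wpM2l.
Qed.

End MatrixBounds.

Lemma metric_bounds (R : realType) (m : nat) (M : ptopologicalType) (S : manifold R M m) (U : set M)
    (g : M -> 'M[R]_m) (c : chart R M m) (K : set 'rV[R]_m) : open U -> riemannian_metric S U g -> atlas S c ->
  compact K -> K `<=` cimg c U -> exists2 C : R, 0 < C & forall x, K x ->
    [/\ C^-1 <= dens S g c x, dens S g c x <= C &
    forall v : 'rV[R]_m, C^-1 * \sum_i v 0 i ^+ 2 <= (v *m invmx (metric_in S c g (cinv c x)) *m v^T) 0 0 /\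
      (v *m invmx (metric_in S c g (cinv c x)) *m v^T) 0 0 <= C * \sum_i v 0 i ^+ 2].
Proof.
move=> oU hg hc cK KU; have oC := open_cimg (c := c) oU.
have hG i j := metric_smooth oU hg 0 i j hc.
have hI i j : Ck_on 0 (cimg c U) (fun x => invmx (metric_in S c g (cinv c x)) i j).
  apply: Ck_invmx => // x /cimgE[_ cx Ux _]; exact: (metric_in_unitmx hg).
have hd := dens_smooth oU hg 0 hc.
have hdV : Ck_on 0 (cimg c U) (fun x => (dens S g c x)^-1).
  by apply: CkV => // _ [p [cp Up] <-]; rewrite gt_eqF//; exact: (dens_gt0 hg).
have bnd (f : 'rV[R]_m -> R) : Ck_on 0 (cimg c U) f -> exists C : R, 0 <= C /\ forall x, K x -> `|f x| <= C.
  move=> hf; have [C C0 hC] := compact_bnd cK (fun x Kx => hf x (KU x Kx)).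
  by exists C.
have /choice[C1 hC1] : forall ij : 'I_m * 'I_m, exists C : R, 0 <= C /\ forall x, K x -> `|metric_in S c g (cinv c x) ij.1 ij.2| <= C.
  by move=> ij; exact: bnd.
have /choice[C2 hC2] : forall ij : 'I_m * 'I_m, exists C : R, 0 <= C /\ forall x, K x -> `|invmx (metric_in S c g (cinv c x)) ij.1 ij.2| <= C.
  by move=> ij; exact: bnd.
have [C3 [C30 hC3]] := bnd _ hd; have [C4 [C40 hC4]] := bnd _ hdV.
pose S1 := \sum_ij C1 ij; pose S2 := \sum_ij C2 ij.
have S10 : 0 <= S1 by apply: sumr_ge0 => ij _; have [] := hC1 ij.
have S20 : 0 <= S2 by apply: sumr_ge0 => ij _; have [] := hC2 ij.
have b1 x i j : K x -> `|metric_in S c g (cinv c x) i j| <= S1.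
  move=> Kx; have [_ h] := hC1 (i, j); apply: (le_trans (h x Kx)).
  by rewrite /S1 (bigD1 (i, j))//= lerDl; apply: sumr_ge0 => ij _; have [] := hC1 ij.
have b2 x i j : K x -> `|invmx (metric_in S c g (cinv c x)) i j| <= S2.
  move=> Kx; have [_ h] := hC2 (i, j); apply: (le_trans (h x Kx)).
  by rewrite /S2 (bigD1 (i, j))//= lerDl; apply: sumr_ge0 => ij _; have [] := hC2 ij.
pose C := 1 + C3 + C4 + S1 * m%:R + S2 * m%:R.
have q1 : 0 <= S1 * m%:R by rewrite mulr_ge0.
have q2 : 0 <= S2 * m%:R by rewrite mulr_ge0.
have Cp : 0 < C by rewrite /C; lra.
exists C => // x Kx; have [_ cx Ux xx] := (cimgE _ _ _).1 (KU x Kx).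
have dx : 0 < dens S g c x by rewrite -xx; exact: (dens_gt0 hg).
split.
- rewrite -[leRHS]invrK lef_pV2 ?posrE ?invr_gt0//.
  by have := hC4 x Kx; rewrite ger0_norm ?invr_ge0 ?(ltW dx)// /C; lra.
- by have := hC3 x Kx; rewrite ger0_norm ?(ltW dx)// /C; lra.
move=> v; have s0 : 0 <= \sum_i v 0 i ^+ 2 by apply: sumr_ge0 => i _; exact: sqr_ge0.
have hsy : (metric_in S c g (cinv c x))^T = metric_in S c g (cinv c x) by exact: (metric_sym hg).
have h1 := mx_form_ge v (fun v v0 => metric_pos hg hc cx Ux v0) hsy S10 (fun i j => b1 x i j Kx).
have h2 := mx_form_le v S20 (fun i j => b2 x i j Kx).
have X0 : 0 <= (v *m invmx (metric_in S c g (cinv c x)) *m v^T) 0 0.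
  have [z|nz] := eqVneq (S1 * m%:R) 0; last first.
    have nzp : 0 < S1 * m%:R by rewrite lt_def nz.
    by rewrite -(@ler_pM2l _ (S1 * m%:R))// mulr0 (le_trans s0).
  have sv : \sum_i v 0 i ^+ 2 = 0 by apply/eqP; rewrite eq_le s0 andbT (le_trans h1)// z mul0r.
  have -> : v = 0.
    apply/rowP => i; rewrite [RHS]mxE; apply/eqP; rewrite -sqrf_eq0.
    by have /eqP := sv; rewrite psumr_eq0 => [/allP/(_ i (mem_index_enum _))//|j _]; exact: sqr_ge0.
  by rewrite !mul0mx mxE.
split.
  rewrite mulrC ler_pdivrMr// (le_trans h1)// mulrC ler_wpM2l// /C; lra.
by apply: (le_trans h2); rewrite ler_wpM2r// /C; lra.
Qed.

Section BlockScaling.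
Context {R : realType} {m : nat}.
Implicit Types (G : 'M[R]_m) (v : 'rV[R]_m).

Definition block_diag (k : nat) (s : R) : 'M[R]_m := diag_mx (\row_(i < m) if (i < k)%N then s else 1).

Lemma invmx_right (A B : 'M[R]_m) : A *m B = 1%:M -> invmx A = B.
Proof. by move=> AB; have [uA _] := mulmx1_unit AB; rewrite -[LHS]mulmx1 -AB mulKmx. Qed.

Lemma block_diagM k (s t : R) : block_diag k s *m block_diag k t = block_diag k (s * t).
Proof.
apply/matrixP => i j; rewrite /block_diag mul_diag_mx !mxE.
by case: (i == j); rewrite ?mulr0n ?mulr0// !mulr1n; case: ifP; rewrite ?mulr1.
Qed.

Lemma block_diag1 k : block_diag k 1 = 1%:M.
Proof. by apply/matrixP => i j; rewrite !mxE; case: ifP. Qed.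

Lemma mul_block_diag k (s : R) v j : (v *m block_diag k s) 0 j = if (j < k)%N then v 0 j * s else v 0 j.
Proof. by rewrite /block_diag mul_mx_diag !mxE; case: ifP => _; rewrite ?mulr1. Qed.

(** As the off-diagonal blocks vanish, the scaling is a congruence D G D, from which determinant and
    inverse are read off. *)
Lemma scale_blockE (n : nat) (s : R) G : (forall i j : 'I_m, (i < m - n)%N != (j < m - n)%N -> G i j = 0) ->
  scale_block n (s ^+ 2) G = block_diag (m - n) s *m G *m block_diag (m - n) s.
Proof.
move=> hG; apply/matrixP => i j; rewrite /block_diag mul_mx_diag mxE mul_diag_mx !mxE.
have := hG i j; case: ltnP => ik; case: ltnP => jk //= h; rewrite ?mul1r ?mulr1//.
- by rewrite expr2; ring.
- by rewrite h ?mulr0.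
- by rewrite h ?mul0r.
Qed.

Lemma det_block_diag k (s : R) : (k <= m)%N -> \det (block_diag k s) = s ^+ k.
Proof.
move=> km; rewrite det_diag; under eq_bigr do rewrite mxE.
rewrite -big_mkcond/= (big_ord_narrow km) prodr_const card_ord.
by [].
Qed.

Lemma det_scale_block (n : nat) (s : R) G :
  (forall i j : 'I_m, (i < m - n)%N != (j < m - n)%N -> G i j = 0) ->
  Num.sqrt (\det (scale_block n (s ^+ 2) G)) = `|s| ^+ (m - n) * Num.sqrt (\det G).
Proof.
move=> hG; rewrite scale_blockE// !det_mulmx det_block_diag ?leq_subr// mulrAC -expr2.
by rewrite sqrtrM ?sqr_ge0// sqrtr_sqr normrX.
Qed.

Lemma inv_scale_block (n : nat) (s : R) G v : s != 0 -> G \in unitmx ->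
  (forall i j : 'I_m, (i < m - n)%N != (j < m - n)%N -> G i j = 0) ->
  (v *m invmx (scale_block n (s ^+ 2) G) *m v^T) 0 0 =
  ((v *m block_diag (m - n) s^-1) *m invmx G *m (v *m block_diag (m - n) s^-1)^T) 0 0.
Proof.
move=> s0 uG hG; rewrite scale_blockE//.
have -> : invmx (block_diag (m - n) s *m G *m block_diag (m - n) s) =
    block_diag (m - n) s^-1 *m invmx G *m block_diag (m - n) s^-1.
  apply: invmx_right; rewrite !mulmxA -[X in X *m invmx G](mulmxA _ _ (block_diag _ _)) block_diagM mulfV//.
  rewrite block_diag1 mulmx1 -[X in X *m block_diag _ _](mulmxA) mulmxV// mulmx1 block_diagM mulfV//.
  exact: block_diag1.
congr (_ 0 0); rewrite trmx_mul; have -> : (block_diag (m - n) s^-1)^T = block_diag (m - n) s^-1 by rewrite tr_diag_mx.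
by rewrite !mulmxA.
Qed.

End BlockScaling.

Section GoodCubeCriterion.
Context {R : realType} {m : nat} {M : ptopologicalType} (S : manifold R M m).
Implicit Types (c : chart R M m) (p q : M) (a : 'rV[R]_m).
Local Notation lam := (rV_measure (R := R) m).
Variables (U : set M) (g : M -> 'M[R]_m).
Hypothesis oU : open U.
Hypothesis hg : riemannian_metric S U g.

(** [F] stands for |f| near N and for 1 elsewhere: the density only has to be dominated by F^k, with
    F integrable to the power mk/2 + eps. *)
Lemma good_cube_intro c a (h : R) (F : borel 'rV[R]_m -> R) (A eps : R) (k : nat) : (0 < k)%N -> (2 <= m)%N -> (2 <= k)%N ->
  0 < eps -> 0 <= A -> atlas S c -> 0 < h -> cbox a (a + const_mx h) `<=` cmap c @` cdom c ->
  (forall x, 0 <= F x) -> measurable_fun (cube a h : set (borel 'rV[R]_m)) F ->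
  lam.-integrable (cube a h) (EFin \o (fun x => F x `^ ((m * k)%:R / 2 + eps))) ->
  (forall x, cube a h x -> cweight S U g c x <= A * F x ^+ k) ->
  (exists2 kap : R, 0 < kap & forall p (v : 'rV[R]_m), cdom c p -> U p -> cube a h (cmap c p) ->
    kap * (\sum_i v 0 i ^+ 2) <= dens S g c (cmap c p) * (v *m invmx (metric_in S c g p) *m v^T) 0 0) ->
  good_cube S U g c a h.
Proof.
move=> k0 m2 k2 e0 A0 hc h0 sub F0 mF iF wF hell.
have kp : k%:R <= (m * k)%:R / 2 + eps :> R.
  have : 2%:R * k%:R <= (m * k)%:R :> R by rewrite -natrM ler_nat leq_mul2r m2 orbT.
  by move=> hh; lra.
have mQ := mcube a h.
have i1 : lam.-integrable (cube a h) (EFin \o cst (1 : R)).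
  by apply: (bounded_intg (C := 1)) => //; [exact: cube_fin (ltW h0)|move=> x _; rewrite normr1].
have iw : lam.-integrable (cube a h) (EFin \o (cweight S U g c : borel 'rV[R]_m -> R)).
  apply: (intg_le mQ _ _ (intgZ mQ A (intgD mQ i1 iF))).
    by apply: measurable_funS (cweight_measurable oU hg hc).
  move=> x Qx; rewrite ger0_norm ?cweight_ge0//; apply: (le_trans (wF x Qx)); rewrite ler_wpM2l//.
  by have := young_powR (F0 x) (@ltr01 R) kp; rewrite expr1n powR1 mulr1.
have [s [th [s0 th1 th2 sk sp]]] := morrey_exponents e0 k0 m2.
have w0 := cweight_ge0 S U g c.
have [A' A'0 hA'] := morrey_condition h0 A0 F0 w0 kp s0 sk sp iF iw wF.
have [B B0 hB] := morrey_poincare w0 h0 iw A'0 th1 th2 hA'.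
split => //; exists B, th; split => //; lra.
Qed.

Lemma small_closed_cube (V : set 'rV[R]_m) x : open V -> V x -> exists a (h : R),
  [/\ 0 < h, cbox a (a + const_mx h) `<=` V & obox a (a + const_mx h) x].
Proof.
move=> oV Vx; have [e e0 he] := small_cbox oV Vx.
exists (x - const_mx e), (2 * e); split; first by rewrite mulr_gt0.
  have -> : x - const_mx e + const_mx (2 * e) = x + const_mx e; last exact: he.
  by apply/rowP => i; rewrite !mxE; ring.
by move=> i; rewrite !mxE; apply/andP; split; lra.
Qed.

Lemma good_cube_regular p : (2 <= m)%N -> U p -> exists c a h,
  [/\ good_cube S U g c a h, cdom c p & obox a (a + const_mx h) (cmap c p)].
Proof.
move=> m2 Up; pose c := chart_at S p.
have hc := atlas_chart_at S p; have cp := cdom_chart_at S p.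
have [a [h [h0 sub ap]]] := small_closed_cube (open_cimg (c := c) oU) (cimg_mem cp Up).
exists c, a, h; split => //.
have sub' : cbox a (a + const_mx h) `<=` cmap c @` cdom c by move=> x /sub[q [cq _] <-]; exists q.
have [C C0 hC] := metric_bounds oU hg hc (@compact_cbox R m a (a + const_mx h)) sub.
have mQ := mcube a h.
(* Away from N the density is bounded on the cube, so the exponents can be chosen freely: k = 2 and
   eps = 1. *)
apply: (good_cube_intro (F := fun=> 1) (A := C) (eps := 1) (k := 2)) => //; first exact: ltW.
- under eq_fun do rewrite powR1.
  by apply: (bounded_intg (C := 1)) => //; [exact: cube_fin (ltW h0)|move=> x _; rewrite normr1].
- move=> x /hbox_cbox Qx; have [_ dC _] := hC x Qx.
  by rewrite expr1n mulr1 /cweight indicE mem_set ?mul1r//; exact: sub.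
exists (C^-1 * C^-1); first by rewrite mulr_gt0 ?invr_gt0.
move=> q v cq Uq /hbox_cbox Qq; have [dC _ /(_ v)[h1 _]] := hC _ Qq.
rewrite (cinvK cq) in h1; rewrite -mulrA; apply: ler_pM => //.
- by rewrite invr_ge0 ltW.
- have s0 : 0 <= \sum_i v 0 i ^+ 2 by apply: sumr_ge0 => i _; exact: sqr_ge0.
  by rewrite mulr_ge0// invr_ge0 ltW.
Qed.

End GoodCubeCriterion.

(** * Radial cutoffs in coordinates *)

Section RadialCutoffs.
Context {R : realType} {m : nat} (k : nat).

(** The squared Euclidean distance to N in diagonal coordinates, where N is given by the vanishing
    of the first k of them. *)
Definition rho (x : 'rV[R]_m) : R := \sum_(i < m) (if (i < k)%N then x 0 i ^+ 2 else 0).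

Lemma Ck_rho l (A : set 'rV[R]_m) : open A -> Ck_on l A rho.
Proof.
move=> oA; have hi (i : 'I_m) : Ck_on l A (fun x => if (i < k)%N then x 0 i ^+ 2 else 0).
  case: (i < k)%N; last exact: Ck_cst.
  by apply: (Ck_ext oA) (CkM oA (Ck_coord l A i) (Ck_coord l A i)) => x _; rewrite expr2.
exact: (Ck_sum (index_enum _) oA hi).
Qed.

Lemma rho_ge0 (x : 'rV[R]_m) : 0 <= rho x.
Proof. by apply: sumr_ge0 => i _; case: ifP => _ //; exact: sqr_ge0. Qed.

Lemma rho_coord (x : 'rV[R]_m) (i : 'I_m) : (i < k)%N -> x 0 i ^+ 2 <= rho x.
Proof.
move=> ik; rewrite /rho (bigD1 i)//= ik lerDl; apply: sumr_ge0 => j _.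
by case: ifP => _ //; exact: sqr_ge0.
Qed.

Lemma derive_rho (x : 'rV[R]_m) (i : 'I_m) : pderiv rho i x = if (i < k)%N then 2 * x 0 i else 0.
Proof.
have dc j : differentiable (fun y : 'rV[R]_m => y 0 j) x by have [+ _] := Ck_coord 1 [set: 'rV[R]_m] j; exact.
have hd (j : 'I_m) : is_derive x (delta_mx 0 i : 'rV[R]_m) (fun y : 'rV[R]_m => if (j < k)%N then y 0 j ^+ 2 else 0)
    (if (j < k)%N then 2 * x 0 j * (j == i)%:R else 0).
  case: ifP => _; last exact: is_derive_cst.
  have -> : (fun y : 'rV[R]_m => y 0 j ^+ 2) = (fun y : 'rV[R]_m => y 0 j) * (fun y : 'rV[R]_m => y 0 j).
    by apply/funext => y; rewrite expr2.
  apply: DeriveDef; first by apply: derivableM; exact: diff_derivable.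
  rewrite deriveM; [|exact: diff_derivable|exact: diff_derivable].
  rewrite derive_coord mxE eqxx/= -[LHS]/(x 0 j * (j == i)%:R + x 0 j * (j == i)%:R); ring.
have -> : rho = \sum_(j < m) (fun y : 'rV[R]_m => if (j < k)%N then y 0 j ^+ 2 else 0).
  by apply/funext => y; rewrite fct_sumE.
rewrite /pderiv derive_sum => [|j]; last by have := hd j; case.
under eq_bigr => j _ do rewrite (@derive_val _ _ _ _ _ _ _ (hd j)).
rewrite (bigD1 i)//= eqxx mulr1 big1 ?addr0// => j /negbTE ->.
by rewrite mulr0 if_same.
Qed.

Definition radial (j : nat) (x : 'rV[R]_m) : R := step (2 - 4 ^+ j * rho x).

Lemma Ck_radial_arg l j (A : set 'rV[R]_m) : open A -> Ck_on l A (fun x => 2 - 4 ^+ j * rho x).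
Proof.
move=> oA; have h1 : Ck_on l A (fun _ : 'rV[R]_m => (2 : R)) by exact: Ck_cst.
have h2 : Ck_on l A (fun x => 4 ^+ j * rho x) by apply: CkZ => //; exact: Ck_rho.
have h := CkB oA h1 h2; exact: h.
Qed.

Lemma Ck_radial l j (A : set 'rV[R]_m) : open A -> Ck_on l A (radial j).
Proof.
by move=> oA; apply: Ck_step => //; exact: Ck_radial_arg.
Qed.

(** Where 4^j rho <= 2 one has |x_i| <= 2 2^(-j), so the factor 4^j 2 x_i from the chain rule is of
    order 2^j. The step is read on row vectors of length 1 in order to use the chain rule for maps
    between row vectors. *)
Lemma radial_derive_le : exists2 C : R, 0 <= C & forall j (x : 'rV[R]_m) (i : 'I_m), 4 ^+ j * rho x <= 2 ->
  `|pderiv (radial j) i x| <= if (i < k)%N then C * 2 ^+ j else 0.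
Proof.
pose psi : 'rV[R]_1 -> R := fun t => step (t 0 0).
have [dpsi cpsi] : Ck_on 1 [set: 'rV[R]_1] psi by apply: Ck_step; [exact: openT|exact: Ck_coord].
have [C C0 hC] := compact_bnd (@compact_cbox R 1 0 (const_mx 2)) (fun t _ => cpsi (delta_mx 0 0) t I).
exists (4 * C); first by rewrite mulr_ge0.
move=> j x i hx; pose G : 'rV[R]_m -> 'rV[R]_1 := fun x => const_mx (2 - 4 ^+ j * rho x).
have cG : Ck_on 1 [set: 'rV[R]_m] (fun x => 2 - 4 ^+ j * rho x).
  exact: (Ck_radial_arg 1 j openT).
have dG : differentiable G x.
  have [h _] : Ck_on 1 [set: 'rV[R]_m] G.
    apply: Ck_matrix; first exact: openT.
    by move=> a b; apply: (Ck_ext openT) cG => y _; rewrite mxE.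
  exact: h.
have -> : radial j = psi \o G by apply/funext => y; rewrite /psi /= mxE.
rewrite /pderiv (derive_comp_rV _ dG (dpsi _ I)) big_ord1.
have -> : (fun y => G y 0 0) = (fun=> 2) - (4 ^+ j \*: rho).
  by apply/funext => y; rewrite mxE.
have [dr _] := Ck_rho 1 openT; have {}dr := dr x I.
rewrite deriveB; [|exact: derivable_cst|exact: derivableZ (diff_derivable dr)].
rewrite derive_cst deriveZ ?sub0r; last exact: diff_derivable.
have := derive_rho x i; rewrite /pderiv => ->; rewrite normrM normrN.
have hG : `|pderiv psi 0 (G x)| <= C.
  apply: hC => a; rewrite !mxE subr_ge0 hx/= gerBl mulr_ge0 ?exprn_ge0//; exact: rho_ge0.
case: ifP => ik; last by rewrite scaler0 normr0 mul0r.
have xi : `|x 0 i| <= 2 * (2 ^+ j)^-1.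
  rewrite -(@ler_pXn2r _ 2) ?nnegrE ?mulr_ge0 ?invr_ge0 ?exprn_ge0// real_normK ?num_real//.
  apply: (le_trans (rho_coord x ik)); rewrite exprMn exprVn -exprM mulnC exprM.
  have -> : (2 : R) ^+ 2 = 4 by ring.
  rewrite ler_pdivlMr ?exprn_gt0// mulrC; lra.
rewrite -[_ *: _]/(4 ^+ j * _) !normrM [`|2|]ger0_norm// [`|4 ^+ j|]ger0_norm ?exprn_ge0//.
have e4 : (4 : R) ^+ j = 2 ^+ j * 2 ^+ j by rewrite -exprMn; congr (_ ^+ _); ring.
have p2 : 0 < (2 : R) ^+ j by rewrite exprn_gt0.
apply: (@le_trans _ _ (4 ^+ j * (2 * (2 * (2 ^+ j)^-1)) * C)).
  by apply: ler_pM => //; rewrite ?mulr_ge0 ?exprn_ge0// ler_pM2l ?exprn_gt0// ler_pM2l.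
by rewrite e4 le_eqVlt; apply/orP; left; apply/eqP; field; rewrite gt_eqF.
Qed.

(** The support of [radial j] reaches distance sqrt(2) 2^(-j); the width 2 2^(-j) makes the
    inclusion strict, so a half-open box catches it. *)
Definition slab (j : nat) (a : 'rV[R]_m) (h : R) : set 'rV[R]_m :=
  hbox (\row_i if (i < k)%N then - (2 * (2 ^+ j)^-1) else a 0 i)
       (\row_i if (i < k)%N then 2 * (2 ^+ j)^-1 else a 0 i + h).

Lemma slab_fin j (a : 'rV[R]_m) (h : R) : 0 <= h -> (rV_measure m (slab j a h) < +oo)%E.
Proof.
move=> h0; have p2 : 0 < (2 : R) ^+ j by rewrite exprn_gt0.
rewrite /slab rV_measure_hbox ?ltry// => i; rewrite !mxE.
by case: ifP => _; [rewrite ge0_cp// mulr_ge0 ?invr_ge0// ltW|rewrite lerDl].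
Qed.

Lemma slab_volume j (a : 'rV[R]_m) (h : R) : (k <= m)%N -> 0 <= h -> ((2 ^+ j) ^+ k * fine (rV_measure m (slab j a h)) = 4 ^+ k * h ^+ (m - k))%R.
Proof.
move=> km h0; have p2 : 0 < (2 : R) ^+ j by rewrite exprn_gt0.
rewrite /slab rV_measure_hbox; last first.
  by move=> i; rewrite !mxE; case: ifP => _; [rewrite ge0_cp// mulr_ge0 ?invr_ge0// ltW|rewrite lerDl].
rewrite /=; have -> : \prod_(i < m) ((\row_i0 (if (i0 < k)%N then 2 * (2 ^+ j)^-1 else a 0 i0 + h)) 0 i -
   (\row_i0 (if (i0 < k)%N then - (2 * (2 ^+ j)^-1) else a 0 i0)) 0 i) = \prod_(i < m) (if (i < k)%N then 4 * (2 ^+ j)^-1 else h).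
  by apply: eq_bigr => i _; rewrite !mxE; case: ifP => _; ring.
have -> : \prod_(i < m) (if (i < k)%N then 4 * (2 ^+ j)^-1 else h) = (4 * (2 ^+ j)^-1) ^+ k * h ^+ (m - k).
  rewrite (bigID (fun i : 'I_m => (i < k)%N))/=; congr (_ * _).
    rewrite (eq_bigr (fun=> 4 * (2 ^+ j)^-1)) => [|i ->//].
    by rewrite (big_ord_narrow km) prodr_const card_ord.
  rewrite (eq_bigr (fun=> h)) => [|i /negbTE ->//].
  rewrite prodr_const; congr (_ ^+ _).
  have := cardC (fun i : 'I_m => (i < k)%N); rewrite card_ord => e.
  have e2 : #|(fun i : 'I_m => (i < k)%N)| = k.
    by rewrite -sum1_card (big_ord_narrow km) sum1_card card_ord.
  by rewrite -[in RHS]e e2 addKn; apply: eq_card => i; rewrite !inE.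
rewrite mulrA -exprMn; congr (_ ^+ _ * _); field; by rewrite gt_eqF.
Qed.

End RadialCutoffs.

(** * The neighbourhood of the submanifold *)

Lemma mul_cancel_mid (R : fieldType) (a b v : R) : b != 0 -> a * b * (v / b) = a * v.
Proof. by move=> h; field. Qed.

Section NearSubmanifold.
Context {R : realType} {m n : nat} {M : ptopologicalType} (S : manifold R M m).
Implicit Types (c : chart R M m) (p q : M) (a : 'rV[R]_m).
Local Notation lam := (rV_measure (R := R) m).
Variables (g g' : M -> 'M[R]_m) (N W : set M) (coords : set (chart R M m)) (f : M -> R)
  (mu : {measure set (borel M) -> \bar R}) (eps : R).
Local Notation U := (~` N).
Local Notation k := (m - n)%N.
Hypothesis hmn : (n + 2 <= m)%N.
Hypothesis cN : closed N.
Hypothesis hg : riemannian_metric S [set: M] g.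
Hypothesis hmu : riemannian_measure S [set: M] g mu.
Hypothesis hg' : riemannian_metric S U g'.
Hypothesis hcoords : diagonal_coordinates S g n N coords.
Hypothesis oW : open W.
Hypothesis NW : N `<=` W.
Hypothesis hf : MCk S 0 U f.
Hypothesis hgg' : forall c p, coords c -> cdom c p -> W p -> ~ N p ->
  metric_in S c g' p = scale_block n (f p ^+ 2) (metric_in S c g p).
Hypothesis eps0 : 0 < eps.
Hypothesis hfp : Lp U mu ((m * k)%:R / 2 + eps) f.
Hypothesis flow : exists2 b : R, 0 < b & forall p, U p -> b <= `|f p| ^+ (k - 2) /\ ((0 < n)%N -> b <= `|f p| ^+ k).
Let oU : open U := closed_openC cN.
Let mU : measurable (U : set (borel M)) := open_borel oU.

Lemma k_ge2 : (1 < k)%N.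
Proof. by rewrite ltn_subRL; apply: leq_trans hmn; rewrite addn1 addn2. Qed.

Lemma coords_atlas c : coords c -> atlas S c.
Proof. by have [h _ _ _ _] := hcoords; exact: h. Qed.

(** Otherwise the first coordinate vector would have length 0 for g', which is positive definite off
    N. *)
Lemma f_neq0 c p : coords c -> cdom c p -> W p -> ~ N p -> f p != 0.
Proof.
move=> hc cp Wp Np; apply/eqP => f0.
have k0 : (0 < m)%N by apply: leq_trans hmn; rewrite addn2.
have ki := ltnW k_ge2.
pose v : 'rV[R]_m := delta_mx 0 (Ordinal k0).
have v0 : v != 0.
  apply/eqP => /rowP/(_ (Ordinal k0)); rewrite !mxE !eqxx => /eqP; by rewrite oner_eq0.
have := metric_pos hg' (coords_atlas hc) cp Np v0.
rewrite (hgg' hc cp Wp Np) mx_formE big1 ?ltxx// => j _; rewrite big1// => i _.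
rewrite !mxE f0 expr0n/= mul0r.
have [e|i0] := eqVneq i (Ordinal k0); last by rewrite !mul0r.
case: ifP => [_|_]; first by rewrite mulr0 mul0r.
case: ifP => [/andP[ki' _]|_]; last by rewrite mulr0 mul0r.
by move: ki'; rewrite e => h0; have := leq_trans ki h0.
Qed.

Lemma near_dens c p : coords c -> cdom c p -> W p -> ~ N p ->
  dens S g' c (cmap c p) = `|f p| ^+ k * dens S g c (cmap c p).
Proof.
move=> hc cp Wp Np; have [_ _ _ _ hd] := hcoords.
by rewrite /dens (cinvK cp) (hgg' hc cp Wp Np) det_scale_block// => i j; exact: hd.
Qed.

Lemma near_form c p (v : 'rV[R]_m) : coords c -> cdom c p -> W p -> ~ N p ->
  (v *m invmx (metric_in S c g' p) *m v^T) 0 0 =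
  ((v *m block_diag k (f p)^-1) *m invmx (metric_in S c g p) *m (v *m block_diag k (f p)^-1)^T) 0 0.
Proof.
move=> hc cp Wp Np; have [_ _ _ _ hd] := hcoords.
rewrite (hgg' hc cp Wp Np) inv_scale_block//; first exact: f_neq0 hc cp Wp Np.
  exact: (metric_in_unitmx hg (coords_atlas hc) cp I).
by move=> i j; exact: hd.
Qed.

(** |f| in coordinates, extended by 0 to N so as to be measurable on the whole cube. *)
Definition chart_weight c (x : 'rV[R]_m) : R := if x \in cimg c U then `|f (cinv c x)| else 0.

Lemma chart_weight_measurable c : atlas S c ->
  measurable_fun (cimg c U : set (borel 'rV[R]_m)) (fun x : borel 'rV[R]_m => `|f (cinv c x)|) /\
  measurable_fun setT (chart_weight c : borel 'rV[R]_m -> R).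
Proof.
move=> hc; have oC := open_cimg (c := c) oU.
have m1 : measurable_fun (cimg c U : set (borel 'rV[R]_m)) (fun x : borel 'rV[R]_m => `|f (cinv c x)|).
  apply: (cont_measurable oC (f := fun x => `|f (cinv c x)|)) => x hx.
  by apply: continuous_comp; [exact: (hf hc hx)|exact: norm_continuous].
split=> //; have mC : measurable (cimg c U : set (borel 'rV[R]_m)) by exact: open_borel.
have := (measurable_restrictT (fun x : borel 'rV[R]_m => `|f (cinv c x)|) mC).1 m1.
by congr measurable_fun; apply/funext => x; rewrite patchE.
Qed.

(** The volume density of g is bounded below on the closed cube, so integrability for the measure of
    g transfers to Lebesgue measure. *)
Lemma chart_weight_intg c a (h : R) : atlas S c -> 0 < h -> cbox a (a + const_mx h) `<=` cmap c @` cdom c ->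
  lam.-integrable (cube a h) (EFin \o (fun x => chart_weight c x `^ ((m * k)%:R / 2 + eps))).
Proof.
set p0 := _ + eps; move=> hc h0 sub; have mQ := mcube a h.
have [m1 mF] := chart_weight_measurable hc; have oC := open_cimg (c := c) oU.
have p00 : 0 < p0 by rewrite ltr_wpDl// divr_ge0.
have mFp : measurable_fun (cube a h : set (borel 'rV[R]_m)) (fun x : borel 'rV[R]_m => chart_weight c x `^ p0).
  exact: (measurableT_comp (measurable_powR p0) (measurable_funTS mF)).
have sub' : cbox a (a + const_mx h) `<=` cimg c setT by move=> x /sub[q cq <-]; exact: cimg_mem.
have [C C0 hC] := metric_bounds openT hg hc (@compact_cbox R m a (a + const_mx h)) sub'.
pose A : set (borel M) := cell c a h `&` U.
have mA : measurable A by apply: measurableI => //; exact: cell_measurable.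
have AU : A `<=` cdom c `&` setT by move=> q [[cq _] _].
have mf : measurable_fun (U : set (borel M)) (fun q : borel M => `|f q| `^ p0).
  have [mf _] := hfp; apply: (measurableT_comp (measurable_powR p0)).
  by apply: measurableT_comp => //; exact: normr_measurable.
have mfA : measurable_fun A (fun q : borel M => `|f q| `^ p0) by apply: measurable_funS mf => // q [].
have fin : (\int[mu]_(q in A) (`|f q| `^ p0)%:E < +oo)%E.
  have [_] := hfp; apply: le_lt_trans; apply: ge0_subset_integral => //.
  - by apply/measurable_EFinP.
  - by move=> q [].
move: fin; rewrite (chart_integral openT hg hmu hc mA AU mfA) cell_image => fin.
pose D : set (borel 'rV[R]_m) := cube a h `&` cimg c U.
have mD : measurable D by apply: measurableI => //; exact: open_borel.
have mfp : measurable_fun D (fun x : borel 'rV[R]_m => `|f (cinv c x)| `^ p0).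
  apply: (measurableT_comp (measurable_powR p0)); apply: measurable_funS m1 => //; last by move=> x [].
  exact: open_borel.
have md : measurable_fun D (dens S g c : borel 'rV[R]_m -> R).
  have oT := open_cimg (c := c) openT.
  have := cont_measurable oT (dens_smooth openT hg 0 hc).
  apply: measurable_funS; first exact: open_borel.
  by move=> x [_ [q [cq _] <-]]; exact: cimg_mem.
apply/integrableP; split; first by apply/measurable_EFinP.
have -> : (\int[lam]_(x in cube a h) `|(EFin \o (fun x => chart_weight c x `^ p0)%R) x| =
    \int[lam]_(x in D) (`|f (cinv c x)| `^ p0)%:E)%E.
  rewrite /D integral_mkcondr; apply: eq_integral => x _; rewrite patchE /chart_weight /=; case: ifP => _.
    by rewrite ger0_norm// powR_ge0.
  by rewrite powR0 ?gt_eqF// normr0.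
apply: (@le_lt_trans _ _ (\int[lam]_(x in D) (C%:E * (dens S g c x * `|f (cinv c x)| `^ p0)%:E))%E).
  apply: ge0_le_integral => //.
  - by apply/measurable_EFinP.
  - by apply/measurable_EFinP; apply: measurable_funM => //; apply: measurable_funM.
  - move=> x [Qx _]; rewrite -EFinM lee_fin mulrA ler_peMl ?powR_ge0//.
    have [dC _ _] := hC x (hbox_cbox Qx).
    by rewrite -(@ler_pM2l _ C) // mulfV ?gt_eqF// in dC.
rewrite ge0_integralZl//.
- by apply: lte_mul_pinfty => //; rewrite lee_fin ltW.
- by apply/measurable_EFinP; apply: measurable_funM.
- by move=> x _; rewrite lee_fin mulr_ge0 ?powR_ge0// sqrtr_ge0.
- by rewrite lee_fin ltW.
Qed.

Lemma near_chart p : N p -> exists c a (h : R),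
  [/\ coords c, cdom c p, 0 < h, cbox a (a + const_mx h) `<=` cimg c (cdom c `&` W) & obox a (a + const_mx h) (cmap c p)].
Proof.
move=> Np; have [_ hcov _ _ _] := hcoords; have [c hc cp] := hcov p Np.
have oV : open (cdom c `&` W) by apply: openI => //; exact: cdom_open.
have [a [h [h0 sub ap]]] := small_closed_cube (open_cimg (c := c) oV) (cimg_mem cp (conj cp (NW Np))).
by exists c, a, h.
Qed.

(** The density of g' is |f|^k times that of g, and its inverse is divided by f^2 in the k normal
    directions. Ellipticity thus rests on a lower bound for |f|^(k-2) and, if there are tangential
    directions, for |f|^k: these are the two halves of [flow]. *)
Lemma good_cube_near p : N p -> exists c a h,
  [/\ good_cube S U g' c a h, cdom c p & obox a (a + const_mx h) (cmap c p)].
Proof.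
move=> Np; have [c [a [h [hc cp h0 sub ap]]]] := near_chart Np.
exists c, a, h; split => //; have hca := coords_atlas hc.
have subd : cbox a (a + const_mx h) `<=` cmap c @` cdom c by move=> x /sub[q [cq _] <-]; exists q.
have subT : cbox a (a + const_mx h) `<=` cimg c setT by move=> x /sub[q [cq _] <-]; exact: cimg_mem.
have [C C0 hC] := metric_bounds openT hg hca (@compact_cbox R m a (a + const_mx h)) subT.
have m2 : (2 <= m)%N by apply: leq_trans hmn; rewrite leq_addl.
have inW q : cdom c q -> cube a h (cmap c q) -> W q.
  move=> cq /hbox_cbox/sub[q' [_ [cq' Wq'] e]].
  by rewrite -(cmap_inj cq' cq e).
have F0 x : 0 <= chart_weight c x by rewrite /chart_weight; case: ifP.
apply: (good_cube_intro oU hg' (ltnW k_ge2) m2 k_ge2 eps0 (ltW C0) hca h0 subd F0).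
- by apply: measurable_funTS; have [] := chart_weight_measurable hca.
- exact: chart_weight_intg.
- move=> x Qx; rewrite /cweight indicE /chart_weight; case: ifPn => [|_]; last first.
    by rewrite mul0r mulr_ge0 ?(ltW C0)// exprn_ge0.
  rewrite inE => -[q [cq Uq] qx]; rewrite mul1r -qx (cinvK cq) near_dens//; last by apply: inW => //; rewrite qx.
  rewrite mulrC ler_wpM2r ?exprn_ge0//.
  by have [_ + _] := hC x (hbox_cbox Qx); rewrite qx.
have [b b0 hb] := flow.
exists (C^-1 * C^-1 * b); first by rewrite !mulr_gt0 ?invr_gt0.
move=> q v cq Uq Qq; have Wq := inW q cq Qq.
have [dC _ /(_ (v *m block_diag k (f q)^-1))[h1 _]] := hC _ (hbox_cbox Qq).
rewrite (cinvK cq) in h1.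
rewrite (near_dens hc cq Wq Uq) (near_form _ hc cq Wq Uq).
have f0 := f_neq0 hc cq Wq Uq.
set X := (_ *m _) 0 0 in h1 *; set w := v *m block_diag k (f q)^-1 in h1 *.
have s0 : 0 <= \sum_i w 0 i ^+ 2 by apply: sumr_ge0 => i _; exact: sqr_ge0.
have Ci : 0 <= C^-1 by rewrite invr_ge0 ltW.
have h2 : C^-1 * (C^-1 * \sum_i w 0 i ^+ 2) <= dens S g c (cmap c q) * X.
  by apply: ler_pM => //; rewrite mulr_ge0.
have h3 : b * (\sum_i v 0 i ^+ 2) <= `|f q| ^+ k * \sum_i w 0 i ^+ 2.
  rewrite !mulr_sumr; apply: ler_sum => i _; rewrite /w mul_block_diag.
  have [hb1 hb2] := hb q Uq; case: ltnP => ik.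
    rewrite exprMn exprVn -(real_normK (num_real (f q))) -(subnK k_ge2) exprD.
    have fn : `|f q| ^+ 2 != 0 by rewrite expf_neq0// normr_eq0.
    have -> : `|f q| ^+ (k - 2) * `|f q| ^+ 2 * (v 0 i ^+ 2 / `|f q| ^+ 2) = `|f q| ^+ (k - 2) * v 0 i ^+ 2 by exact: mul_cancel_mid.
    by rewrite ler_wpM2r ?sqr_ge0.
  rewrite ler_wpM2r ?sqr_ge0//; apply: hb2.
  by have := ltn_ord i; case: (posnP n) => // n0; rewrite n0 subn0 in ik; rewrite ltnNge ik.
rewrite -mulrA -[leRHS]mulrA; apply: (@le_trans _ _ (`|f q| ^+ k * (C^-1 * (C^-1 * \sum_i w 0 i ^+ 2)))).
  rewrite -!mulrA; have -> : `|f q| ^+ k * (C^-1 * (C^-1 * \sum_i w 0 i ^+ 2)) = C^-1 * (C^-1 * (`|f q| ^+ k * \sum_i w 0 i ^+ 2)) by ring.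
  by rewrite !ler_wpM2l.
by rewrite ler_wpM2l// exprn_ge0.
Qed.

(** * Cutoffs of bounded energy and the constant function *)

Hypothesis hM : compact [set: M].
Variable mu' : {measure set (borel M) -> \bar R}.
Hypothesis hmu' : riemannian_measure S U g' mu'.
Local Notation energy := (fun u => inner g' (grad S g' u) (grad S g' u)).

Lemma grad_norm_in c u p : atlas S c -> cdom c p -> U p -> differentiable (u \o cinv c) (cmap c p) ->
  energy u p = (dloc c u p *m invmx (metric_in S c g' p) *m (dloc c u p)^T) 0 0.
Proof.
move=> hc cp Up du; have uG := metric_in_unitmx hg' hc cp Up.
rewrite (inner_in _ _ _ hc cp) (grad_in hc cp du (metric_unitmx hg' Up)) trmx_mul trmx_inv (metric_sym hg')//.
by rewrite (mulmxKV uG) mulmxA.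
Qed.

Lemma intg_indic_fin (d : measure_display) (T : measurableType d) (nu : {measure set T -> \bar R}) (D B : set T) :
  measurable D -> (nu D < +oo)%E -> measurable B -> nu.-integrable D (EFin \o (\1_B : T -> R)).
Proof.
move=> mD fD mB; apply: (bounded_intg (C := 1)) => //.
by move=> x _; rewrite indicE; case: (_ \in _); rewrite ?normr1 ?normr0.
Qed.

Definition cut c (b : M -> R) (j : nat) : M -> R := fun q => b q * radial k j (cmap c q).

Lemma cut_smooth c b K j l : coords c -> (forall l, MCk S l setT b) -> compact K -> K `<=` cdom c ->
  (forall q, ~ K q -> b q = 0) -> MCk S l setT (cut c b j).
Proof.
move=> hc sb cK KV b0; have hca := coords_atlas hc; have oc := @cdom_open _ _ _ c.
apply: (MCk_zero_ext oc cK KV) => [q nK|]; first by rewrite /cut b0// mul0r.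
apply: MCk_local => q cq; exists c, (cdom c); split; [by []|by []|by []|by []|].
have oC := open_cimg (c := c) oc.
apply: (Ck_ext oC) (CkM oC (Ck_sub (cimg_sub (c := c) (@subsetT _ _)) (sb l c hca)) (Ck_radial k l j oC)).
by move=> x /cimgE[_ _ _ xx]; rewrite /= /cut /= xx.
Qed.

Lemma cut_ge0_le1 c b j : (forall q, 0 <= b q <= 1) -> forall q, 0 <= cut c b j q <= 1.
Proof.
move=> hb q; have /andP[b0 b1] := hb q; rewrite /cut /radial mulr_ge0 ?step_ge0//=.
by rewrite mulr_ile1 ?step_ge0 ?step_le1.
Qed.

(** Only normal derivatives see the radial factor and cost 2^j; in the tangential directions the
    bump alone is differentiated. *)
Lemma cut_derive_le c a (h : R) b K : coords c -> 0 < h -> cbox a (a + const_mx h) `<=` cimg c (cdom c `&` W) ->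
  (forall l, MCk S l setT b) -> (forall q, 0 <= b q <= 1) -> compact K -> K `<=` cell c a h ->
  (forall q, ~ K q -> b q = 0) ->
  exists2 L : R, 0 <= L & forall j q (i : 'I_m), cdom c q -> cube a h (cmap c q) ->
    `|dloc c (cut c b j) q 0 i| <= if 4 ^+ j * rho k (cmap c q) <= 2 then (if (i < k)%N then L * 2 ^+ j else L) else 0.
Proof.
move=> hc h0 sub sb hb cK KV b0; have hca := coords_atlas hc.
have subT : cbox a (a + const_mx h) `<=` cimg c setT by move=> x /sub[q [cq _] <-]; exact: cimg_mem.
have [_ db] := sb 1%N c hca; have [dfb _] := sb 1%N c hca.
have /choice[C hC] : forall i : 'I_m, exists C : R, 0 <= C /\ forall x, cbox a (a + const_mx h) x ->
    `|pderiv (b \o cinv c) i x| <= C.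
  move=> i; have [C C0 hC] := compact_bnd (@compact_cbox R m a (a + const_mx h)) (fun x hx => db (delta_mx 0 i) _ (subT x hx)).
  by exists C.
have [Cr Cr0 hr] := @radial_derive_le R m k.
pose L0 := \sum_i C i; have L00 : 0 <= L0 by apply: sumr_ge0 => i _; have [] := hC i.
have CL i : C i <= L0 by rewrite /L0 (bigD1 i)//= lerDl; apply: sumr_ge0 => j _; have [] := hC j.
exists (L0 + Cr); first exact: addr_ge0.
move=> j q i cq Qq; have [_ hi] := hC i; have hLb := hi _ (hbox_cbox Qq).
case: ifPn => [r2|]; last first.
  rewrite -ltNge => r2.
  pose O : set M := cdom c `&` cmap c @^-1` [set x | 2 < 4 ^+ j * rho k x].
  have oO : open O.
    apply: open_preimage; [exact: cdom_open|exact: cmap_cont|].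
    have : open ([set: 'rV[R]_m] `&` (fun x => 4 ^+ j * rho k x) @^-1` [set r | 2 < r]).
      apply: open_preimage => //; first exact: openT.
      by move=> x _; exact: (CkZ (4 ^+ j) openT (Ck_rho k 0 openT) _ I).
    by rewrite setTI.
  rewrite (dloc_eq0 oO cq (conj cq r2)) ?mxE ?normr0// => q' [cq' r2'].
  by rewrite /cut /radial step_le0 ?mulr0// subr_le0 ltW.
have -> : dloc c (cut c b j) q 0 i = b q * pderiv (radial k j) i (cmap c q) + radial k j (cmap c q) * pderiv (b \o cinv c) i (cmap c q).
  have cx : \forall y \near cmap c q, (b \o cinv c) y * radial k j y = (cut c b j \o cinv c) y.
    apply: (near_open (open_cimg (c := c) openT) (cimg_mem cq I)) => y /cimgE[_ _ _ yy].
    by rewrite /= /cut yy.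
  rewrite mxE /pderiv -(near_eq_derive _ cx).
  have -> : (fun y => (b \o cinv c) y * radial k j y) = (b \o cinv c) * radial k j by [].
  have [dr _] := Ck_radial k 1 j (@openT 'rV[R]_m).
  rewrite deriveM; [|exact: (diff_derivable (dfb _ (cimg_mem cq I)))|exact: (diff_derivable (dr _ I))].
  by rewrite /= (cinvK cq).
have := hr j (cmap c q) i r2; set d1 := pderiv (radial k j) i _; set d2 := pderiv _ i _ in hLb * => hd1.
have p2 : 1 <= (2 : R) ^+ j by rewrite exprn_ege1// ler1n.
have /andP[bq0 bq1] := hb q.
apply: (le_trans (ler_normD _ _)); have rad0 : 0 <= radial k j (cmap c q) by exact: step_ge0.
rewrite (normrM (b q) d1) (normrM (radial k j (cmap c q)) d2) (ger0_norm bq0) (ger0_norm rad0).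
have h1 : b q * `|d1| <= `|d1| by rewrite ler_piMl.
have h2 : radial k j (cmap c q) * `|d2| <= L0.
  by apply: (le_trans _ (le_trans hLb (CL i))); rewrite ler_piMl// step_le1.
have h3 := lerD h1 h2; apply: (le_trans h3); move: hd1; case: ifP => _ hd1.
  rewrite mulrDl addrC; apply: lerD => //.
  by rewrite -[leLHS]mulr1 ler_wpM2l.
by move: hd1 Cr0; lra.
Qed.

Lemma chart_weight_pow_intg c a (h : R) : atlas S c -> 0 < h -> cbox a (a + const_mx h) `<=` cmap c @` cdom c ->
  lam.-integrable (cube a h) (EFin \o (fun x => chart_weight c x ^+ k)).
Proof.
move=> hc h0 sub; have iF := chart_weight_intg hc h0 sub; have mQ := mcube a h.
have [_ mF] := chart_weight_measurable hc.
have i1 : lam.-integrable (cube a h) (EFin \o cst (1 : R)).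
  by apply: (bounded_intg (C := 1)) => //; [exact: cube_fin (ltW h0)|move=> x _; rewrite normr1].
apply: (intg_le mQ _ _ (intgD mQ i1 iF)).
  by apply: measurable_funX; exact: measurable_funTS.
have m2 : (2 <= m)%N by apply: leq_trans hmn; rewrite leq_addl.
have kp : k%:R <= (m * k)%:R / 2 + eps :> R.
  have : 2%:R * k%:R <= (m * k)%:R :> R by rewrite -natrM ler_nat leq_mul2r m2 orbT.
  by move: eps0 => e0 hh; lra.
move=> x Qx; have F0 : 0 <= chart_weight c x by rewrite /chart_weight; case: ifP.
rewrite ger0_norm ?exprn_ge0//.
by have := young_powR F0 (@ltr01 R) kp; rewrite expr1n powR1 mulr1.
Qed.

Lemma pow_balance (x : R) j : 0 <= x -> 4 ^+ j * x ^+ (k - 2) <= (2 ^+ j) ^+ k + x ^+ k.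
Proof.
move=> x0; have e4 : (4 : R) ^+ j = (2 ^+ j) ^+ 2 by rewrite exprAC; congr (_ ^+ _); ring.
have p2 : 0 < (2 : R) ^+ j by rewrite exprn_gt0.
have ek (y : R) : y ^+ k = y ^+ 2 * y ^+ (k - 2) by rewrite -exprD addnC subnK// k_ge2.
rewrite e4; have [xj|jx] := leP x (2 ^+ j).
  apply: (@le_trans _ _ ((2 ^+ j) ^+ k)); last by rewrite lerDl exprn_ge0.
  by rewrite ek ler_wpM2l ?exprn_ge0 ?(ltW p2)// lerXn2r// nnegrE// ltW.
apply: (@le_trans _ _ (x ^+ k)); last by rewrite lerDr exprn_ge0// exprn_ge0.
by rewrite ek ler_wpM2r ?exprn_ge0// lerXn2r// ?nnegrE ?(ltW p2)// ltW.
Qed.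

Lemma energy_ge0 u q : U q -> 0 <= energy u q.
Proof. by move=> Uq; exact: (semi_ip_ge0 (field_form_ip hg' Uq)). Qed.

Lemma energy_continuous u : MCk S 1 setT u -> MCk S 0 U (energy u).
Proof.
by move=> su; apply: (inner_smooth oU hg') => d i hd; apply: (grad_smooth oU hg') => //; exact: MCk_sub (@subsetT _ U) su.
Qed.

Lemma energy_measurable u : MCk S 1 setT u -> measurable_fun (U : set (borel M)) (energy u : borel M -> R).
Proof. by move=> su; apply: (cont_measurable oU) => q Uq; exact: (MCk_cont oU (energy_continuous su)). Qed.

(** Tangential derivatives cost |f|^k and normal ones 4^j |f|^(k-2), both dominated through
    [pow_balance] by the function [G]. Its term (2^j)^k is confined to the slab, where its integral
    is at most 4^k h^(m-k), independently of j. *)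
Lemma cut_energy c a (h : R) b K : coords c -> 0 < h -> cbox a (a + const_mx h) `<=` cimg c (cdom c `&` W) ->
  (forall l, MCk S l setT b) -> (forall q, 0 <= b q <= 1) -> compact K -> K `<=` cell c a h ->
  (forall q, ~ K q -> b q = 0) ->
  exists E : R, forall j, (\int[mu']_(q in U) (energy (cut c b j) q)%:E <= E%:E)%E.
Proof.
move=> hc h0 sub sb hb cK KV b0; have hca := coords_atlas hc.
have subd : cbox a (a + const_mx h) `<=` cmap c @` cdom c by move=> x /sub[q [cq _] <-]; exists q.
have subT : cbox a (a + const_mx h) `<=` cimg c setT by move=> x /sub[q [cq _] <-]; exact: cimg_mem.
have KVd : K `<=` cdom c by move=> q /KV[].
have [C C0 hC] := metric_bounds openT hg hca (@compact_cbox R m a (a + const_mx h)) subT.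
have [L L0 hL] := cut_derive_le hc h0 sub sb hb cK KV b0.
have mQ := mcube a h.
pose F := chart_weight c; have F0 x : 0 <= F x by rewrite /F /chart_weight; case: ifP.
have iFk := chart_weight_pow_intg hca h0 subd.
pose B : R := C * C * (m%:R * L ^+ 2).
have B0 : 0 <= B by rewrite !mulr_ge0 ?(ltW C0) ?sqr_ge0.
pose I0 := \int[lam]_(x in cube a h) F x ^+ k.
exists (B * (4 ^+ k * h ^+ (m - k) + 2 * I0)) => j.
have scut l := cut_smooth j l hc sb cK KVd b0.
have me := energy_measurable (scut 1%N).
have e0 q : U q -> 0 <= energy (cut c b j) q := @energy_ge0 (cut c b j) q.
have es : MCk S 0 U (energy (cut c b j)) := energy_continuous (scut 1%N).
have mC := @cell_measurable _ _ _ c a h.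
have -> : (\int[mu']_(q in U) (energy (cut c b j) q)%:E = \int[mu']_(q in cell c a h `&` U) (energy (cut c b j) q)%:E)%E.
  rewrite setIC integral_mkcondr; apply: eq_integral => q; rewrite inE => Uq; rewrite patchE; case: ifPn => //.
  rewrite notin_setE => nq; have nK : ~ K q by move=> /KV.
  congr (_%:E); apply: inner0l; apply: (grad_eq0 S g' (closed_openC (manifold_compact_closed S cK)) nK).
  by move=> q' /b0 z; rewrite /cut z mul0r.
have AU : cell c a h `&` U `<=` cdom c `&` U by move=> q [[]].
have mA : measurable (cell c a h `&` U : set (borel M)) by apply: measurableI => //; exact: open_borel.
have meA : measurable_fun (cell c a h `&` U : set (borel M)) (energy (cut c b j) : borel M -> R) by apply: measurable_funS me => // q [].
rewrite (chart_integral oU hg' hmu' hca mA AU meA) cell_image.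
have msl : measurable (slab k j a h : set (borel 'rV[R]_m)) by exact: mhbox.
pose G x : R := B * ((2 ^+ j) ^+ k * \1_(slab k j a h) x + 2 * F x ^+ k).
have isl : lam.-integrable (cube a h) (EFin \o (\1_(slab k j a h) : 'rV[R]_m -> R)).
  by apply: intg_indic_fin => //; exact: cube_fin (ltW h0).
have iG0 := intgD mQ (intgZ mQ ((2 ^+ j) ^+ k) isl) (intgZ mQ 2 iFk).
have iG : lam.-integrable (cube a h) (EFin \o G) := intgZ mQ B iG0.
have G0 x : 0 <= G x.
  by rewrite mulr_ge0// addr_ge0// ?mulr_ge0// exprn_ge0.
apply: (@le_trans _ _ (\int[lam]_(x in cube a h) (G x)%:E)%E); last first.
  have -> : (\int[lam]_(x in cube a h) (G x)%:E = (\int[lam]_(x in cube a h) G x)%:E)%E.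
    by rewrite /Rintegral fineK//; exact: integrable_fin_num.
  rewrite lee_fin (RintegralZl _ mQ iG0) ler_wpM2l//.
  rewrite (RintegralD mQ (intgZ mQ _ isl) (intgZ mQ 2 iFk)) (RintegralZl _ mQ iFk) (RintegralZl _ mQ isl).
  rewrite -/I0 lerD2r -(slab_volume j a (leq_subr n m) (ltW h0)) ler_wpM2l ?exprn_ge0//.
  have slfin := slab_fin k j a (ltW h0).
  rewrite /Rintegral integral_indic//; apply: fine_le.
  - by rewrite ge0_fin_numE//; apply: le_lt_trans slfin; apply: le_measure; rewrite ?inE//; exact: measurableI.
  - by rewrite ge0_fin_numE.
  - by apply: le_measure; rewrite ?inE//; exact: measurableI.
pose D : set (borel 'rV[R]_m) := cube a h `&` cimg c U.
have oC := open_cimg (c := c) oU.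
have mD : measurable D by apply: measurableI => //; exact: open_borel.
apply: (@le_trans _ _ (\int[lam]_(x in D) (G x)%:E)%E); last first.
  apply: (@ge0_subset_integral _ _ _ lam D (cube a h) mD mQ (EFin \o G)); last by move=> x [].
    by apply/measurable_EFinP; exact: intg_measurable iG.
  by move=> x _; rewrite lee_fin.
have mde : measurable_fun (cimg c U : set (borel 'rV[R]_m)) (fun x : borel 'rV[R]_m => dens S g' c x * energy (cut c b j) (cinv c x)).
  apply: (cont_measurable oC (f := fun x => dens S g' c x * energy (cut c b j) (cinv c x))).
  exact: (CkM oC (dens_smooth oU hg' 0 hca) (es c hca)).
apply: ge0_le_integral; first exact: mD.
- by move=> x [Qx [q [cq Uq] <-]]; rewrite (cinvK cq) lee_fin mulr_ge0 ?e0// sqrtr_ge0.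
- apply/measurable_EFinP; apply: measurable_funS mde; first exact: open_borel.
  by move=> x [].
- apply/measurable_EFinP; apply: measurable_funS (intg_measurable iG); first exact: mQ.
  by move=> x [].
move=> x [Qx [q [cq Uq] qx]]; rewrite -qx in Qx *; rewrite (cinvK cq) lee_fin.
have Wq : W q.
  have [q' [_ [cq' Wq'] e]] := sub _ (hbox_cbox Qx).
  by rewrite -(cmap_inj cq' cq e).
have [df _] := scut 1%N c hca; have {}df := df _ (cimg_mem cq I).
rewrite (grad_norm_in hca cq Uq df) (near_form _ hc cq Wq Uq) (near_dens hc cq Wq Uq).
set w := _ *m block_diag k _; have [_ dC /(_ w)[_ h1]] := hC _ (hbox_cbox Qx).
rewrite (cinvK cq) in h1.
have Fq : F (cmap c q) = `|f q| by rewrite /F /chart_weight mem_set ?(cinvK cq)//; exact: cimg_mem.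
have s0 : 0 <= \sum_i w 0 i ^+ 2 by apply: sumr_ge0 => i _; exact: sqr_ge0.
have f0 : f q != 0 := f_neq0 hc cq Wq Uq.
have fk0 : 0 <= `|f q| ^+ k by rewrite exprn_ge0.
have key : `|f q| ^+ k * \sum_i w 0 i ^+ 2 <= m%:R * L ^+ 2 * ((2 ^+ j) ^+ k * \1_(slab k j a h) (cmap c q) + 2 * F (cmap c q) ^+ k).
  have sl0 : 0 <= (2 ^+ j) ^+ k * \1_(slab k j a h) (cmap c q) + 2 * F (cmap c q) ^+ k.
    by rewrite addr_ge0// mulr_ge0 ?exprn_ge0.
  have wE i := mul_block_diag k (f q)^-1 (dloc c (cut c b j) q) i; rewrite -/w in wE.
  have [r2|r2] := boolP (4 ^+ j * rho k (cmap c q) <= 2); last first.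
    rewrite big1 ?mulr0; first by rewrite mulr_ge0// mulr_ge0// sqr_ge0.
    move=> i _; have := hL j q i cq Qx; rewrite (negbTE r2) normr_le0 => /eqP d0.
    by rewrite wE d0 mul0r; case: ifP; rewrite expr0n.
  have p2 : 0 < (2 : R) ^+ j by rewrite exprn_gt0.
  have -> : \1_(slab k j a h) (cmap c q) = 1 :> R.
    rewrite indicE mem_set// => i; rewrite !mxE; case: ifP => ik; last by have := (cubeP _ _ _).1 Qx i.
    have xi := le_lt_trans (rho_coord (cmap c q) ik) (_ : _ < (2 * (2 ^+ j)^-1) ^+ 2).
    have : `|cmap c q 0 i| < 2 * (2 ^+ j)^-1.
      rewrite -(@ltr_pXn2r _ 2) ?nnegrE ?mulr_ge0 ?invr_ge0 ?(ltW p2)// real_normK ?num_real//; apply: xi.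
      rewrite exprMn exprVn -exprM mulnC exprM; have -> : (2 : R) ^+ 2 = 4 by ring.
      by rewrite ltr_pdivlMr ?exprn_gt0// mulrC; lra.
    by rewrite ltr_norml => /andP[/ltW -> ->].
  rewrite mulr1 Fq mulr_sumr -mulrA -[m%:R * _](_ : \sum_(i < m) L ^+ 2 * ((2 ^+ j) ^+ k + 2 * `|f q| ^+ k) = _); last first.
    by rewrite sumr_cst card_ord.
  apply: ler_sum => i _; have := hL j q i cq Qx; rewrite r2 wE.
  have pj0 : 0 <= (2 ^+ j) ^+ k :> R by rewrite exprn_ge0// ltW.
  have L2 : 0 <= L ^+ 2 := sqr_ge0 L.
  have nsq (y z : R) : `|y| <= z -> y ^+ 2 <= z ^+ 2.
    by move=> yz; rewrite -(real_normK (num_real y)) lerXn2r ?nnegrE// (le_trans _ yz).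
  case: ifP => ik /nsq hd; last first.
    by apply: (le_trans (ler_wpM2l fk0 hd)); rewrite mulrC ler_wpM2l//; lra.
  have ek : `|f q| ^+ k = `|f q| ^+ (k - 2) * `|f q| ^+ 2 by rewrite -exprD subnK// k_ge2.
  have e4 : (4 : R) ^+ j = (2 ^+ j) ^+ 2 by rewrite exprAC; congr (_ ^+ _); ring.
  rewrite exprMn exprVn -(real_normK (num_real (f q))) {1}ek mul_cancel_mid; last by rewrite expf_neq0// normr_eq0.
  apply: (le_trans (ler_wpM2l _ hd)); first by rewrite exprn_ge0.
  rewrite exprMn mulrCA ler_wpM2l// -e4 mulrC; apply: (le_trans (pow_balance j (normr_ge0 (f q)))); lra.
have d0 : 0 <= dens S g c (cmap c q) by rewrite sqrtr_ge0.
rewrite -mulrA; apply: (@le_trans _ _ (`|f q| ^+ k * (C * (C * \sum_i w 0 i ^+ 2)))).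
  apply: ler_wpM2l => //; apply: ler_pM => //.
  have h2 := (hC _ (hbox_cbox Qx)); have [_ _ /(_ w)[h3 _]] := h2; rewrite (cinvK cq) in h3.
  by apply: le_trans h3; rewrite mulr_ge0// invr_ge0 ltW.
have -> : `|f q| ^+ k * (C * (C * \sum_i w 0 i ^+ 2)) = C * C * (`|f q| ^+ k * \sum_i w 0 i ^+ 2) by ring.
by rewrite /G /B -[leRHS]mulrA ler_wpM2l ?mulr_ge0 ?(ltW C0).
Qed.

(** Being 1 on a neighbourhood of each point of N in [O], and not merely on N, is what makes
    products of the functions 1 - w j vanish near N and have compact support off N. *)
Definition cutoff_family (O : set M) (w : nat -> M -> R) (E : R) := [/\ forall j l, MCk S l setT (w j), forall j q, 0 <= w j q <= 1 &
  [/\ forall j q, O q -> N q -> \forall q' \near q, w j q' = 1,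
     forall q, U q -> exists J, forall j, (J <= j)%N -> w j q = 0 &
     forall j, (\int[mu']_(q in U) (energy (w j) q)%:E <= E%:E)%E]].

Lemma local_cutoffs p : N p -> exists O w (E : R), open O /\ O p /\ cutoff_family O w E.
Proof.
move=> Np; have [c [a [h [hc cp h0 sub ap]]]] := near_chart Np.
have [_ _ hN _ _] := hcoords.
pose V : set M := cdom c `&` cmap c @^-1` (obox a (a + const_mx h)).
have oV : open V.
  by apply: open_preimage; [exact: cdom_open|exact: cmap_cont|exact: open_obox].
have [psi [K [spsi psi0 psip cK [KV psiK]]]] := bump_exists S oV (conj cp ap).
(* The factor 2 / psi p makes b equal to 1 wherever psi > psi p / 2, which is the set [O] below. *)
pose b q := step (2 / psi p * psi q).
have sb l : MCk S l setT b.
  move=> d hd; apply: Ck_step; first by apply: open_cimg; exact: openT.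
  by apply: (CkZ (2 / psi p)); [apply: open_cimg; exact: openT|exact: spsi].
have hb q : 0 <= b q <= 1 by rewrite step_ge0 step_le1.
have b0 q : ~ K q -> b q = 0 by move=> nK; rewrite /b (psiK q nK) mulr0 step_le0.
have KC : K `<=` cell c a h.
  by move=> q /KV[cq aq]; split => // i; have /andP[h1 h2] := aq i; rewrite (ltW h1) h2.
have KD : K `<=` cdom c by move=> q /KC[].
have [E hE] := cut_energy hc h0 sub sb hb cK KC b0.
pose O : set M := [set q | psi p / 2 < psi q].
have oO : open O.
  have : open ([set: M] `&` psi @^-1` [set r | psi p / 2 < r]).
    apply: open_preimage => //; first exact: openT.
    by move=> q _; exact: (MCk_cont openT (spsi 0%N)).
  by rewrite setTI.
have OK q : O q -> K q.
  move=> Oq; apply: contrapT => nK; move: Oq; rewrite /O /= (psiK q nK) => h'; move: psip; lra.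
exists O, (cut c b), E; split => //; split; first by rewrite /O /=; lra.
split.
- by move=> j l; exact: (cut_smooth j l hc sb cK KD b0).
- by move=> j q; exact: cut_ge0_le1.
split=> //.
- move=> j q Oq Nq; have cq := KD _ (OK _ Oq).
  have rq : rho k (cmap c q) = 0.
    rewrite /rho big1// => i _; case: ifP => // ik.
    have : (N `&` cdom c) q by [].
    by rewrite (hN c hc) => -[_ h']; rewrite h'// expr0n.
  pose O' : set M := cdom c `&` cmap c @^-1` [set x | 4 ^+ j * rho k x < 1].
  have oO' : open O'.
    apply: open_preimage; [exact: cdom_open|exact: cmap_cont|].
    have : open ([set: 'rV[R]_m] `&` (fun x => 4 ^+ j * rho k x) @^-1` [set r | r < 1]).
      apply: open_preimage => //; first exact: openT.
      by move=> x _; exact: (CkZ (4 ^+ j) openT (Ck_rho k 0 openT) _ I).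
    by rewrite setTI.
  have O'q : O' q by split => //=; rewrite rq mulr0.
  apply: (near_open (openI oO oO') (conj Oq O'q)) => q' [Oq' [_ /= r1]].
  rewrite /cut /b /radial !step_ge1 ?mulr1//; first by lra.
  by rewrite mulrAC ler_pdivlMr// mul1r; move: Oq'; rewrite /O /=; lra.
- move=> q Uq; have [Kq|nK] := pselect (K q); last by exists 0%N => j _; rewrite /cut b0// mul0r.
  have cq := KD _ Kq.
  have r0 : 0 < rho k (cmap c q).
    rewrite lt_def rho_ge0 andbT; apply/eqP => r0; apply: Uq.
    suff : (N `&` cdom c) q by case.
    rewrite (hN c hc); split => // i ik; apply/eqP; rewrite -sqrf_eq0 eq_le sqr_ge0 andbT.
    by have := rho_coord (cmap c q) ik; rewrite r0.
  have q0 : 0 <= (4^-1 : R) by [].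
  have q1 : (4^-1 : R) < 1 by rewrite invf_lt1// ltr1n.
  have r2 : 0 < rho k (cmap c q) / 2 by rewrite divr_gt0.
  have [J] := geometric_small 1 q0 q1 r2; rewrite mul1r exprVn => hJ.
  have p4 : 0 < (4 : R) ^+ J by rewrite exprn_gt0.
  exists J => j Jj; rewrite /cut /radial step_le0 ?mulr0// subr_le0.
  have h1 : 1 < 4 ^+ J * (rho k (cmap c q) / 2) by have := eqbRL (ltr_pM2l p4 _ _) hJ; rewrite mulfV// lt0r_neq0.
  have h2 : 4 ^+ J * (rho k (cmap c q) / 2) <= 4 ^+ j * (rho k (cmap c q) / 2).
    by rewrite ler_pM2r// ler_eXn2l// ltr1n.
  by move: h1 h2; move: (4 ^+ j) (4 ^+ J) => x y h1 h2; lra.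
Qed.

Hypothesis mu_fin : (mu' U < +oo)%E.
Local Notation D := (test_function S U).
Local Notation A := (laplacian S g').
Local Notation ip := (ipL2 U mu').
Local Notation H := (L2 U mu').

Lemma grad_cutoff u v q : MCk S 1 setT u -> MCk S 1 setT v ->
  grad S g' (fun p => (1 - u p) * v p) q = (1 - u q) *: grad S g' v q - v q *: grad S g' u q.
Proof.
move=> su sv; have cq := cdom_chart_at S q; have hc := atlas_chart_at S q.
have [du _] := su _ hc; have [dv _] := sv _ hc.
have {}du := du _ (cimg_mem cq I); have {}dv := dv _ (cimg_mem cq I).
rewrite /grad !scalemxAl -mulmxBl; congr (_ *m _); apply/rowP => i; rewrite !mxE.
set uc := u \o cinv (chart_at S q) in du *; set vc := v \o cinv (chart_at S q) in dv *.
have -> : (fun p => (1 - u p) * v p) \o cinv (chart_at S q) = ((fun=> 1) - uc) * vc by [].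
have d1 : derivable ((fun=> 1) - uc) (cmap (chart_at S q) q) (delta_mx 0 i).
  by apply: derivableB; [exact: derivable_cst|exact: diff_derivable].
rewrite deriveM//; last exact: diff_derivable.
rewrite deriveB; [|exact: derivable_cst|exact: diff_derivable].
rewrite derive_cst sub0r /uc /vc /= -[((fun=> 1) - uc) _]/(1 - u (cinv (chart_at S q) (cmap (chart_at S q) q))).
by rewrite (cinvK cq) scalerN.
Qed.

Lemma energy_cutoff u v q : MCk S 1 setT u -> MCk S 1 setT v -> 0 <= u q <= 1 -> 0 <= v q <= 1 -> U q ->
  energy (fun p => (1 - u p) * v p) q <= 2 * energy v q + 2 * energy u q.
Proof.
move=> su sv /andP[u0 u1] /andP[v0 v1] Uq; have hff := field_form_ip hg' Uq.
have e (X Y : M -> 'rV[R]_m) : inner g' X Y q = field_form g' q (X q) (Y q) by [].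
rewrite !e grad_cutoff//; apply: (le_trans (nipB_le hff I I)).
rewrite (nipZ hff)// (nipZ hff)//.
have h1 := energy_ge0 v Uq; have h2 := energy_ge0 u Uq; rewrite !e in h1 h2.
have s1 : (1 - u q) ^+ 2 <= 1 by rewrite expr_le1//; lra.
have s2 : v q ^+ 2 <= 1 by rewrite expr_le1.
by apply: lerD; rewrite ler_pM2l// ler_piMl.
Qed.

(** One factor is peeled off at a time: the energy of (1 - u) v is at most twice the sum of both
    energies, since u and v take values in [0, 1]. The constant grows with the number of factors but
    is independent of j. *)
Lemma product_cutoffs (I : Type) (r : seq I) (w : I -> nat -> M -> R) (E : I -> R) :
  (forall i j l, MCk S l setT (w i j)) -> (forall i j q, 0 <= w i j q <= 1) ->
  (forall i j, (\int[mu']_(q in U) (energy (w i j) q)%:E <= (E i)%:E)%E) ->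
  exists C : R, forall j, [/\ forall l, MCk S l setT (fun q => \prod_(i <- r) (1 - w i j q)),
    forall q, 0 <= \prod_(i <- r) (1 - w i j q) <= 1 &
    (\int[mu']_(q in U) (energy (fun q => \prod_(i <- r) (1 - w i j q)) q)%:E <= C%:E)%E].
Proof.
move=> sw w01 hE; elim: r => [|i r [C ih]].
  exists 0 => j; have e1 : (fun q : M => \prod_(i <- [::]) (1 - w i j q)) = fun=> 1.
    by apply/funext => q; rewrite big_nil.
  rewrite e1; split=> [l|q|]; first exact: MCk_cst.
    by rewrite big_nil ler01 lexx.
  by rewrite integral0_eq// => q _; rewrite inner0l// grad_cst.
exists (2 * C + 2 * E i) => j; have [sv v01 hv] := ih j.
have e1 : (fun q : M => \prod_(i0 <- i :: r) (1 - w i0 j q)) = fun q => (1 - w i j q) * \prod_(i0 <- r) (1 - w i0 j q).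
  by apply/funext => q; rewrite big_cons.
rewrite e1; split=> [l|q|].
- have h1 : MCk S l setT ((fun=> 1) + (fun q => (-1) * w i j q)).
    exact: (MCkD openT (MCk_cst l setT 1) (MCkM openT (MCk_cst l setT (-1)) (sw i j l))).
  have h2 := MCkM openT h1 (sv l).
  by apply: (MCk_ext openT _ h2) => q _; rewrite -[((fun=> 1) + _) q]/(1 + (-1) * w i j q) mulN1r.
- rewrite big_cons; have /andP[a0 a1] := w01 i j q; have /andP[b0 b1] := v01 q.
  by rewrite mulr_ge0 ?subr_ge0//= mulr_ile1 ?subr_ge0//; lra.
set v := fun q => \prod_(i0 <- r) (1 - w i0 j q) in sv v01 hv *.
have me := energy_measurable.
apply: (@le_trans _ _ (\int[mu']_(q in U) ((2%:E * (energy v q)%:E) + (2%:E * (energy (w i j) q)%:E)))%E).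
  apply: ge0_le_integral => //.
  - by move=> q Uq; rewrite lee_fin energy_ge0.
  - apply/measurable_EFinP; apply: me; have h := MCkM openT (MCkD openT (MCk_cst 1 setT 1) (MCkM openT (MCk_cst 1 setT (-1)) (sw i j 1%N))) (sv 1%N).
    by apply: (MCk_ext openT _ h) => q _; rewrite -[((fun=> 1) + _) q]/(1 + (-1) * w i j q) mulN1r.
  - by apply: emeasurable_funD; apply: measurable_funeM; apply/measurable_EFinP; apply: me.
  - move=> q Uq; rewrite -!EFinM -EFinD lee_fin; exact: (energy_cutoff (sw i j 1%N) (sv 1%N) (w01 i j q) (v01 q) Uq).
have n0 u q : U q -> (0 <= (energy u q)%:E)%E by move=> Uq; rewrite lee_fin energy_ge0.
have mv := me _ (sv 1%N); have mw := me _ (sw i j 1%N).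
rewrite ge0_integralD//; last 4 first.
- by move=> q Uq; rewrite mule_ge0// n0.
- by apply: measurable_funeM; apply/measurable_EFinP.
- by move=> q Uq; rewrite mule_ge0// n0.
- by apply: measurable_funeM; apply/measurable_EFinP.
rewrite ge0_integralZl//; [|by apply/measurable_EFinP|by move=> q; exact: n0].
rewrite ge0_integralZl//; [|by apply/measurable_EFinP|by move=> q; exact: n0].
rewrite [leRHS]EFinD; apply: leeD; rewrite EFinM; apply: lee_wpmul2l => //; exact: hE.
Qed.

Lemma trivial_or_local p : exists O w (E : R), open O /\ (N p -> O p) /\ cutoff_family O w E.
Proof.
have [Np|nN] := pselect (N p).
  by have [Q1 [w [E [h1 [h2 h3]]]]] := local_cutoffs Np; exists Q1, w, E.
exists set0, (fun _ _ => 0), 0; split; [exact: open0|split=> //]; split; [by move=> j l; exact: MCk_cst|by move=> j q; rewrite lexx ler01|].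
split => // [q _|j]; first by exists 0%N.
by rewrite integral0_eq// => q _; rewrite inner0l// grad_cst.
Qed.

(** Products of the functions 1 - w over a finite cover of N: they vanish near N and are eventually
    1 at each point off N, so dominated convergence on a space of finite measure gives the L2
    limit. *)
Lemma capacity_sequence : exists (v : nat -> M -> R) (C : R), [/\ forall j, D (v j),
  cvgH ip v (fun=> 1) & forall j, ip (A (v j)) (v j) <= C].
Proof.
have /choice[OO hOO] := trivial_or_local.
have /choice[w hww] := hOO.
have /choice[E hw] := hww.
have cpN : cover_compact N by rewrite -compact_cover; exact: subclosed_compact cN hM _.
have [G GN cov] := cpN M N OO (fun p Np => proj1 (hw p)) (fun p Np => ex_intro2 _ _ p Np ((proj2 (hw p)).1 Np)).
pose r := finmap.enum_fset G.
have [|||C hC] := @product_cutoffs M r w E; [by move=> p; have [_ [_ []]] := hw p|by move=> p; have [_ [_ []]] := hw p|by move=> p; have [_ [_ [_ _ []]]] := hw p|].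
pose v j q := \prod_(p <- r) (1 - w p j q).
have Dv j : D (v j).
  have [sv _ _] := hC j; apply/(test_functionP _ _ oU); split => //.
  (* The complement of the interior of the zero set is closed, hence compact; it avoids N because
     some factor vanishes near each point of N. *)
  exists (~` (v j @^-1` [set 0])°); split.
  - by apply: subclosed_compact hM _ => //; rewrite closedC; exact: open_interior.
  - move=> q; apply: contra_not => Nq; have [p Gp Oq] := cov q Nq.
    have [_ [_ [_ _ [h1 _ _]]]] := hw p; have := h1 j q Oq Nq.
    apply: filterS => q' h; rewrite /= /v (big_rem p)//=; first by rewrite h subrr mul0r.
  - by move=> q /contrapT /interior_subset.
have mv j : measurable_fun (U : set (borel M)) (v j : borel M -> R).
  have [sv _ _] := hC j; apply: (cont_measurable oU) => q _.
  exact: (MCk_cont openT (sv 0%N)).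
have v1 q : U q -> exists J, forall j, (J <= j)%N -> v j q = 1.
  move=> Uq; rewrite /v; elim: (r) => [|p s [J hJ]]; first by exists 0%N => j _; rewrite big_nil.
  have [_ [_ [_ _ [_ h _]]]] := hw p; have [J' hJ'] := h q Uq.
  exists (maxn J J') => j; rewrite geq_max => /andP[j1 j2].
  by rewrite big_cons (hJ j j1) (hJ' j j2) subr0 mulr1.
exists v, (Num.max C 0); split => //.
- rewrite /cvgH.
  have i1 := bounded_intg (f := cst (1 : R)) (C := 1) mU mu_fin (measurable_cst _) (fun _ _ => ltac:(by rewrite normr1)).
  have [] := @Rintegral_dominated_cvg _ (borel M) R mu' U (fun j q => (v j q - 1) * (v j q - 1)) (fun=> 0) (cst 1) mU.
  + move=> j; have h : measurable_fun (U : set (borel M)) (fun q : borel M => v j q - 1).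
      by apply: measurable_funB; [exact: mv|exact: measurable_cst].
    exact: measurable_funM.
  + move=> q Uq; have [J hJ] := v1 q Uq; apply: cvg_near_cst; exists J => // j /= /hJ ->.
    by rewrite subrr mul0r.
  + exact: i1.
  + move=> j q _; have [_ /(_ q)/andP[a0 a1] _] := hC j; rewrite /cst -/(v j q) in a0 a1 *.
    by rewrite ger0_norm; nra.
  by move=> _; rewrite Rintegral_cst// mul0r.
move=> j; have [sv v01 hv] := hC j.
have LG := test_field_L2 oU hg' mu_fin (test_grad oU hg' (Dv j)).
apply: (@le_trans _ _ (\int[mu']_(p in U) energy (v j) p)).
  exact: (eqbRL (le_eqVlt _ _) (introT orP (or_introl (introT eqP (laplacian_form hM oU hg' hmu' mu_fin (Dv j) (Dv j)))))).
rewrite le_max; apply/orP; left; rewrite -lee_fin; apply: le_trans hv.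
rewrite /Rintegral fineK//; exact: (integrable_fin_num mU (field_intg hM oU hg' LG LG)).
Qed.

(** Membership comes from [form_domain_bounded]. For a test function u, q(1, u) = <1, A u> = 0 by
    the divergence theorem. So if u is close to 1 in the form norm, q(1, 1) = - q(1, u - 1), and
    Cauchy-Schwarz gives q(1, 1) <= q(u - 1, u - 1), which is arbitrarily small. *)
Lemma one_form_domain : form_domain H ip D A (fun=> 1) /\
  form_ext (D := D) (ip := ip) (A := A) (fun=> 1) (fun=> 1) = 0.
Proof.
have hs := L2_semi_ip mu' oU; have hq := dirichlet_semi_ip hM oU hg' hmu' mu_fin.
have DH u (h : D u) := test_L2 oU mu_fin h.
have AH u (h : D u) := laplacian_L2 oU hg' hmu' mu_fin h.
have [v [C [Dv cv hC]]] := capacity_sequence.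
have F1 : form_domain H ip D A (fun=> 1) by exact: (form_domain_bounded hs hq DH (cst_L2 oU mu_fin 1) Dv cv hC).
split => //; have hF := form_ext_semi_ip hs hq DH AH.
pose q : (M -> R) -> (M -> R) -> R := form_ext (D := D) (ip := ip) (A := A).
rewrite -/q in hF *.
have q1v u : D u -> q (fun=> 1) u = 0.
  move=> Du; rewrite /q (form_ext_A hs hq DH AH F1 Du).
  have [K cK [KU Y0]] := test_field_support (test_grad oU hg' Du).
  have := divergence_theorem oU hg' hmu' mu_fin oU (fun _ h => h) (MCk_cst 1 U 1) (test_field_C1 oU (test_grad oU hg' Du)) cK KU Y0.
  have iA := L2_L1 oU mu_fin (divergence_L2 oU hg' hmu' mu_fin (test_grad oU hg' Du)).
  have -> : \int[mu']_(p in U) (inner g' (grad S g' (fun=> 1)) (grad S g' u) p + 1 * divergence S g' (grad S g' u) p) =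
     \int[mu']_(p in U) divergence S g' (grad S g' u) p.
    by apply: eq_Rintegral => p _; rewrite inner0l ?grad_cst// add0r mul1r.
  move=> d0; rewrite /ipL2.
  have -> : \int[mu']_(p in U) (1 * A u p) = \int[mu']_(p in U) (- 1 * divergence S g' (grad S g' u) p).
    by apply: eq_Rintegral => p _; rewrite mul1r mulN1r.
  by rewrite (RintegralZl _ mU iA) d0 mulr0.
have q0 := semi_ip_ge0 hF F1.
apply/eqP; rewrite eq_le q0 andbT; apply/ler_addgt0Pr => e e0; rewrite add0r.
have [u Du [_ hu]] := form_approxP hs hq DH AH F1 e0.
have Fu := form_domain_D hs hq DH AH Du.
have F2 := sipB hF Fu F1.
have h1 : q (fun=> 1) (u - (fun=> 1)) = - q (fun=> 1) (fun=> 1).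
  exact: (etrans (ipBr hF Fu F1 F1) (etrans (congr1 (fun z => z - _) (q1v u Du)) (sub0r _))).
have := ip_CS hF F1 F2; rewrite h1 sqrrN -/q; move: hu q0; rewrite -/q.
move: (q (fun=> 1) (fun=> 1)) (q (u - (fun=> 1)) (u - (fun=> 1))) => x y hu q0 h.
have [->|x0] := eqVneq x 0; first exact: ltW.
have xp : 0 < x by rewrite lt_def x0.
by rewrite -(ler_pM2l xp) -expr2 (le_trans h)// ler_pM2l// ltW.
Qed.

End NearSubmanifold.

(** * Assembly of the spectral theorem *)

Lemma form_null (R : realType) (V : lmodType R) (H D : set V) (ip : V -> V -> R) (A : V -> V)
    (q := form_ext (D := D) (ip := ip) (A := A)) u v :
  semi_ip H ip -> semi_ip D (fun u v => ip (A u) v) -> D `<=` H -> (forall u, D u -> H (A u)) ->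
  form_domain H ip D A u -> H v -> ip (v - u) (v - u) = 0 ->
  form_domain H ip D A v /\ q (v - u) (v - u) = 0.
Proof.
move=> hs hq DH AH Fu Hv z; have [Hu _] := Fu; have Hw := sipB hs Hv Hu; have D0 := semi_ip0 hq.
(* The zero sequence converges in [H] to every null vector, and it has no energy. *)
have ap : form_approx (D := D) (ip := ip) (A := A) (fun=> 0) (v - u).
  split=> //; last first.
    by move=> e e0; exists 0%N => i j _ _; rewrite subrr (ip0r hs (AH _ D0)).
  have c0 : ip (0 - (v - u)) (0 - (v - u)) = 0.
    by rewrite sub0r -z (ipNr hs Hw (sipN hs Hw)) (semi_ipC hs (sipN hs Hw) Hw) (ipNr hs Hw Hw) opprK.
  by rewrite /cvgH c0; exact: cvg_cst.
have Fw := form_approx_domain Hw ap.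
have hF := form_ext_semi_ip hs hq DH AH.
split; first by have := sipD hF Fw Fu; rewrite subrK.
have := form_ext_cvg hs hq DH AH Hw Hw ap ap.
have -> : (fun k : nat => ip (A 0) 0) = fun=> 0 by apply/funext => k; rewrite (ip0r hs (AH _ D0)).
by move=> /(cvg_unique (@Rhausdorff R))/(_ (cvg_cst _)).
Qed.

Section Assembly.
Context {R : realType} {m : nat} {M : ptopologicalType} {S : manifold R M m}.

(** One of the corners a and a + h of a coordinate cube has a nonzero first coordinate, hence lies
    off N. *)
Lemma submanifold_co_dense n N (V : set M) : (n < m)%N -> submanifold S n N -> open V -> V !=set0 ->
  V `&` ~` N !=set0.
Proof.
move=> nm hN oV [p Vp]; have [Np|nN] := pselect (N p); last by exists p.
have [c [hc cp hNc]] := hN p Np.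
have [a [h [h0 sub _]]] := small_closed_cube (open_cimg (c := c) oV) (cimg_mem cp Vp).
pose i0 : 'I_m := Ordinal (leq_ltn_trans (leq0n n) nm).
suff [x [bx x0]] : exists x, cbox a (a + const_mx h) x /\ x 0 i0 != 0.
  have [q [cq Vq] qx] := sub _ bx; exists q; split=> // Nq.
  have : (N `&` cdom c) q by [].
  by rewrite hNc => -[_ /(_ i0)]; rewrite qx subn_gt0 => /(_ nm)/eqP; rewrite (negbTE x0).
have [a0|a0] := eqVneq (a 0 i0) 0; last by exists a; split => // i; rewrite !mxE lexx lerDl ltW.
exists (a + const_mx h); rewrite !mxE a0 add0r gt_eqF//; split => // i.
by rewrite !mxE lexx lerDl ltW.
Qed.

Variables (U : set M) (g : M -> 'M[R]_m) (mu : {measure set (borel M) -> \bar R}).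
Hypothesis hM : compact [set: M].
Hypothesis oU : open U.
Hypothesis hg : riemannian_metric S U g.
Hypothesis hmu : riemannian_measure S U g mu.
Hypothesis mu_fin : (mu U < +oo)%E.
Local Notation D := (test_function S U).
Local Notation ip := (ipL2 U mu).

Lemma test_function_null u p : D u -> ip u u = 0 -> U p -> u p = 0.
Proof.
move=> Du u0 Up; apply: contrapT => /eqP up.
have [su _] := (test_functionP _ _ oU).1 Du; have cu q : {for q, continuous u} by exact: (MCk_cont openT (su 0%N)).
have mU := open_borel oU.
have mu_ : measurable_fun (U : set (borel M)) (u : borel M -> R) by apply: (cont_measurable oU).
pose E : set M := U `&` u @^-1` [set x | x != 0].
have oE : open E.
  by apply: open_preimage => //; exact: open_neq.
have EU : E `<=` U by move=> q [].
have := measure_open_gt0 oU hg hmu oE EU (conj Up up); rewrite ltNge => /negP; apply.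
rewrite le_eqVlt; apply/orP; left; apply/eqP.
apply: (@integral_pos_null R _ (borel M) mu U E (fun q => u q * u q)) => //.
- exact: open_borel.
- exact: measurable_funM.
- by move=> q _; rewrite -expr2 sqr_ge0.
- by move=> q [_ /= uq]; rewrite -expr2 exprn_even_gt0.
have Hu := test_L2 oU mu_fin Du.
have := u0; rewrite /ipL2 /Rintegral => h.
rewrite -[LHS]fineK ?h//.
exact: (integrable_fin_num mU (L2_intg oU Hu Hu)).
Qed.

(** Bumps around d points spaced e apart on the diagonal of a coordinate cube, each vanishing at the
    other points. A null test function is 0 at every point of [U], so evaluating at these points
    isolates the coefficients. *)
Lemma test_functions_independent p d : (0 < m)%N -> U p -> exists b : 'I_d -> M -> R, (forall i, D (b i)) /\
  forall a : 'I_d -> R, ip (\sum_i a i *: b i) (\sum_i a i *: b i) = 0 -> forall i, a i = 0.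
Proof.
move=> m0 Up; have cp := cdom_chart_at S p; have hc := atlas_chart_at S p; set c := chart_at S p in cp hc.
have [a [h [h0 sub _]]] := small_closed_cube (open_cimg (c := c) oU) (cimg_mem cp Up).
pose i0 : 'I_m := Ordinal m0; pose e : R := h / d.+1%:R.
have e0 : 0 < e by rewrite divr_gt0.
pose x (i : 'I_d) : 'rV[R]_m := a + const_mx (e * i%:R).
have xb i : cbox a (a + const_mx h) (x i).
  move=> k; rewrite !mxE lerDl lerD2l mulr_ge0 ?(ltW e0)//= /e mulrAC ler_pdivrMr// ler_wpM2l ?(ltW h0)//.
  by rewrite ler_nat ltnW// ltnS ltnW.
pose V i : set M := (cdom c `&` U) `&` cmap c @^-1` (obox (x i - const_mx e) (x i + const_mx e)).
have oV i : open (V i).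
  apply: open_preimage; [by apply: openI => //; exact: cdom_open|by move=> q [cq _]; exact: cmap_cont|exact: open_obox].
have /choice[P hP] : forall i, exists q, [/\ cdom c q, U q & cmap c q = x i].
  by move=> i; have [q [cq Uq] qx] := sub _ (xb i); exists q.
have VP i : V i (P i).
  have [cq Uq qx] := hP i; split => //= k; rewrite qx !mxE; apply/andP; split; lra.
have VN i j : j != i -> ~ V i (P j).
  move=> ji [_ /= /(_ i0)]; have [_ _ ->] := hP j; rewrite !mxE => /andP[h1 h2].
  have {}h1 : e * (i%:R - 1) < e * j%:R by lra.
  have {}h2 : e * j%:R < e * (i%:R + 1) by lra.
  move: h1 h2; rewrite !ltr_pM2l// ltrBlDr -!(natrD _ _ 1) !ltr_nat !addn1 !ltnS => h1 h2.
  by move/eqP: ji; apply; apply/val_inj/eqP; rewrite eqn_leq h1 h2.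
have /choice[b hb] : forall i, exists b : M -> R, [/\ D b, b (P i) != 0 & forall j, j != i -> b (P j) = 0].
  move=> i; have [psi [K [spsi _ psip cK [KV psiK]]]] := bump_exists S (oV i) (VP i).
  exists psi; split; [|by rewrite gt_eqF|by move=> j ji; apply: psiK => /KV; exact: VN].
  by apply/(test_functionP _ _ oU); split => //; exists K; split => // q /KV[[]].
exists b; split=> [i|a' z i]; first by have [] := hb i.
have hD := dirichlet_semi_ip hM oU hg hmu mu_fin.
have Ds : D (\sum_i a' i *: b i).
  by apply: (sip_sum hD) => j _; apply: (sipZ hD); have [] := hb j.
have [_ UP _] := hP i; have := test_function_null Ds z UP; have [_ bi _] := hb i.
have sE (s : seq 'I_d) : (\sum_(j <- s) a' j *: b j) (P i) = \sum_(j <- s) a' j * b j (P i).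
  elim: s => [|j s ih]; first by rewrite !big_nil.
  by rewrite !big_cons -ih.
rewrite sE (bigD1 i)//= big1 ?addr0 => [|j ji].
  by move/eqP; rewrite mulf_eq0 (negbTE bi) orbF => /eqP.
by have [_ _ ->] := hb j; rewrite ?mulr0// eq_sym.
Qed.

End Assembly.

(** Unifies the two cases of the theorem. If m = 2 then n = 0 and k = 2, so mk/2 = 2 and |f|^(k-2) =
    1; if m >= 3 the lower bounds are powers of the infimum of f. *)
Lemma conformal_exponent (R : realType) (m n : nat) (M : ptopologicalType)
    (U : set M) (f : M -> R) (mu : {measure set (borel M) -> \bar R}) : (n + 2 <= m)%N ->
  (m = 2%N -> exists2 eps : R, 0 < eps & Lp U mu (2 + eps) f) ->
  ((3 <= m)%N -> 0 < inf (f @` U) /\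
     exists2 eps : R, 0 < eps & Lp U mu ((m * (m - n))%:R / 2 + eps) f) ->
  (exists2 eps : R, 0 < eps & Lp U mu ((m * (m - n))%:R / 2 + eps) f) /\
  exists2 b : R, 0 < b & forall p, U p ->
    b <= `|f p| ^+ (m - n - 2) /\ ((0 < n)%N -> b <= `|f p| ^+ (m - n)).
Proof.
move=> hmn h2 h3; have [m3|m2] := leqP 3 m.
  have [f0 ef] := h3 m3; split => //; set b := inf _ in f0.
  exists (Num.min (b ^+ (m - n - 2)) (b ^+ (m - n))).
    by rewrite lt_min !exprn_gt0.
  (* A set without an infimum gets the value 0 by convention, so positivity of [inf] entails that f
     is bounded below. *)
  have hi : has_inf (f @` U).
    by apply: contrapT => /inf_out e; move: f0; rewrite /b e ltxx.
  move=> p Up; have bf : b <= `|f p|.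
    by apply: le_trans (ler_norm _); apply: ge_inf; [case: hi|exists p].
  have hb k : b ^+ k <= `|f p| ^+ k by rewrite lerXn2r// nnegrE ltW.
  by split=> [|_]; rewrite ge_min hb ?orbT.
have e2 : m = 2%N by apply/eqP; rewrite eqn_leq -ltnS m2 (leq_trans _ hmn)// leq_addl.
have n0 : n = 0%N by move: hmn; rewrite e2 -{2}[2%N]add0n leq_add2r leqn0 => /eqP.
split; last by exists 1 => // p _; rewrite e2 n0 expr0; split.
have -> : (m * (m - n))%:R / 2 = 2 :> R by rewrite e2 n0 subn0 natrM mulfK.
exact: h2.
Qed.

Unset Implicit Arguments.
Theorem corollary1p1 (R : realType) (m n : nat) (M : ptopologicalType)
    (S : manifold R M m) (g g' : M -> 'M[R]_m) (N : set M)
    (coords : set (chart R M m)) (f : M -> R)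
    (mu mu' : {measure set (borel M) -> \bar R})
    (hM : compact [set: M]) (hMc : connected [set: M])
    (hg : riemannian_metric S [set: M] g)
    (hmu : riemannian_measure S [set: M] g mu)
    (hmn : (n + 2 <= m)%N)
    (hN : compact N) (hNn : submanifold S n N)
    (hcoords : diagonal_coordinates S g n N coords)
    (hg' : riemannian_metric S (~` N) g')
    (hmu' : riemannian_measure S (~` N) g' mu')
    (hf : smooth_function S (~` N) f)
    (hgg' : conformal_block_near S g g' f n N coords)
    (hm2 : m = 2%N -> exists2 eps : R, 0 < eps & Lp (~` N) mu (2 + eps) f)
    (hm3 : (3 <= m)%N ->
       0 < inf (f @` (~` N)) /\
       exists2 eps : R, 0 < eps &
         Lp (~` N) mu ((m * (m - n))%:R / 2 + eps) f) :
  let U := ~` N in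
  let H := L2 U mu' in
  let ip := ipL2 U mu' in
  let T := friedrichs H ip (test_function S U) (laplacian S g') in
  exists (lam : nat -> R) (phi : nat -> M -> R),
    [/\ lam 0%N = 0 /\ lam 0%N < lam 1%N,
        forall j, lam j <= lam j.+1,
        lam @ \oo --> +oo
      & op_spectrum H ip T = range lam] /\
    (forall (z : R) (K : nat), (forall j, (K <= j)%N -> lam j != z) ->
       subspace_of_dim H ip (\sum_(j < K) (lam j == z))%N (op_eigenspace T z)) /\
    [/\ forall j, W12 S U g' mu' (phi j),
        forall j, T (phi j) (lam j *: phi j)
      & orthonormal_basis H ip phi] /\
    (forall j : nat,
       (lam j)%:E = ereal_inf
         [set ereal_sup
            [set (gradL2sq S U g' mu' v / normL2sq U mu' v)%:E
              | v in E `&` [set v | normL2sq U mu' v != 0]]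
           | E in [set E | subspace_of_dim H ip j.+1 E /\
                           E `<=` W120 S U g' mu']]).
Proof.
move=> U H ip T; have [[eps eps0 hfp] flow] := conformal_exponent hmn hm2 hm3.
have [W [oW NW] hW] := hgg'.
have cN := manifold_compact_closed S hN; have oU : open U := closed_openC cN.
have nm : (n < m)%N by apply: leq_trans hmn; rewrite addn2.
have hf0 : MCk S 0 U f by move=> c hc; exact: (hf c hc 0%N).
(* At points of N the integrability of f makes the cube good; off N the metric g' is smooth on a
   closed cube, and any small one will do. *)
have good p : exists c a (h : R),
    [/\ good_cube S U g' c a h, cdom c p & obox a (a + const_mx h) (cmap c p)].
  have [Np|Up] := pselect (N p).
    exact: (good_cube_near hmn cN hg hmu hg' hcoords oW NW hf0 hW eps0 hfp flow Np).
  by apply: (good_cube_regular oU hg') => //; apply: leq_trans hmn; rewrite leq_addl.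
have mu_fin := good_measure_fin hM oU hg' hmu' good.
have dU (V : set M) : open V -> V !=set0 -> V `&` U !=set0 := submanifold_co_dense nm hNn.
have [p [_ Up]] := dU setT openT (ex_intro _ point I).
pose D := test_function S U; pose A := laplacian S g'; pose F := form_domain H ip D A.
pose q := form_ext (D := D) (ip := ip) (A := A).
have [F1 q1] : F (fun=> 1) /\ q (fun=> 1) (fun=> 1) = 0 :=
  one_form_domain hmn cN hg hmu hg' hcoords oW NW hf0 hW eps0 hfp hM hmu' mu_fin.
have n1 : ip (fun=> 1) (fun=> 1) != 0.
  have h := measure_open_gt0 oU hg' hmu' oU (fun _ h => h) Up.
  have -> : ip (fun=> 1) (fun=> 1) = \int[mu']_(x in U) (cst (1 * 1) x) by [].
  have mU := open_borel oU.
  by rewrite Rintegral_cst// !mul1r gt_eqF// fine_gt0// h mu_fin.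
have hs : semi_ip H ip := L2_semi_ip mu' oU.
have hq : semi_ip D (fun u v => ip (A u) v) := dirichlet_semi_ip hM oU hg' hmu' mu_fin.
have DH : D `<=` H := fun u h => test_L2 oU mu_fin h.
have AH u : D u -> H (A u) := fun h => laplacian_L2 oU hg' hmu' mu_fin h.
have Hc := L2_complete (mu := mu') oU.
have dD := test_function_dense (S := S) oU mu_fin.
have hF : semi_ip F q := form_ext_semi_ip hs hq DH AH.
have DF : D `<=` F := form_domain_D hs hq DH AH.
have FH : F `<=` H := @form_domain_sub _ _ H D ip A.
have Fc := form_complete hs hq DH AH Hc.
have Fk := form_compact hs hq DH AH (good_finite_rank hM oU hg' hmu' good).
have Fd w : H w -> (forall v, F v -> ip w v = 0) -> ip w w = 0.
  by move=> hw h; apply: (dD _ hw) => v /DF; exact: h.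
have Fi d : exists b : 'I_d -> M -> R, (forall i, F (b i)) /\
    forall a : 'I_d -> R, ip (\sum_i a i *: b i) (\sum_i a i *: b i) = 0 -> forall i, a i = 0.
  have [b [Db hb]] := test_functions_independent hM oU hg' hmu' mu_fin d (leq_ltn_trans (leq0n n) nm) Up.
  by exists b; split=> [i|]; [exact: (DF _ (Db i))|exact: hb].
have Fn u v := @form_null R _ H D ip A u v hs hq DH AH.
have TP : forall u w, T u w <-> [/\ F u, H w & forall v, F v -> q u v = ip w v] :=
  friedrichsP hs hq DH AH dD.
have l0 := eigenval0 hs hF FH Fc Fk Fi F1 n1 q1.
exists (eigenval (F := F) (ip := ip) (q := q)), (eigenvec (F := F) (ip := ip) (q := q)).
split; [split; [split=> //| | | ]|split; [|split; [split| ]]].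
- exact: (eigenval1_gt0 hs hF FH Fc Fk Fi F1
    (fun u Fu h => kernel_constant hM oU hg' hmu' good hMc dU Fu h) l0).
- exact: (eigenval_nd hs hF FH Fc Fk Fi).
- exact: (eigenval_cvg hs hF FH Fc Fk Fi).
- exact: (eigen_spectrum hs hF FH Hc Fc Fk Fd Fi TP).
- exact: (eigenspace_dim hs hF FH Hc Fc Fk Fd Fi Fn TP).
- by move=> j; apply: (form_domain_W12 hM oU hg' hmu' mu_fin); exact: (eigenvec_F hs hF FH Fc Fk Fi).
- exact: (eigenvec_T hs hF FH Fc Fk Fi TP).
- exact: (eigen_orthonormal_basis hs hF FH Hc Fc Fk Fd Fi).
exact: (eigenval_minmax hs hF FH Fc Fk Fi Fn (W120_form_domain hM oU hg' hmu' mu_fin)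
  (fun v Fv => gradL2sq_form_ext hM oU hg' hmu' mu_fin Fv)).
Qed.
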